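(* For all real numbers $t_1, t_2$ with $t_2 > t_1 > 10^5$, $$\left| \int_{t_1}^{t_2} S(t)\, dt \right| \le 1.698 + 0.183 \log\log t_2 + 0.049 \log t_2 .$$
   Context: $\zeta(s)$ denotes the Riemann zeta-function. For real $t$ not the ordinate of a zero of $\zeta$, $S(t) = \frac{1}{\pi}\arg \zeta(\tfrac12 + it)$, where the argument is defined by continuous variation along the straight line segments from $2$ to $2+it$ and then to $\tfrac12 + it$, starting with $\arg\zeta(2)=0$. If $t$ is the ordinate of a zero, $S(t) = \tfrac12\lim_{\epsilon\to 0^+}\bigl(S(t+\epsilon)+S(t-\epsilon)\bigr)$. $\log$ is the natural logarithm. *)

(* Defs.v *)
From Stdlib Require Import Reals ClassicalEpsilon.
From Coquelicot Require Import Coquelicot.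
Local Open Scope R_scope.

Definition Cexp (z : C) : C :=
  (exp (Re z) * cos (Im z), exp (Re z) * sin (Im z)).

(** The Dirichlet series [sum_(n >= 1) n^(-s)] on [Re s > 1] (indices are shifted
    by one, and [n^(-s) = exp (- s ln n)]), continued holomorphically to [C \ {1}].
    By the identity theorem this determines [zeta] away from [s = 1]; its value
    at the pole is left unconstrained. *)
Definition is_riemann_zeta (zeta : C -> C) : Prop :=
  (forall s : C, 1 < Re s ->
     @is_series C_AbsRing C_NormedModule
       (fun n : nat => Cexp (- s * RtoC (ln (INR (S n))))%C) (zeta s)) /\
  (forall s : C, s <> RtoC 1 -> @ex_derive C_AbsRing C_NormedModule zeta s).

(** Every real zero counts, so [0] is an ordinate (trivial zeros), and the path
    below never meets the pole when [t] is not an ordinate. *)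
Definition zero_ordinate (zeta : C -> C) (t : R) : Prop :=
  exists sigma : R, zeta (sigma, t) = RtoC 0.

(** From [2] to [2 + it] for [u] in [[0, 1]], then from [2 + it] to [1/2 + it]
    for [u] in [[1, 2]]. *)
Definition arg_path (t u : R) : C :=
  if Rle_dec u 1 then (2, u * t) else (2 - (3 / 2) * (u - 1), t).

(** [a] is the value at [1/2 + it] of the argument of [zeta] obtained by
    continuous variation along [arg_path t], starting from [arg zeta(2) = 0]. *)
Definition is_arg_by_variation (zeta : C -> C) (t a : R) : Prop :=
  exists theta : R -> R,
    (forall u : R, 0 <= u <= 2 -> continuous theta u) /\
    (forall u : R, 0 <= u <= 2 ->
       zeta (arg_path t u) =
       (RtoC (Cmod (zeta (arg_path t u))) * Cexp (Ci * RtoC (theta u)))%C) /\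
    theta 0 = 0 /\
    theta 2 = a.

Definition arg_zeta_half (zeta : C -> C) (t : R) : R :=
  epsilon (inhabits 0) (is_arg_by_variation zeta t).

(** Ordinates being isolated, [t + eps] and [t - eps] are not ordinates for small
    [eps > 0], so the limit may be written with [arg_zeta_half] directly. *)
Definition S_zeta (zeta : C -> C) (t : R) : R :=
  if excluded_middle_informative (zero_ordinate zeta t) then
    epsilon (inhabits 0) (fun l : R =>
      filterlim
        (fun eps : R => / 2 * (/ PI * arg_zeta_half zeta (t + eps)
                               + / PI * arg_zeta_half zeta (t - eps)))
        (at_right 0) (locally l))
  else / PI * arg_zeta_half zeta t.

(* Main.v *)
(* Put U(t) = int_{1/2}^oo ln |zeta(sigma + i t)| d sigma. On small discs zeta is a
   product of linear factors times an exponential, and integrating its logarithm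
   there yields pi int_a^b S = U(b) - U(a); so U is to be bounded on both sides.

   Upper bound: Euler-Maclaurin summation, with the sawtooth function expanded into
   its Fourier series and the resulting integrals estimated by the first-derivative
   test, majorizes |zeta(s + i t)| for -0.35 <= s <= 1.2 by a positive combination of
   exponentials in s. Such a combination is log-convex, so its values at -0.3, 0, 1/2
   and 1 control ln |zeta| linearly in between; farther to the right the convex
   function ln zeta(sigma) is integrated by trapezoids.

   Lower bound (Turing): on the disc with centre c = 1.3 + i t and radius 1.6, the
   Poisson formula expresses ln |zeta(c + s)| - ln |zeta(c - s)| - kappa s Re
   (zeta'/zeta)(c) by the values of ln |zeta| on the circle and the zeros inside.
   For a suitable kappa each zero contributes with the favourable sign once the
   identity is integrated over s. On the left half of the circle the majorant above
   applies, on the right half |zeta(s)| >= zeta(2 sigma) / zeta(sigma). *)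

Require Import Defs.
From Stdlib Require Import Reals Psatz ClassicalEpsilon Lia ZArith List Arith Factorial Ranalysis5.
From Coquelicot Require Import Coquelicot.
Import ListNotations.
Local Open Scope R_scope.

(** * Calculus for functions from the reals to the complex numbers *)

(** Neither the functional equation nor a count of zeros enters. The size of zeta left of the
    critical line, down to the abscissa -0.3 reached by the circle, is read off from a Dirichlet
    polynomial and its dual sum. Zeros obstruct twice: S is irregular at ordinates, and the Poisson
    formula wants a circle and a diameter without zeros. Both are met by working at heights avoiding
    a finite set in every bounded range ([good]); the integral of S is continuous in its endpoints,
    which gives the other heights. The upper limit of U is a finite K, because arg zeta(K + it) is
    O(2^(-K)). The constant kappa is 1.65. In coordinates where the circle has radius 2, the
    estimates for one zero rho meet at |rho|^2 = 3/2, and both sides just fit: (3/2) ln 3 = 1.648 on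
    one side, 1.3879 against 1.3887 on the other. A larger kappa would increase the kernel and the
    term with zeta'/zeta at the centre. All majorants are affine in ln t and ln ln t and are tuned
    to be sharpest at t = 10^5, where the final inequality has little room. *)

Notation CV := C_R_CompleteNormedModule.
Notation RN := R_NormedModule.
Notation RV := R_CompleteNormedModule.
Notation Cont := (@continuous R_UniformSpace CV).
Notation CDer := (@is_derive R_AbsRing CV).
Notation CInt := (@is_RInt CV).
Notation derive_cts := (@ex_derive_continuous R_AbsRing RN).
Notation cts_RInt := (@ex_RInt_continuous RV).
Ltac cts_derive := apply derive_cts; auto_derive; try exact I.

(** [ring] and [field] on complex numbers recognise [Cplus], [Cminus] and [Copp], whereas
    integration and derivation lemmas produce the convertible operations of the algebraic
    hierarchy. *)
Ltac cnorm :=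
  repeat match goal with
  | |- context [@plus ?G ?a ?b] => change (@plus G a b) with (Cplus a b)
  | |- context [@minus ?G ?a ?b] => change (@minus G a b) with (Cminus a b)
  | |- context [@opp ?G ?a] => change (@opp G a) with (Copp a)
  end; match goal with |- @eq _ ?a ?b => change (@eq C a b) end.

(** The real power x^a, with the exponent first so that [rp a] can be differentiated as a function
    of x. *)
Definition rp (a x : R) : R := exp (a * ln x).

Lemma rp_pos (a x : R) : 0 < rp a x. Proof. apply exp_pos. Qed.

Ltac pos := solve [repeat first [assumption | lra | apply exp_pos | apply rp_pos | match goal with |- _ <= exp _ => left | |- _ <= rp _ _ => left | |- _ <= / _ => left end | apply Cmod_ge_0 | apply Rabs_pos | apply pos_INR | apply pow2_ge_0 | apply Rinv_0_lt_compat | apply Rdiv_lt_0_compat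
  | apply Rdiv_le_0_compat | apply Rmult_lt_0_compat | apply Rmult_le_pos | apply pow_lt | apply pow_le | apply Rgt_not_eq | apply Rplus_le_le_0_compat | apply lt_0_INR; lia]].
Ltac rsc := unfold minus, plus, opp, scal; simpl; unfold mult; simpl.
Ltac cring := cnorm; ring.
Ltac cfield := cnorm; field.
Ltac Ctri := eapply Rle_trans; [apply Cmod_triangle |].

Lemma Cmod_minus_le (a b : C) : Cmod (a - b)%C <= Cmod a + Cmod b.
Proof. rewrite <- (Cmod_opp b). apply Cmod_triangle.
Qed.

Lemma Cmod_minus_sym (a b : C) : Cmod (a - b)%C = Cmod (b - a)%C.
Proof. rewrite <- Cmod_opp. f_equal. ring. Qed.

Lemma Cmod_ge_minus (a b : C) : Cmod a - Cmod b <= Cmod (a - b)%C.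
Proof.
  assert (H := Cmod_triangle (a - b)%C b).
  replace (a - b + b)%C with a in H by ring. lra.
Qed.

Lemma Cmod_dist_triangle (a b c : C) : Cmod (a - c)%C <= Cmod (a - b)%C + Cmod (b - c)%C.
Proof. replace (a - c)%C with ((a - b) + (b - c))%C by ring. apply Cmod_triangle. Qed.

Lemma RtoC_neq0 (x : R) : x <> 0 -> RtoC x <> 0%C.
Proof. intros H E. apply H. exact (RtoC_inj _ _ E). Qed.

Lemma Cmod_minus_0 (a : C) : Cmod (a - a)%C = 0.
Proof. replace (a - a)%C with (RtoC 0) by ring. apply Cmod_0. Qed.

Lemma scal_C (u : R) (l : C) : @scal R_AbsRing CV u l = (RtoC u * l)%C.
Proof. unfold Cmult, RtoC; simpl. unfold scal; simpl. unfold prod_scal, scal; simpl. unfold mult; simpl. f_equal; ring.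
Qed.

Lemma norm_C (z : C) : @norm R_AbsRing CV z = Cmod z.
Proof. symmetry. apply Cmod_norm. Qed.

Lemma Cmod_eq (x y : C) : Cmod (x - y)%C <= 0 -> x = y.
Proof.
  intro H. assert (E : (x - y)%C = 0%C).
  { apply Cmod_eq_0. apply Rle_antisym; pos. }
  replace x with ((x - y) + y)%C by ring. rewrite E. ring.
Qed.

Lemma Cmod_eq_eps (x y : C) (K : R) : (forall eps, 0 < eps -> Cmod (x - y)%C <= K * eps) -> x = y.
Proof.
  intro H. apply Cmod_eq. apply le_epsilon. intros e He. rewrite Rplus_0_l.
  assert (HK : 0 < 1 + Rabs K) by (pose proof (Rabs_pos K); lra).
  apply Rle_trans with (K * (e / (1 + Rabs K))).
  - apply H. apply Rdiv_lt_0_compat; lra.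
  - assert (K * (e / (1 + Rabs K)) <= (1 + Rabs K) * (e / (1 + Rabs K))).
    { apply Rmult_le_compat_r. left; apply Rdiv_lt_0_compat; lra. pose proof (Rle_abs K); lra. }
    replace ((1 + Rabs K) * (e / (1 + Rabs K))) with e in H0 by (field; lra). exact H0.
Qed.

(** Complex derivative in the form without a quotient: no case w = z has to be excluded, and the
    inequality can be integrated along a segment. *)
Definition Cd (f : C -> C) (z l : C) : Prop :=
  forall eps, 0 < eps -> exists del, 0 < del /\
    forall w, Cmod (w - z)%C < del ->
      Cmod (f w - f z - l * (w - z))%C <= eps * Cmod (w - z)%C.

Definition Ccts (f : C -> C) (z : C) : Prop :=
  forall eps, 0 < eps -> exists del, 0 < del /\
    forall w, Cmod (w - z)%C < del -> Cmod (f w - f z)%C <= eps.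

Notation CN := (AbsRing_NormedModule C_AbsRing).
Notation Cderive := (@is_derive C_AbsRing CN).

Lemma Cd_is_derive (f : C -> C) (z l : C) : Cd f z l <-> Cderive f z l.
Proof.
  split.
  - split; [apply is_linear_scal_l |]. intros x Hx.
    rewrite <- (is_filter_lim_locally_unique (V := CN) z x Hx).
    intro eps. destruct (H eps (cond_pos eps)) as [d [Hd Hf]]. exists (mkposreal d Hd). intros w Hw. specialize (Hf w Hw).
    rewrite Cmult_comm in Hf. exact Hf.
  - intros [_ H] eps He. destruct (H z (fun P HP => HP) (mkposreal eps He)) as [d Hd]. exists d.
    split; [apply cond_pos |]. intros w Hw. rewrite (Cmult_comm l). apply Hd, Hw.
Qed.

Lemma Cd_cts (f : C -> C) (z l : C) : Cd f z l -> Ccts f z.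
Proof.
  intros H eps He. apply Cd_is_derive in H. pose proof (@ex_derive_continuous C_AbsRing CN f z (ex_intro _ _ H)) as K.
  destruct (proj1 (filterlim_locally_ball_norm (U := CN) f (f z)) K (mkposreal eps He)) as [d Hd].
  exists d. split; [apply cond_pos |]. intros w Hw. left. apply Hd, Hw.
Qed.

Lemma Cd_ext_loc (f g : C -> C) (z l : C) :
  (exists d, 0 < d /\ forall w, Cmod (w - z)%C < d -> f w = g w) -> Cd f z l -> Cd g z l.
Proof.
  intros [d [Hd E]] H. apply Cd_is_derive in H. apply Cd_is_derive. revert H. apply is_derive_ext_loc.
  exists (mkposreal d Hd). exact E.
Qed.

Lemma Cd_const (a z : C) : Cd (fun _ => a) z 0%C.
Proof. apply Cd_is_derive. exact (is_derive_const (V := CN) a z). Qed.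

Lemma Cd_id (z : C) : Cd (fun w => w) z 1%C.
Proof. apply Cd_is_derive. exact (is_derive_id z). Qed.

Lemma Cd_plus (f g : C -> C) (z l m : C) : Cd f z l -> Cd g z m -> Cd (fun w => f w + g w)%C z (l + m)%C.
Proof. rewrite !Cd_is_derive. apply (@is_derive_plus C_AbsRing CN). Qed.

Lemma Cd_mult (f g : C -> C) (z l m : C) : Cd f z l -> Cd g z m ->
  Cd (fun w => f w * g w)%C z (l * g z + f z * m)%C.
Proof. rewrite !Cd_is_derive. intros Hf Hg. apply (is_derive_mult f g z l m Hf Hg). exact Cmult_comm. Qed.

Lemma Cd_ext (f g : C -> C) (z l m : C) : (forall w, f w = g w) -> l = m -> Cd f z l -> Cd g z m.
Proof. intros E -> H. apply (Cd_ext_loc f); [exists 1; split; [lra | intros; apply E] | pos].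
Qed.

Lemma Cd_scal (a : C) (f : C -> C) (z l : C) : Cd f z l -> Cd (fun w => a * f w)%C z (a * l)%C.
Proof. intro H. eapply Cd_ext; [| | apply (Cd_mult _ _ _ _ _ (Cd_const a z) H)]; [reflexivity | ring]. Qed.

Lemma Cd_opp (f : C -> C) (z l : C) : Cd f z l -> Cd (fun w => - f w)%C z (- l)%C.
Proof. intro H. eapply Cd_ext; [| | apply (Cd_scal (- (1))%C _ _ _ H)]; [intro; simpl; ring | ring]. Qed.

Lemma Cd_minus (f g : C -> C) (z l m : C) : Cd f z l -> Cd g z m -> Cd (fun w => f w - g w)%C z (l - m)%C.
Proof. intros Hf Hg. eapply Cd_ext; [| | apply (Cd_plus _ _ _ _ _ Hf (Cd_opp _ _ _ Hg))]; [intro; simpl; ring | ring]. Qed.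

Lemma Cd_comp (f g : C -> C) (z l m : C) : Cd f z l -> Cd g (f z) m -> Cd (fun w => g (f w)) z (m * l)%C.
Proof. rewrite !Cd_is_derive, Cmult_comm. intros Hf Hg. exact (@is_derive_comp C_AbsRing CN g f z m l Hg Hf). Qed.

(** The error is exactly (w - z)^2 / (z^2 w), and |w| > |z| / 2 close to z. *)
Lemma Cd_inv_id (z : C) : z <> 0%C -> Cd (fun w => / w)%C z (- / (z * z))%C.
Proof.
  intros Hz eps Heps.
  assert (Hm : 0 < Cmod z) by (apply Cmod_gt_0; exact Hz).
  set (r := Cmod z) in *.
  assert (Hr3 : 0 < r * r * r) by pos.
  exists (Rmin (r / 2) (eps * (r * r * r) / 2)). split.
  - apply Rmin_pos; nra.
  - intros w Hw.
    assert (Hw1 : Cmod (w - z)%C < r / 2) by (eapply Rlt_le_trans; [exact Hw | apply Rmin_l]).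
    assert (Hw2 : Cmod (w - z)%C < eps * (r * r * r) / 2) by (eapply Rlt_le_trans; [exact Hw | apply Rmin_r]).
    assert (Hwr : r / 2 < Cmod w).
    { pose proof (Cmod_ge_minus z w) as H. rewrite Cmod_minus_sym in H. fold r in H. lra. }
    assert (Hw0 : w <> 0%C) by (apply Cmod_gt_0; lra).
    replace (/ w - / z - - / (z * z) * (w - z))%C with ((w - z) * (w - z) * / (z * z * w))%C
      by (field; split; assumption).
    rewrite !Cmod_mult, Cmod_inv by (repeat apply Cmult_neq_0; assumption).
    rewrite !Cmod_mult.
    set (x := Cmod (w - z)%C) in *. pose proof (Cmod_ge_0 (w - z)%C) as Hx; fold x in Hx.
    rewrite Rmult_assoc, (Rmult_comm eps). apply Rmult_le_compat_l; [lra |].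
    assert (0 < r * r * Cmod w) by nra.
    apply Rmult_le_reg_r with (r * r * Cmod w); [lra |].
    rewrite Rmult_assoc, Rinv_l, Rmult_1_r by lra.
    nra.
Qed.

Lemma Cd_inv (f : C -> C) (z l : C) : f z <> 0%C -> Cd f z l -> Cd (fun w => / f w)%C z (- / (f z * f z) * l)%C.
Proof. intros Hz H. exact (Cd_comp f Cinv z l _ H (Cd_inv_id _ Hz)). Qed.

Lemma Cd_div (f g : C -> C) (z l m : C) : g z <> 0%C -> Cd f z l -> Cd g z m ->
  Cd (fun w => f w / g w)%C z ((l * g z - f z * m) / (g z * g z))%C.
Proof.
  intros Hz Hf Hg. eapply Cd_ext; [| | apply (Cd_mult _ _ _ _ _ Hf (Cd_inv _ _ _ Hz Hg))].
  - intro; reflexivity.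
  - field. exact Hz.
Qed.

Lemma Cd_unique (f : C -> C) (z l m : C) : Cd f z l -> Cd f z m -> l = m.
Proof.
  intros Hl Hm. apply (Cmod_eq_eps l m 2). intros e He.
  destruct (Hl e He) as [d1 [Hd1 H1]]. destruct (Hm e He) as [d2 [Hd2 H2]].
  set (h := Rmin d1 d2 / 2). assert (Hh : 0 < Rmin d1 d2) by (apply Rmin_pos; assumption).
  pose proof (Rmin_l d1 d2). pose proof (Rmin_r d1 d2).
  assert (E : (z + RtoC h - z)%C = RtoC h) by ring. assert (E' : Cmod (RtoC h) = h) by (rewrite Cmod_R; apply Rabs_pos_eq; unfold h; lra).
  specialize (H1 (z + RtoC h)%C). specialize (H2 (z + RtoC h)%C). rewrite E, E' in H1, H2.
  set (u := (f (z + RtoC h) - f z)%C) in *.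
  assert (K : Cmod ((l - m) * RtoC h)%C <= 2 * e * h).
  { replace ((l - m) * RtoC h)%C with ((u - m * RtoC h) - (u - l * RtoC h))%C by ring.
    eapply Rle_trans; [apply Cmod_minus_le |]. unfold h in *. lra. }
  rewrite Cmod_mult, E' in K. unfold h in K. nra.
Qed.

Lemma is_linear_Cmult (l : C) : @is_linear R_AbsRing CV CV (fun h => (h * l)%C).
Proof.
  split.
  - intros. apply (Cmult_plus_distr_r x y l).
  - intros k x. change ((scal k x * l)%C = scal k (x * l)%C). rewrite !scal_C. ring.
  - exists (1 + Cmod l). pose proof (Cmod_ge_0 l). split; [lra |]. intro x. rewrite !norm_C, Cmod_mult. pose proof (Cmod_ge_0 x). nra.
Qed.

(** Reads a complex derivative as a real-linear differential, which makes the chain rule with curves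
    in C available. *)
Lemma Cd_filterdiff (f : C -> C) (z l : C) : Cd f z l -> @filterdiff R_AbsRing CV CV f (locally z) (fun h => (h * l)%C).
Proof. split; [apply is_linear_Cmult |]. intros x Hx. rewrite <- (is_filter_lim_locally_unique z x Hx).
  intro eps. destruct (H eps (cond_pos eps)) as [d [Hd Hf]].
  apply (@locally_le_locally_norm R_AbsRing CV). exists (mkposreal d Hd). intros w Hw. unfold ball_norm in Hw. rewrite norm_C in Hw.
  rewrite !norm_C. specialize (Hf w Hw). rewrite Cmult_comm in Hf. exact Hf.
Qed.

Lemma is_derive_C_eps (g : R -> C) (t : R) (l : C) :
  (forall eps, 0 < eps -> exists del, 0 < del /\ forall u, Rabs (u - t) < del ->
     Cmod (g u - g t - RtoC (u - t) * l)%C <= eps * Rabs (u - t)) ->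
  CDer g t l.
Proof. split; [apply is_linear_scal_l |].
  intros x Hx. assert (Ex : t = x) by exact (is_filter_lim_locally_unique (V := AbsRing_NormedModule R_AbsRing) t x Hx). rewrite <- Ex.
  intro eps. destruct (H eps (cond_pos eps)) as [d [Hd Hg]].
  exists (mkposreal d Hd). intros u Hu.
  specialize (Hg u Hu).
  eapply Rle_trans; [| exact Hg]. rewrite norm_C.
  rewrite scal_C. reflexivity.
Qed.

Lemma continuous_C_eps (g : R -> C) (t : R) :
  (forall eps, 0 < eps -> exists del, 0 < del /\ forall u, Rabs (u - t) < del -> Cmod (g u - g t)%C <= eps) ->
  Cont g t.
Proof.
  intro H. apply (filterlim_locally_ball_norm (U := C_R_NormedModule)). intro eps.
  destruct (H (eps / 2) ltac:(pose proof (cond_pos eps); lra)) as [d [Hd Hg]].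
  exists (mkposreal d Hd). intros u Hu. specialize (Hg u Hu).
  unfold ball_norm. rewrite norm_C. pose proof (cond_pos eps).
  apply Rle_lt_trans with (eps / 2); pos.
Qed.

Lemma continuous_C_eps_inv (g : R -> C) (t : R) :
  Cont g t ->
  (forall eps, 0 < eps -> exists del, 0 < del /\ forall u, Rabs (u - t) < del -> Cmod (g u - g t)%C <= eps).
Proof.
  intros H eps Heps. assert (H' := proj1 (filterlim_locally_ball_norm (U := C_R_NormedModule) g (g t)) H (mkposreal eps Heps)). clear H; rename H' into H.
  destruct H as [d Hd]. exists d. split; [apply cond_pos |]. intros u Hu. specialize (Hd u Hu).
  unfold ball_norm in Hd. rewrite norm_C in Hd. left. exact Hd.
Qed.

Lemma continuous_Ccts_comp {T : UniformSpace} (f : C -> C) (g : T -> C) (t : T) :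
  Ccts f (g t) -> @continuous T CV g t -> @continuous T CV (fun u => f (g u)) t.
Proof.
  intros Hf Hg. apply (@continuous_comp T CV CV g f t Hg). apply (filterlim_locally_ball_norm (U := C_R_NormedModule)). intro eps.
  destruct (Hf (eps / 2) ltac:(pose proof (cond_pos eps); lra)) as [d [Hd H]].
  apply (@locally_le_locally_norm R_AbsRing CV). exists (mkposreal d Hd). intros w Hw. unfold ball_norm in *. rewrite norm_C in *.
  pose proof (cond_pos eps). eapply Rle_lt_trans; [apply (H w Hw) | lra].
Qed.

Lemma is_derive_Cd_comp (F : C -> C) (g : R -> C) (t : R) (l dg : C) :
  Cd F (g t) l -> CDer g t dg -> CDer (fun u => F (g u)) t (l * dg)%C.
Proof.
  intros HF Hg. eapply filterdiff_ext_lin; [exact (filterdiff_comp' g F t _ _ Hg (Cd_filterdiff _ _ _ HF)) |].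
  intro y. rewrite !scal_C. cring.
Qed.

Lemma is_derive_C_pair (g1 g2 : R -> R) (t l1 l2 : R) :
  is_derive g1 t l1 -> is_derive g2 t l2 -> CDer (fun u => (g1 u, g2 u)) t (l1, l2).
Proof.
  intros H1 H2. apply (is_derive_ext (fun u => plus (scal (g1 u) (1, 0) : CV) (scal (g2 u) (0, 1)))).
  - intro u. rewrite !scal_C. unfold plus; simpl. unfold prod_plus, Cmult, RtoC, plus; simpl. f_equal; ring.
  - replace (l1, l2) with (plus (scal l1 ((1, 0) : CV)) (scal l2 ((0, 1) : CV))).
    + apply (@is_derive_plus R_AbsRing CV); apply (@is_derive_scal_l R_AbsRing CV); assumption.
    + rewrite !scal_C. unfold plus; simpl. unfold prod_plus, Cmult, RtoC, plus; simpl. f_equal; ring.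
Qed.

Lemma is_derive_C_fst (g : R -> C) (t : R) (l : C) :
  CDer g t l -> is_derive (fun u => Re (g u)) t (Re l).
Proof. intro H. exact (filterdiff_comp' g _ t _ _ H (filterdiff_linear _ (@is_linear_fst R_AbsRing RN RN))). Qed.

Lemma Cd_Re_x (g : C -> C) (x t : R) (l : C) : Cd g (x, t) l -> is_derive (fun x => Re (g (x, t))) x (Re l).
Proof.
  intro H. replace l with (l * (1, 0))%C by (destruct l; apply injective_projections; simpl; ring).
  apply (is_derive_C_fst (fun x => g (x, t))), (is_derive_Cd_comp g (fun x => (x, t))); [pos | apply is_derive_C_pair; auto_derive; trivial].
Qed.

(** Cauchy-Riemann: the direction (0, 1) multiplies the derivative by i. *)
Lemma Cd_Re_t (g : C -> C) (x t : R) (l : C) : Cd g (x, t) l -> is_derive (fun t => Re (g (x, t))) t (- Im l).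
Proof.
  intro H. replace (- Im l) with (Re (l * (0, 1))%C) by (destruct l; simpl; ring).
  apply (is_derive_C_fst (fun t => g (x, t))), (is_derive_Cd_comp g (fun t => (x, t))); [pos | apply is_derive_C_pair; auto_derive; trivial].
Qed.

Lemma im_le_Cmod (c : C) : Rabs (Im c) <= Cmod c.
Proof. eapply Rle_trans; [| apply Rmax_Cmod]. apply Rmax_r. Qed.

Lemma continuous_C_pair {T : UniformSpace} (g1 g2 : T -> R) (t : T) :
  continuous g1 t -> continuous g2 t -> @continuous T CV (fun u => (g1 u, g2 u)) t.
Proof.
  intros H1 H2. apply (continuous_ext (fun u => plus (scal (g1 u) (1, 0) : CV) (scal (g2 u) (0, 1)))).
  - intro u. rewrite !scal_C. unfold plus; simpl. unfold prod_plus, Cmult, RtoC, plus; simpl. f_equal; ring.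
  - apply (@continuous_plus T R_AbsRing CV); apply (@continuous_scal_l T R_AbsRing CV); assumption.
Qed.

Lemma continuous_C_fst {T : UniformSpace} (g : T -> C) (t : T) : @continuous T CV g t -> continuous (fun u => Re (g u)) t.
Proof. intro H. apply (continuous_comp g Re); [pos | apply continuous_fst].
Qed.

Lemma continuous_C_snd {T : UniformSpace} (g : T -> C) (t : T) : @continuous T CV g t -> continuous (fun u => Im (g u)) t.
Proof. intro H. apply (continuous_comp g Im); [pos | apply continuous_snd].
Qed.

Lemma continuous_C_mult {T : UniformSpace} (f g : T -> C) (t : T) :
  @continuous T CV f t -> @continuous T CV g t -> @continuous T CV (fun u => f u * g u)%C t.
Proof.
  intros Hf Hg.
  pose proof (continuous_C_fst _ _ Hf). pose proof (continuous_C_snd _ _ Hf).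
  pose proof (continuous_C_fst _ _ Hg). pose proof (continuous_C_snd _ _ Hg).
  apply continuous_C_pair; [apply (@continuous_minus T R_AbsRing RN) | apply (@continuous_plus T R_AbsRing RN)];
    apply (@continuous_mult T R_AbsRing); assumption.
Qed.

Lemma is_RInt_C_mult (a : C) (g : R -> C) (x y : R) (l : C) :
  CInt g x y l -> CInt (fun u => a * g u)%C x y (a * l)%C.
Proof.
  intro H. pose proof (is_RInt_fct_extend_fst g x y l H) as H1. pose proof (is_RInt_fct_extend_snd g x y l H) as H2. apply is_RInt_fct_extend_pair; simpl.
  - apply (@is_RInt_minus RN); apply (@is_RInt_scal RN); assumption.
  - apply (@is_RInt_plus RN); apply (@is_RInt_scal RN); assumption.
Qed.

Lemma is_RInt_C_re (g : R -> C) (x y : R) (l : C) : CInt g x y l -> is_RInt (fun u => Re (g u)) x y (Re l).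
Proof. intro H. exact (is_RInt_fct_extend_fst g x y l H). Qed.

Lemma is_RInt_C_im (g : R -> C) (x y : R) (l : C) : CInt g x y l -> is_RInt (fun u => Im (g u)) x y (Im l).
Proof. intro H. exact (is_RInt_fct_extend_snd g x y l H). Qed.

Lemma Cmod_RInt_le (g : R -> C) (h : R -> R) (a b : R) (l : C) (m : R) : a <= b ->
  (forall x, a <= x <= b -> Cmod (g x) <= h x) -> CInt g a b l -> is_RInt h a b m -> Cmod l <= m.
Proof.
  intros Hab Hle Hg Hh. rewrite <- norm_C. apply (norm_RInt_le g h a b l m Hab); try assumption.
  intros x Hx. rewrite norm_C. apply Hle; assumption.
Qed.

Lemma Cmod_RInt_le_const (g : R -> C) (M a b : R) (l : C) : a <= b ->
  (forall x, a <= x <= b -> Cmod (g x) <= M) -> CInt g a b l -> Cmod l <= M * (b - a).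
Proof.
  intros Hab Hle Hg. apply (Cmod_RInt_le g (fun _ => M) a b l); try assumption.
  replace (M * (b - a)) with (scal (b - a) M) by (unfold scal; simpl; unfold mult; simpl; ring).
  apply (@is_RInt_const RN).
Qed.

Lemma is_RInt_eq (f g : R -> R) (a b v w : R) : is_RInt f a b v -> v = w -> (forall t, Rmin a b < t < Rmax a b -> f t = g t) -> is_RInt g a b w.
Proof. intros H <- E. exact (is_RInt_ext f g a b v E H). Qed.

(** * Goursat's theorem *)

Definition seg (a b : C) (u : R) : C := (a + RtoC u * (b - a))%C.

(** The contour integral of f along the straight segment from a to b. *)
Definition J (f : C -> C) (a b : C) : C := ((b - a) * @RInt CV (fun u => f (seg a b u)) 0 1)%C.

Lemma is_derive_seg (a b : C) (t : R) : CDer (seg a b) t (b - a)%C.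
Proof.
  apply is_derive_C_eps. exists 1. split; [lra |]. intros u _.
  unfold seg. replace (a + u * (b - a) - (a + t * (b - a)) - RtoC (u - t) * (b - a))%C with (RtoC 0).
  - rewrite Cmod_0. pos.
  - rewrite RtoC_minus. ring.
Qed.

Lemma continuous_seg (a b : C) (t : R) : Cont (seg a b) t.
Proof. apply (@ex_derive_continuous R_AbsRing CV). exists (b - a)%C. apply is_derive_seg. Qed.

Lemma continuous_C_const {T : UniformSpace} (a : C) (t : T) : @continuous T CV (fun _ => a) t.
Proof. apply continuous_const. Qed.

Lemma ex_RInt_C_cts (g : R -> C) (a b : R) :
  (forall x, Rmin a b <= x <= Rmax a b -> Cont g x) -> @ex_RInt CV g a b.
Proof. intro H. apply (@ex_RInt_continuous CV). exact H. Qed.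

Lemma J_is (f : C -> C) (a b : C) : (forall u, 0 <= u <= 1 -> Ccts f (seg a b u)) ->
  exists I, CInt (fun u => f (seg a b u)) 0 1 I /\ J f a b = ((b - a) * I)%C.
Proof.
  intro H. destruct (ex_RInt_C_cts (fun u => f (seg a b u)) 0 1) as [I HI].
  - intros x Hx. rewrite Rmin_left, Rmax_right in Hx by lra.
    apply continuous_Ccts_comp; [apply H; exact Hx | apply continuous_seg].
  - exists I. split; [pos |]. unfold J. rewrite (is_RInt_unique _ _ _ _ HI). reflexivity.
Qed.

Lemma J_FTC (f F : C -> C) (a b : C) :
  (forall u, 0 <= u <= 1 -> Cd F (seg a b u) (f (seg a b u))) ->
  (forall u, 0 <= u <= 1 -> Ccts f (seg a b u)) -> J f a b = (F b - F a)%C.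
Proof.
  intros HF Hf. destruct (J_is f a b Hf) as [I [HI ->]].
  assert (H : CInt (fun u => f (seg a b u) * (b - a))%C 0 1 (minus (F (seg a b 1)) (F (seg a b 0)) : CV)).
  { apply (@is_RInt_derive CV (fun u => F (seg a b u))).
    - intros x Hx. rewrite Rmin_left, Rmax_right in Hx by lra.
      apply is_derive_Cd_comp; [apply HF; exact Hx | apply is_derive_seg].
    - intros x Hx. rewrite Rmin_left, Rmax_right in Hx by lra.
      apply continuous_C_mult; [apply continuous_Ccts_comp; [apply Hf; exact Hx | apply continuous_seg] | apply continuous_C_const]. }
  pose proof (is_RInt_C_mult (b - a)%C _ _ _ _ HI) as H2.
  apply is_RInt_unique in H. apply is_RInt_unique in H2.
  assert (E : (minus (F (seg a b 1)) (F (seg a b 0)) : CV) = ((b - a) * I)%C).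
  { rewrite <- H, <- H2. apply RInt_ext. intros; apply Cmult_comm. }
  rewrite <- E. change ((F (a + 1 * (b - a)) - F (a + 0 * (b - a)))%C = (F b - F a)%C).
  f_equal; [f_equal; ring | f_equal; f_equal; ring].
Qed.

Lemma J_bound (f : C -> C) (a b : C) (M : R) : (forall u, 0 <= u <= 1 -> Ccts f (seg a b u)) ->
  (forall u, 0 <= u <= 1 -> Cmod (f (seg a b u)) <= M) -> Cmod (J f a b) <= Cmod (b - a)%C * M.
Proof.
  intros Hc HM. destruct (J_is f a b Hc) as [I [HI ->]]. rewrite Cmod_mult.
  apply Rmult_le_compat_l; [pos |].
  replace M with (M * (1 - 0)) by ring. apply (Cmod_RInt_le_const (fun u => f (seg a b u)) M 0 1 I); pos.
Qed.

Lemma J_minus (f g : C -> C) (a b : C) : (forall u, 0 <= u <= 1 -> Ccts f (seg a b u)) ->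
  (forall u, 0 <= u <= 1 -> Ccts g (seg a b u)) -> J (fun w => f w - g w)%C a b = (J f a b - J g a b)%C.
Proof.
  intros Hf Hg. destruct (J_is f a b Hf) as [I [HI ->]]. destruct (J_is g a b Hg) as [I' [HI' ->]].
  pose proof (@is_RInt_minus CV _ _ _ _ _ _ HI HI') as H. unfold J.
  assert (E : @RInt CV (fun u => (f (seg a b u) - g (seg a b u))%C) 0 1 = (I - I')%C).
  { exact (is_RInt_unique _ _ _ _ H). }
  rewrite E. ring.
Qed.

(** Integrals over subsegments become integrals of one function of a real parameter; reversal and
    bisection are then [is_RInt_swap] and the Chasles relation. *)
Lemma J_sub (f : C -> C) (a b : C) (x y : R) : (forall u, 0 <= u <= 1 -> Ccts f (seg a b u)) -> 0 <= x <= 1 -> 0 <= y <= 1 ->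
  CInt (fun u => (b - a) * f (seg a b u))%C x y (J f (seg a b x) (seg a b y)).
Proof.
  intros Hc Hx Hy. assert (Hxy : forall u, Rmin x y <= u <= Rmax x y -> 0 <= u <= 1) by (intro u; unfold Rmin, Rmax; destruct Rle_dec; lra).
  destruct (ex_RInt_C_cts (fun u => (b - a) * f (seg a b u))%C x y) as [I HI].
  { intros u Hu. apply continuous_C_mult; [apply continuous_C_const | apply continuous_Ccts_comp; [apply Hc, Hxy, Hu | apply continuous_seg]]. }
  assert (Es : forall u, seg (seg a b x) (seg a b y) u = seg a b ((y - x) * u + x)) by (intro u; unfold seg; rewrite RtoC_plus, RtoC_mult, RtoC_minus; ring).
  replace (J f (seg a b x) (seg a b y)) with I; [pos |].
  destruct (J_is f (seg a b x) (seg a b y)) as [I' [HI' ->]]; [intros u Hu; rewrite Es; apply Hc; nra |].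
  pose proof (@is_RInt_comp_lin CV (fun u => (b - a) * f (seg a b u))%C (y - x) x 0 1 I) as K.
  replace ((y - x) * 0 + x) with x in K by ring. replace ((y - x) * 1 + x) with y in K by ring.
  apply K, is_RInt_unique in HI. rewrite <- HI. apply is_RInt_unique.
  apply (is_RInt_C_mult (seg a b y - seg a b x)%C) in HI'. revert HI'. apply (@is_RInt_ext CV). intros u _.
  rewrite Es, scal_C. unfold seg. rewrite RtoC_minus. cring.
Qed.

Lemma seg_0 (a b : C) : seg a b 0 = a.
Proof. unfold seg. ring. Qed.

Lemma seg_1 (a b : C) : seg a b 1 = b.
Proof. unfold seg. ring. Qed.

Lemma J_rev (f : C -> C) (a b : C) : (forall u, 0 <= u <= 1 -> Ccts f (seg a b u)) -> J f b a = (- J f a b)%C.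
Proof.
  intro Hc. pose proof (J_sub f a b 0 1 Hc ltac:(lra) ltac:(lra)) as H. pose proof (J_sub f a b 1 0 Hc ltac:(lra) ltac:(lra)) as H'.
  rewrite seg_0, seg_1 in *. apply (@is_RInt_swap CV), is_RInt_unique in H. rewrite <- (is_RInt_unique _ _ _ _ H'). exact H.
Qed.

Lemma J_mid (f : C -> C) (a b m : C) : (a + b = m + m)%C -> (forall u, 0 <= u <= 1 -> Ccts f (seg a b u)) ->
  J f a b = (J f a m + J f m b)%C.
Proof.
  intros Em Hc. pose proof (J_sub f a b 0 1 Hc ltac:(lra) ltac:(lra)) as H.
  pose proof (@is_RInt_Chasles CV _ _ _ _ _ _ (J_sub f a b 0 (/ 2) Hc ltac:(lra) ltac:(lra)) (J_sub f a b (/ 2) 1 Hc ltac:(lra) ltac:(lra))) as H'.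
  replace (seg a b (/ 2)) with m in H' by (unfold seg; replace b with (m + m - a)%C by (rewrite <- Em; ring); rewrite RtoC_inv by lra; field; apply RtoC_neq0; lra).
  rewrite seg_0, seg_1 in *. apply is_RInt_unique in H, H'. rewrite <- H. exact H'.
Qed.

Lemma geom_small (q K e : R) : 0 <= q < 1 -> 0 <= K -> 0 < e -> exists n, K * q ^ n < e.
Proof.
  intros Hq HK He. destruct (pow_lt_1_zero q ltac:(rewrite Rabs_pos_eq; lra) (e / (1 + K)) ltac:(pos)) as [n Hn].
  exists n. specialize (Hn n (le_n n)). apply Rlt_div_r in Hn; [| lra]. pose proof (Rle_abs (q ^ n)). nra.
Qed.

(** The sequences u n - 2K 2^(-n) and u n + 2K 2^(-n) are adjacent. *)
Lemma geom_seq_limit (u : nat -> R) (K : R) : (forall n, Rabs (u (S n) - u n) <= K * (/ 2) ^ n) ->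
  exists l, forall n, Rabs (u n - l) <= 2 * K * (/ 2) ^ n.
Proof.
  intro H. set (a n := u n - 2 * K * (/ 2) ^ n). set (b n := u n + 2 * K * (/ 2) ^ n).
  assert (Ha : forall n, a n <= a (S n)) by (intro n; specialize (H n); apply Rabs_le_between in H; unfold a; simpl; lra).
  assert (Hb : forall n, b (S n) <= b n) by (intro n; specialize (H n); apply Rabs_le_between in H; unfold b; simpl; lra).
  destruct (ex_lim_seq_adj a b Ha Hb) as [[la Hla] [[lb Hlb] E]].
  { apply is_lim_seq_ext with (fun n => 4 * K * (/ 2) ^ n); [intro n; unfold a, b; ring |].
    replace (Finite 0) with (Rbar_mult (4 * K) 0) by (simpl; f_equal; ring). apply is_lim_seq_scal_l, is_lim_seq_geom. rewrite Rabs_pos_eq; lra. }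
  rewrite (is_lim_seq_unique _ _ Hla), (is_lim_seq_unique _ _ Hlb) in E. injection E as E. exists la. intro n.
  pose proof (is_lim_seq_incr_compare a la Hla Ha n). pose proof (is_lim_seq_decr_compare b lb Hlb Hb n). unfold a, b in *. apply Rabs_le. lra.
Qed.

Definition holo (f : C -> C) (c : C) (rad : R) : Prop := forall z, Cmod (z - c)%C < rad -> exists l, Cd f z l.

Lemma holo_cts (f : C -> C) (c : C) (rad : R) (z : C) : holo f c rad -> Cmod (z - c)%C < rad -> Ccts f z.
Proof. intros H Hz. destruct (H z Hz) as [l Hl]. exact (Cd_cts _ _ _ Hl). Qed.

Lemma seg_dist (c a b : C) (m u : R) : Cmod (a - c)%C <= m -> Cmod (b - c)%C <= m -> 0 <= u <= 1 -> Cmod (seg a b u - c)%C <= m.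
Proof.
  intros Ha Hb Hu. unfold seg.
  replace (a + u * (b - a) - c)%C with (RtoC (1 - u) * (a - c) + RtoC u * (b - c))%C by (rewrite RtoC_minus; ring).
  Ctri. rewrite !Cmod_mult, !Cmod_R, !Rabs_pos_eq by lra. nra.
Qed.

Lemma disc_seg (c a b : C) (rad u : R) : Cmod (a - c)%C < rad -> Cmod (b - c)%C < rad -> 0 <= u <= 1 -> Cmod (seg a b u - c)%C < rad.
Proof.
  intros Ha Hb Hu. apply Rle_lt_trans with (Rmax (Cmod (a - c)%C) (Cmod (b - c)%C)); [| apply Rmax_lub_lt; assumption].
  apply seg_dist; [apply Rmax_l | apply Rmax_r | lra].
Qed.

Lemma Cmod_le_abs (x y : R) : Cmod (x, y) <= Rabs x + Rabs y.
Proof.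
  replace ((x, y) : C) with (RtoC x + RtoC y * Ci)%C by (unfold RtoC, Ci, Cplus, Cmult; simpl; f_equal; ring).
  Ctri. rewrite Cmod_mult, !Cmod_R, Cmod_Ci. lra.
Qed.

Section Goursat.
Variables (f : C -> C) (c u v : C) (rad m : R).
Hypothesis Hf : holo f c rad.
Hypothesis Hm : m < rad.
(** All triangles of the repeated bisection are homothetic, so a base point p and a scale s describe
    them. The middle one of the four parts is reflected and gets a negative scale. *)
Let tri (t : C * R) : C := let '(p, s) := t in (J f p (p + s * u) + J f (p + s * u) (p + s * v) + J f (p + s * v) p)%C.
Let small (t : C * R) : Prop := let '(p, s) := t in Cmod (p - c)%C <= m /\ Cmod (p + s * u - c)%C <= m /\ Cmod (p + s * v - c)%C <= m.
Let K := Cmod u + Cmod v.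
Let child (t t' : C * R) : Prop := small t' /\ Rabs (snd t') = Rabs (snd t) / 2 /\ Cmod (fst t' - fst t)%C <= K * Rabs (snd t) /\ Cmod (tri t) <= 4 * Cmod (tri t').

Lemma disc_cts (a b : C) : Cmod (a - c)%C < rad -> Cmod (b - c)%C < rad -> forall w, 0 <= w <= 1 -> Ccts f (seg a b w).
Proof. intros Ha Hb w Hw. apply (holo_cts f c rad); [pos | apply disc_seg; assumption].
Qed.

(** The four parts add up to the whole after the inner edges cancel, so one of them carries at least
    a quarter of the modulus. *)
Lemma tri_child (t : C * R) : small t -> exists t', child t t'.
Proof.
  destruct t as [p s]. intros [H1 [H2 H3]].
  set (e := RtoC (s / 2)). assert (Es : RtoC s = (e + e)%C) by (unfold e; rewrite <- RtoC_plus; f_equal; field).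
  assert (Ee : RtoC (- (s / 2)) = (- e)%C) by apply RtoC_opp.
  assert (Hmid : forall x y z, (x + y = z + z)%C -> Cmod (x - c)%C <= m -> Cmod (y - c)%C <= m -> Cmod (z - c)%C <= m).
  { intros x y z E Hx Hy. assert (H : Cmod (2 * (z - c))%C <= m + m).
    { replace (2 * (z - c))%C with ((x - c) + (y - c))%C by (transitivity ((x + y) - (c + c))%C; [ring | rewrite E; ring]). Ctri. lra. }
    rewrite Cmod_mult, Cmod_R, Rabs_pos_eq in H by lra. lra. }
  assert (M1 : Cmod (p + e * u - c)%C <= m) by (apply (Hmid p (p + s * u)%C); [rewrite Es; ring | lra | assumption]).
  assert (M2 : Cmod (p + e * v - c)%C <= m) by (apply (Hmid p (p + s * v)%C); [rewrite Es; ring | nra | assumption]).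
  assert (M3 : Cmod (p + e * (u + v) - c)%C <= m) by (apply (Hmid (p + s * u)%C (p + s * v)%C); [rewrite Es; ring | lra | assumption]).
  assert (HJ : tri (p, s) = (tri (p, (s / 2)%R) + tri (p + e * u, (s / 2)%R) + tri (p + e * v, (s / 2)%R) + tri (p + e * (u + v), (- (s / 2))%R))%C).
  { unfold tri. fold e. rewrite Ee.
    rewrite (J_mid f p (p + s * u) (p + e * u)), (J_mid f (p + s * u) (p + s * v) (p + e * (u + v))), (J_mid f (p + s * v) p (p + e * v))
      by (first [rewrite Es; ring | apply disc_cts; lra]).
    replace (p + e * u + e * u)%C with (p + s * u)%C by (rewrite Es; ring). replace (p + e * u + e * v)%C with (p + e * (u + v))%C by ring.
    replace (p + e * v + e * u)%C with (p + e * (u + v))%C by ring. replace (p + e * v + e * v)%C with (p + s * v)%C by (rewrite Es; ring).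
    replace (p + e * (u + v) + - e * u)%C with (p + e * v)%C by ring. replace (p + e * (u + v) + - e * v)%C with (p + e * u)%C by ring.
    rewrite (J_rev f (p + e * u) (p + e * v)), (J_rev f (p + e * (u + v)) (p + e * u)), (J_rev f (p + e * v) (p + e * (u + v))) by (apply disc_cts; lra). ring. }
  assert (Hle : Cmod (tri (p, s)) <= Cmod (tri (p, (s / 2)%R)) + Cmod (tri (p + e * u, (s / 2)%R)%C) + Cmod (tri (p + e * v, (s / 2)%R)%C) + Cmod (tri (p + e * (u + v), (- (s / 2))%R)%C)).
  { rewrite HJ. Ctri. apply Rplus_le_compat_r. Ctri. apply Rplus_le_compat_r, Cmod_triangle. }
  assert (As : Rabs (s / 2) = Rabs s / 2) by (unfold Rdiv; rewrite Rabs_mult, (Rabs_pos_eq (/ 2)); lra).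
  assert (Hd : forall w, Cmod w <= K -> Cmod (p + e * w - p)%C <= K * Rabs s).
  { intros w Hw. replace (p + e * w - p)%C with (e * w)%C by ring. rewrite Cmod_mult. unfold e. rewrite Cmod_R, As. pose proof (Rabs_pos s). pose proof (Cmod_ge_0 w). nra. }
  pose proof (Cmod_ge_0 u). pose proof (Cmod_ge_0 v).
  assert (Q : Cmod (tri (p, s)) <= 4 * Cmod (tri (p, (s / 2)%R)) \/ Cmod (tri (p, s)) <= 4 * Cmod (tri (p + e * u, (s / 2)%R)%C) \/
    Cmod (tri (p, s)) <= 4 * Cmod (tri (p + e * v, (s / 2)%R)%C) \/ Cmod (tri (p, s)) <= 4 * Cmod (tri (p + e * (u + v), (- (s / 2))%R)%C)) by lra.
  destruct Q as [Q | [Q | [Q | Q]]]; eexists; (split; [| split; [| split; [| exact Q]]]); cbn [fst snd]; unfold small; fold e; rewrite ?Ee, ?Rabs_Ropp; try exact As.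
  - lra.
  - replace p with (p + e * 0)%C at 1 by ring. apply Hd. rewrite Cmod_0. unfold K; lra.
  - repeat split; [lra | |]; [replace (p + e * u + e * u)%C with (p + s * u)%C by (rewrite Es; ring) | replace (p + e * u + e * v)%C with (p + e * (u + v))%C by ring]; assumption.
  - apply Hd. unfold K; lra.
  - repeat split; [lra | |]; [replace (p + e * v + e * u)%C with (p + e * (u + v))%C by ring | replace (p + e * v + e * v)%C with (p + s * v)%C by (rewrite Es; ring)]; assumption.
  - apply Hd. unfold K; lra.
  - repeat split; [lra | |]; [replace (p + e * (u + v) + - e * u)%C with (p + e * v)%C by ring | replace (p + e * (u + v) + - e * v)%C with (p + e * u)%C by ring]; assumption.
  - apply Hd. apply Cmod_triangle.
Qed.

Lemma Goursat_param (p0 : C) : small (p0, 1) -> tri (p0, 1) = 0%C.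
Proof.
  (* [epsilon] turns the choice of a part into a function, which is then iterated. *)
  intro H0. set (next := fun t => epsilon (inhabits t) (child t)).
  assert (Hnext : forall t, small t -> child t (next t)) by (intros t Ht; apply epsilon_spec, tri_child, Ht).
  set (sq n := Nat.iter n next (p0, 1)).
  assert (Hsq : forall n, small (sq n) /\ Rabs (snd (sq n)) = (/ 2) ^ n /\ Cmod (tri (p0, 1)) <= 4 ^ n * Cmod (tri (sq n))).
  { induction n as [| n [I1 [I2 I3]]]; [split; [pos | simpl; rewrite Rabs_R1; lra] |].
    destruct (Hnext _ I1) as [N1 [N2 [_ N4]]]. change (next (sq n)) with (sq (S n)) in *. split; [pos |].
    rewrite N2, I2. pose proof (pow_lt 4 n ltac:(lra)). split; [simpl; field |]. rewrite <- tech_pow_Rmult. nra. }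
  assert (Hst : forall n, Cmod (fst (sq (S n)) - fst (sq n))%C <= K * (/ 2) ^ n).
  { intro n. destruct (Hsq n) as [I1 [<- _]]. apply (Hnext _ I1). }
  destruct (geom_seq_limit (fun n => Re (fst (sq n))) K) as [x Hx]; [intro n; eapply Rle_trans; [apply re_le_Cmod with (c := (fst (sq (S n)) - fst (sq n))%C) | apply Hst] |].
  destruct (geom_seq_limit (fun n => Im (fst (sq n))) K) as [y Hy]; [intro n; eapply Rle_trans; [apply im_le_Cmod with (c := (fst (sq (S n)) - fst (sq n))%C) | apply Hst] |].
  set (p := (x, y) : C).
  assert (HK : 0 <= K) by pos.
  assert (Hp : forall n, Cmod (fst (sq n) - p)%C <= 4 * K * (/ 2) ^ n).
  { intro n. eapply Rle_trans; [apply Cmod_le_abs |]. specialize (Hx n). specialize (Hy n). fold (Re (fst (sq n))). fold (Im (fst (sq n))). simpl. unfold Rminus in *. lra. }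
  assert (Hin : Cmod (p - c)%C < rad).
  { destruct (geom_small (/ 2) (4 * K) (rad - m) ltac:(lra) ltac:(lra) ltac:(lra)) as [n Hn]. destruct (Hsq n) as [I1 _]. specialize (Hp n). rewrite Cmod_minus_sym in Hp.
    pose proof (Cmod_dist_triangle p (fst (sq n)) c). destruct (sq n) as [q s]. cbn [fst] in *. destruct I1 as [I1 _]. lra. }
  destruct (Hf p Hin) as [l Hl].
  (* Three edges of length at most 2B, error at most eps B on each, and B = 5 K h with h = 2^(-n):
     together 150 K^2 eps h^2, and h^2 cancels the factor 4^n. *)
  apply (Cmod_eq_eps _ _ (150 * K * K)). intros eps He. replace (tri (p0, 1) - 0)%C with (tri (p0, 1)) by ring.
  destruct (Hl eps He) as [del [Hdel Hbd]].
  destruct (geom_small (/ 2) (5 * K) del ltac:(lra) ltac:(lra) Hdel) as [n Hn].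
  destruct (Hsq n) as [I1 [I2 I3]]. specialize (Hp n). pose proof (pow_lt (/ 2) n ltac:(lra)) as Hh.
  assert (E4 : 4 ^ n * ((/ 2) ^ n * (/ 2) ^ n) = 1) by (rewrite <- !Rpow_mult_distr; replace (4 * (/ 2 * / 2)) with 1 by field; apply pow1).
  pose proof (pow_lt 4 n ltac:(lra)) as H4.
  destruct (sq n) as [q s]. cbn [fst snd] in *. set (h := (/ 2) ^ n) in *. set (B := 5 * K * h) in *.
  (* The affine part of f at the limit point p has the primitive G, hence contributes nothing around
     the triangle. *)
  set (g := fun w => (f p + l * (w - p))%C). set (G := fun w => (f p * w + RtoC (/ 2) * l * ((w - p) * (w - p)))%C).
  assert (Hs : forall w, Cd (fun w => w - p)%C w 1%C).
  { intro w. eapply Cd_ext; [| | apply (Cd_minus _ _ _ _ _ (Cd_id w) (Cd_const p w))]; [reflexivity | ring]. }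
  assert (HG : forall w, Cd G w (g w)).
  { intro w. eapply Cd_ext; [| | apply Cd_plus; [apply (Cd_scal (f p)), Cd_id | apply (Cd_scal (RtoC (/ 2) * l)%C), (Cd_mult _ _ _ _ _ (Hs w) (Hs w))]]; [reflexivity |].
    unfold g. transitivity (f p + (RtoC (/ 2) + RtoC (/ 2)) * l * (w - p))%C; [ring |]. rewrite <- RtoC_plus. replace (/ 2 + / 2) with 1 by field. ring. }
  assert (Hfg : forall w, Cmod (w - c)%C < rad -> Ccts (fun w => f w - g w)%C w).
  { intros w Hw. destruct (Hf w Hw) as [k Hk]. eapply Cd_cts, Cd_minus; [exact Hk | apply Cd_plus; [apply Cd_const | apply Cd_scal, Hs]]. }
  assert (Hgc : forall w, Ccts g w) by (intro w; eapply Cd_cts, Cd_plus; [apply Cd_const | apply Cd_scal, Hs]).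
  assert (HB : forall w, Cmod (w - q)%C <= K * h -> Cmod (w - p)%C <= B) by (intros w Hw; pose proof (Cmod_dist_triangle w q p); unfold B; lra).
  assert (HE : forall a b, Cmod (a - c)%C <= m -> Cmod (b - c)%C <= m -> Cmod (a - q)%C <= K * h -> Cmod (b - q)%C <= K * h ->
    Cmod (J f a b - (G b - G a))%C <= 2 * B * (eps * B)).
  { intros a b Ha Hb Haq Hbq. apply HB in Haq, Hbq. rewrite <- (J_FTC g G) by auto. rewrite <- J_minus by (auto; apply disc_cts; lra).
    eapply Rle_trans; [apply (J_bound _ _ _ (eps * B)) |].
    - intros w Hw. apply Hfg. apply disc_seg; lra.
    - intros w Hw. pose proof (seg_dist p a b B w Haq Hbq Hw) as Hd. specialize (Hbd (seg a b w) ltac:(lra)). unfold g.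
      replace (f (seg a b w) - (f p + l * (seg a b w - p)))%C with (f (seg a b w) - f p - l * (seg a b w - p))%C by ring. nra.
    - pose proof (Cmod_dist_triangle b p a) as Hd. rewrite (Cmod_minus_sym p a) in Hd. pose proof (Cmod_ge_0 (a - p)%C). apply Rmult_le_compat_r; nra; lra. }
  destruct I1 as [V1 [V2 V3]].
  assert (Dw : forall w, Cmod w <= K -> Cmod (q + s * w - q)%C <= K * h).
  { intros w Hw. replace (q + s * w - q)%C with (s * w)%C by ring. rewrite Cmod_mult, Cmod_R, I2. nra. }
  pose proof (Cmod_ge_0 u). pose proof (Cmod_ge_0 v).
  assert (D0 : Cmod (q - q)%C <= K * h) by (rewrite Cmod_minus_0; nra). pose proof (Dw u ltac:(unfold K; lra)) as Du. pose proof (Dw v ltac:(unfold K; lra)) as Dv.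
  pose proof (HE _ _ V1 V2 D0 Du) as B1. pose proof (HE _ _ V2 V3 Du Dv) as B2. pose proof (HE _ _ V3 V1 Dv D0) as B3.
  assert (BT : Cmod (tri (q, s)) <= 3 * (2 * B * (eps * B))).
  { replace (tri (q, s)) with ((J f q (q + s * u) - (G (q + s * u) - G q)) + (J f (q + s * u) (q + s * v) - (G (q + s * v) - G (q + s * u))) + (J f (q + s * v) q - (G q - G (q + s * v))))%C
      by (unfold tri; ring).
    Ctri. eapply Rle_trans; [apply Rplus_le_compat_r, Cmod_triangle |]. lra. } apply Rle_trans with (4 ^ n * (3 * (2 * B * (eps * B)))); [nra |].
  replace (4 ^ n * (3 * (2 * B * (eps * B)))) with (150 * K * K * eps * (4 ^ n * (h * h))) by (unfold B; ring). rewrite E4. lra.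
Qed.
End Goursat.

(** Goursat for the triangle c, z, w turns the increment of [J f c] into [J f z w], and f is nearly
    constant on that short segment. *)
Lemma holo_primitive (f : C -> C) (c : C) (rad : R) : 0 < rad -> holo f c rad -> forall z, Cmod (z - c)%C < rad -> Cd (J f c) z (f z).
Proof.
  intros HR Hf z Hz eps Heps. pose proof (disc_cts f c rad Hf) as Hcts.
  assert (Hc0 : Cmod (c - c)%C < rad) by (rewrite Cmod_minus_0; exact HR).
  destruct (holo_cts f c rad z Hf Hz eps Heps) as [d1 [Hd1 H1]].
  exists (Rmin d1 (rad - Cmod (z - c)%C)). split; [apply Rmin_pos; lra |]. intros w Hw. apply Rmin_Rgt_l in Hw as [Hw1 Hw2].
  pose proof (Cmod_dist_triangle w z c) as Hwc.
  assert (HG := Goursat_param f c (z - c)%C (w - c)%C rad (Rmax (Cmod (z - c)%C) (Cmod (w - c)%C)) Hf ltac:(apply Rmax_lub_lt; lra) c).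
  cbv beta iota in HG. rewrite Cmod_minus_0 in HG. replace (c + 1 * (z - c))%C with z in HG by ring. replace (c + 1 * (w - c))%C with w in HG by ring.
  specialize (HG ltac:(repeat split; [eapply Rle_trans; [pos | apply Rmax_l] | apply Rmax_l | apply Rmax_r])).
  rewrite (J_rev f c w) in HG by (apply Hcts; lra).
  replace (J f c w - J f c z - f z * (w - z))%C with ((J f z w - f z * (w - z)) - (J f c z + J f z w + - J f c w))%C by ring.
  rewrite HG. replace (J f z w - f z * (w - z) - 0)%C with (J f z w - f z * (w - z))%C by ring.
  assert (Ek : J (fun _ => f z) z w = (f z * (w - z))%C).
  { rewrite (J_FTC (fun _ => f z) (fun x => f z * x)%C); [ring | |].
    - intros u _. eapply Cd_ext; [| | apply (Cd_scal (f z)), Cd_id]; [reflexivity | ring].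
    - intros u _. exact (Cd_cts _ _ _ (Cd_const (f z) _)). }
  rewrite <- Ek, <- J_minus by first [apply Hcts; lra | intros u _; exact (Cd_cts _ _ _ (Cd_const (f z) _))].
  rewrite (Rmult_comm eps). apply J_bound.
  - intros u Hu. destruct (Hf (seg z w u)) as [k Hk]; [apply disc_seg; lra |]. exact (Cd_cts _ _ _ (Cd_minus _ _ _ _ _ Hk (Cd_const _ _))).
  - intros u Hu. apply H1. unfold seg. replace (z + u * (w - z) - z)%C with (RtoC u * (w - z))%C by ring.
    rewrite Cmod_mult, Cmod_R, Rabs_pos_eq by lra. pose proof (Cmod_ge_0 (w - z)%C). nra.
Qed.

(** * Cauchy's integral formula *)

Definition cis (t : R) : C := (cos t, sin t).

Lemma Cmod_cis (t : R) : Cmod (cis t) = 1.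
Proof. unfold Cmod, cis; simpl. replace (cos t * (cos t * 1) + sin t * (sin t * 1)) with 1; [apply sqrt_1 |]. generalize (sin2_cos2 t). unfold Rsqr. lra. Qed.

Lemma cis_neq0 (t : R) : cis t <> 0%C.
Proof. apply Cmod_gt_0. rewrite Cmod_cis. lra. Qed.

Lemma is_derive_cis (t : R) : CDer cis t (Ci * cis t)%C.
Proof.
  replace (Ci * cis t)%C with ((- sin t, cos t) : C) by (unfold Ci, cis, Cmult; simpl; f_equal; ring).
  apply is_derive_C_pair; [apply is_derive_cos | apply is_derive_sin].
Qed.

Lemma continuous_cis (t : R) : Cont cis t.
Proof. apply (@ex_derive_continuous R_AbsRing CV). exists (Ci * cis t)%C. apply is_derive_cis. Qed.

Definition circ (c : C) (r t : R) : C := (c + RtoC r * cis t)%C.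

Lemma is_derive_circ (c : C) (r t : R) : CDer (circ c r) t (RtoC r * (Ci * cis t))%C.
Proof.
  apply (is_derive_Cd_comp (fun w => c + RtoC r * w)%C cis); [| apply is_derive_cis].
  eapply Cd_ext; [| | apply Cd_plus; [apply Cd_const | apply (Cd_scal (RtoC r)), Cd_id]]; [intro; reflexivity | ring].
Qed.

Lemma continuous_circ (c : C) (r t : R) : Cont (circ c r) t.
Proof. apply (@ex_derive_continuous R_AbsRing CV). eexists. apply is_derive_circ. Qed.

Lemma Cmod_circ (c : C) (r t : R) : 0 <= r -> Cmod (circ c r t - c)%C = r.
Proof.
  intro Hr. unfold circ. replace (c + r * cis t - c)%C with (RtoC r * cis t)%C by ring.
  rewrite Cmod_mult, Cmod_R, Cmod_cis, Rabs_pos_eq; lra.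
Qed.

(** The primitive Q returns to its value after one turn. The constant r i of the line element is
    divided out, here and in later circle integrals. *)
Lemma circle_closed (Q q : C -> C) (c : C) (r : R) : 0 < r -> (forall t, Cd Q (circ c r t) (q (circ c r t))) ->
  (forall t, Ccts q (circ c r t)) -> CInt (fun t => q (circ c r t) * cis t)%C 0 (2 * PI) (RtoC 0).
Proof.
  intros Hr HQ Hq.
  assert (H : CInt (fun t => q (circ c r t) * (RtoC r * (Ci * cis t)))%C 0 (2 * PI)
     (minus (Q (circ c r (2 * PI))) (Q (circ c r 0)) : CV)).
  { apply (@is_RInt_derive CV (fun t => Q (circ c r t))); intros t _; [apply is_derive_Cd_comp; [apply HQ | apply is_derive_circ] |].
    apply continuous_C_mult; [apply continuous_Ccts_comp; [apply Hq | apply continuous_circ] |].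
    apply continuous_C_mult; [apply continuous_C_const |]. apply continuous_C_mult; [apply continuous_C_const | apply continuous_cis]. }
  assert (E : circ c r (2 * PI) = circ c r 0) by (unfold circ, cis; rewrite cos_2PI, sin_2PI, cos_0, sin_0; reflexivity).
  rewrite E in H. apply (is_RInt_C_mult (/ (RtoC r * Ci))%C) in H.
  assert (Hri : (RtoC r * Ci)%C <> 0%C).
  { apply Cmod_gt_0. rewrite Cmod_mult, Cmod_R, Cmod_Ci, Rabs_pos_eq; lra. }
  change (minus (Q (circ c r 0)) (Q (circ c r 0)) : CV) with (Q (circ c r 0) - Q (circ c r 0))%C in H.
  replace (/ (RtoC r * Ci) * (Q (circ c r 0) - Q (circ c r 0)))%C with (RtoC 0) in H by ring.
  revert H. apply is_RInt_ext. intros t _.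
  transitivity ((/ (r * Ci) * (r * Ci)) * (q (circ c r t) * cis t))%C; [cring |]. rewrite Cinv_l by exact Hri. cring.
Qed.

Lemma circle_holo (q : C -> C) (c : C) (rad r : R) : holo q c rad -> 0 < r < rad ->
  CInt (fun t => q (circ c r t) * cis t)%C 0 (2 * PI) (RtoC 0).
Proof.
  intros Hq Hr. apply (circle_closed (J q c) q); [lra | |]; intro t; [apply (holo_primitive q c rad); [lra | pos |] | apply (holo_cts q c rad); [pos |]];
    rewrite Cmod_circ; lra.
Qed.

Lemma Cd_poly1 (a b z : C) : Cd (fun w => a + b * w)%C z b.
Proof. eapply Cd_ext; [| | apply Cd_plus; [apply Cd_const | apply (Cd_scal b), Cd_id]]; [intro; reflexivity | ring]. Qed.

Lemma Cd_shift (a z : C) : Cd (fun w => w - a)%C z 1%C.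
Proof. eapply Cd_ext; [| | apply (Cd_poly1 (- a)%C 1%C)]; [intro; simpl; ring | reflexivity]. Qed.

Lemma is_RInt_C_const (a : C) (x y : R) : CInt (fun _ => a) x y (RtoC (y - x) * a)%C.
Proof. rewrite <- scal_C. apply (@is_RInt_const CV). Qed.

(* With u = 1/w the integrand a/(w-a) becomes the function a u/(1-a u), regular on the disc bounded by the image circle and zero at its centre. *)
Lemma circle_recip (a : C) (r : R) : Cmod a < r ->
  CInt (fun t => RtoC r * cis t / (RtoC r * cis t - a))%C 0 (2 * PI) (RtoC (2 * PI)).
Proof.
  intro Ha. pose proof (Cmod_ge_0 a) as Ha0. assert (Hr : 0 < r) by lra.
  assert (Hrc : RtoC r <> 0%C) by (apply Cmod_gt_0; rewrite Cmod_R, Rabs_pos_eq; lra).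
  set (rho := 2 / (r + Cmod a)).
  assert (Hrho : / r < rho).
  { unfold rho. apply Rmult_lt_reg_r with (r * (r + Cmod a)); [nra |]. field_simplify; lra. }
  assert (Hnz : forall z, Cmod (z - 0)%C < rho -> (1 - a * z)%C <> 0%C).
  { intros z Hz E. replace (z - 0)%C with z in Hz by ring.
    assert (E1 : (a * z)%C = 1%C) by (replace (a * z)%C with (1 - (1 - a * z))%C by ring; rewrite E; ring).
    apply (f_equal Cmod) in E1. rewrite Cmod_mult, Cmod_1 in E1.
    assert (Cmod a * rho < 1).
    { unfold rho. apply Rmult_lt_reg_r with (r + Cmod a); [lra |]. field_simplify; lra. } nra. }
  set (q := fun u => (a / (1 - a * u))%C).
  assert (Hq : holo q 0 rho).
  { intros z Hz. eexists. apply (Cd_div (fun _ => a) (fun u => 1 - a * u)%C); [apply Hnz; exact Hz | apply Cd_const |].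
    apply Cd_minus; [apply Cd_const | apply Cd_scal, Cd_id]. }
  assert (H0 : CInt (fun t => q (circ 0 (/ r) t) * cis t)%C 0 (2 * PI) (RtoC 0)).
  { apply (circle_holo q 0 rho); [pos |]. split; pos. }
  assert (H1 : CInt (fun t => scal (-1) (q (circ 0 (/ r) (-1 * t + 2 * PI)) * cis (-1 * t + 2 * PI))%C) 0 (2 * PI) (opp (RtoC 0 : CV))).
  { apply (@is_RInt_comp_lin CV (fun t => (q (circ 0 (/ r) t) * cis t)%C) (-1) (2 * PI) 0 (2 * PI)).
    replace (-1 * 0 + 2 * PI) with (2 * PI) by ring. replace (-1 * (2 * PI) + 2 * PI) with 0 by ring.
    apply (@is_RInt_swap CV). exact H0. }
  apply (is_RInt_C_mult (- RtoC (/ r))%C) in H1.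
  pose proof (@is_RInt_plus CV _ _ _ _ _ _ H1 (is_RInt_C_const 1%C 0 (2 * PI))) as H2.
  change (plus (- RtoC (/ r) * opp (RtoC 0 : CV))%C (RtoC (2 * PI - 0) * 1)%C : CV) with ((- RtoC (/ r) * (- 0) + RtoC (2 * PI - 0) * 1)%C) in H2.
  replace (- RtoC (/ r) * (- 0) + RtoC (2 * PI - 0) * 1)%C with (RtoC (2 * PI)) in H2 by (rewrite Rminus_0_r; ring).
  revert H2. apply (@is_RInt_ext CV). intros t _.
  assert (Ecis : (cis t * cis (-1 * t + 2 * PI))%C = 1%C).
  { unfold cis. rewrite cos_plus, sin_plus, cos_2PI, sin_2PI. replace (-1 * t) with (- t) by ring. rewrite cos_neg, sin_neg. apply injective_projections; simpl; [generalize (sin2_cos2 t); unfold Rsqr; lra | ring]. }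
  set (e := cis t) in *. set (e' := cis (-1 * t + 2 * PI)) in *.
  assert (He : e <> 0%C) by apply cis_neq0.
  assert (Ee' : e' = (/ e)%C) by (transitivity (/ e * (e * e'))%C; [field; exact He | rewrite Ecis; ring]).
  assert (Hden : (RtoC r * e - a)%C <> 0%C).
  { apply Cmod_gt_0. pose proof (Cmod_ge_minus (RtoC r * e)%C a) as K. rewrite Cmod_mult, Cmod_R, Rabs_pos_eq in K by lra.
    unfold e in K at 1. rewrite Cmod_cis in K. lra. }
  rewrite scal_C. unfold q, circ. fold e'. rewrite Ee', RtoC_inv.
  change ((- / r * (RtoC (-1) * (a / (1 - a * (0 + / r * / e)) * / e)) + 1)%C = (r * e / (r * e - a))%C).
  field. repeat split; try assumption. lra.
Qed.

Section Homotopy.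
Variables (f f1 : C -> C) (c z : C) (rad r : R).
Hypothesis Hd : forall w, Cmod (w - c)%C < rad -> Cd f w (f1 w).
Hypothesis Hf1 : forall w, Cmod (w - c)%C < rad -> Ccts f1 w.
Hypothesis Hz : Cmod (z - c)%C < r < rad.
Let k (t : R) : C := (RtoC r * cis t / (circ c r t - z))%C.

Lemma circ_off (t : R) : (circ c r t - z)%C <> 0%C.
Proof.
  intro E. pose proof (Cmod_dist_triangle (circ c r t) z c) as H. rewrite E, Cmod_0, Cmod_circ in H; [lra |].
  pose proof (Cmod_ge_0 (z - c)%C). lra.
Qed.

Lemma k_cts (t : R) : Cont k t.
Proof.
  apply continuous_C_mult; [apply continuous_C_mult; [apply continuous_C_const | apply continuous_cis] |].
  apply (continuous_Ccts_comp (fun w => / (w - z))%C (circ c r)); [| apply continuous_circ].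
  exact (Cd_cts _ _ _ (Cd_inv (fun w => w - z)%C _ _ (circ_off t) (Cd_shift z _))).
Qed.

(* The integral of [f] along the homothetic image [seg z (circ c r t) u] of the circle does not depend on [u]: its derivative in [u] is the integral of a derivative along a closed curve. *)
Lemma homotopy_Re : RInt (fun t => Re (f (circ c r t) * k t)%C) 0 (2 * PI) = RInt (fun t => Re (f z * k t)%C) 0 (2 * PI).
Proof. pose proof (Cmod_ge_0 (z - c)%C) as Hz0.
  (* The derivative in u is needed in a neighbourhood of 0 and of 1 as well; [eta] is chosen so that
     these slightly larger homothetic circles still lie in the disc. *)
  set (phi u t := Re (f (seg z (circ c r t) u) * k t)%C). set (eta := (rad - r) / (4 * r)).
  assert (He : 0 < eta) by pos.
  assert (Heta : eta * (4 * r) = rad - r) by (unfold eta; field; lra).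
  assert (Hin : forall u, - eta < u < 1 + eta -> forall t, Cmod (seg z (circ c r t) u - c)%C < rad).
  { intros u Hu t. unfold seg. replace (z + u * (circ c r t - z) - c)%C with (RtoC (1 - u) * (z - c) + RtoC u * (circ c r t - c))%C by (rewrite RtoC_minus; ring).
    eapply Rle_lt_trans; [apply Cmod_triangle |]. rewrite !Cmod_mult, !Cmod_R, Cmod_circ by lra.
    assert (Rabs (1 - u) * Cmod (z - c)%C <= Rabs (1 - u) * r) by (apply Rmult_le_compat_l; pos).
    assert (Rabs (1 - u) + Rabs u < 1 + 2 * eta + eta) by (unfold Rabs; repeat destruct Rcase_abs; lra). nra. }
  assert (Dphi : forall u, - eta < u < 1 + eta -> forall t, is_derive (fun u => phi u t) u (Re (f1 (seg z (circ c r t) u) * (RtoC r * cis t))%C)).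
  { intros u Hu t. pose proof (is_derive_Cd_comp (fun w => f w * k t)%C (seg z (circ c r t)) u _ _
      (Cd_mult _ _ _ _ _ (Hd _ (Hin u Hu t)) (Cd_const (k t) _)) (is_derive_seg _ _ u)) as K.
    apply is_derive_C_fst in K. replace (f1 (seg z (circ c r t) u) * (RtoC r * cis t))%C with
      ((f1 (seg z (circ c r t) u) * k t + f (seg z (circ c r t) u) * 0) * (circ c r t - z))%C by (unfold k; field; apply circ_off). exact K. }
  assert (Hsc : forall p : prod_UniformSpace R_UniformSpace R_UniformSpace, @continuous _ CV (fun p => seg z (circ c r (snd p)) (fst p)) p).
  { intro p. apply (@continuous_plus _ R_AbsRing CV); [apply continuous_C_const |]. apply continuous_C_mult.
    - apply continuous_C_pair; [apply continuous_fst | apply continuous_const].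
    - apply (@continuous_minus _ R_AbsRing CV); [| apply continuous_C_const]. apply (continuous_comp snd (circ c r)); [apply continuous_snd | apply continuous_circ]. }
  assert (Hloc : forall u, 0 <= u <= 1 -> @locally R_UniformSpace u (fun u => - eta < u < 1 + eta)).
  { exists (mkposreal eta He). intros y Hy. change (Rabs (y - u) < eta) in Hy. apply Rabs_lt_between in Hy. lra. }
  transitivity (RInt (phi 1) 0 (2 * PI)); [apply RInt_ext; intros; unfold phi; rewrite seg_1; reflexivity |].
  transitivity (RInt (phi 0) 0 (2 * PI)); [| apply RInt_ext; intros; unfold phi; rewrite seg_0; reflexivity].
  symmetry. apply (eq_is_derive (fun u => RInt (phi u) 0 (2 * PI))); [| lra]. intros u Hu.
  evar_last.
  - apply is_derive_RInt_param.
    + eapply filter_imp; [| exact (Hloc u Hu)]. intros y Hy t _. eexists. apply Dphi, Hy.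
    + intros t _. eapply continuity_2d_pt_ext_loc with (f := fun u t => Re (f1 (seg z (circ c r t) u) * (RtoC r * cis t))%C).
      * destruct (Hloc u Hu) as [d Hl]. exists d. intros y s Hy _. symmetry. apply is_derive_unique, Dphi, Hl. exact Hy.
      * apply continuity_2d_pt_filterlim. apply (continuous_C_fst (fun p => f1 (seg z (circ c r (snd p)) (fst p)) * (RtoC r * cis (snd p)))%C (u, t)).
        apply continuous_C_mult; [apply continuous_Ccts_comp; [apply Hf1, Hin; simpl; lra | apply Hsc] |].
        apply continuous_C_mult; [apply continuous_C_const |]. apply (continuous_comp snd cis); [apply continuous_snd | apply continuous_cis].
    + eapply filter_imp; [| exact (Hloc u Hu)]. intros y Hy. apply cts_RInt. intros t _. apply continuous_C_fst, continuous_C_mult; [| apply k_cts].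
      apply continuous_Ccts_comp; [exact (Cd_cts _ _ _ (Hd _ (Hin y Hy t))) |].
      apply (continuous_comp (fun t => (y, t)) (fun p => seg z (circ c r (snd p)) (fst p)) t); [| apply Hsc].
      apply (continuous_comp_2 (fun _ => y) (fun t => t) pair); [apply continuous_const | apply continuous_id |]. apply continuous_ext with (fun p => p); [intros [? ?]; reflexivity | apply continuous_id].
  - assert (K : CInt (fun t => f1 (seg z (circ c r t) u) * cis t)%C 0 (2 * PI) (RtoC 0)).
    { assert (Hc : forall t, Cmod (circ c r t - c)%C < rad) by (intro t; rewrite Cmod_circ; lra).
      (* As a function of w, [f1 (seg z w u)] has the primitive [f (seg z w u)] divided by u; for u
         = 0 it is constant. *)
      apply (circle_closed (fun w => if Req_dec_T u 0 then f1 z * w else / RtoC u * f (seg z w u))%C (fun w => f1 (seg z w u))); [lra | |]; intro t.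
      - destruct (Req_dec_T u 0) as [-> | Hu0].
        + rewrite seg_0. eapply Cd_ext; [| | apply (Cd_scal (f1 z)), Cd_id]; [reflexivity | ring].
        + assert (RtoC u <> 0%C) by (intro E; apply Hu0, (RtoC_inj _ _ E)).
          eapply Cd_ext; [| | apply Cd_scal, (Cd_comp (fun w => z + RtoC u * (w - z))%C f); [apply Cd_plus; [apply Cd_const | apply Cd_scal, Cd_shift] | apply Hd, disc_seg; [lra | apply Hc | lra]]];
            [reflexivity | unfold seg; field; assumption].
      - set (w := circ c r t). intros e Hee. destruct (Hf1 (seg z w u) ltac:(apply disc_seg; [lra | apply Hc | lra]) e Hee) as [d [Hd1 Hb]]. exists d. split; [lra |]. intros x Hx. apply Hb.
        unfold seg. replace (z + u * (x - z) - (z + u * (w - z)))%C with (RtoC u * (x - w))%C by ring. rewrite Cmod_mult, Cmod_R, Rabs_pos_eq by lra.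
        pose proof (Cmod_ge_0 (x - w)%C). nra. }
    apply (is_RInt_C_mult (RtoC r)), is_RInt_C_re in K. rewrite Cmult_0_r in K. apply is_RInt_unique. revert K. apply is_RInt_ext. intros t _.
    etransitivity; [| symmetry; apply is_derive_unique, (Dphi u ltac:(lra) t)]. f_equal. ring.
Qed.
End Homotopy.

Lemma cts_bounded (g : R -> C) (a b : R) : a <= b -> (forall x, a <= x <= b -> Cont g x) ->
  exists M, 0 <= M /\ forall x, a <= x <= b -> Cmod (g x) <= M.
Proof.
  intros Hab Hg. destruct (continuity_ab_maj (fun x => Cmod (g x)) a b Hab) as [m [Hm _]].
  - intros x Hx. apply continuity_pt_filterlim. apply (continuous_ext (fun x => @norm R_AbsRing CV (g x))); [intro; apply norm_C |].
    apply (continuous_comp g (@norm R_AbsRing CV)); [apply Hg; exact Hx | apply (@filterlim_norm R_AbsRing CV)].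
  - exists (Cmod (g m)). split; pos.
Qed.

Lemma ex_Cd_pow (g : C -> C) (z l : C) (n : nat) : Cd g z l -> exists m, Cd (fun w => g w ^ n)%C z m.
Proof. intro H. induction n as [| n [m IH]]; [exists (RtoC 0); exact (Cd_const 1%C z) |]. eexists. apply Cd_mult; [exact H | exact IH]. Qed.

Lemma circ_far (c z : C) (r t : R) : 0 <= r -> r - Cmod (z - c)%C <= Cmod (circ c r t - z)%C.
Proof. intro Hr. pose proof (Cmod_dist_triangle (circ c r t) z c) as H. rewrite Cmod_circ in H; lra. Qed.

(** Meant for X = 1/(v - w), Y = 1/(v - z) and h = w - z: a second-order expansion of (v - z)^(-n)
    whose constant does not depend on the point v of the circle. *)
Lemma pow_taylor (n : nat) (A : R) : 0 < A -> exists K, 0 <= K /\ forall X Y h : C, (X - Y = h * X * Y)%C -> Cmod X <= A -> Cmod Y <= A ->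
  Cmod (X ^ n - Y ^ n - RtoC (INR n) * h * Y ^ (S n))%C <= K * Cmod h ^ 2.
Proof.
  intro HA. induction n as [| n [K [HK IH]]].
  - exists 0. split; [lra |]. intros X Y h _ _ _. simpl. replace (1 - 1 - 0 * h * (Y * 1))%C with (RtoC 0) by ring. rewrite Cmod_0. lra.
  - exists (A * K + INR (S n) * (A * A ^ S (S n))). pose proof (pos_INR (S n)) as HS. pose proof (pow_lt A (S (S n)) HA) as HP. assert (0 <= A * A ^ S (S n)) by nra. split; [nra |].
    intros X Y h E HX HY. specialize (IH X Y h E HX HY).
    replace (X ^ S n - Y ^ S n - RtoC (INR (S n)) * h * Y ^ S (S n))%C with (X * (X ^ n - Y ^ n - RtoC (INR n) * h * Y ^ S n) + RtoC (INR (S n)) * h * Y ^ S n * (h * X * Y))%C.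
    + Ctri. rewrite !Cmod_mult, Cmod_R, Rabs_pos_eq, Cmod_pow by exact HS.
      assert (Cmod Y ^ S n * Cmod Y <= A ^ S (S n)) by (rewrite (Rmult_comm (Cmod Y ^ S n)), tech_pow_Rmult; apply pow_incr; split; pos).
      pose proof (Cmod_ge_0 X). set (y := Cmod Y ^ S n * Cmod Y) in *. assert (0 <= y) by pos.
      assert (Cmod X * y <= A * A ^ S (S n)) by nra.
      replace (INR (S n) * Cmod h * Cmod Y ^ S n * (Cmod h * Cmod X * Cmod Y)) with (INR (S n) * (Cmod X * y) * Cmod h ^ 2) by (unfold y; ring).
      rewrite (Rmult_plus_distr_r (A * K)). apply Rplus_le_compat; [rewrite Rmult_assoc; apply Rmult_le_compat; assumption || apply Cmod_ge_0 |].
      apply Rmult_le_compat_r; [nra |]. apply Rmult_le_compat_l; assumption.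
    + rewrite <- E, S_INR, RtoC_plus. simpl Cpow.
      match goal with |- _ = ?x => transitivity (x + Y ^ n * (h * X * Y - (X - Y)))%C; [ring | rewrite E; ring] end.
Qed.

(** * Differentiability of Cauchy-type integrals *)

Section Kernel.
Variables (psi : R -> C) (c : C) (r : R).
Hypothesis Hpsi : forall t, Cont psi t.

Definition ker (n : nat) (z : C) (t : R) : C := (psi t * (/ (circ c r t - z)) ^ n)%C.

Lemma ex_RInt_ker (n : nat) (z : C) : Cmod (z - c)%C < r -> @ex_RInt CV (ker n z) 0 (2 * PI).
Proof.
  intro Hz. pose proof (Cmod_ge_0 (z - c)%C). apply ex_RInt_C_cts. intros t _. apply continuous_C_mult; [apply Hpsi |].
  assert (Hne : (circ c r t - z)%C <> 0%C) by (apply Cmod_gt_0; pose proof (circ_far c z r t ltac:(lra)); lra).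
  destruct (ex_Cd_pow (fun w => / (w - z))%C (circ c r t) _ n (Cd_inv (fun w => w - z)%C _ _ Hne (Cd_shift z _))) as [m Hm].
  apply (continuous_Ccts_comp (fun w => (/ (w - z)) ^ n)%C (circ c r)); [exact (Cd_cts _ _ _ Hm) | apply continuous_circ].
Qed.

(** Differentiation under the integral sign for an arbitrary continuous density: by [pow_taylor] the
    remainder is at most L |w - z|^2, uniformly on the circle. *)
Lemma Cd_ker (n : nat) (z : C) : Cmod (z - c)%C < r ->
  Cd (fun w => @RInt CV (ker n w) 0 (2 * PI)) z (RtoC (INR n) * @RInt CV (ker (S n) z) 0 (2 * PI))%C.
Proof.
  intro Hz. pose proof PI_RGT_0 as HPI. pose proof (Cmod_ge_0 (z - c)%C) as Hz0. set (del := r - Cmod (z - c)%C).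
  destruct (cts_bounded psi 0 (2 * PI) ltac:(lra) (fun t _ => Hpsi t)) as [M [HM0 HM]].
  destruct (pow_taylor n (2 / del)) as [K [HK0 HK]]; [apply Rdiv_lt_0_compat; unfold del; lra |].
  set (L := M * K * (2 * PI)). assert (HL : 0 <= L) by pos.
  intros eps Heps. exists (Rmin (del / 2) (eps / (1 + L))).
  split; [apply Rmin_pos; [unfold del; lra | pos] |]. intros w Hw. apply Rmin_Rgt_l in Hw as [Hw1 Hw2].
  apply Rlt_div_r in Hw2; [| lra]. pose proof (Cmod_dist_triangle w z c) as Hwc. unfold del in *.
  pose proof (RInt_correct (V := CV) _ _ _ (ex_RInt_ker n w ltac:(lra))) as H1. pose proof (RInt_correct (V := CV) _ _ _ (ex_RInt_ker n z Hz)) as H2.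
  pose proof (RInt_correct (V := CV) _ _ _ (ex_RInt_ker (S n) z Hz)) as H3.
  pose proof (@is_RInt_minus CV _ _ _ _ _ _ (@is_RInt_minus CV _ _ _ _ _ _ H1 H2) (is_RInt_C_mult (RtoC (INR n) * (w - z))%C _ _ _ _ H3)) as H4.
  apply (Cmod_RInt_le_const _ (M * (K * Cmod (w - z)%C ^ 2))) in H4; [| lra |].
  - match type of H4 with Cmod ?X <= _ => match goal with |- Cmod ?Y <= _ => replace Y with (X : C) end end.
    + eapply Rle_trans; [exact H4 |]. pose proof (Cmod_ge_0 (w - z)%C) as Hx. set (x := Cmod (w - z)%C) in *.
      replace (M * (K * x ^ 2) * (2 * PI - 0)) with (L * x * x) by (unfold L; ring). apply Rmult_le_compat_r; lra.
    + match goal with |- _ = (?A - ?B - RtoC (INR n) * ?D * _)%C => change ((A - B - (RtoC (INR n) * (w - z)) * D)%C = (A - B - RtoC (INR n) * D * (w - z))%C) end. ring.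
  - intros t Ht. pose proof (circ_far c z r t ltac:(lra)) as F1. pose proof (circ_far c w r t ltac:(lra)) as F2.
    assert (Ha : forall x : C, del / 2 <= Cmod x -> x <> 0%C /\ Cmod (/ x)%C <= 2 / del).
    { intros x Hx. unfold del in *. assert (Hx0 : x <> 0%C) by (apply Cmod_gt_0; lra). split; [pos |]. rewrite Cmod_inv by exact Hx0.
      replace (2 / (r - Cmod (z - c)%C)) with (/ ((r - Cmod (z - c)%C) / 2)) by (field; lra). apply Rinv_le_contravar; lra. }
    unfold del in *. destruct (Ha (circ c r t - z)%C ltac:(lra)) as [N1 B1]. destruct (Ha (circ c r t - w)%C ltac:(lra)) as [N2 B2].
    specialize (HK (/ (circ c r t - w))%C (/ (circ c r t - z))%C (w - z)%C ltac:(field; split; assumption) B2 B1).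
    change (Cmod (ker n w t - ker n z t - RtoC (INR n) * (w - z) * ker (S n) z t)%C <= M * (K * Cmod (w - z)%C ^ 2)). unfold ker.
    match type of HK with Cmod ?X <= _ => match goal with |- Cmod ?Y <= _ => replace Y with (psi t * X)%C by ring end end.
    rewrite Cmod_mult. apply Rmult_le_compat; [pos | apply Cmod_ge_0 | apply HM; exact Ht | exact HK].
Qed.
End Kernel.

Definition cpsi (f : C -> C) (c : C) (r t : R) : C := (f (circ c r t) * (RtoC r * cis t))%C.

Lemma C2PI_neq0 : RtoC (2 * PI) <> 0%C.
Proof. pose proof PI_RGT_0. apply RtoC_neq0. lra. Qed.

Lemma cpsi_cts (f : C -> C) (c : C) (rad r t : R) : (forall z, Cmod (z - c)%C < rad -> Ccts f z) -> 0 <= r < rad -> Cont (cpsi f c r) t.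
Proof.
  intros Hf Hr. apply continuous_C_mult; [apply continuous_Ccts_comp; [apply Hf; rewrite Cmod_circ; lra | apply continuous_circ] |].
  apply continuous_C_mult; [apply continuous_C_const | apply continuous_cis].
Qed.

Lemma ker_bound (f : C -> C) (c z I : C) (r M : R) : Cmod (z - c)%C < r -> (forall t, 0 <= t <= 2 * PI -> Cmod (f (circ c r t)) <= M) ->
  CInt (ker (cpsi f c r) c r 1 z) 0 (2 * PI) I -> Cmod I <= 2 * PI * (M * r / (r - Cmod (z - c)%C)).
Proof.
  intros Hz HM HI. pose proof (Cmod_ge_0 (z - c)%C). pose proof PI_RGT_0.
  rewrite Rmult_comm. replace (2 * PI) with (2 * PI - 0) by ring. refine (Cmod_RInt_le_const _ _ _ _ _ _ _ HI); [lra |]. intros t Ht.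
  pose proof (circ_far c z r t ltac:(lra)). unfold ker, cpsi. simpl.
  rewrite !Cmod_mult, Cmod_R, Cmod_cis, Rabs_pos_eq, Cmod_inv, Cmod_1, !Rmult_1_r by first [lra | apply Cmod_gt_0; lra].
  specialize (HM t Ht). pose proof (Cmod_ge_0 (f (circ c r t))). apply Rmult_le_compat; [nra | left; apply Rinv_0_lt_compat; lra | nra | apply Rinv_le_contravar; lra].
Qed.

Lemma Cauchy_to_Cd (f : C -> C) (psi : R -> C) (c z : C) (r : R) : Cmod (z - c)%C < r -> (forall t, Cont psi t) ->
  (forall w, Cmod (w - c)%C < r -> @RInt CV (ker psi c r 1 w) 0 (2 * PI) = (RtoC (2 * PI) * f w)%C) ->
  (forall w, Cmod (w - c)%C < r -> Cd f w (/ RtoC (2 * PI) * @RInt CV (ker psi c r 2 w) 0 (2 * PI))%C) /\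
  exists l, Cd (fun w => / RtoC (2 * PI) * @RInt CV (ker psi c r 2 w) 0 (2 * PI))%C z l.
Proof.
  intros Hz Hpsi HF. split; [| eexists; apply Cd_scal, Cd_ker; assumption]. intros w Hw.
  apply (Cd_ext_loc (fun w => / RtoC (2 * PI) * @RInt CV (ker psi c r 1 w) 0 (2 * PI))%C).
  - exists (r - Cmod (w - c)%C). split; [lra |]. intros x Hx. pose proof (Cmod_dist_triangle x w c). rewrite HF by lra. field. apply C2PI_neq0.
  - apply Cd_scal. pose proof (Cd_ker psi c r Hpsi 1 w Hw) as K. rewrite Cmult_1_l in K. exact K.
Qed.

(** The homotopy replaces f on the circle by the constant f z, and [circle_recip] evaluates what
    remains. The homotopy gives real parts only; applying it to a f with a = 1 and a = i recovers
    the complex identity. *)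
Lemma Cauchy_C1 (f f1 : C -> C) (c z : C) (rad r : R) : (forall w, Cmod (w - c)%C < rad -> Cd f w (f1 w)) ->
  (forall w, Cmod (w - c)%C < rad -> Ccts f1 w) -> Cmod (z - c)%C < r < rad ->
  CInt (ker (cpsi f c r) c r 1 z) 0 (2 * PI) (RtoC (2 * PI) * f z)%C.
Proof.
  intros Hd Hf1 Hz. pose proof (Cmod_ge_0 (z - c)%C). set (k := fun t => (RtoC r * cis t / (circ c r t - z))%C).
  assert (HK : CInt k 0 (2 * PI) (RtoC (2 * PI))).
  { generalize (circle_recip (z - c)%C r ltac:(lra)). apply (@is_RInt_ext CV). intros t _. unfold k, circ. replace (c + r * cis t - z)%C with (r * cis t - (z - c))%C by ring. reflexivity. }
  destruct (ex_RInt_C_cts (fun t => f (circ c r t) * k t)%C 0 (2 * PI)) as [I HI].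
  { intros t _. apply continuous_C_mult; [| apply k_cts with (rad := rad); lra]. apply continuous_Ccts_comp; [| apply continuous_circ].
    eapply Cd_cts, Hd. rewrite Cmod_circ; lra. }
  assert (HR : forall a : C, Re (a * I)%C = Re (a * (RtoC (2 * PI) * f z))%C).
  { intro a. pose proof (is_RInt_unique _ _ _ _ (is_RInt_C_re _ _ _ _ (is_RInt_C_mult a _ _ _ _ HI))) as <-.
    replace (a * (RtoC (2 * PI) * f z))%C with (a * f z * RtoC (2 * PI))%C by ring.
    pose proof (is_RInt_unique _ _ _ _ (is_RInt_C_re _ _ _ _ (is_RInt_C_mult (a * f z)%C _ _ _ _ HK))) as <-.
    etransitivity; [| apply (homotopy_Re (fun w => a * f w)%C (fun w => a * f1 w)%C c z rad r)].
    - apply RInt_ext. intros t _. f_equal. fold (k t). ring.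
    - intros w Hw. apply Cd_scal, Hd, Hw.
    - intros w Hw e He. destruct (Hf1 w Hw (e / (1 + Cmod a)) ltac:(pose proof (Cmod_ge_0 a); apply Rdiv_lt_0_compat; lra)) as [d [Hd1 Hb]]. exists d. split; [lra |]. intros x Hx.
      replace (a * f1 x - a * f1 w)%C with (a * (f1 x - f1 w))%C by ring. rewrite Cmod_mult. pose proof (Cmod_ge_0 a). specialize (Hb x Hx). apply Rle_div_r in Hb; [| lra].
      nra. - lra. }
  assert (E : (I : C) = (RtoC (2 * PI) * f z)%C).
  { pose proof (HR 1%C) as E1. pose proof (HR Ci) as E2. destruct I as [I1 I2], (RtoC (2 * PI) * f z)%C as [v1 v2]. simpl in E1, E2. f_equal; lra. }
  rewrite <- E. revert HI. apply (@is_RInt_ext CV). intros t _. unfold k, ker, cpsi. cfield. apply (circ_off c z rad r Hz t).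
Qed.

(** The derivative of f is not yet known to be continuous, so [Cauchy_C1] is applied to a primitive
    F, whose derivative f is. Differentiating in z gives the kernel with exponent 2, and integrating
    by parts around the circle brings back f. *)
Lemma Cauchy_formula (f : C -> C) (c z : C) (rad r : R) : holo f c rad -> Cmod (z - c)%C < r < rad ->
  CInt (ker (cpsi f c r) c r 1 z) 0 (2 * PI) (RtoC (2 * PI) * f z)%C.
Proof.
  intros Hf Hz. pose proof (Cmod_ge_0 (z - c)%C). pose proof (holo_primitive f c rad ltac:(lra) Hf) as HF. set (F := J f c) in *.
  assert (Hin : forall t, Cmod (circ c r t - c)%C < rad) by (intro t; rewrite Cmod_circ; lra).
  pose proof (circ_off c z rad r Hz) as Hne.
  assert (Hpsi : forall t, Cont (cpsi F c r) t) by (intro t; apply cpsi_cts with (rad := rad); [intros w Hw; exact (Cd_cts _ _ _ (HF w Hw)) | lra]).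
  destruct (Cauchy_to_Cd F (cpsi F c r) c z r ltac:(lra) Hpsi) as [HD _].
  { intros w Hw. apply is_RInt_unique, (Cauchy_C1 F f c w rad r); [pos | intro; apply holo_cts, Hf | lra]. }
  pose proof (Cd_unique _ _ _ _ (HD z ltac:(lra)) (HF z ltac:(lra))) as E.
  assert (Hq : forall t, Cd (fun w => F w * / (w - z))%C (circ c r t) (f (circ c r t) * / (circ c r t - z) + F (circ c r t) * (- / ((circ c r t - z) * (circ c r t - z)) * 1))%C).
  { intro t. apply (Cd_mult F (fun w => / (w - z))%C); [apply HF, Hin | apply (Cd_inv (fun w => w - z)%C); [apply Hne | apply Cd_shift]]. }
  pose proof (circle_closed _ (fun w => f w * / (w - z) + F w * (- / ((w - z) * (w - z)) * 1))%C c r ltac:(lra) Hq) as K.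
  match type of K with ?H -> _ => assert (Hc : H) end.
  { intro t. destruct (Hf _ (Hin t)) as [l Hl]. pose proof (Cd_inv (fun w => w - z)%C _ _ (Hne t) (Cd_shift z _)) as Hi.
    eapply Cd_cts. apply Cd_plus; [apply Cd_mult; [exact Hl | exact Hi] |]. apply Cd_mult; [apply HF, Hin |]. apply Cd_mult; [| apply Cd_const].
    apply Cd_opp, (Cd_inv (fun w => (w - z) * (w - z))%C); [apply Cmult_neq_0; apply Hne | apply Cd_mult; apply Cd_shift]. }
  pose proof (@is_RInt_plus CV _ _ _ _ _ _ (is_RInt_C_mult (RtoC r) _ _ _ _ (K Hc)) (RInt_correct (V := CV) _ _ _ (ex_RInt_ker (cpsi F c r) c r Hpsi 2 z ltac:(lra)))) as K2.
  match type of K2 with is_RInt _ _ _ ?v => replace (v : C) with (RtoC (2 * PI) * f z)%C in K2 end.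
  - revert K2. apply (@is_RInt_ext CV). intros t _. unfold ker, cpsi. cfield. apply Hne.
  - rewrite <- E. cfield. apply C2PI_neq0.
Qed.

Lemma mean_value (f : C -> C) (c : C) (rad r : R) : holo f c rad -> 0 < r < rad ->
  CInt (fun t => f (circ c r t)) 0 (2 * PI) (RtoC (2 * PI) * f c)%C.
Proof.
  intros Hf Hr. assert (H := Cauchy_formula f c c rad r Hf). rewrite Cmod_minus_0 in H. specialize (H Hr).
  revert H. apply (@is_RInt_ext CV). intros t _. unfold ker, cpsi, circ. replace (c + r * cis t - c)%C with (r * cis t)%C by ring. cfield. split; [apply cis_neq0 | apply RtoC_neq0; lra].
Qed.

(** The derivative is picked by [epsilon]; near z it agrees with a Cauchy-type integral over a
    circle halfway to the boundary, which is differentiable. *)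
Lemma holo_deriv (f : C -> C) (c : C) (rad : R) : holo f c rad ->
  exists f1, (forall z, Cmod (z - c)%C < rad -> Cd f z (f1 z)) /\ holo f1 c rad.
Proof.
  intro Hf. exists (fun z => epsilon (inhabits (RtoC 0)) (Cd f z)).
  assert (H1 : forall z, Cmod (z - c)%C < rad -> Cd f z (epsilon (inhabits (RtoC 0)) (Cd f z))).
  { intros z Hz. apply epsilon_spec. apply Hf; exact Hz. }
  split; [pos |]. intros z Hz. pose proof (Cmod_ge_0 (z - c)%C).
  set (r := (Cmod (z - c)%C + rad) / 2).
  destruct (Cauchy_to_Cd f (cpsi f c r) c z r) as [Hf1 [l Hl]].
  - unfold r; lra.
  - intro t. apply cpsi_cts with (rad := rad); [intros w Hw; exact (holo_cts f c rad w Hf Hw) | unfold r; lra].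
  - intros w Hw. apply is_RInt_unique, (Cauchy_formula f c w rad r Hf). unfold r in *; lra.
  - exists l. eapply Cd_ext_loc; [| exact Hl]. exists (r - Cmod (z - c)%C). split; [unfold r; lra |].
    intros w Hw. pose proof (Cmod_dist_triangle w z c). apply (Cd_unique f w); [apply Hf1; lra | apply H1; unfold r in *; lra].
Qed.

Lemma Csub_neq0 (a b : C) : a <> b -> (a - b)%C <> 0%C.
Proof. intros H E. apply H. replace a with ((a - b) + b)%C by ring. rewrite E. ring. Qed.

(** Removable singularity: the difference quotient at p is completed by f'(p). Its derivative there
    is f''(p) / 2, found by integrating the first-order error of f' along the segment from p. *)
Lemma holo_quot (f : C -> C) (c p : C) (rad : R) : holo f c rad -> Cmod (p - c)%C < rad ->
  exists q, holo q c rad /\ forall w, (f w = f p + (w - p) * q w)%C.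
Proof.
  intros Hf Hp. destruct (holo_deriv f c rad Hf) as [f1 [Hf1 Hh]]. destruct (Hh p Hp) as [m Hm].
  set (q := fun w => if excluded_middle_informative (w = p) then f1 p else ((f w - f p) / (w - p))%C).
  assert (Hq : forall w, w <> p -> q w = ((f w - f p) / (w - p))%C) by (intros w Hw; unfold q; destruct (excluded_middle_informative _); tauto).
  assert (Hqp : q p = f1 p) by (unfold q; destruct (excluded_middle_informative _); tauto).
  exists q. split.
  - intros z Hz. destruct (classic (z = p)) as [-> | Hne].
    + exists (RtoC (/ 2) * m)%C. intros eps Heps. destruct (Hm eps Heps) as [d [Hd Hb]].
      exists (Rmin d (rad - Cmod (p - c)%C)). split; [apply Rmin_pos; lra |]. intros w Hw. apply Rmin_Rgt_l in Hw as [Hw1 Hw2].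
      destruct (classic (w = p)) as [-> | Hwp]; [replace (q p - q p - RtoC (/ 2) * m * (p - p))%C with (RtoC 0) by ring; rewrite Cmod_0, Cmod_minus_0; lra |].
      pose proof (Csub_neq0 _ _ Hwp) as Hwp'. pose proof (proj1 (Cmod_gt_0 _) Hwp') as Hx. set (x := Cmod (w - p)%C) in *.
      pose proof (Cmod_dist_triangle w p c) as Hwc. fold x in Hwc.
      set (h := fun y => (f y - f1 p * (y - p) - RtoC (/ 2) * m * ((y - p) * (y - p)))%C). set (h1 := fun y => (f1 y - f1 p - m * (y - p))%C).
      assert (Hseg : forall u, 0 <= u <= 1 -> Cmod (seg p w u - c)%C < rad /\ Cmod (seg p w u - p)%C <= x).
      { intros u Hu. split; [apply disc_seg; lra | apply seg_dist; [rewrite Cmod_minus_0; lra | unfold x; lra | lra]]. }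
      assert (K : Cmod (h w - h p)%C <= x * (eps * x)).
      { rewrite <- (J_FTC h1 h p w).
        - apply J_bound; intros u Hu; destruct (Hseg u Hu) as [S1 S2]; [| eapply Rle_trans; [apply Hb; lra | nra]].
          destruct (Hh _ S1) as [l Hl]. eapply Cd_cts, Cd_minus; [apply Cd_minus; [exact Hl | apply Cd_const] | apply Cd_scal, Cd_shift].
        - intros u Hu. eapply Cd_ext; [| | apply Cd_minus; [apply Cd_minus; [apply Hf1, Hseg, Hu | apply Cd_scal, Cd_shift] | apply Cd_scal, Cd_mult; apply Cd_shift]]; [reflexivity |].
          unfold h1. rewrite RtoC_inv by lra. field.
        - intros u Hu. destruct (Hh _ (proj1 (Hseg u Hu))) as [l Hl]. eapply Cd_cts, Cd_minus; [apply Cd_minus; [exact Hl | apply Cd_const] | apply Cd_scal, Cd_shift]. }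
      rewrite (Hq w Hwp), Hqp. replace ((f w - f p) / (w - p) - f1 p - RtoC (/ 2) * m * (w - p))%C with ((h w - h p) / (w - p))%C by (unfold h; field; exact Hwp').
      rewrite Cmod_div by exact Hwp'. fold x. apply Rle_div_l; lra.
    + destruct (Hf z Hz) as [l Hl]. pose proof (Csub_neq0 _ _ Hne) as Hzp. eexists. eapply (Cd_ext_loc (fun w => (f w - f p) / (w - p))%C).
      * exists (Cmod (z - p)%C). split; [apply Cmod_gt_0; exact Hzp |]. intros w Hw. symmetry. apply Hq. intros ->. rewrite Cmod_minus_sym in Hw. lra.
      * apply Cd_div; [pos | apply Cd_minus; [exact Hl | apply Cd_const] | apply Cd_shift].
  - intro w. destruct (classic (w = p)) as [-> | Hne]; [ring |]. rewrite (Hq w Hne). field. apply Csub_neq0, Hne.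
Qed.

Lemma Cauchy_bound (f : C -> C) (c z : C) (rad r M : R) : holo f c rad -> Cmod (z - c)%C < r < rad ->
  (forall t, 0 <= t <= 2 * PI -> Cmod (f (circ c r t)) <= M) -> Cmod (f z) <= M * r / (r - Cmod (z - c)%C).
Proof.
  intros Hf Hr HM. pose proof PI_RGT_0. pose proof (ker_bound f c z _ r M (proj1 Hr) HM (Cauchy_formula f c z rad r Hf Hr)) as K.
  rewrite Cmod_mult, Cmod_R, Rabs_pos_eq in K by lra. apply Rmult_le_reg_l in K; lra.
Qed.

Lemma circ_bounded (f : C -> C) (c : C) (rad r : R) : holo f c rad -> 0 <= r < rad -> exists M, 0 <= M /\ forall t, 0 <= t <= 2 * PI -> Cmod (f (circ c r t)) <= M.
Proof.
  intros Hf Hr. pose proof PI_RGT_0. apply (cts_bounded (fun t => f (circ c r t))); [lra |]. intros t _.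
  apply continuous_Ccts_comp; [apply (holo_cts f c rad _ Hf); rewrite Cmod_circ; lra | apply continuous_circ].
Qed.

(** Every f / (w - c)^n is holomorphic in the whole disc, being 0 near c; the Cauchy bound for it
    gives |f z| <= A (x / r)^n with x = |z - c| < r, for all n. *)
Lemma holo_identity (f : C -> C) (c : C) (rad e : R) : holo f c rad -> 0 < e ->
  (forall z, Cmod (z - c)%C < e -> f z = 0%C) -> forall z, Cmod (z - c)%C < rad -> f z = 0%C.
Proof.
  intros Hf He H0 z Hz. destruct (classic (z = c)) as [-> | Hne]; [apply H0; rewrite Cmod_minus_0; exact He |].
  apply Csub_neq0, Cmod_gt_0 in Hne. set (x := Cmod (z - c)%C) in *. set (r := (x + rad) / 2). assert (Hr : x < r < rad) by (unfold r; lra).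
  destruct (circ_bounded f c rad r Hf ltac:(lra)) as [M [HM0 HM]].
  assert (Hg : forall n, holo (fun w => f w / (w - c) ^ n)%C c rad).
  { intros n w Hw. destruct (classic (w = c)) as [-> | Hwc].
    - exists 0%C. apply (Cd_ext_loc (fun _ => 0%C)); [| apply Cd_const]. exists e. split; [lra |]. intros y Hy. rewrite (H0 y Hy). unfold Cdiv; ring.
    - destruct (Hf w Hw) as [l Hl]. destruct (ex_Cd_pow _ w _ n (Cd_shift c w)) as [m Hm]. eexists. apply Cd_div; [apply Cpow_nz, Csub_neq0, Hwc | exact Hl | exact Hm]. }
  set (A := M * r / (r - x)). assert (HA : 0 <= A) by pos.
  assert (Hb : forall n, Cmod (f z) <= A * (x / r) ^ n).
  { intro n. pose proof (pow_lt r n ltac:(lra)) as Hrn. pose proof (pow_lt x n Hne) as Hxn.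
    assert (K : Cmod (f z / (z - c) ^ n)%C <= M / r ^ n * r / (r - x)).
    { apply (Cauchy_bound (fun w => f w / (w - c) ^ n)%C c z rad r _ (Hg n) Hr). intros t Ht.
      rewrite Cmod_div by (apply Cpow_nz, Cmod_gt_0; rewrite Cmod_circ; lra). rewrite Cmod_pow, Cmod_circ by lra.
      apply Rmult_le_compat_r; [left; apply Rinv_0_lt_compat; exact Hrn | apply HM, Ht]. }
    rewrite Cmod_div in K by (apply Cpow_nz, Cmod_gt_0; exact Hne). rewrite Cmod_pow in K. fold x in K. apply -> (Rle_div_l (Cmod (f z))) in K; [| lra]. unfold A, Rdiv. rewrite (Rpow_mult_distr x), pow_inv. lra. }
  apply Cmod_eq_0, Rle_antisym; [| pos]. apply le_epsilon. intros ep Hep.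
  destruct (geom_small (x / r) A ep) as [n Hn]; [split; [pos | apply Rlt_div_l; lra] | lra | exact Hep |].
  specialize (Hb n). lra.
Qed.

(** Cauchy's formula survives a uniform limit, and a function given by that formula is
    differentiable. *)
Lemma holo_uniform_limit (F : nat -> C -> C) (G : C -> C) (c : C) (rad r : R) (eps : nat -> R) : 0 < r < rad ->
  (forall n, holo (F n) c rad) -> (forall n z, Cmod (z - c)%C <= r -> Cmod (F n z - G z)%C <= eps n) ->
  (forall e, 0 < e -> exists n, eps n <= e) -> holo G c r.
Proof.
  intros Hr HF Hlim Heps. pose proof PI_RGT_0.
  assert (Hpsi : forall t, Cont (cpsi G c r) t).
  { intro t. apply continuous_C_mult; [| apply continuous_C_mult; [apply continuous_C_const | apply continuous_cis]].
    apply continuous_C_eps. intros e He. destruct (Heps (e / 3) ltac:(lra)) as [n Hn].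
    assert (Hc : Cont (fun t => F n (circ c r t)) t).
    { apply continuous_Ccts_comp; [| apply continuous_circ]. apply (holo_cts _ c rad _ (HF n)). rewrite Cmod_circ; lra. }
    destruct (continuous_C_eps_inv _ _ Hc (e / 3) ltac:(lra)) as [d [Hd Hb]]. exists d. split; [lra |]. intros u Hu. specialize (Hb u Hu).
    pose proof (Hlim n (circ c r u) ltac:(rewrite Cmod_circ; lra)). pose proof (Hlim n (circ c r t) ltac:(rewrite Cmod_circ; lra)).
    replace (G (circ c r u) - G (circ c r t))%C with ((F n (circ c r u) - F n (circ c r t)) - (F n (circ c r u) - G (circ c r u)) + (F n (circ c r t) - G (circ c r t)))%C by ring.
    Ctri. eapply Rle_trans; [apply Rplus_le_compat_r, Cmod_minus_le |]. lra. }
  intros z Hz. eexists. apply (Cauchy_to_Cd G (cpsi G c r) c z r Hz Hpsi); [| lra].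
  intros w Hw. pose proof (RInt_correct (V := CV) _ _ _ (ex_RInt_ker _ c r Hpsi 1 w Hw)) as HI.
  set (I := @RInt CV (ker (cpsi G c r) c r 1 w) 0 (2 * PI)) in *.
  apply (Cmod_eq_eps _ _ (2 * PI * (r / (r - Cmod (w - c)%C)) + 2 * PI)). intros e He. destruct (Heps e He) as [n Hn].
  pose proof (@is_RInt_minus CV _ _ _ _ _ _ HI (Cauchy_formula (F n) c w rad r (HF n) ltac:(lra))) as HD.
  assert (K : Cmod (I - RtoC (2 * PI) * F n w)%C <= 2 * PI * (e * r / (r - Cmod (w - c)%C))).
  { apply (ker_bound (fun z => G z - F n z)%C c w _ r e Hw).
    - intros t _. rewrite Cmod_minus_sym. eapply Rle_trans; [apply Hlim; rewrite Cmod_circ; lra | lra].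
    - revert HD. apply (@is_RInt_ext CV). intros t _. unfold ker, cpsi. cring. }
  replace (I - RtoC (2 * PI) * G w)%C with ((I - RtoC (2 * PI) * F n w) + RtoC (2 * PI) * (F n w - G w))%C by ring.
  Ctri. rewrite Cmod_mult, Cmod_R, Rabs_pos_eq by lra. pose proof (Hlim n w ltac:(lra)). nra.
Qed.

(** * Complex exponential and zeros of holomorphic functions *)

Lemma Rabs_sin_le (u : R) : Rabs (sin u) <= Rabs u.
Proof.
  destruct (Rlt_le_dec 0 u) as [H | H].
  - rewrite (Rabs_pos_eq u) by lra. apply Rabs_le. pose proof (sin_lt_x u H).
    destruct (Rle_dec u PI); [pose proof (sin_ge_0 u ltac:(lra) r); lra |].
    pose proof (SIN_bound u). pose proof PI2_1. lra.
  - destruct (Req_dec u 0) as [-> | Hn]; [rewrite sin_0; lra |].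
    rewrite <- (Rabs_Ropp u), <- (Rabs_Ropp (sin u)), <- sin_neg. rewrite (Rabs_pos_eq (- u)) by lra.
    apply Rabs_le. pose proof (sin_lt_x (- u) ltac:(lra)).
    destruct (Rle_dec (- u) PI); [pose proof (sin_ge_0 (- u) ltac:(lra) r); lra |].
    pose proof (SIN_bound (- u)). pose proof PI2_1. lra.
Qed.

Lemma cos_sub_1 (y : R) : Rabs (cos y - 1) <= y ^ 2 / 2.
Proof.
  replace y with (2 * (y / 2)) at 1 by field. rewrite cos_2a_sin.
  replace (1 - 2 * sin (y / 2) * sin (y / 2) - 1) with (- (2 * (sin (y / 2)) ^ 2)) by ring.
  rewrite Rabs_Ropp, Rabs_pos_eq by nra.
  pose proof (Rabs_sin_le (y / 2)) as H. apply pow_maj_Rabs with (n := 2%nat) in H.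
  rewrite RPow_abs, Rabs_pos_eq in H by nra. lra.
Qed.

Lemma exp_sub_1 (x : R) : Rabs x <= / 2 -> 0 <= exp x - 1 - x <= 2 * x ^ 2.
Proof.
  intro H. apply Rabs_le_between in H. pose proof (exp_ineq1_le x). pose proof (exp_ineq1_le (- x)).
  rewrite exp_Ropp in H1.
  assert (exp x * (1 - x) <= 1).
  { apply Rmult_le_reg_l with (/ exp x); [lra |]. rewrite <- Rmult_assoc, Rinv_l by lra. lra. } nra.
Qed.

Lemma sin_sub_id (y : R) : Rabs y <= 1 -> Rabs (sin y - y) <= y ^ 2.
Proof.
  destruct (MVT_gen (fun u => sin u - u) 0 y (fun u => cos u - 1)) as [c [Hc E]].
  - intros u _. auto_derive; lra.
  - intros u _. apply continuity_pt_minus; [apply continuity_sin | apply derivable_continuous_pt, derivable_pt_id].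
  - rewrite sin_0 in E. replace (sin y - y) with (sin y - y - (0 - 0)) by ring. rewrite E, Rminus_0_r, Rabs_mult.
    assert (Hcy : Rabs c <= Rabs y).
    { unfold Rmin, Rmax in Hc. destruct (Rle_dec 0 y); [rewrite !Rabs_pos_eq by lra; lra |]. rewrite !Rabs_left1 by lra. lra. }
    pose proof (cos_sub_1 c) as K.
    assert (Hc2 : c ^ 2 <= Rabs y * Rabs y) by (replace (c ^ 2) with (Rabs c * Rabs c) by (rewrite <- Rabs_mult, Rabs_pos_eq; nra); pose proof (Rabs_pos c); nra).
    replace (y ^ 2) with (Rabs y * Rabs y) by (rewrite <- Rabs_mult, Rabs_pos_eq; nra).
    pose proof (Rabs_pos y). nra.
Qed.

Lemma Cexp_plus (a b : C) : Cexp (a + b)%C = (Cexp a * Cexp b)%C.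
Proof. unfold Cexp, Cmult, Cplus, Re, Im; simpl. rewrite exp_plus, cos_plus, sin_plus.
  f_equal; ring.
Qed.

Lemma Cexp_0 : Cexp 0%C = 1%C.
Proof. unfold Cexp; simpl. rewrite exp_0, cos_0, sin_0. unfold RtoC. f_equal; ring. Qed.

Lemma Cexp_cis (z : C) : Cexp z = (RtoC (exp (Re z)) * cis (Im z))%C.
Proof. unfold Cexp, cis, Cmult, RtoC; simpl. f_equal; ring. Qed.

Lemma Cmod_Cexp (z : C) : Cmod (Cexp z) = exp (Re z).
Proof. rewrite Cexp_cis, Cmod_mult, Cmod_R, Cmod_cis, Rabs_pos_eq; [ring | left; apply exp_pos]. Qed.

Lemma Cexp_neq0 (z : C) : Cexp z <> 0%C.
Proof. apply Cmod_gt_0. rewrite Cmod_Cexp. apply exp_pos. Qed.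

Lemma Cexp_opp (z : C) : (Cexp z * Cexp (- z) = 1)%C.
Proof. rewrite <- Cexp_plus. replace (z + - z)%C with (RtoC 0) by ring. apply Cexp_0. Qed.

Lemma Cexp_near_0 (h : C) : Cmod h <= / 2 -> Cmod (Cexp h - 1 - h)%C <= 16 * Cmod h ^ 2.
Proof.
  intro Hh. pose proof (re_le_Cmod h) as Hx. pose proof (im_le_Cmod h) as Hy. set (m := Cmod h) in *.
  destruct h as [x y]. unfold Re, Im in *; simpl in Hx, Hy.
  assert (Hm : 0 <= m) by pos.
  replace (Cexp (x, y) - 1 - (x, y))%C with
    (((exp x - 1 - x) + exp x * (cos y - 1), exp x * (sin y - y) + (exp x - 1) * y) : C)
    by (unfold Cexp, Cminus, Cplus, Copp, RtoC; simpl; f_equal; ring).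
  eapply Rle_trans; [apply Cmod_le_abs |].
  pose proof (exp_sub_1 x ltac:(lra)) as E1. pose proof (cos_sub_1 y) as E2. pose proof (sin_sub_id y ltac:(lra)) as E3.
  assert (Hx2 : x ^ 2 <= m ^ 2) by (replace (x ^ 2) with (Rabs x * Rabs x) by (rewrite <- Rabs_mult, Rabs_pos_eq; nra); pose proof (Rabs_pos x); nra).
  assert (Hy2 : y ^ 2 <= m ^ 2) by (replace (y ^ 2) with (Rabs y * Rabs y) by (rewrite <- Rabs_mult, Rabs_pos_eq; nra); pose proof (Rabs_pos y); nra).
  assert (He : 0 < exp x <= 3).
  { apply Rabs_le_between in Hx. nra. }
  assert (He1 : Rabs (exp x - 1) <= 2 * m).
  { replace (exp x - 1) with ((exp x - 1 - x) + x) by ring. eapply Rle_trans; [apply Rabs_triang |]. rewrite (Rabs_pos_eq (exp x - 1 - x)) by lra. nra. }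
  assert (T1 : Rabs (exp x - 1 - x + exp x * (cos y - 1)) <= 2 * m ^ 2 + 3 * (m ^ 2 / 2)).
  { eapply Rle_trans; [apply Rabs_triang |]. rewrite Rabs_mult, (Rabs_pos_eq (exp x)), (Rabs_pos_eq (exp x - 1 - x)) by lra. nra. }
  assert (T2 : Rabs (exp x * (sin y - y) + (exp x - 1) * y) <= 3 * m ^ 2 + 2 * m * m).
  { eapply Rle_trans; [apply Rabs_triang |]. rewrite !Rabs_mult, (Rabs_pos_eq (exp x)) by lra. pose proof (Rabs_pos (exp x - 1)). nra. }
  nra.
Qed.

Lemma Cd_Cexp (z : C) : Cd Cexp z (Cexp z).
Proof.
  intros eps Heps. set (A := 1 + exp (Re z)). assert (HA : 1 < A) by (unfold A; pose proof (exp_pos (Re z)); lra).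
  exists (Rmin (/ 2) (eps / (16 * A))). split; [apply Rmin_pos; pos |]. intros w Hw.
  assert (H1 : Cmod (w - z)%C < / 2) by (eapply Rlt_le_trans; [exact Hw | apply Rmin_l]).
  assert (H2 : Cmod (w - z)%C < eps / (16 * A)) by (eapply Rlt_le_trans; [exact Hw | apply Rmin_r]).
  set (h := (w - z)%C) in *. replace w with (z + h)%C by (unfold h; ring). rewrite Cexp_plus.
  replace (Cexp z * Cexp h - Cexp z - Cexp z * h)%C with (Cexp z * (Cexp h - 1 - h))%C by ring.
  rewrite Cmod_mult, Cmod_Cexp. pose proof (Cexp_near_0 h ltac:(lra)) as K. pose proof (Cmod_ge_0 h). pose proof (exp_pos (Re z)).
  apply Rle_trans with (A * (16 * Cmod h ^ 2)).
  - apply Rmult_le_compat; [lra | pos | unfold A; lra | exact K].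
  - apply Rmult_lt_compat_r with (r := 16 * A) in H2; [| lra].
    unfold Rdiv in H2. rewrite Rmult_assoc, Rinv_l, Rmult_1_r in H2 by lra. nra.
Qed.

Lemma Cexp_surj (z : C) : z <> 0%C -> exists a, Cexp a = z.
Proof.
  intro Hz. assert (Hm : 0 < Cmod z) by (apply Cmod_gt_0; exact Hz).
  pose proof (re_le_Cmod z) as Hre. apply Rabs_le_between in Hre. pose proof (Cmod2_alt z) as Hm2.
  destruct z as [x y]. unfold Re, Im in *; cbn [fst snd] in *. set (m := Cmod (x, y)) in *.
  assert (Hu : -1 <= x / m <= 1).
  { split; apply Rmult_le_reg_r with m; try lra; unfold Rdiv; rewrite Rmult_assoc, Rinv_l; lra. }
  assert (Hs : sqrt (1 - (x / m)²) = Rabs y / m).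
  { replace (1 - (x / m)²) with ((Rabs y / m)²).
    - apply sqrt_Rsqr. apply Rdiv_le_0_compat; pos.
    - unfold Rsqr. replace (Rabs y / m * (Rabs y / m)) with ((Rabs y * Rabs y) / (m * m)) by (field; lra).
      replace (Rabs y * Rabs y) with (y * y) by (rewrite <- Rabs_mult, Rabs_pos_eq; nra).
      replace (y * y) with (m * m - x * x) by lra. field; lra. }
  destruct (Rle_dec 0 y) as [Hy | Hy].
  - exists (ln m, acos (x / m)). unfold Cexp, Re, Im; cbn [fst snd]. rewrite exp_ln, cos_acos, sin_acos, Hs, Rabs_pos_eq by lra.
    f_equal; field; lra.
  - exists (ln m, - acos (x / m)). unfold Cexp, Re, Im; cbn [fst snd]. rewrite cos_neg, sin_neg, exp_ln, cos_acos, sin_acos, Hs, Rabs_left by lra.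
    f_equal; field; lra.
Qed.

Lemma Cd_0_const (f : C -> C) (c z : C) (rad : R) : (forall w, Cmod (w - c)%C < rad -> Cd f w 0%C) -> Cmod (z - c)%C < rad -> f z = f c.
Proof.
  intros H Hz. pose proof (Cmod_ge_0 (z - c)%C).
  assert (E : J (fun _ => 0%C) c z = (f z - f c)%C).
  { apply J_FTC; intros u Hu; [apply H | exact (Cd_cts _ _ _ (Cd_const 0%C _))].
    apply disc_seg; [rewrite Cmod_minus_0; lra | lra | exact Hu]. }
  assert (E0 : J (fun _ => 0%C) c z = 0%C).
  { rewrite (J_FTC (fun _ => 0%C) (fun _ => 0%C)); [ring | |]; intros u _; [apply Cd_const | exact (Cd_cts _ _ _ (Cd_const 0%C _))]. }
  replace (f z) with ((f z - f c) + f c)%C by ring. rewrite <- E, E0. ring.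
Qed.

(** With H0 a primitive of g'/g, the product g exp(-H0) has derivative 0; its constant value is an
    exponential because [Cexp] is onto the nonzero numbers. *)
Lemma holo_log (g : C -> C) (c : C) (rad : R) : 0 < rad -> holo g c rad -> (forall z, Cmod (z - c)%C < rad -> g z <> 0%C) ->
  exists H, holo H c rad /\ forall z, Cmod (z - c)%C < rad -> g z = Cexp (H z).
Proof.
  intros Hr Hg Hnz. destruct (holo_deriv g c rad Hg) as [g1 [Hg1 Hg1h]].
  set (q := fun z => (g1 z / g z)%C).
  assert (Hq : holo q c rad).
  { intros z Hz. destruct (Hg1h z Hz) as [l Hl]. eexists. apply Cd_div; [apply Hnz; exact Hz | exact Hl | apply Hg1; exact Hz]. }
  pose proof (holo_primitive q c rad Hr Hq) as HP. set (H0 := J q c) in *.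
  assert (Hc : Cmod (c - c)%C < rad) by (rewrite Cmod_minus_0; exact Hr).
  set (E := fun z => (g z * Cexp (- H0 z))%C).
  assert (HE : forall w, Cmod (w - c)%C < rad -> Cd E w 0%C).
  { intros w Hw. eapply Cd_ext; [| | apply (Cd_mult g (fun z => Cexp (- H0 z))%C w (g1 w) (Cexp (- H0 w) * (- q w)))%C].
    - intro; reflexivity.
    - unfold q. field. apply Hnz; exact Hw.
    - apply Hg1; exact Hw.
    - apply (Cd_comp (fun z => - H0 z)%C Cexp); [apply Cd_opp, HP; exact Hw | apply Cd_Cexp]. }
  destruct (Cexp_surj (E c)) as [a Ha].
  { apply Cmult_neq_0; [apply Hnz; exact Hc | apply Cexp_neq0]. }
  exists (fun z => a + H0 z)%C. split.
  - intros z Hz. eexists. apply Cd_plus; [apply Cd_const | apply HP; exact Hz].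
  - intros z Hz. rewrite Cexp_plus, Ha, <- (Cd_0_const E c z rad HE Hz). unfold E.
    replace (g z * Cexp (- H0 z) * Cexp (H0 z))%C with (g z * (Cexp (H0 z) * Cexp (- H0 z)))%C by ring. rewrite Cexp_opp. ring.
Qed.

Definition prodl (l : list C) (w : C) : C := fold_right (fun rho acc => (w - rho) * acc)%C 1%C l.

Lemma prodl_le (l : list C) (c : C) (r0 : R) : (forall rho, In rho l -> Cmod (rho - c)%C <= r0) -> Cmod (prodl l c) <= r0 ^ length l.
Proof.
  induction l as [| a l IH]; intro Hi; simpl; [rewrite Cmod_1; lra |]. rewrite Cmod_mult.
  apply Rmult_le_compat; try apply Cmod_ge_0; [rewrite Cmod_minus_sym; apply Hi; left; reflexivity | apply IH; intros; apply Hi; right; assumption].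
Qed.

Lemma prodl_ge (l : list C) (c w : C) (r0 r1 : R) : (forall rho, In rho l -> Cmod (rho - c)%C <= r0) -> r0 <= r1 -> Cmod (w - c)%C = r1 -> (r1 - r0) ^ length l <= Cmod (prodl l w).
Proof.
  intros Hi Hr Hw. induction l as [| a l IH]; simpl; [rewrite Cmod_1; lra |]. rewrite Cmod_mult.
  pose proof (Cmod_dist_triangle w a c). pose proof (Hi a (or_introl eq_refl)).
  apply Rmult_le_compat; [lra | pos | lra | apply IH; intros; apply Hi; right; assumption].
Qed.

(* Splitting off zeros one at a time must stop: with [n] zeros split off, the maximum principle gives [|f c| <= M (r0 / (r1 - r0)) ^ n]. *)
Lemma finite_zeros (f : C -> C) (c : C) (rad r0 r1 : R) : holo f c rad -> f c <> 0%C -> 0 < r0 -> 2 * r0 < r1 < rad ->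
  exists (l : list C) (g : C -> C), holo g c rad /\ (forall w, f w = prodl l w * g w)%C /\
    (forall rho, In rho l -> Cmod (rho - c)%C <= r0 /\ f rho = 0%C) /\ (forall z, Cmod (z - c)%C <= r0 -> g z <> 0%C).
Proof.
  intros Hf Hfc Hr0 Hr1. destruct (circ_bounded f c rad r1 Hf ltac:(lra)) as [M [HM0 HM]].
  set (fact (l : list C) (g : C -> C) := holo g c rad /\ (forall w, f w = prodl l w * g w)%C /\ (forall rho, In rho l -> Cmod (rho - c)%C <= r0 /\ f rho = 0%C)).
  assert (Hfact : forall n, (exists l g, fact l g /\ (forall z, Cmod (z - c)%C <= r0 -> g z <> 0%C)) \/ (exists l g, length l = n /\ fact l g)).
  { induction n as [| n [IH | [l [g [Hl [Hg [Hfg Hin]]]]]]]; [right; exists nil, f; repeat split; try tauto; intro w; simpl; ring | left; exact IH |].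
    destruct (classic (exists z, Cmod (z - c)%C <= r0 /\ g z = 0%C)) as [[z [Hz Hgz]] | Hno].
    - right. destruct (holo_quot g c z rad Hg ltac:(lra)) as [q [Hq Eq]]. exists (z :: l), q. split; [simpl; rewrite Hl; reflexivity |]. split; [pos |]. split.
      + intro w. rewrite Hfg, Eq, Hgz. simpl. ring.
      + intros rho [<- | Hr]; [split; [lra | rewrite Hfg, Hgz; ring] | apply Hin; exact Hr].
    - left. exists l, g. repeat split; try assumption; try (apply Hin; assumption). intros z Hz E. apply Hno. exists z. split; assumption. }
  destruct (geom_small (r0 / (r1 - r0)) M (Cmod (f c))) as [n Hn]; [split; [pos | apply Rlt_div_l; lra] | lra | apply Cmod_gt_0, Hfc |].
  destruct (Hfact n) as [[l [g [[H1 [H2 H3]] H4]]] | [l [g [Hl [Hg [Hfg Hin]]]]]]; [exists l, g; tauto | exfalso].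
  assert (Hin' : forall rho, In rho l -> Cmod (rho - c)%C <= r0) by (intros; apply Hin; assumption).
  assert (Hpw : 0 < (r1 - r0) ^ n) by pos.
  assert (Hgc : Cmod (g c) <= M / (r1 - r0) ^ n * r1 / (r1 - 0)).
  { rewrite <- (Cmod_minus_0 c). apply (Cauchy_bound g c c rad r1); [pos | rewrite Cmod_minus_0; lra |]. intros t Ht. specialize (HM t Ht). rewrite Hfg, Cmod_mult in HM.
    pose proof (prodl_ge l c (circ c r1 t) r0 r1 Hin' ltac:(lra) ltac:(apply Cmod_circ; lra)) as P. rewrite Hl in P. apply Rle_div_r; [lra |]. nra. }
  replace (M / (r1 - r0) ^ n * r1 / (r1 - 0)) with (M / (r1 - r0) ^ n) in Hgc by (field; lra).
  rewrite Hfg, Cmod_mult in Hn. pose proof (prodl_le l c r0 Hin') as P1. rewrite Hl in P1.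
  assert (Cmod (prodl l c) * Cmod (g c) <= r0 ^ n * (M / (r1 - r0) ^ n)) by (apply Rmult_le_compat; try apply Cmod_ge_0; assumption).
  replace (M * (r0 / (r1 - r0)) ^ n) with (r0 ^ n * (M / (r1 - r0) ^ n)) in Hn by (unfold Rdiv; rewrite Rpow_mult_distr, pow_inv; ring). lra.
Qed.

(** * Poisson formula and first Taylor coefficient *)

Definition poisson (rad s t : R) : R := (rad ^ 2 - s ^ 2) / (rad ^ 2 - 2 * rad * s * cos t + s ^ 2).

Lemma poisson_den (rad s t : R) : Rabs s < rad -> 0 < rad ^ 2 - 2 * rad * s * cos t + s ^ 2.
Proof.
  intro H. apply Rabs_lt_between in H. pose proof (COS_bound t).
  assert (Rabs (s * cos t) < rad).
  { rewrite Rabs_mult. apply Rle_lt_trans with (Rabs s); [| apply Rabs_def1; lra].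
    rewrite <- (Rmult_1_r (Rabs s)) at 2. apply Rmult_le_compat_l; [pos | apply Rabs_le; lra]. }
  apply Rabs_lt_between in H1. generalize (sin2_cos2 t). unfold Rsqr.
  nra.
Qed.

(** The Poisson kernel is the Cauchy kernel at s plus a term whose pole is the reflected point rad^2
    / s outside the circle; that term integrates to 0 against a holomorphic function. *)
Lemma poisson_split (rad s t : R) : 0 < rad -> Rabs s < rad ->
  let z := (RtoC rad * cis t)%C in
  (z / (z - RtoC s) + RtoC s * z / (RtoC (rad ^ 2) - RtoC s * z))%C = RtoC (poisson rad s t).
Proof.
  intros Hr Hs z. pose proof (poisson_den rad s t Hs) as HD.
  set (zb := (RtoC rad * (cos t, (- sin t)%R))%C).
  assert (E1 : (z * zb)%C = RtoC (rad ^ 2)).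
  { generalize (sin2_cos2 t). unfold Rsqr. intro E. apply injective_projections; simpl; [| ring].
    nra. }
  assert (E2 : ((z - s) * (zb - s))%C = RtoC (rad ^ 2 - 2 * rad * s * cos t + s ^ 2)).
  { replace ((z - s) * (zb - s))%C with (z * zb - s * (z + zb) + s * s)%C by ring. rewrite E1. apply injective_projections; simpl; ring. }
  assert (N : RtoC (rad ^ 2 - 2 * rad * s * cos t + s ^ 2) <> 0%C) by (apply Cmod_gt_0; rewrite Cmod_R, Rabs_pos_eq; lra).
  assert (N1 : (z - s)%C <> 0%C) by (intro E; apply N; rewrite <- E2, E; ring).
  assert (N2 : (zb - s)%C <> 0%C) by (intro E; apply N; rewrite <- E2, E; ring).
  assert (N0 : z <> 0%C) by (apply Cmult_neq_0; [apply Cmod_gt_0; rewrite Cmod_R, Rabs_pos_eq; lra | apply cis_neq0]).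
  unfold poisson, Rdiv. rewrite RtoC_mult, RtoC_inv by lra. rewrite <- E2, RtoC_minus, <- E1.
  replace (RtoC (s ^ 2)) with (RtoC s * RtoC s)%C by (rewrite <- RtoC_mult; f_equal; ring).
  replace (z * zb - s * z)%C with (z * (zb - s))%C by ring.
  field. repeat split; assumption.
Qed.

Lemma Poisson_formula (H : C -> C) (c : C) (R0 rad s : R) : holo H c R0 -> 0 < rad < R0 -> Rabs s < rad ->
  CInt (fun t => H (circ c rad t) * RtoC (poisson rad s t))%C 0 (2 * PI) (RtoC (2 * PI) * H (c + RtoC s)%C)%C.
Proof.
  intros HH Hr Hs.
  assert (HC := Cauchy_formula H c (c + RtoC s)%C R0 rad HH).
  replace (c + s - c)%C with (RtoC s) in HC by ring. rewrite Cmod_R in HC. specialize (HC ltac:(lra)).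
  set (q := fun w => (H w * (RtoC s / (RtoC (rad ^ 2) - RtoC s * (w - c))))%C).
  assert (Hs0 := Rabs_pos s).
  (* The second entry lies between rad and rad^2 / |s| and also makes sense for s = 0, so the
     reflected term is holomorphic in a disc larger than the circle. *)
  set (R1 := Rmin R0 (2 * rad ^ 2 / (rad + Rabs s))).
  assert (HR1 : rad < R1).
  { apply Rmin_glb_lt; [lra |]. apply Rmult_lt_reg_r with (rad + Rabs s); [lra |]. unfold Rdiv. rewrite Rmult_assoc, Rinv_l by lra. nra. }
  assert (HR1' : Rabs s * R1 < rad ^ 2).
  { apply Rle_lt_trans with (Rabs s * (2 * rad ^ 2 / (rad + Rabs s))); [apply Rmult_le_compat_l; [lra | apply Rmin_r] |].
    apply Rmult_lt_reg_r with (rad + Rabs s); [lra |]. replace (Rabs s * (2 * rad ^ 2 / (rad + Rabs s)) * (rad + Rabs s)) with (2 * Rabs s * rad ^ 2) by (field; lra).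
    assert (0 < rad ^ 2 * (rad - Rabs s)) by pos. lra. }
  assert (Hden : forall w, Cmod (w - c)%C < R1 -> (RtoC (rad ^ 2) - RtoC s * (w - c))%C <> 0%C).
  { intros w Hw. apply Cmod_gt_0. pose proof (Cmod_ge_minus (RtoC (rad ^ 2)) (RtoC s * (w - c))%C) as K.
    rewrite Cmod_mult, !Cmod_R, (Rabs_pos_eq (rad ^ 2)) in K by nra. nra. }
  assert (Hq : holo q c R1).
  { intros w Hw. destruct (HH w) as [l Hl]; [eapply Rlt_le_trans; [exact Hw | apply Rmin_l] |].
    eexists. apply Cd_mult; [exact Hl |]. apply Cd_div; [apply Hden; exact Hw | apply Cd_const |].
    apply Cd_minus; [apply Cd_const | apply Cd_scal, Cd_shift]. }
  assert (H0 : CInt (fun t => q (circ c rad t) * cis t)%C 0 (2 * PI) (RtoC 0)).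
  { apply (circle_holo q c R1); pos. }
  pose proof (@is_RInt_plus CV _ _ _ _ _ _ HC (is_RInt_C_mult (RtoC rad) _ _ _ _ H0)) as HS.
  match type of HS with is_RInt _ _ _ ?v => replace (v : C) with (RtoC (2 * PI) * H (c + s))%C in HS by cring end.
  revert HS. apply (@is_RInt_ext CV). intros t _.
  rewrite <- (poisson_split rad s t) by lra. unfold q.
  unfold ker, cpsi. replace (circ c rad t - (c + s))%C with (rad * cis t - s)%C by (unfold circ; ring).
  replace (circ c rad t - c)%C with (rad * cis t)%C by (unfold circ; ring). unfold Cdiv. cring.
Qed.

Lemma is_RInt_cis : CInt cis 0 (2 * PI) (RtoC 0).
Proof.
  pose proof (circle_holo (fun _ => 1%C) 0%C 2 1 (fun w _ => ex_intro _ _ (Cd_const 1%C w)) ltac:(lra)) as H.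
  revert H. apply (@is_RInt_ext CV). intros t _. cring.
Qed.

(** In cos t = (e^(it) + e^(-it)) / 2 the first half integrates to 0; the second divides by w - c,
    and the mean value of the quotient (H w - H c) / (w - c) is H'(c). *)
Lemma circle_first_coeff (H : C -> C) (c l : C) (R0 rad : R) : holo H c R0 -> 0 < rad < R0 -> Cd H c l ->
  CInt (fun t => H (circ c rad t) * RtoC (cos t))%C 0 (2 * PI) (RtoC (PI * rad) * l)%C.
Proof.
  intros HH Hr Hl.
  assert (Hcc : Cmod (c - c)%C < R0) by (rewrite Cmod_minus_0; lra).
  assert (Hc1 : CInt (fun t => H (circ c rad t) * cis t)%C 0 (2 * PI) (RtoC 0)).
  { apply (circle_holo H c R0); assumption. }
  destruct (holo_quot H c c R0 HH Hcc) as [q [Hq Eq]].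
  assert (Eqc : q c = l).
  { apply (Cd_unique H c); [| pos]. destruct (Hq c Hcc) as [m Hm].
    eapply Cd_ext; [| | apply (Cd_plus _ _ _ _ _ (Cd_const (H c) c) (Cd_mult _ _ _ _ _ (Cd_shift c c) Hm))].
    - symmetry. apply Eq.
    - ring. }
  pose proof (mean_value q c R0 rad Hq Hr) as Hm.
  assert (Hcb : CInt (fun t => cis (- t)) 0 (2 * PI) (RtoC 0)).
  { pose proof is_RInt_cis as K.
    pose proof (is_RInt_C_re _ _ _ _ K) as K1. pose proof (is_RInt_C_im _ _ _ _ K) as K2.
    apply (@is_RInt_scal RN _ _ _ (-1)) in K2. apply is_RInt_fct_extend_pair; simpl.
    - revert K1. apply is_RInt_ext. intros t _. rewrite cos_neg. reflexivity.
    - replace 0 with (scal (-1) 0) at 2 by (rsc; ring). revert K2. apply is_RInt_ext.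
      intros t _. rewrite sin_neg. rsc. ring. }
  pose proof (@is_RInt_plus CV _ _ _ _ _ _ (is_RInt_C_mult (RtoC (/ 2)) _ _ _ _ Hc1)
    (@is_RInt_plus CV _ _ _ _ _ _ (is_RInt_C_mult (RtoC (/ 2) * H c)%C _ _ _ _ Hcb) (is_RInt_C_mult (RtoC (/ 2) * RtoC rad)%C _ _ _ _ Hm))) as HS.
  match type of HS with is_RInt _ _ _ ?v => assert (Ev : (v : C) = (RtoC (PI * rad) * l)%C) end.
  { rewrite Eqc. change (RtoC (/ 2) * 0 + (RtoC (/ 2) * H c * 0 + RtoC (/ 2) * rad * (RtoC (2 * PI) * l)) = RtoC (PI * rad) * l)%C.
    replace (RtoC (PI * rad)) with (RtoC (/ 2) * RtoC rad * RtoC (2 * PI))%C by (rewrite <- !RtoC_mult; f_equal; field). ring. }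
  rewrite Ev in HS. revert HS. apply (@is_RInt_ext CV). intros t _.
  assert (Ec : RtoC (cos t) = (RtoC (/ 2) * (cis t + cis (- t)))%C).
  { unfold cis, RtoC, Cmult, Cplus; simpl. rewrite cos_neg, sin_neg. apply injective_projections; simpl; field. }
  assert (E1 : (cis (- t) * cis t)%C = 1%C).
  { unfold cis, RtoC, Cmult; simpl. rewrite cos_neg, sin_neg. generalize (sin2_cos2 t). unfold Rsqr. intro. apply injective_projections; simpl; lra. }
  rewrite Ec.
  change (RtoC (/ 2) * (H (circ c rad t) * cis t) + (RtoC (/ 2) * H c * cis (- t) + RtoC (/ 2) * rad * q (circ c rad t)) = H (circ c rad t) * (RtoC (/ 2) * (cis t + cis (- t))))%C.
  assert (Eh : H (circ c rad t) = (H c + rad * cis t * q (circ c rad t))%C).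
  { rewrite (Eq (circ c rad t)) at 1. unfold circ; ring. }
  replace (RtoC (/ 2) * rad * q (circ c rad t))%C with (RtoC (/ 2) * rad * q (circ c rad t) * (cis (- t) * cis t))%C by (rewrite E1; ring).
  replace (RtoC (/ 2) * H c * cis (- t) + RtoC (/ 2) * rad * q (circ c rad t) * (cis (- t) * cis t))%C with (RtoC (/ 2) * cis (- t) * (H c + rad * cis t * q (circ c rad t)))%C by ring.
  rewrite <- Eh. ring.
Qed.

(** The Poisson kernels reproduce the values at c + s and c - s, the cosine the derivative at c; the
    sum is odd under t -> PI - t. *)
Definition oddker (rad kap s t : R) : R := poisson rad s t - poisson rad (- s) t - (4 * kap * s / rad) * cos t.

Lemma odd_functional (H : C -> C) (c l : C) (R0 rad kap s : R) : holo H c R0 -> 0 < rad < R0 -> Cd H c l -> Rabs s < rad ->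
  is_RInt (fun t => Re (H (circ c rad t)) * oddker rad kap s t) 0 (2 * PI)
    (2 * PI * (Re (H (c + RtoC s)%C) - Re (H (c - RtoC s)%C) - 2 * kap * s * Re l)).
Proof.
  intros HH Hr Hl Hs.
  assert (P1 := is_RInt_C_re _ _ _ _ (Poisson_formula H c R0 rad s HH Hr Hs)).
  assert (P2 := is_RInt_C_re _ _ _ _ (Poisson_formula H c R0 rad (- s) HH Hr ltac:(rewrite Rabs_Ropp; exact Hs))).
  assert (P3 := is_RInt_C_re _ _ _ _ (circle_first_coeff H c l R0 rad HH Hr Hl)).
  apply (@is_RInt_scal RN _ _ _ (4 * kap * s / rad)) in P3.
  pose proof (@is_RInt_minus RN _ _ _ _ _ _ (@is_RInt_minus RN _ _ _ _ _ _ P1 P2) P3) as HS.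
  replace (c + RtoC (- s))%C with (c - RtoC s)%C in HS by (rewrite RtoC_opp; ring).
  match type of HS with is_RInt _ _ _ ?v => replace v with (2 * PI * (Re (H (c + RtoC s)%C) - Re (H (c - RtoC s)%C) - 2 * kap * s * Re l)) in HS end.
  - revert HS. apply is_RInt_ext. intros t _. unfold oddker, minus, plus, opp, scal, mult; simpl. unfold mult; simpl. unfold Re. ring.
  - unfold minus, plus, opp, scal, mult; simpl. unfold mult; simpl. unfold Re. field. lra.
Qed.

(** * Contribution of a single zero *)

(** Partial sum of exp with a running term: t is the current term and k the next divisor, so that on
    literals it unfolds to plain rational arithmetic without factorials. *)
Fixpoint texp (n : nat) (k t y : R) : R :=
  match n with O => t | S n => t + texp n (k + 1) (t * y / k) y end.

Lemma texp_sum (n m : nat) (y : R) :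
  texp n (INR (S m)) (y ^ m / INR (fact m)) y = sum_f_R0 (fun i => y ^ (m + i) / INR (fact (m + i))) n.
Proof.
  revert m. induction n as [| n IH]; intro m.
  - simpl. rewrite Nat.add_0_r. reflexivity.
  - rewrite decomp_sum by lia. cbn [texp]. rewrite Nat.add_0_r. f_equal.
    replace (y ^ m / INR (fact m) * y / INR (S m)) with (y ^ (S m) / INR (fact (S m))).
    + rewrite <- S_INR. rewrite IH. apply sum_eq. intros i _. replace (m + S i)%nat with (S m + i)%nat by lia. reflexivity.
    + rewrite fact_simpl, mult_INR. simpl pow. field. split; [apply INR_fact_neq_0 | pos].
Qed.

Lemma Derive_n_exp (n : nat) (x : R) : Derive_n exp n x = exp x.
Proof.
  revert x. induction n as [| n IH]; intro x; [reflexivity |]. simpl. rewrite (Derive_ext _ exp x IH).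
  apply is_derive_unique, is_derive_exp.
Qed.

Lemma exp_taylor (n : nat) (y : R) : 0 < y -> exists z, 0 < z < y /\
  exp y = texp n 1 1 y + y ^ (S n) / INR (fact (S n)) * exp z.
Proof.
  intro Hy. destruct (Taylor_Lagrange exp n 0 y Hy) as [z [Hz E]].
  - intros t _ k _. destruct k as [| k]; [exact I |]. exists (exp t).
    apply (is_derive_ext exp); [intro u; symmetry; apply Derive_n_exp | apply is_derive_exp].
  - exists z. split; [lra |]. rewrite E, Rminus_0_r, Derive_n_exp. f_equal.
    pose proof (texp_sum n 0 y) as H. simpl INR in H. simpl pow in H. replace (1 / 1) with 1 in H by field. rewrite H.
    apply sum_eq. intros i _. rewrite Derive_n_exp, exp_0. lra.
Qed.

Lemma ln_le_texp (n : nat) (x y : R) : 0 < x -> 0 < y -> x <= texp n 1 1 y -> ln x <= y.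
Proof.
  intros Hx Hy H. destruct (exp_taylor n y Hy) as [z [_ E]].
  rewrite <- (ln_exp y). apply ln_le; [lra |].
  assert (0 <= y ^ S n / INR (fact (S n)) * exp z); [| lra].
  apply Rmult_le_pos; [apply Rdiv_le_0_compat; [pos | apply INR_fact_lt_0] | left; apply exp_pos].
Qed.

Fixpoint tterm (n : nat) (k t y : R) : R := match n with O => t | S n => tterm n (k + 1) (t * y / k) y end.

Lemma tterm_eq (n m : nat) (y : R) : tterm n (INR (S m)) (y ^ m / INR (fact m)) y = y ^ (m + n) / INR (fact (m + n)).
Proof.
  revert m. induction n as [| n IH]; intro m; [rewrite Nat.add_0_r; reflexivity |]. cbn [tterm].
  replace (y ^ m / INR (fact m) * y / INR (S m)) with (y ^ (S m) / INR (fact (S m))).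
  - rewrite <- S_INR, IH. replace (m + S n)%nat with (S m + n)%nat by lia. reflexivity.
  - rewrite fact_simpl, mult_INR. simpl pow. field. split; [apply INR_fact_neq_0 | pos].
Qed.

(** The Lagrange remainder is at most u exp y with u the next Taylor term; solving for exp y leaves
    the factor 1 - u. *)
Lemma ln_ge_texp (n : nat) (x y : R) : 0 < x -> 0 < y -> tterm (S n) 1 1 y < 1 ->
  texp n 1 1 y <= x * (1 - tterm (S n) 1 1 y) -> y <= ln x.
Proof.
  intros Hx Hy Ht H. destruct (exp_taylor n y Hy) as [z [Hz E]].
  assert (Et : tterm (S n) 1 1 y = y ^ S n / INR (fact (S n))).
  { pose proof (tterm_eq (S n) 0 y) as Et. rewrite Rdiv_1_r in Et. exact Et. } set (u := tterm (S n) 1 1 y) in *.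
  assert (Hu : 0 <= u) by (rewrite Et; apply Rdiv_le_0_compat; [pos | apply INR_fact_lt_0]).
  assert (Hez : exp z <= exp y) by (left; apply exp_increasing; lra).
  rewrite <- (ln_exp y). apply ln_le; [pos |]. nra.
Qed.

Ltac num_ln_le n := apply (ln_le_texp n); [lra | lra | cbv [texp]; lra].
Ltac num_ln_ge n := apply (ln_ge_texp n); [lra | lra | cbv [tterm]; lra | cbv [tterm texp]; lra].

Lemma ln2_le : ln 2 <= 0.69315. Proof. num_ln_le 9%nat. Qed.

Lemma ln2_ge : 0.69314 <= ln 2. Proof. num_ln_ge 9%nat. Qed.

Lemma ln3_le : ln 3 <= 1.09862. Proof. num_ln_le 11%nat. Qed.

Lemma ln25_le : ln 25 <= 3.22. Proof. num_ln_le 14%nat. Qed.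

Lemma ln144_25_ge : 1.75 <= ln (144 / 25). Proof. num_ln_ge 11%nat. Qed.

Lemma MVT_le (f df : R -> R) (a b m : R) : a <= b -> (forall x, a <= x <= b -> is_derive f x (df x)) ->
  (forall x, a <= x <= b -> df x <= m) -> f b - f a <= m * (b - a).
Proof.
  intros Hab Hd Hm.
  destruct (MVT_gen f a b df) as [c [Hc E]].
  - intros x Hx. rewrite Rmin_left, Rmax_right in Hx by lra. apply Hd; lra.
  - intros x Hx. rewrite Rmin_left, Rmax_right in Hx by lra. apply continuity_pt_filterlim.
    apply derive_cts. exists (df x). apply Hd; lra.
  - rewrite Rmin_left, Rmax_right in Hc by lra. rewrite E. apply Rmult_le_compat_r; [lra | apply Hm; exact Hc].
Qed.

Lemma MVT_ge (f df : R -> R) (a b m : R) : a <= b -> (forall x, a <= x <= b -> is_derive f x (df x)) ->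
  (forall x, a <= x <= b -> m <= df x) -> m * (b - a) <= f b - f a.
Proof.
  intros Hab Hd Hm. pose proof (MVT_le (fun x => - f x) (fun x => - df x) a b (- m) Hab ltac:(intros x Hx; apply (is_derive_opp f), Hd, Hx) ltac:(intros x Hx; specialize (Hm x Hx); lra)). lra.
Qed.

(** For a convex f with f 0 = 0 the quotient f x / x increases; stated without division, since a may
    be 0. *)
Lemma slope_le (f df : R -> R) (a r : R) : 0 <= a <= r -> f 0 = 0 -> (forall x, 0 <= x <= r -> is_derive f x (df x)) ->
  (forall x y, 0 <= x <= y -> y <= r -> df x <= df y) -> r * f a <= a * f r.
Proof.
  intros Ha H0 Hd Hm.
  assert (H1 := MVT_le f df 0 a (df a) ltac:(lra) ltac:(intros; apply Hd; lra) ltac:(intros; apply Hm; lra)).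
  assert (H2 := MVT_ge f df a r (df a) ltac:(lra) ltac:(intros; apply Hd; lra) ltac:(intros; apply Hm; lra)). nra.
Qed.

Lemma ln_diff_le (x y : R) : 0 < x -> 0 < y -> ln y - ln x <= (y - x) / x.
Proof.
  intros Hx Hy. pose proof (exp_ineq1_le (ln y - ln x)) as K. replace (exp (ln y - ln x)) with (y / x) in K by (unfold Rminus; rewrite exp_plus, exp_Ropp, !exp_ln by assumption; reflexivity).
  replace ((y - x) / x) with (y / x - 1) by (field; lra). lra.
Qed.

Lemma sqrt_spec (q : R) : 0 < q -> 0 < sqrt q /\ sqrt q ^ 2 = q.
Proof. intro H. split; [apply sqrt_lt_R0, H | apply pow2_sqrt; lra]. Qed.

(** The integral over s in [0, 1] of ln |(r + s) / (r - s)|: the limiting case of a real zero at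
    distance r < 1 from the centre. *)
Definition gam (r : R) : R := (1 + r) * ln (1 + r) - (1 - r) * ln (1 - r) - 2 * r * ln r.

(* [3.22 - 1.75 r] lies above the tangent of the concave function [gam] at [12/13]. *)
Lemma gam_tangent (r : R) : 0 < r < 1 -> gam r <= 3.22 - 1.75 * r.
Proof.
  intro Hr. set (T := fun x => gam x - (ln 25 - x * ln (144 / 25))).
  assert (HdT : forall x, 0 < x < 1 -> is_derive T x (ln ((1 - x ^ 2) / x ^ 2) + ln (144 / 25))).
  { intros x Hx. unfold T, gam. auto_derive; [lra |].
    replace (ln ((1 - x ^ 2) / x ^ 2)) with (ln (1 + x) + ln (1 - x) - 2 * ln x).
    - change (1 + - x) with (1 - x). field. lra.
    - replace ((1 - x ^ 2) / x ^ 2) with ((1 + x) * (1 - x) * (/ x * / x)) by (field; lra).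
      assert (0 < / x) by pos.
      rewrite !ln_mult, ln_Rinv by nra. ring. }
  assert (HT0 : T (12 / 13) = 0).
  { unfold T, gam. replace (1 + 12 / 13) with (25 * / 13) by lra. replace (1 - 12 / 13) with (/ 13) by lra.
    replace (144 / 25) with ((12 * 12) * / 25) by lra. replace (12 / 13) with (12 * / 13) by lra.
    rewrite !ln_mult, !ln_Rinv by lra. lra. }
  assert (HT : T r <= 0).
  { destruct (Rle_dec r (12 / 13)) as [Hc | Hc].
    - assert (H := MVT_ge T _ r (12 / 13) 0 Hc (fun x Hx => HdT x ltac:(lra))). rewrite HT0 in H.
      assert (0 * (12 / 13 - r) <= 0 - T r); [| lra]. apply H. intros x Hx.
      rewrite <- ln_mult by (try lra; apply Rdiv_lt_0_compat; nra). rewrite <- ln_1. apply ln_le; [lra |].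
      apply Rmult_le_reg_r with (x ^ 2); [nra |]. field_simplify; nra.
    - assert (H := MVT_le T _ (12 / 13) r 0 ltac:(lra) (fun x Hx => HdT x ltac:(lra))). rewrite HT0 in H.
      assert (T r - 0 <= 0 * (r - 12 / 13)); [| lra]. apply H. intros x Hx.
      rewrite <- ln_mult by (try lra; apply Rdiv_lt_0_compat; nra). rewrite <- ln_1. apply ln_le.
      + apply Rmult_lt_0_compat; [apply Rdiv_lt_0_compat; nra | lra].
      + apply Rmult_le_reg_r with (x ^ 2); [nra |]. field_simplify; nra. }
  unfold T in HT. pose proof ln25_le. pose proof ln144_25_ge. nra.
Qed.

(** ln |s - rho| - ln |-s - rho| for a zero with a = - Re rho and q = |rho|^2. *)
Definition Lq (a q s : R) : R := / 2 * (ln (q + s ^ 2 + 2 * a * s) - ln (q + s ^ 2 - 2 * a * s)).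

Lemma Lq_dom (a q s : R) : a ^ 2 < q -> 0 < q + s ^ 2 - 2 * a * s /\ 0 < q + s ^ 2 + 2 * a * s.
Proof. pose proof (pow2_ge_0 (s - a)). pose proof (pow2_ge_0 (s + a)). nra.
Qed.

Lemma is_derive_Lq_a (q s a : R) : 0 <= a -> 0 <= s -> 0 < q + s ^ 2 - 2 * a * s ->
  is_derive (fun a => Lq a q s) a (2 * s * (q + s ^ 2) / ((q + s ^ 2) ^ 2 - 4 * a ^ 2 * s ^ 2)).
Proof.
  intros Ha Hs H1. assert (H2 : 0 < q + s ^ 2 + 2 * a * s) by nra. unfold Lq. auto_derive; [lra |].
  replace ((q + s ^ 2) ^ 2 - 4 * a ^ 2 * s ^ 2) with ((q + s ^ 2 - 2 * a * s) * (q + s ^ 2 + 2 * a * s)) by ring.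
  field. repeat split; lra.
Qed.

(** [Lq] vanishes at a = 0 and is convex in a. Hence, relative to a, the worst zero of given modulus
    is the real one, a = sqrt q. *)
Lemma Lq_slope (q s a a' : R) : 0 <= q -> 0 <= s -> 0 <= a <= a' -> 0 < q + s ^ 2 - 2 * a' * s -> a' * Lq a q s <= a * Lq a' q s.
Proof.
  intros Hq0 Hs Ha Hq.
  apply (slope_le (fun a => Lq a q s) (fun a => 2 * s * (q + s ^ 2) / ((q + s ^ 2) ^ 2 - 4 * a ^ 2 * s ^ 2))); [lra | | |].
  - unfold Lq. replace (q + s ^ 2 + 2 * 0 * s) with (q + s ^ 2 - 2 * 0 * s) by ring. ring.
  - intros x Hx. apply is_derive_Lq_a; nra.
  - intros x y Hx Hy.
    assert (HD : 0 < (q + s ^ 2) ^ 2 - 4 * y ^ 2 * s ^ 2) by (replace ((q + s ^ 2) ^ 2 - 4 * y ^ 2 * s ^ 2) with ((q + s ^ 2 - 2 * y * s) * (q + s ^ 2 + 2 * y * s)) by ring; apply Rmult_lt_0_compat; nra).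
    apply Rmult_le_compat_l; [nra |]. apply Rinv_le_contravar; [lra |].
    assert (x ^ 2 <= y ^ 2) by nra. nra.
Qed.

Lemma ex_RInt_Lq (a q x y : R) : a ^ 2 < q -> ex_RInt (Lq a q) x y.
Proof.
  intro H. apply cts_RInt. intros s _.
  apply derive_cts. destruct (Lq_dom a q s H). unfold Lq. auto_derive. lra.
Qed.

Definition Hb (b x : R) : R := / 2 * x * ln (x ^ 2 + b ^ 2) - x + b * atan (x / b).

Lemma is_derive_Hb (b x : R) : 0 < b -> is_derive (Hb b) x (/ 2 * ln (x ^ 2 + b ^ 2)).
Proof.
  intro Hb0. unfold Hb. auto_derive; [nra |].
  replace (x * (x * 1) + b * (b * 1)) with (x ^ 2 + b ^ 2) by ring. field. repeat split; nra.
Qed.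

Lemma RInt_Lq_exact (a b : R) : 0 < b -> is_RInt (Lq a (a ^ 2 + b ^ 2)) 0 1 (Hb b (1 + a) - Hb b (1 - a) - (Hb b a - Hb b (- a))).
Proof.
  intro Hb0.
  set (F := fun s => Hb b (s + a) - Hb b (s - a)).
  replace (Hb b (1 + a) - Hb b (1 - a) - (Hb b a - Hb b (- a))) with (minus (F 1) (F 0)).
  2:{ unfold F; rsc. replace (0 + a) with a by ring. replace (0 - a) with (- a) by ring. ring. }
  apply (@is_RInt_derive RV F).
  - intros s _. unfold Lq, F.
    replace (/ 2 * (ln (a ^ 2 + b ^ 2 + s ^ 2 + 2 * a * s) - ln (a ^ 2 + b ^ 2 + s ^ 2 - 2 * a * s))) with
      (1 * (/ 2 * ln ((s + a) ^ 2 + b ^ 2)) - 1 * (/ 2 * ln ((s - a) ^ 2 + b ^ 2))).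
    + apply (is_derive_minus (fun s => Hb b (s + a)) (fun s => Hb b (s - a))).
      * apply (is_derive_comp (Hb b) (fun s => s + a)); [apply is_derive_Hb; exact Hb0 | auto_derive; lra].
      * apply (is_derive_comp (Hb b) (fun s => s - a)); [apply is_derive_Hb; exact Hb0 | auto_derive; lra].
    + replace ((s + a) ^ 2 + b ^ 2) with (a ^ 2 + b ^ 2 + s ^ 2 + 2 * a * s) by ring.
      replace ((s - a) ^ 2 + b ^ 2) with (a ^ 2 + b ^ 2 + s ^ 2 - 2 * a * s) by ring. ring.
  - intros s _. apply derive_cts. destruct (Lq_dom a (a ^ 2 + b ^ 2) s ltac:(nra)). unfold Lq. auto_derive. lra.
Qed.

(** For q <= 1 the comparison with a = sqrt q would put a singularity at s = sqrt q in [0, 1]. The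
    comparison is made with x < sqrt q, where the integral is explicit and exceeds [gam x] by at
    most 4 sqrt (q - x^2); then x tends to sqrt q from the left. *)
Lemma RInt_Lq_small (a q : R) : 0 < a -> a ^ 2 < q -> q <= 1 -> RInt (Lq a q) 0 1 <= a / sqrt q * (3.22 - 1.75 * sqrt q).
Proof.
  intros Ha Hq Hq1. destruct (sqrt_spec q ltac:(nra)) as [Hr0 Hrq]. set (r := sqrt q) in *.
  assert (Hr1 : r <= 1) by nra. assert (Har : a < r) by nra.
  assert (Hb : forall x, a < x < r -> RInt (Lq a q) 0 1 <= a / x * (3.22 - 1.75 * x + 4 * sqrt (q - x ^ 2))).
  { intros x Hx. set (b := sqrt (q - x ^ 2)). assert (Hb0 : 0 < b) by (apply sqrt_lt_R0; nra).
    assert (Hbq : x ^ 2 + b ^ 2 = q) by (unfold b; rewrite pow2_sqrt by nra; ring).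
    assert (Hb1 : b < 1) by nra.
    assert (HI := RInt_Lq_exact x b Hb0). rewrite Hbq in HI.
    assert (H1 : RInt (Lq a q) 0 1 <= RInt (fun s => a / x * Lq x q s) 0 1).
    { apply RInt_le; [lra | apply ex_RInt_Lq; exact Hq | apply (@ex_RInt_scal RV), ex_RInt_Lq; nra |].
      intros s Hs. destruct (Lq_dom x q s ltac:(nra)) as [Hdx _].
      pose proof (Lq_slope q s a x ltac:(nra) ltac:(lra) ltac:(lra) Hdx).
      apply Rmult_le_reg_l with x; [lra |]. replace (x * (a / x * Lq x q s)) with (a * Lq x q s) by (field; lra). assumption. }
    rewrite (RInt_scal (V := RV)) in H1 by (apply ex_RInt_Lq; nra).
    rewrite (is_RInt_unique _ _ _ _ HI) in H1. change (scal (a / x)) with (Rmult (a / x)) in H1.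
    eapply Rle_trans; [exact H1 |]. apply Rmult_le_compat_l; [pos |].
    pose proof (gam_tangent x ltac:(lra)) as G. unfold gam in G.
    unfold Hb. rewrite !Hbq.
    replace ((- x) ^ 2 + b ^ 2) with q by lra.
    replace (- x / b) with (- (x / b)) by lra. rewrite atan_opp.
    assert (A1 : 0 < atan (x / b)) by (rewrite <- atan_0; apply atan_increasing; apply Rdiv_lt_0_compat; lra).
    assert (A2 : 0 < atan ((1 - x) / b)) by (rewrite <- atan_0; apply atan_increasing; apply Rdiv_lt_0_compat; lra).
    pose proof (atan_bound ((1 + x) / b)) as A3. pose proof PI_4 as HPI.
    assert (L1 : ln ((1 + x) ^ 2 + b ^ 2) <= 2 * ln (1 + x) + b ^ 2).
    { pose proof (ln_diff_le ((1 + x) * (1 + x)) ((1 + x) ^ 2 + b ^ 2) ltac:(nra) ltac:(nra)) as Ee. rewrite ln_mult in Ee by lra.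
      assert (((1 + x) ^ 2 + b ^ 2 - (1 + x) * (1 + x)) / ((1 + x) * (1 + x)) <= b ^ 2) by (apply Rle_div_l; nra). lra. }
    assert (L2 : 2 * ln (1 - x) <= ln ((1 - x) ^ 2 + b ^ 2)).
    { replace (2 * ln (1 - x)) with (ln ((1 - x) * (1 - x))) by (rewrite ln_mult by lra; ring). apply ln_le; nra. }
    assert (L3 : 2 * ln x <= ln q).
    { replace (2 * ln x) with (ln (x * x)) by (rewrite ln_mult by lra; ring). apply ln_le; nra. }
    assert (T1 : / 2 * (1 + x) * ln ((1 + x) ^ 2 + b ^ 2) <= (1 + x) * ln (1 + x) + b ^ 2) by nra.
    assert (T2 : (1 - x) * ln (1 - x) <= / 2 * (1 - x) * ln ((1 - x) ^ 2 + b ^ 2)) by nra.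
    assert (T3 : x * (2 * ln x) <= x * ln q) by nra.
    assert (T4 : b * atan ((1 + x) / b) <= b * 2) by (apply Rmult_le_compat_l; lra).
    assert (T5 : 0 <= b * atan ((1 - x) / b)) by nra.
    nra. }
  assert (Hlim : continuous (fun x => a / x * (3.22 - 1.75 * x + 4 * sqrt (q - x ^ 2))) r).
  { apply (continuous_mult (fun x => a / x) (fun x => 3.22 - 1.75 * x + 4 * sqrt (q - x ^ 2))).
    - cts_derive. lra.
    - apply (continuous_plus (fun x => 3.22 - 1.75 * x) (fun x => 4 * sqrt (q - x ^ 2))).
      + cts_derive.
      + apply (continuous_mult (fun _ => 4) (fun x => sqrt (q - x ^ 2))); [apply continuous_const |].
        apply (continuous_comp (fun x => q - x ^ 2) sqrt); [cts_derive | apply continuous_sqrt]. }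
  replace (a / r * (3.22 - 1.75 * r)) with (a / r * (3.22 - 1.75 * r + 4 * sqrt (q - r ^ 2))) by (rewrite Hrq, Rminus_diag, sqrt_0; ring).
  apply (filterlim_le (F := at_left r) (fun _ => RInt (Lq a q) 0 1) (fun x => a / x * (3.22 - 1.75 * x + 4 * sqrt (q - x ^ 2))) (Finite _) (Finite _)).
  - exists (mkposreal (r - a) ltac:(lra)). intros x Hx Hxr. apply Hb. change (Rabs (x - r) < r - a) in Hx. apply Rabs_def2 in Hx. lra.
  - apply filterlim_const.
  - intros P HP. destruct (Hlim P HP) as [d Hd]. exists d. intros x Hx _. apply Hd, Hx.
Qed.

(** Twice the inverse hyperbolic tangent; [Lq] reduces to it at a real zero. *)
Definition hl (x : R) : R := ln (1 + x) - ln (1 - x).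

Lemma is_derive_hl (x : R) : -1 < x < 1 -> is_derive hl x (2 / (1 - x ^ 2)).
Proof.
  intro H. unfold hl. auto_derive; [lra |].
  replace (1 - x ^ 2) with ((1 - x) * (1 + x)) by ring. field. lra.
Qed.

Lemma hl_0 : hl 0 = 0. Proof. unfold hl. rewrite Rplus_0_r, Rminus_0_r. ring. Qed.

Lemma hl_deriv_mono (x y : R) : 0 <= x <= y -> y < 1 -> 2 / (1 - x ^ 2) <= 2 / (1 - y ^ 2).
Proof. intros. apply Rmult_le_compat_l; [lra |]. apply Rinv_le_contravar; nra.
Qed.

Lemma hl_slope (x y : R) : 0 <= x <= y -> y < 1 -> y * hl x <= x * hl y.
Proof.
  intros Hx Hy. apply (slope_le hl (fun x => 2 / (1 - x ^ 2))); [lra | apply hl_0 | |].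
  - intros z Hz. apply is_derive_hl. lra.
  - intros. apply hl_deriv_mono; lra.
Qed.

Lemma hl_ge (x : R) : 0 <= x < 1 -> 2 * x <= hl x.
Proof.
  intro H. assert (K := MVT_ge hl (fun x => 2 / (1 - x ^ 2)) 0 x 2 ltac:(lra)).
  rewrite hl_0 in K. assert (2 * (x - 0) <= hl x - 0); [| lra]. apply K.
  - intros z Hz. apply is_derive_hl. lra.
  - intros z Hz. pose proof (hl_deriv_mono 0 z ltac:(lra) ltac:(lra)) as M. lra.
Qed.

Lemma hl_diff (x y : R) : 0 <= y <= x -> x < 1 -> hl x - hl y <= 2 / (1 - x ^ 2) * (x - y).
Proof.
  intros Hy Hx. apply (MVT_le hl (fun x => 2 / (1 - x ^ 2))); [lra | |].
  - intros z Hz. apply is_derive_hl. lra.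
  - intros z Hz. apply hl_deriv_mono; lra.
Qed.

Lemma RInt_hl_div (r : R) : 1 < r -> is_RInt (fun s => hl (s / r)) 0 1 ((r + 1) * ln (r + 1) + (r - 1) * ln (r - 1) - 2 * r * ln r).
Proof.
  intro Hr. set (F := fun s => (r + s) * ln (r + s) + (r - s) * ln (r - s)).
  replace ((r + 1) * ln (r + 1) + (r - 1) * ln (r - 1) - 2 * r * ln r) with (minus (F 1) (F 0)).
  2:{ unfold F; rsc. rewrite Rplus_0_r, Rminus_0_r. ring. }
  apply (@is_RInt_derive RV F).
  - rewrite Rmin_left, Rmax_right by lra. intros s Hs. unfold F, hl.
    replace (1 + s / r) with ((r + s) / r) by (field; lra). replace (1 - s / r) with ((r - s) / r) by (field; lra).
    rewrite !ln_div by lra. auto_derive; [lra |]. change (r + - s) with (r - s). field. lra.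
  - rewrite Rmin_left, Rmax_right by lra. intros s Hs. apply derive_cts.
    unfold hl. assert (-1 < s / r < 1) by (split; [apply Rlt_div_r | apply Rlt_div_l]; lra).
    auto_derive. lra.
Qed.

Lemma ex_RInt_hl_div (r : R) : 1 < r -> ex_RInt (fun s => hl (s / r)) 0 1.
Proof. eexists. apply RInt_hl_div, H.
Qed.

Lemma Lq_diag (r s : R) : 0 <= s < r -> Lq r (r ^ 2) s = hl (s / r).
Proof.
  intro H. unfold Lq, hl. replace (r ^ 2 + s ^ 2 + 2 * r * s) with ((r + s) * (r + s)) by ring.
  replace (r ^ 2 + s ^ 2 - 2 * r * s) with ((r - s) * (r - s)) by ring.
  replace (1 + s / r) with ((r + s) / r) by (field; lra). replace (1 - s / r) with ((r - s) / r) by (field; lra).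
  rewrite !ln_div by lra. rewrite !ln_mult by lra. field.
Qed.

Lemma ln_slope_2 (x : R) : 1 <= x -> ln (1 + x) <= ln 2 + (x - 1) / 2.
Proof.
  intro H. pose proof (ln_diff_le 2 (1 + x) ltac:(lra) ltac:(lra)). lra.
Qed.

(** After passing to the real zero r = sqrt q, the quantity r hl(s / r) decreases in r, so its
    supremum over r > 1 is approached at r = 1, where its integral is 2 ln 2. *)
Lemma RInt_Lq_mid (a q : R) : 0 < a -> a ^ 2 < q -> 1 < q -> RInt (Lq a q) 0 1 <= a / q * 1.3879.
Proof.
  intros Ha Hq Hq1. destruct (sqrt_spec q ltac:(nra)) as [Hr0 Hrq]. set (r := sqrt q) in *.
  assert (Hr1 : 1 < r) by nra. assert (Har : a < r) by nra.
  (* Exactly r = 1 would make the integrand singular at s = 1; a radius slightly above 1 costs only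
     the last digits of 1.3879. *)
  set (r' := Rmin r 1.0005). assert (H1 : 1 < r') by (unfold r'; apply Rmin_glb_lt; lra).
  assert (H2 : r' <= r) by apply Rmin_l. assert (H3 : r' <= 1.0005) by apply Rmin_r.
  assert (HI : RInt (Lq a q) 0 1 <= RInt (fun s => a / q * r' * hl (s / r')) 0 1).
  { apply RInt_le; [lra | apply ex_RInt_Lq; exact Hq | apply (@ex_RInt_scal RV (fun s => hl (s / r'))), ex_RInt_hl_div, H1 |].
    intros s Hs. pose proof (Lq_slope q s a r ltac:(lra) ltac:(lra) ltac:(lra) ltac:(nra)) as K.
    rewrite <- Hrq in K at 2. rewrite Lq_diag in K by lra.
    assert (Hsr : s / r' < 1) by (apply Rlt_div_l; lra).
    assert (Hle : s / r <= s / r') by (unfold Rdiv; apply Rmult_le_compat_l; [lra | apply Rinv_le_contravar; lra]).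
    assert (H0 : 0 <= s / r) by (apply Rdiv_le_0_compat; lra).
    pose proof (hl_slope (s / r) (s / r') ltac:(lra) Hsr) as M.
    assert (M' : r * hl (s / r) <= r' * hl (s / r')).
    { apply Rmult_le_reg_l with (s / (r * r')); [apply Rdiv_lt_0_compat; nra |].
      replace (s / (r * r') * (r * hl (s / r))) with (s / r' * hl (s / r)) by (field; lra).
      replace (s / (r * r') * (r' * hl (s / r'))) with (s / r * hl (s / r')) by (field; lra). exact M. }
    apply Rmult_le_reg_l with r; [lra |]. eapply Rle_trans; [exact K |].
    replace (r * (a / q * r' * hl (s / r'))) with (a / r * (r' * hl (s / r'))) by (rewrite <- Hrq; field; lra).
    replace (a * hl (s / r)) with (a / r * (r * hl (s / r))) by (field; lra).
    apply Rmult_le_compat_l; nra. }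
  eapply Rle_trans; [exact HI |].
  rewrite (RInt_scal (V := RV) (fun s => hl (s / r'))) by (apply ex_RInt_hl_div, H1).
  rewrite (is_RInt_unique _ _ _ _ (RInt_hl_div r' H1)).
  rewrite Rmult_assoc. apply Rmult_le_compat_l; [apply Rdiv_le_0_compat; lra |].
  assert (ln (r' - 1) <= 0) by (rewrite <- ln_1; apply ln_le; lra).
  assert (0 <= ln r') by (rewrite <- ln_1; apply ln_le; lra).
  pose proof (ln_slope_2 r' ltac:(lra)) as L. pose proof ln2_le. rewrite (Rplus_comm 1 r') in L.
  assert ((r' - 1) * ln (r' - 1) <= 0) by nra. nra.
Qed.

(** The analogue of [Lq] for the reflected factor 2 - conj(rho) z / 2, which has the same modulus as
    z - rho on the circle |z| = 2. *)
Definition Lq2 (a q s : R) : R := / 2 * (ln (4 + q * s ^ 2 / 4 + 2 * a * s) - ln (4 + q * s ^ 2 / 4 - 2 * a * s)).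

Lemma Lq2_dom (a q s : R) : 0 <= a -> 0 <= s <= 1 -> a ^ 2 <= q -> q < 4 -> 0 < 4 + q * s ^ 2 / 4 - 2 * a * s.
Proof.
  intros Ha Hs H1 H2. assert (a < 2) by nra. nra.
Qed.

Lemma ex_RInt_Lq2 (a q : R) : 0 <= a -> a ^ 2 <= q -> q < 4 -> ex_RInt (Lq2 a q) 0 1.
Proof.
  intros Ha H1 H2. apply cts_RInt. rewrite Rmin_left, Rmax_right by lra. intros s Hs.
  apply derive_cts. pose proof (Lq2_dom a q s Ha Hs H1 H2). unfold Lq2. auto_derive.
  nra.
Qed.

Lemma half_hl (A u : R) : 0 < A -> Rabs u < A -> / 2 * (ln (A + u) - ln (A - u)) = / 2 * hl (u / A).
Proof.
  intros HA Hu. apply Rabs_def2 in Hu. unfold hl. replace (1 + u / A) with ((A + u) / A) by (field; lra).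
  replace (1 - u / A) with ((A - u) / A) by (field; lra). rewrite !ln_div by lra. ring.
Qed.

Lemma Lq2_ge (a q s : R) : 0 <= a -> 0 <= s <= 1 -> a ^ 2 <= q -> q < 4 -> a * s / 2 * (1 - q * s ^ 2 / 16) <= Lq2 a q s.
Proof.
  intros Ha Hs H1 H2. pose proof (Lq2_dom a q s Ha Hs H1 H2) as D. assert (0 <= 2 * a * s) by nra. assert (0 <= q * s ^ 2) by nra. set (A := 4 + q * s ^ 2 / 4) in *.
  unfold Lq2. fold A. rewrite half_hl by (try (rewrite Rabs_right); lra).
  assert (Hx : 0 <= 2 * a * s / A < 1) by (split; [apply Rdiv_le_0_compat | apply Rlt_div_l]; lra).
  pose proof (hl_ge _ Hx) as G. apply Rle_trans with (2 * a * s / A); [| lra].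
  apply -> Rle_div_r; [| lra]. rewrite (Rmult_assoc 2).
  assert (0 <= a * s) by nra. assert (E : q * s ^ 2 = 4 * (A - 4)) by (unfold A; field). rewrite E.
  replace (a * s / 2 * (1 - 4 * (A - 4) / 16) * A) with (a * s * ((1 - (A - 4) / 4) * A / 2)) by field.
  rewrite (Rmult_comm 2). apply Rmult_le_compat_l; [lra |]. nra.
Qed.

Lemma RInt_Lq2_ge (a q : R) : 0 <= a -> a ^ 2 <= q -> q < 4 -> a * (/ 4 - q / 128) <= RInt (Lq2 a q) 0 1.
Proof.
  intros Ha H1 H2. assert (HI : is_RInt (fun s => a * s / 2 * (1 - q * s ^ 2 / 16)) 0 1 (a * (/ 4 - q / 128))).
  { set (F := fun s => a * (s ^ 2 / 4 - q * s ^ 4 / 128)). replace (a * (/ 4 - q / 128)) with (minus (F 1) (F 0)) by (unfold F; rsc; field).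
    apply (@is_RInt_derive RV F).
    - intros s _. unfold F. auto_derive; lra.
    - intros s _. cts_derive. }
  rewrite <- (is_RInt_unique _ _ _ _ HI). apply RInt_le; [lra | eexists; exact HI | apply ex_RInt_Lq2; assumption |].
  intros s Hs. apply Lq2_ge; lra.
Qed.

(** Moving the lower bound for [Lq2] to the right leaves a / q times 1.65 - 0.1625 q - q^2 / 128. At
    q = 3/2 this polynomial is 1.3887 against 1.3879 from [RInt_Lq_mid], so the threshold cannot be
    moved up much. *)
Lemma zero_lemma_small (a q : R) : 0 < a -> a ^ 2 < q -> q <= 3 / 2 ->
  RInt (Lq a q) 0 1 - RInt (Lq2 a q) 0 1 <= 1.65 * (a / q - a / 4).
Proof.
  intros Ha Hq Hq1. pose proof (RInt_Lq2_ge a q ltac:(lra) ltac:(lra) ltac:(lra)) as G.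
  assert (H : RInt (Lq a q) 0 1 <= a / q * (1.65 - 0.1625 * q - q ^ 2 / 128)).
  { destruct (Rle_dec q 1) as [Hc | Hc].
    - eapply Rle_trans; [apply RInt_Lq_small; assumption |]. destruct (sqrt_spec q ltac:(nra)) as [Hr0 Hrq]. set (r := sqrt q) in *.
      assert (Hr1 : r <= 1) by nra. replace (a / r) with (a / q * r) by (rewrite <- Hrq; field; lra). rewrite Rmult_assoc.
      apply Rmult_le_compat_l; [apply Rdiv_le_0_compat; nra |]. nra.
    - eapply Rle_trans; [apply RInt_Lq_mid; lra |]. apply Rmult_le_compat_l; [apply Rdiv_le_0_compat; nra |]. nra. }
  assert (E : 1.65 * (a / q - a / 4) + a * (/ 4 - q / 128) = a / q * (1.65 - 0.1625 * q - q ^ 2 / 128)).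
  { replace 1.65 with (33 / 20) by lra. replace 0.1625 with (13 / 80) by lra. field. nra. }
  lra.
Qed.

(** As q approaches 4 the two logarithms cancel, so separate bounds would be too weak; the
    difference itself is convex in a and again worst for a real zero. *)
Lemma Lq12_slope (q s a a' : R) : 0 <= q -> q < 4 -> 0 <= s <= 1 -> 0 <= a <= a' -> a' ^ 2 <= q -> 0 < q + s ^ 2 - 2 * a' * s ->
  a' * (Lq a q s - Lq2 a q s) <= a * (Lq a' q s - Lq2 a' q s).
Proof.
  intros Hq0 Hq4 Hs Ha Ha' Hq. set (A := q + s ^ 2) in *. set (B := 4 + q * s ^ 2 / 4).
  assert (HAB : A <= B) by (assert (0 <= (4 - q) * (1 - s ^ 2 / 4)) by (apply Rmult_le_pos; nra); unfold A, B; nra).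
  apply (slope_le (fun a => Lq a q s - Lq2 a q s) (fun a => 2 * s * (B - A) * ((A * B + 4 * a ^ 2 * s ^ 2) / ((A ^ 2 - 4 * a ^ 2 * s ^ 2) * (B ^ 2 - 4 * a ^ 2 * s ^ 2))))); [lra | | |].
  - unfold Lq, Lq2. rewrite !Rmult_0_r, !Rmult_0_l, !Rplus_0_r, !Rminus_0_r. ring.
  - intros x Hx. assert (0 <= x * s <= a' * s) by nra. unfold Lq, Lq2. fold A B. auto_derive; [lra |].
    replace (A ^ 2 - 4 * x ^ 2 * s ^ 2) with ((A - 2 * x * s) * (A + 2 * x * s)) by ring.
    replace (B ^ 2 - 4 * x ^ 2 * s ^ 2) with ((B - 2 * x * s) * (B + 2 * x * s)) by ring.
    field. repeat split; lra.
  - intros x y Hx Hy. apply Rmult_le_compat_l; [nra |]. assert (Hxy : 0 <= x * s <= y * s) by nra. assert (y * s <= a' * s) by nra.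
    replace (4 * x ^ 2 * s ^ 2) with (4 * (x * s) ^ 2) by ring. replace (4 * y ^ 2 * s ^ 2) with (4 * (y * s) ^ 2) by ring.
    set (u := x * s) in *. set (v := y * s) in *. assert (Huv : u ^ 2 <= v ^ 2) by nra.
    assert (HA : 0 < A ^ 2 - 4 * v ^ 2) by nra.
    assert (HB : 0 < B ^ 2 - 4 * v ^ 2) by nra. apply Rmult_le_compat; [nra | left; apply Rinv_0_lt_compat; nra | nra |].
    apply Rinv_le_contravar; nra.
Qed.

Lemma log_slope_23 (u : R) : 0 < u <= 2 / 3 -> - ln (1 - u) <= 1.65 * u.
Proof.
  intro Hu. pose proof (slope_le (fun u => - ln (1 - u)) (fun u => / (1 - u)) u (2 / 3) ltac:(lra)) as S. cbv beta in S.
  rewrite Rminus_0_r, ln_1 in S. specialize (S ltac:(lra)).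
  assert (E : - ln (1 - 2 / 3) = ln 3) by (replace (1 - 2 / 3) with (/ 3) by lra; rewrite ln_Rinv by lra; ring). rewrite E in S.
  pose proof ln3_le. assert (2 / 3 * - ln (1 - u) <= u * ln 3); [| nra]. apply S.
  - intros x Hx. auto_derive; [lra |]. change (1 + - x) with (1 - x). lra.
  - intros x y Hx Hy. apply Rinv_le_contravar; lra.
Qed.

(** At a real zero the difference is hl(sX) - hl(sY) with X = 1/r, Y = r/4, and a/q - a/4 = a X (X -
    Y). The mean value theorem yields the same factor X - Y, and the remaining integral is -ln(1 -
    X^2) / X^2, at most (3/2) ln 3 because X^2 <= 2/3. *)
Lemma zero_lemma_large (a q : R) : 0 < a -> a ^ 2 < q -> 3 / 2 <= q < 4 ->
  RInt (Lq a q) 0 1 - RInt (Lq2 a q) 0 1 <= 1.65 * (a / q - a / 4).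
Proof.
  intros Ha Hq Hq1. destruct (sqrt_spec q ltac:(nra)) as [Hr0 Hrq]. set (r := sqrt q) in *.
  assert (Hr1 : 1.2 < r) by nra. assert (Har : a < r) by nra. assert (Hr2 : r < 2) by nra.
  assert (EM : RInt (fun s => minus (Lq a q s) (Lq2 a q s)) 0 1 = RInt (Lq a q) 0 1 - RInt (Lq2 a q) 0 1).
  { apply (RInt_minus (V := RV)); [apply ex_RInt_Lq | apply ex_RInt_Lq2]; lra. }
  rewrite <- EM.
  pose (X := / r). pose (Y := r / 4). assert (HrX : r * X = 1) by (unfold X; field; lra). assert (HX0 : 0 < X) by nra.
  assert (HX : X < 1) by nra. assert (HYX : Y < X) by (unfold Y; nra). assert (HqX : q * X ^ 2 = 1) by nra.
  assert (HX2 : X ^ 2 <= 2 / 3) by nra.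
  assert (HI : is_RInt (fun s => a * X * (X - Y) * (2 * s / (1 - s ^ 2 * X ^ 2))) 0 1 (a * X * (X - Y) * (- ln (1 - X ^ 2) / X ^ 2))).
  { apply (@is_RInt_scal RN (fun s => 2 * s / (1 - s ^ 2 * X ^ 2))). set (F := fun s => - ln (1 - s ^ 2 * X ^ 2) / X ^ 2).
    replace (- ln (1 - X ^ 2) / X ^ 2) with (minus (F 1) (F 0)).
    2:{ unfold F; rsc. replace (1 - 0 * (0 * 1) * (X * (X * 1))) with 1 by ring. rewrite ln_1. replace (1 - 1 * (1 * 1) * (X * (X * 1))) with (1 - X * (X * 1)) by ring. lra. }
    apply (@is_RInt_derive RV F); rewrite Rmin_left, Rmax_right by lra; intros s Hs; assert (0 < 1 - s ^ 2 * X ^ 2) by nra.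
    - unfold F. auto_derive; [nra |]. field. nra.
    - cts_derive. nra. }
  apply Rle_trans with (a * X * (X - Y) * (- ln (1 - X ^ 2) / X ^ 2)).
  - rewrite <- (is_RInt_unique _ _ _ _ HI). apply RInt_le; [lra | apply (@ex_RInt_minus RV); [apply ex_RInt_Lq; exact Hq | apply ex_RInt_Lq2; lra] | eexists; exact HI |].
    intros s Hs. change (minus (Lq a q s) (Lq2 a q s)) with (Lq a q s - Lq2 a q s).
    pose proof (Lq12_slope q s a r ltac:(lra) ltac:(lra) ltac:(lra) ltac:(lra) ltac:(lra) ltac:(nra)) as S.
    assert (E1 : Lq r q s = hl (s * X)) by (rewrite <- Hrq, Lq_diag by lra; reflexivity).
    assert (E2 : Lq2 r q s = hl (s * Y)).
    { unfold Lq2, hl. rewrite <- Hrq. unfold Y.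
      replace (4 + r ^ 2 * s ^ 2 / 4 + 2 * r * s) with ((2 * (1 + s * (r / 4))) * (2 * (1 + s * (r / 4)))) by field.
      replace (4 + r ^ 2 * s ^ 2 / 4 - 2 * r * s) with ((2 * (1 - s * (r / 4))) * (2 * (1 - s * (r / 4)))) by field.
      rewrite !ln_mult by nra. field. }
    rewrite E1, E2 in S. assert (HY0 : 0 < Y) by (unfold Y; lra).
    pose proof (hl_diff (s * X) (s * Y) ltac:(nra) ltac:(nra)) as Dh.
    apply Rmult_le_reg_l with r; [lra |].
    replace (r * (a * X * (X - Y) * (2 * s / (1 - s ^ 2 * X ^ 2)))) with (a * (2 / (1 - (s * X) ^ 2) * (s * X - s * Y))).
    + nra.
    + transitivity (a * (r * X) * (X - Y) * (2 * s / (1 - s ^ 2 * X ^ 2))); [rewrite HrX; field; nra | lra].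
  - pose proof (log_slope_23 (X ^ 2) ltac:(nra)) as LS.
    replace (1.65 * (a / q - a / 4)) with (a * X * (X - Y) * 1.65).
    2:{ unfold X, Y. rewrite <- Hrq. field. lra. }
    apply Rmult_le_compat_l; [apply Rmult_le_pos; nra |]. apply Rle_div_l; nra.
Qed.

Lemma zero_lemma (a q : R) : 0 < a -> a ^ 2 < q -> q < 4 ->
  RInt (fun s => Lq a q s - Lq2 a q s - 3.3 * s * (a / q - a / 4)) 0 1 <= 0.
Proof.
  intros Ha Hq Hq4.
  assert (HI : is_RInt (fun s => Lq a q s - Lq2 a q s - 3.3 * s * (a / q - a / 4)) 0 1 (RInt (Lq a q) 0 1 - RInt (Lq2 a q) 0 1 - 1.65 * (a / q - a / 4))).
  { apply (is_RInt_minus (fun s => Lq a q s - Lq2 a q s) (fun s => 3.3 * s * (a / q - a / 4))).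
    - apply (is_RInt_minus (Lq a q) (Lq2 a q)); apply (RInt_correct (V := RV)); [apply ex_RInt_Lq; lra | apply ex_RInt_Lq2; lra].
    - set (F := fun s => 1.65 * s ^ 2 * (a / q - a / 4)). replace (1.65 * (a / q - a / 4)) with (minus (F 1) (F 0)) by (unfold F; rsc; ring).
      apply (@is_RInt_derive RV F).
      + intros s _. unfold F. auto_derive; lra.
      + intros s _. cts_derive. }
  rewrite (is_RInt_unique _ _ _ _ HI).
  destruct (Rle_dec q (3 / 2)) as [Hc | Hc]; [pose proof (zero_lemma_small a q Ha Hq Hc) | pose proof (zero_lemma_large a q Ha Hq ltac:(lra))]; lra.
Qed.

(** * A Turing-type inequality on a disc *)

Lemma ln_Cmod (z : C) : z <> 0%C -> ln (Cmod z) = / 2 * ln (Re z ^ 2 + Im z ^ 2).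
Proof.
  intro Hz. assert (H : 0 < Cmod z) by (apply Cmod_gt_0; exact Hz).
  assert (E : Re z ^ 2 + Im z ^ 2 = Cmod z * Cmod z).
  { unfold Cmod. rewrite sqrt_sqrt; [reflexivity | nra]. }
  rewrite E, ln_mult by assumption. field.
Qed.

(** The odd Poisson identity for ln |f| on |z| = 2 with kappa = 1.65, up to a deficit Z caused by
    the zeros of f inside the circle. Deficits add when functions are multiplied. *)
Definition DF (f : C -> C) (l : C) (s Z : R) : Prop :=
  is_RInt (fun t => ln (Cmod (f (circ 0%C 2 t))) * oddker 2 1.65 s t) 0 (2 * PI)
    (2 * PI * (ln (Cmod (f (RtoC s))) - ln (Cmod (f (- RtoC s)%C)) - 3.3 * s * Re (l / f 0%C)%C - Z)).

Lemma Cmod_sub0 (z : C) : Cmod (z - 0)%C = Cmod z.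
Proof. f_equal. ring. Qed.

Lemma Cmod_circ0 (t : R) : Cmod (circ 0%C 2 t) = 2.
Proof. rewrite <- Cmod_sub0. apply Cmod_circ. lra. Qed.

Lemma DF_free (g : C -> C) (l : C) (R0 s : R) : 2 < R0 -> holo g 0%C R0 -> (forall z, Cmod z < R0 -> g z <> 0%C) -> Cd g 0%C l -> Rabs s < 2 -> DF g l s 0.
Proof.
  intros HR Hg Hnz Hl Hs. destruct (holo_log g 0%C R0 ltac:(lra) Hg) as [H [HH E]].
  { intros z Hz. apply Hnz. rewrite Cmod_sub0 in Hz. exact Hz. }
  assert (H0 : Cmod (0 - 0)%C < R0) by (rewrite Cmod_sub0, Cmod_0; lra).
  destruct (HH 0%C H0) as [m Hm].
  assert (El : l = (Cexp (H 0%C) * m)%C).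
  { apply (Cd_unique g 0%C); [pos |]. apply (Cd_ext_loc (fun w => Cexp (H w))).
    - exists R0. split; [lra |]. intros w Hw. symmetry. apply E, Hw.
    - apply (Cd_comp H Cexp 0%C m _ Hm (Cd_Cexp _)). }
  assert (Eln : forall z, Cmod z < R0 -> ln (Cmod (g z)) = Re (H z)).
  { intros z Hz. rewrite E by (rewrite Cmod_sub0; exact Hz). rewrite Cmod_Cexp. apply ln_exp. }
  pose proof (odd_functional H 0%C m R0 2 1.65 s HH ltac:(lra) Hm Hs) as K. unfold DF.
  assert (Ed : (l / g 0%C = m)%C).
  { rewrite El, (E 0%C H0). pose proof (Cexp_neq0 (H 0%C)). field. assumption. }
  rewrite Ed, !Eln by (try rewrite Cmod_opp; rewrite Cmod_R; lra).
  replace (0 + RtoC s)%C with (RtoC s) in K by ring. replace (0 - RtoC s)%C with (- RtoC s)%C in K by ring.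
  refine (is_RInt_eq _ _ _ _ _ _ K _ _); [lra |]. intros t _. rewrite Eln; [lra |]. rewrite Cmod_circ0. lra.
Qed.

Lemma DF_mult (f g : C -> C) (l m : C) (s Z W : R) :
  (forall t, f (circ 0%C 2 t) <> 0%C) -> (forall t, g (circ 0%C 2 t) <> 0%C) ->
  f 0%C <> 0%C -> g 0%C <> 0%C -> f (RtoC s) <> 0%C -> g (RtoC s) <> 0%C -> f (- RtoC s)%C <> 0%C -> g (- RtoC s)%C <> 0%C ->
  DF f l s Z -> DF g m s W -> DF (fun z => f z * g z)%C (l * g 0%C + f 0%C * m)%C s (Z + W).
Proof.
  intros Hf Hg Hf0 Hg0 Hfs Hgs Hfm Hgm DFf DFg. unfold DF in *.
  pose proof (@is_RInt_plus RN _ _ _ _ _ _ DFf DFg) as K.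
  assert (L : forall a b : C, a <> 0%C -> b <> 0%C -> ln (Cmod (a * b)%C) = ln (Cmod a) + ln (Cmod b)).
  { intros a b Ha Hb. rewrite Cmod_mult, ln_mult by (apply Cmod_gt_0; assumption). reflexivity. }
  rewrite !L by assumption.
  replace ((l * g 0 + f 0 * m) / (f 0 * g 0))%C with (l / f 0 + m / g 0)%C by (field; split; assumption).
  refine (is_RInt_eq _ _ _ _ _ _ K _ _); [rsc; unfold Re; simpl; ring |]. intros t _. rewrite L by auto. rsc. ring.
Qed.

Definition Zf (rho : C) (s : R) : R :=
  let a := - Re rho in let q := Re rho ^ 2 + Im rho ^ 2 in Lq a q s - Lq2 a q s - 3.3 * s * (a / q - a / 4).

Lemma Cmod_lt_sq (z : C) (r : R) : 0 <= r -> Cmod z < r -> Re z ^ 2 + Im z ^ 2 < r ^ 2.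
Proof. pose proof (Cmod_ge_0 z). assert (E : Re z ^ 2 + Im z ^ 2 = Cmod z ^ 2).
  { unfold Cmod. rewrite pow2_sqrt; [reflexivity | nra]. } nra.
Qed.

(** On the circle z - rho may be replaced by the reflected factor b, which has no zero in the closed
    disc. [DF_free] applies to b, and the deficit is the difference of the two functionals at 0, s
    and -s. *)
Lemma DF_factor_in (rho : C) (s : R) : Re rho < 0 -> Im rho <> 0 -> Cmod rho < 2 -> 0 <= s <= 1 -> DF (fun z => z - rho)%C 1%C s (Zf rho s).
Proof.
  intros Hre Him Hm Hs. set (k := (Cconj rho * RtoC (/ 2))%C). set (b := fun z => (RtoC 2 + (- k) * z)%C).
  assert (Hrho : 0 < Cmod rho) by (apply Cmod_gt_0; intro E; apply Him; rewrite E; reflexivity).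
  assert (Hk : Cmod k = Cmod rho / 2) by (unfold k; rewrite Cmod_mult, Cmod_R, Cmod_conj, Rabs_pos_eq by lra; reflexivity).
  assert (Hb : forall z, Cd b z (- k)%C) by (intro z; apply Cd_poly1).
  set (R0 := 4 / Cmod rho). assert (HR0 : 2 < R0) by (unfold R0; apply Rmult_lt_reg_r with (Cmod rho); [lra |]; field_simplify; lra).
  assert (Hbn : forall z, Cmod z < R0 -> b z <> 0%C).
  { intros z Hz. apply Cmod_gt_0. pose proof (Cmod_ge_minus (RtoC 2) (k * z)%C) as K. rewrite Cmod_mult, Hk, Cmod_R, Rabs_pos_eq in K by lra.
    replace (b z) with (RtoC 2 - k * z)%C by (unfold b; ring).
    assert (Cmod rho / 2 * Cmod z < Cmod rho / 2 * R0) by nra.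
    assert (Cmod rho / 2 * R0 = 2) by (unfold R0; field; lra). lra. }
  pose proof (DF_free b (- k)%C R0 s HR0 (fun z _ => ex_intro _ _ (Hb z)) Hbn (Hb 0%C) ltac:(rewrite Rabs_pos_eq; lra)) as D. destruct rho as [u v]. simpl in Hre, Him.
  assert (Hcirc : forall t, Cmod (b (circ 0%C 2 t)) = Cmod (circ 0%C 2 t - (u, v))%C).
  { intro t. unfold b, k, circ, cis, Cmod, Cconj, Cmult, Cplus, Cminus, Copp, RtoC; simpl. f_equal.
    generalize (sin2_cos2 t). unfold Rsqr. nra. }
  refine (is_RInt_eq _ _ _ _ _ _ D _ _); [| intros t _; rewrite Hcirc; reflexivity].
  - unfold Zf. change (Re (u, v)) with u. change (Im (u, v)) with v. set (q := u ^ 2 + v ^ 2).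
    assert (Hnz : forall x y : R, y <> 0 -> ((x, y) : C) <> 0%C) by (intros x y Hy E; apply Hy; injection E; auto).
    assert (E1 : ln (Cmod (RtoC s - (u, v))%C) = / 2 * ln (q + s ^ 2 + 2 * (- u) * s)).
    { rewrite ln_Cmod by (apply Hnz; simpl; lra). f_equal. f_equal. unfold q; simpl. ring. }
    assert (E2 : ln (Cmod (- RtoC s - (u, v))%C) = / 2 * ln (q + s ^ 2 - 2 * (- u) * s)).
    { rewrite ln_Cmod by (apply Hnz; simpl; lra). f_equal. f_equal. unfold q; simpl. ring. }
    assert (E3 : ln (Cmod (b (RtoC s))) = / 2 * ln (4 + q * s ^ 2 / 4 + 2 * (- u) * s)).
    { rewrite ln_Cmod by (apply Hbn; rewrite Cmod_R, Rabs_pos_eq; lra). f_equal. f_equal. unfold b, k, q; simpl. field. }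
    assert (E4 : ln (Cmod (b (- RtoC s)%C)) = / 2 * ln (4 + q * s ^ 2 / 4 - 2 * (- u) * s)).
    { rewrite ln_Cmod by (apply Hbn; rewrite Cmod_opp, Cmod_R, Rabs_pos_eq; lra). f_equal. f_equal. unfold b, k, q; simpl. field. }
    assert (E5 : Re (- k / b 0%C)%C = - u / 4).
    { unfold k, Cconj, Cdiv, Cinv, Cmult, Copp, RtoC, Re; simpl. field. }
    assert (E6 : Re (1 / (0 - (u, v)))%C = - u / q).
    { unfold Cdiv, Cinv, Cmult, Copp, Cminus, Cplus, RtoC, Re, q; simpl. field. nra. }
    rewrite E1, E2, E3, E4, E5, E6. unfold Lq, Lq2. lra.
Qed.

Lemma DF_factor_out (rho : C) (s : R) : 2 < Cmod rho -> 0 <= s <= 1 -> DF (fun z => z - rho)%C 1%C s 0.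
Proof.
  intros Hm Hs. apply (DF_free _ _ (Cmod rho)); [lra | | | apply Cd_shift | rewrite Rabs_pos_eq; lra].
  - eexists. apply Cd_shift.
  - intros z Hz. apply Csub_neq0. intros ->. lra.
Qed.

Definition Zf2 (rho : C) (s : R) : R := if Rlt_dec (Cmod rho) 2 then Zf rho s else 0.

Definition ZL (l : list C) (s : R) : R := fold_right (fun rho acc => Zf2 rho s + acc) 0 l.

(** The centre is moved to 0. Zeros lie to its left because zeta has none right of abscissa 1; the
    other conditions keep the real diameter and the circle free. *)
Definition okzero (rho : C) : Prop := Re rho < 0 /\ Im rho <> 0 /\ Cmod rho <> 2.

Lemma okzero_circ (rho : C) (t : R) : okzero rho -> (circ 0%C 2 t - rho)%C <> 0%C.
Proof. intros [_ [_ H]]. apply Csub_neq0. intro E. apply H. rewrite <- E. apply Cmod_circ0. Qed.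

Lemma okzero_real (rho : C) (x : C) : okzero rho -> Im x = 0 -> (x - rho)%C <> 0%C.
Proof. intros [_ [H _]] Hx. apply Csub_neq0. intro E. apply H. rewrite <- E. exact Hx. Qed.

Lemma prodl_neq0 (l : list C) (w : C) : (forall rho, In rho l -> (w - rho)%C <> 0%C) -> prodl l w <> 0%C.
Proof.
  induction l as [| rho l IH]; intro H; simpl.
  - intro E. injection E. lra.
  - apply Cmult_neq_0; [apply H; left; reflexivity | apply IH; intros; apply H; right; assumption].
Qed.

Lemma DF_prodl (l : list C) (s : R) : (forall rho, In rho l -> okzero rho) -> 0 <= s <= 1 ->
  exists m, Cd (prodl l) 0%C m /\ DF (prodl l) m s (ZL l s).
Proof.
  intros H Hs. induction l as [| rho l IH].
  - exists 0%C. split; [apply Cd_const |]. apply (DF_free _ _ 3); [lra | intros z _; eexists; apply Cd_const | | apply Cd_const | rewrite Rabs_pos_eq; lra].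
    intros z _ E. injection E. lra.
  - destruct IH as [m [Hm Dm]]; [intros; apply H; right; assumption |].
    assert (Hr : okzero rho) by (apply H; left; reflexivity).
    assert (Hl : forall r, In r l -> okzero r) by (intros; apply H; right; assumption).
    eexists. split; [exact (Cd_mult (fun w => w - rho)%C (prodl l) 0%C 1%C m (Cd_shift rho 0%C) Hm) |].
    apply (DF_mult (fun w => w - rho)%C (prodl l) 1%C m s (Zf2 rho s) (ZL l s));
      try (apply okzero_real; [pos | simpl; ring]); try (apply prodl_neq0; intros r Hin; apply okzero_real; [apply Hl; exact Hin | simpl; ring]); try exact Dm.
    + intro t. apply okzero_circ, Hr.
    + intro t. apply prodl_neq0. intros r Hin. apply okzero_circ, Hl, Hin.
    + unfold Zf2. destruct Hr as [R1 [R2 R3]]. destruct (Rlt_dec (Cmod rho) 2) as [Hc | Hc].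
      * apply DF_factor_in; assumption.
      * apply DF_factor_out; lra.
Qed.

Lemma ex_RInt_Zf2 (rho : C) : okzero rho -> ex_RInt (Zf2 rho) 0 1 /\ RInt (Zf2 rho) 0 1 <= 0.
Proof.
  intros [H1 [H2 H3]]. unfold Zf2. destruct (Rlt_dec (Cmod rho) 2) as [Hc | Hc].
  - pose proof (Cmod_lt_sq rho 2 ltac:(lra) Hc) as Hq. set (q := Re rho ^ 2 + Im rho ^ 2) in *. split.
    + apply (@ex_RInt_minus RV (fun s => Lq (- Re rho) q s - Lq2 (- Re rho) q s) (fun s => 3.3 * s * (- Re rho / q - - Re rho / 4))).
      * apply (@ex_RInt_minus RV); [apply ex_RInt_Lq | apply ex_RInt_Lq2]; unfold q in *; lra || nra.
      * apply cts_RInt. intros s _. cts_derive.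
    + apply zero_lemma; [lra | nra | unfold q in *; lra].
  - split; [apply ex_RInt_const |]. rewrite RInt_const. rsc. lra.
Qed.

Lemma ex_RInt_ZL (l : list C) : (forall rho, In rho l -> okzero rho) -> ex_RInt (ZL l) 0 1 /\ RInt (ZL l) 0 1 <= 0.
Proof.
  induction l as [| rho l IH]; intro H.
  - unfold ZL; simpl. split; [apply ex_RInt_const |]. rewrite RInt_const. rsc. lra.
  - destruct (ex_RInt_Zf2 rho) as [E1 E2]; [apply H; left; reflexivity |].
    destruct IH as [F1 F2]; [intros; apply H; right; assumption |]. split.
    + apply (@ex_RInt_plus RV (Zf2 rho) (ZL l)); assumption.
    + assert (E : RInt (ZL (rho :: l)) 0 1 = RInt (Zf2 rho) 0 1 + RInt (ZL l) 0 1) by (apply (RInt_plus (V := RV) (Zf2 rho) (ZL l)); assumption). lra.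
Qed.

(** * Symmetry, positivity and moments of the kernel *)

Lemma oddker_period (s t : R) : oddker 2 1.65 s (t + 2 * PI) = oddker 2 1.65 s t.
Proof.
  unfold oddker, poisson. replace (cos (t + 2 * PI)) with (cos t) by (rewrite cos_plus, cos_2PI, sin_2PI; ring). reflexivity.
Qed.

Lemma oddker_refl (s t : R) : oddker 2 1.65 s (PI - t) = - oddker 2 1.65 s t.
Proof.
  unfold oddker, poisson. replace (cos (PI - t)) with (- cos t) by (rewrite Rtrigo_facts.cos_pi_minus; reflexivity).
  replace (2 ^ 2 - 2 * 2 * s * - cos t + s ^ 2) with (2 ^ 2 - 2 * 2 * - s * cos t + (- s) ^ 2) by ring.
  replace (2 ^ 2 - 2 * 2 * - s * - cos t + (- s) ^ 2) with (2 ^ 2 - 2 * 2 * s * cos t + s ^ 2) by ring.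
  lra.
Qed.

Lemma continuous_oddker (s t : R) : 0 <= s <= 1 -> continuous (oddker 2 1.65 s) t.
Proof.
  intro Hs. apply derive_cts. unfold oddker, poisson.
  pose proof (poisson_den 2 s t ltac:(rewrite Rabs_pos_eq; lra)) as D1. pose proof (poisson_den 2 (- s) t ltac:(rewrite Rabs_Ropp, Rabs_pos_eq; lra)) as D2.
  auto_derive. repeat split; simpl in *; lra.
Qed.

(** The kernel is odd under t -> PI - t, so the circle folds onto its left half and only differences
    between a left point and its mirror image count. *)
Lemma symm_int (u : R -> R) (s V : R) : 0 <= s <= 1 -> (forall t, continuous u t) -> (forall t, u (t + 2 * PI) = u t) ->
  is_RInt (fun t => u t * oddker 2 1.65 s t) 0 (2 * PI) V ->
  is_RInt (fun t => (u t - u (PI - t)) * oddker 2 1.65 s t) (PI / 2) (3 * (PI / 2)) V.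
Proof.
  intros Hs Hc Hp HI. set (h := fun t => u t * oddker 2 1.65 s t).
  assert (Hh : forall t, continuous h t) by (intro t; apply (continuous_mult u (oddker 2 1.65 s)); [apply Hc | apply continuous_oddker; exact Hs]).
  assert (He : forall a b, ex_RInt h a b) by (intros; apply cts_RInt; intros; apply Hh).
  assert (Hhp : forall t, h (t + 2 * PI) = h t) by (intro t; unfold h; rewrite Hp, oddker_period; reflexivity).
  set (h' := fun t => h (PI - t)).
  assert (Hh' : forall t, continuous h' t).
  { intro t. apply (continuous_comp (fun t => PI - t) h); [cts_derive | apply Hh]. }
  assert (He' : forall a b, ex_RInt h' a b) by (intros; apply cts_RInt; intros; apply Hh').
  assert (E1 : RInt h (3 * (PI / 2)) (2 * PI) = RInt h (- (PI / 2)) 0).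
  { pose proof (RInt_comp_lin (V := RV) h 1 (2 * PI) (- (PI / 2)) 0 (He _ _)) as K.
    replace (1 * - (PI / 2) + 2 * PI) with (3 * (PI / 2)) in K by field. replace (1 * 0 + 2 * PI) with (2 * PI) in K by ring. rewrite <- K.
    apply RInt_ext. intros t _. rewrite !Rmult_1_l. apply Hhp. }
  assert (E2 : RInt h (- (PI / 2)) (PI / 2) = RInt h' (PI / 2) (3 * (PI / 2))).
  { pose proof (RInt_comp_lin (V := RV) h (-1) PI (3 * (PI / 2)) (PI / 2) (He _ _)) as K.
    replace (-1 * (3 * (PI / 2)) + PI) with (- (PI / 2)) in K by field. replace (-1 * (PI / 2) + PI) with (PI / 2) in K by field. rewrite <- K.
    pose proof (opp_RInt_swap (V := RV) h' _ _ (He' (3 * (PI / 2)) (PI / 2))) as Ko. rewrite <- Ko.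
    assert (E : RInt (fun y => scal (-1) (h (-1 * y + PI))) (3 * (PI / 2)) (PI / 2) = RInt (fun y => opp (h' y)) (3 * (PI / 2)) (PI / 2)).
    { apply RInt_ext. intros t _. unfold h', scal, opp; simpl; unfold mult; simpl. replace (PI - t) with (-1 * t + PI) by ring. ring. }
    exact (eq_trans E (RInt_opp (V := RV) h' _ _ (He' _ _))). }
  assert (EV : V = RInt (fun t => plus (h t) (h' t)) (PI / 2) (3 * (PI / 2))).
  { rewrite (RInt_plus (V := RV)) by auto. rewrite <- E2.
    rewrite <- (is_RInt_unique _ _ _ _ HI). change (fun t => u t * oddker 2 1.65 s t) with h.
    rewrite <- (RInt_Chasles (V := RV) h 0 (3 * (PI / 2)) (2 * PI)) by auto. rewrite E1.
    rewrite <- (RInt_Chasles (V := RV) h (- (PI / 2)) 0 (PI / 2)) by auto.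
    rewrite <- (RInt_Chasles (V := RV) h 0 (PI / 2) (3 * (PI / 2))) by auto.
    rsc. ring. }
  rewrite EV. apply (is_RInt_ext (fun t => plus (h t) (h' t))).
  - intros t _. unfold h', h, plus; simpl. rewrite oddker_refl. ring.
  - apply (RInt_correct (V := RV)). apply (@ex_RInt_plus RV); auto.
Qed.

Lemma oddker_eq (s t : R) : 0 <= s <= 1 -> oddker 2 1.65 s t = 8 * s * cos t * (4 - s ^ 2) / ((4 + s ^ 2) ^ 2 - 16 * s ^ 2 * cos t ^ 2) - 3.3 * s * cos t.
Proof.
  intro Hs. unfold oddker, poisson.
  pose proof (poisson_den 2 s t ltac:(rewrite Rabs_pos_eq; lra)) as D1. pose proof (poisson_den 2 (- s) t ltac:(rewrite Rabs_Ropp, Rabs_pos_eq; lra)) as D2.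
  replace ((4 + s ^ 2) ^ 2 - 16 * s ^ 2 * cos t ^ 2) with ((2 ^ 2 - 2 * 2 * s * cos t + s ^ 2) * (2 ^ 2 - 2 * 2 * - s * cos t + (- s) ^ 2)) by ring.
  replace (4 * 1.65 * s / 2 * cos t) with (3.3 * s * cos t) by lra. field. split; lra.
Qed.

Lemma oddker_den (s t : R) : 0 <= s <= 1 -> 9 <= (4 + s ^ 2) ^ 2 - 16 * s ^ 2 * cos t ^ 2.
Proof.
  intro Hs. pose proof (COS_bound t). assert (cos t ^ 2 <= 1) by nra. assert (0 <= s ^ 2 <= 1) by nra. nra.
Qed.

(** The kernel is s cos t times 8 (4 - s^2) / den - 3.3, and den >= (4 - s^2)^2 makes the first part
    at most 8/3. *)
Lemma oddker_left (s t : R) : 0 <= s <= 1 -> cos t <= 0 -> 0 <= oddker 2 1.65 s t.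
Proof.
  intros Hs Hc. rewrite oddker_eq by exact Hs. pose proof (oddker_den s t Hs) as D. pose proof (COS_bound t).
  assert (K : (4 - s ^ 2) / ((4 + s ^ 2) ^ 2 - 16 * s ^ 2 * cos t ^ 2) <= / 3).
  { apply Rle_div_l; [lra |]. assert (cos t ^ 2 <= 1) by nra. nra. }
  assert (0 <= 8 * s * - cos t) by nra.
  nra.
Qed.

Lemma oddker_mass (s : R) : 0 <= s <= 1 ->
  is_RInt (oddker 2 1.65 s) (PI / 2) (3 * (PI / 2)) (2 * (3.3 * s - 2 * atan (4 * s / (4 - s ^ 2)))).
Proof.
  intro Hs. set (c := 4 * s / (4 - s ^ 2)). set (F := fun t => 2 * atan (c * sin t) - 3.3 * s * sin t).
  replace (2 * (3.3 * s - 2 * atan c)) with (minus (F (3 * (PI / 2))) (F (PI / 2))).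
  2:{ unfold F; rsc. rewrite sin_3PI2, sin_PI2. rewrite Rmult_1_r. replace (c * -1) with (- c) by ring. rewrite atan_opp. ring. }
  apply (@is_RInt_derive RV F).
  - intros t _. rewrite oddker_eq by exact Hs.
    unfold F. auto_derive; [lra |].
    generalize (sin2_cos2 t). unfold Rsqr. intro E.
    assert (E' : (4 + s ^ 2) ^ 2 - 16 * s ^ 2 * cos t ^ 2 = (4 - s ^ 2) ^ 2 + 16 * s ^ 2 * sin t ^ 2) by nra.
    rewrite E' in *. unfold c in *. field. repeat split; nra.
  - intros t _. apply continuous_oddker. exact Hs.
Qed.

Lemma atan_kernel_ge (s : R) : 0 <= s <= 1 -> 2 * s - s ^ 3 / 6 <= 2 * atan (4 * s / (4 - s ^ 2)).
Proof.
  intro Hs.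
  pose proof (MVT_ge (fun s => 2 * atan (4 * s / (4 - s ^ 2)) - (2 * s - s ^ 3 / 6)) (fun s => 8 / (4 + s ^ 2) - (2 - s ^ 2 / 2)) 0 s 0 ltac:(lra)) as M.
  cbv beta in M. replace (4 * 0 / (4 - 0 ^ 2)) with 0 in M by field. rewrite atan_0 in M.
  assert (0 * (s - 0) <= 2 * atan (4 * s / (4 - s ^ 2)) - (2 * s - s ^ 3 / 6) - (2 * 0 - (2 * 0 - 0 ^ 3 / 6))); [apply M | lra].
  - intros x Hx. auto_derive; [nra |]. field. repeat split; nra.
  - intros x Hx. assert (0 < 4 + x ^ 2) by nra. replace (8 / (4 + x ^ 2) - (2 - x ^ 2 / 2)) with (x ^ 4 / 2 / (4 + x ^ 2)) by (field; nra).
    pos.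
Qed.

Lemma PI_ge_314 : 3.14 <= PI.
Proof. pose proof (proj1 (PI_2_3_7_ineq 1)) as H. unfold PI_2_3_7_tg, tg_alt, Ratan_seq in H. simpl in H. lra. Qed.

Lemma PI_le_32 : PI <= 3.2.
Proof. pose proof (proj2 (PI_2_3_7_ineq 1)) as H. unfold PI_2_3_7_tg, tg_alt, Ratan_seq in H. simpl in H. lra. Qed.

(** Odd polynomials in cos t are boundary values of holomorphic polynomials, so [odd_functional]
    integrates them exactly: by cos 3t = 4 cos^3 t - 3 cos t the cubic H has real part b1 cos t + b3
    cos^3 t on |w| = 2. *)
Lemma symm_cube (s b1 b3 : R) : 0 <= s <= 1 -> is_RInt (fun t => (b1 * - cos t + b3 * (- cos t) ^ 3) * oddker 2 1.65 s t) (PI / 2) (3 * (PI / 2))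
  (2 * PI * (0.325 * b1 * s + b3 * (0.24375 * s - s ^ 3 / 32))).
Proof.
  intro Hs. set (k := 3 / 8 * b3 + b1 / 2). set (H := fun w => (RtoC (b3 / 32) * (w * w * w) + RtoC k * w)%C).
  assert (HdH : forall z, Cd H z (RtoC (b3 / 32) * ((1 * z + z * 1) * z + z * z * 1) + RtoC k * 1)%C).
  { intro z. apply (Cd_plus (fun w => RtoC (b3 / 32) * (w * w * w))%C (fun w => RtoC k * w)%C); apply Cd_scal; [| apply Cd_id].
    apply (Cd_mult (fun w => w * w)%C (fun w => w)); [apply (Cd_mult (fun w => w) (fun w => w)) |]; apply Cd_id. }
  assert (K := odd_functional H 0%C _ 3 2 1.65 s (fun z _ => ex_intro _ _ (HdH z)) ltac:(lra) (HdH 0%C) ltac:(rewrite Rabs_pos_eq; lra)).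
  assert (K1 : is_RInt (fun t => (b1 * cos t + b3 * cos t ^ 3) * oddker 2 1.65 s t) 0 (2 * PI) (2 * PI * (b3 * s ^ 3 / 16 - 1.3 * s * k))).
  { refine (is_RInt_eq _ _ _ _ _ _ K _ _); [unfold H; simpl; lra |]. intros t _. unfold H, k, circ, cis; simpl. generalize (sin2_cos2 t). unfold Rsqr. intro E.
    assert (E' : sin t * sin t = 1 - cos t * cos t) by lra. field_simplify. replace (sin t ^ 2) with (1 - cos t * cos t) by lra. field. }
  apply (symm_int (fun t => b1 * cos t + b3 * cos t ^ 3) s _ Hs) in K1; [| intro t; cts_derive | intro t; rewrite cos_plus, cos_2PI, sin_2PI; simpl; ring].
  (* Folding doubled an odd function, and the statement is in powers of - cos t: hence the factor
     -1/2. *)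
  refine (is_RInt_eq _ _ _ _ _ _ (@is_RInt_scal RN _ _ _ (- / 2) _ K1) _ _); [rsc; unfold k; lra |]. intros t _. rsc. rewrite Rtrigo_facts.cos_pi_minus. field.
Qed.

Lemma is_RInt_id_poly (a b : R) : is_RInt (fun s => a * s + b * s ^ 3) 0 1 (a / 2 + b / 4).
Proof.
  set (F := fun s => a * s ^ 2 / 2 + b * s ^ 4 / 4). replace (a / 2 + b / 4) with (minus (F 1) (F 0)) by (unfold F; rsc; field).
  apply (@is_RInt_derive RV F).
  - intros s _. unfold F. auto_derive; lra.
  - intros s _. cts_derive.
Qed.

Lemma continuous_Cmod (g : R -> C) (t : R) : Cont g t -> continuous (fun t => Cmod (g t)) t.
Proof.
  intro Hc. apply filterlim_locally. intro e. pose proof (cond_pos e).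
  destruct (continuous_C_eps_inv g t Hc (e / 2) ltac:(lra)) as [d [Hd Hdd]].
  exists (mkposreal d Hd). intros y Hy. change (Rabs (Cmod (g y) - Cmod (g t)) < e).
  pose proof (Hdd y Hy) as K. pose proof (Cmod_ge_minus (g y) (g t)). pose proof (Cmod_ge_minus (g t) (g y)) as K2. rewrite Cmod_minus_sym in K2.
  apply Rabs_def1; lra.
Qed.

Lemma ln_Cmod_cts (g : R -> C) (t : R) : Cont g t -> g t <> 0%C -> continuous (fun t => ln (Cmod (g t))) t.
Proof.
  intros Hc Hn. apply (continuous_comp (fun t => Cmod (g t)) ln).
  - apply continuous_Cmod, Hc.
  - apply derive_cts. exists (/ Cmod (g t)). apply is_derive_ln. apply Cmod_gt_0, Hn.
Qed.

Lemma circ_surj (z : C) (r : R) : 0 < r -> Cmod z = r -> exists t, z = circ 0%C r t.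
Proof.
  intros Hr Hz. destruct (Cexp_surj z) as [a Ea]; [intro E; rewrite E, Cmod_0 in Hz; lra |]. exists (Im a). rewrite Cexp_cis in Ea.
  assert (H : exp (Re a) = r) by (rewrite <- Hz, <- Ea, Cmod_mult, Cmod_cis, Cmod_R, Rabs_pos_eq; [ring | left; apply exp_pos]). rewrite <- Ea, H. unfold circ. ring.
Qed.

(** * The inequality on a disc of radius 2 *)

Section Disc.
Variables (f : C -> C) (l : C) (b0 b1 b3 : R).
Hypothesis Hf : holo f 0%C 5.
Hypothesis Hright : forall z, Cmod z < 5 -> 0 <= Re z -> f z <> 0%C.
Hypothesis Hcirc : forall t, f (circ 0%C 2 t) <> 0%C.
Hypothesis Hreal : forall x, Rabs x <= 2.2 -> f (RtoC x) <> 0%C.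
Hypothesis Hl : Cd f 0%C l.
Hypothesis Hb0 : 0 <= b0.
Hypothesis Hb : forall x y, 0 <= x -> x ^ 2 + y ^ 2 = 4 ->
  ln (Cmod (f (- x, y))) - ln (Cmod (f (x, y))) <= b0 + b1 * (x / 2) + b3 * (x / 2) ^ 3.

Let T (s : R) : R := ln (Cmod (f (RtoC s))) - ln (Cmod (f (- RtoC s)%C)) - 3.3 * s * Re (l / f 0%C)%C.

Lemma disc_zeros : exists (lz : list C), (forall rho, In rho lz -> okzero rho) /\ forall s, 0 <= s <= 1 -> DF f l s (ZL lz s).
Proof.
  assert (Hf0 : f 0%C <> 0%C) by (apply Hright; [rewrite Cmod_0; lra | simpl; lra]).
  (* Zeros are split off a little beyond the circle, up to radius 2.2, so that the cofactor has a
     logarithm in a neighbourhood of the closed disc; [finite_zeros] asks for 2 times 2.2 < 4.5 <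
     5. *)
  destruct (finite_zeros f 0%C 5 2.2 4.5 Hf Hf0 ltac:(lra) ltac:(lra)) as [lz [g [Hg [E [Hz Hgn]]]]].
  exists lz.
  assert (Hok : forall rho, In rho lz -> okzero rho).
  { intros rho Hin. destruct (Hz rho Hin) as [Hm H0]. rewrite Cmod_sub0 in Hm. split; [| split].
    - apply Rnot_le_lt. intro Hc. apply (Hright rho); pos.
    - intro Him. apply (Hreal (Re rho)).
      + apply Rle_trans with (Cmod rho); [| lra]. eapply Rle_trans; [apply Rmax_l | apply Rmax_Cmod].
      + replace (RtoC (Re rho)) with rho; [pos |]. destruct rho as [u v]; simpl in *. rewrite Him. reflexivity.
    - intro Hm2. destruct (circ_surj rho 2 ltac:(lra) Hm2) as [t ->]. apply (Hcirc t), H0. }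
  split; [pos |]. intros s Hs.
  destruct (DF_prodl lz s Hok Hs) as [m [Hm Dm]].
  destruct (Hg 0%C) as [k Hk]; [rewrite Cmod_sub0, Cmod_0; lra |].
  assert (Hgn' : forall z, Cmod z < 2.2 -> g z <> 0%C) by (intros z Hz'; apply Hgn; rewrite Cmod_sub0; lra).
  assert (Dg : DF g k s 0).
  { apply (DF_free g k 2.2); [lra | | pos | exact Hk | rewrite Rabs_pos_eq; lra].
    intros z Hz'. apply Hg. lra. }
  assert (HD : DF (fun w => prodl lz w * g w)%C (m * g 0 + prodl lz 0 * k)%C s (ZL lz s + 0)).
  { assert (Hpr : forall w, Im w = 0 -> prodl lz w <> 0%C) by (intros w Hw; apply prodl_neq0; intros r Hr; apply okzero_real; [apply Hok; exact Hr | lra]).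
    apply DF_mult; try assumption; try (apply Hpr; simpl; ring); try (apply Hgn').
    - intro t. apply prodl_neq0. intros r Hr. apply okzero_circ, Hok, Hr.
    - intro t. apply Hgn'. rewrite Cmod_circ0. lra.
    - rewrite Cmod_0. lra.
    - rewrite Cmod_R, Rabs_pos_eq; lra.
    - rewrite Cmod_opp, Cmod_R, Rabs_pos_eq; lra. }
  assert (El : l = (m * g 0 + prodl lz 0 * k)%C).
  { apply (Cd_unique f 0%C); [pos |]. apply (Cd_ext (fun w => prodl lz w * g w)%C f 0%C (m * g 0%C + prodl lz 0%C * k)%C); [intro; symmetry; apply E | reflexivity |].
    apply Cd_mult; assumption. }
  rewrite <- El, Rplus_0_r in HD. unfold DF in *. rewrite <- !E in HD.
  revert HD. apply is_RInt_ext. intros t _. rewrite <- E. reflexivity.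
Qed.

Lemma circ_period (t : R) : circ 0%C 2 (t + 2 * PI) = circ 0%C 2 t.
Proof. unfold circ, cis. rewrite cos_plus, sin_plus, cos_2PI, sin_2PI. apply injective_projections; simpl; ring. Qed.

Lemma circ_point_left (t : R) : circ 0%C 2 t = (- (- (2 * cos t)), 2 * sin t).
Proof. apply injective_projections; simpl; ring.
Qed.

Lemma circ_point_right (t : R) : circ 0%C 2 (PI - t) = (- (2 * cos t), 2 * sin t).
Proof.
  unfold circ, cis, Cplus, Cmult, RtoC; simpl. rewrite Rtrigo_facts.cos_pi_minus, Rtrigo_facts.sin_pi_minus. apply injective_projections; simpl; ring.
Qed.

(** On the folded half circle the kernel is nonnegative, so the majorant [Hb] may be inserted; b0 is
    paired with the total mass, b1 and b3 with the exact moments of [symm_cube]. *)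
Lemma disc_pointwise (lz : list C) (s : R) : 0 <= s <= 1 -> DF f l s (ZL lz s) ->
  T s - ZL lz s <= (0.65 * 2 / PI * b0 + 0.325 * b1 + 0.24375 * b3) * s + (b0 / (6 * PI) - b3 / 32) * s ^ 3.
Proof.
  intros Hs D. pose proof PI_ge_314 as HPI.
  assert (Hu : forall t, continuous (fun t => ln (Cmod (f (circ 0%C 2 t)))) t).
  { intro t. apply (ln_Cmod_cts (fun t => f (circ 0%C 2 t))); [| apply Hcirc]. apply continuous_Ccts_comp; [| apply continuous_circ].
    apply (holo_cts f 0%C 5); [pos | rewrite Cmod_circ by lra; lra]. }
  apply symm_int in D; [| lra | exact Hu | intro t; rewrite circ_period; reflexivity].
  pose proof (@is_RInt_plus RN _ _ _ _ _ _ (@is_RInt_scal RN _ _ _ b0 _ (oddker_mass s Hs)) (symm_cube s b1 b3 Hs)) as M.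
  assert (Hle := is_RInt_le _ _ (PI / 2) (3 * (PI / 2)) _ _ ltac:(lra) D M).
  match type of Hle with ?A -> _ => assert (HA : A) end.
  { intros t Ht. rsc.
    assert (Hct : cos t <= 0) by (apply cos_le_0; lra).
    pose proof (oddker_left s t Hs Hct) as Hk.
    pose proof (Hb (- (2 * cos t)) (2 * sin t) ltac:(lra)) as B.
    assert (EE : (- (2 * cos t)) ^ 2 + (2 * sin t) ^ 2 = 4) by (generalize (sin2_cos2 t); unfold Rsqr; intro; nra). rewrite <- circ_point_left, <- circ_point_right in B.
    nra. }
  specialize (Hle HA).
  pose proof (atan_kernel_ge s Hs) as Ha.
  set (A := 2 * atan (4 * s / (4 - s ^ 2))) in *.
  apply Rmult_le_reg_l with (2 * PI); [lra |].
  assert (b0 * (2 * (3.3 * s - A)) <= b0 * (2 * (3.3 * s - (2 * s - s ^ 3 / 6)))) by nra.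
  replace (2 * PI * ((0.65 * 2 / PI * b0 + 0.325 * b1 + 0.24375 * b3) * s + (b0 / (6 * PI) - b3 / 32) * s ^ 3))
    with (b0 * (2 * (3.3 * s - (2 * s - s ^ 3 / 6))) + 2 * PI * (0.325 * b1 * s + b3 * (0.24375 * s - s ^ 3 / 32))).
  - eapply Rle_trans; [exact Hle |]. apply Rplus_le_compat_r. exact H.
  - replace 3.3 with (33 / 10) by lra. replace 0.65 with (65 / 100) by lra. field. lra.
Qed.

(** Integration over s in [0, 1]: the deficits have nonpositive integral and drop out. The constants
    are (0.65 + 1/24) / PI <= 0.2203, 0.325 / 2, and 0.24375 / 2 - 1/128. *)
Lemma disc_lower :
  RInt (fun s => ln (Cmod (f (RtoC s)))) 0 1 - RInt (fun s => ln (Cmod (f (- RtoC s)%C))) 0 1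
    <= 1.65 * Re (l / f 0%C)%C + 0.2203 * b0 + 0.1625 * b1 + 0.1140625 * b3.
Proof.
  destruct disc_zeros as [lz [Hok HD]]. destruct (ex_RInt_ZL lz Hok) as [Z1 Z2]. assert (Hw : exists w1, w1 = Re (l / f 0%C)%C) by (eexists; reflexivity). destruct Hw as [w1 Ew].
  assert (C1 : forall s, Rabs s <= 1 -> continuous (fun s => ln (Cmod (f (RtoC s)))) s).
  { intros s Hs. apply (ln_Cmod_cts (fun s => f (RtoC s))); [| apply Hreal; lra].
    apply (continuous_Ccts_comp f RtoC); [apply (holo_cts f 0%C 5 _ Hf); rewrite Cmod_sub0, Cmod_R; lra | apply continuous_C_pair; [apply continuous_id | apply continuous_const]]. }
  assert (E1 : ex_RInt (fun s => ln (Cmod (f (RtoC s)))) 0 1) by (apply cts_RInt; rewrite Rmin_left, Rmax_right by lra; intros s Hs; apply C1, Rabs_le; lra).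
  assert (E2 : ex_RInt (fun s => ln (Cmod (f (- RtoC s)%C))) 0 1).
  { apply cts_RInt. rewrite Rmin_left, Rmax_right by lra. intros s Hs. apply (continuous_ext (fun s => ln (Cmod (f (RtoC (- s)))))); [intro; rewrite RtoC_opp; reflexivity |].
    apply (continuous_comp Ropp (fun s => ln (Cmod (f (RtoC s))))); [apply derive_cts; auto_derive; exact I | apply C1, Rabs_le; lra]. }
  apply (RInt_correct (V := RV)) in E1. apply (RInt_correct (V := RV)) in E2. apply (RInt_correct (V := RV)) in Z1.
  pose proof (@is_RInt_minus RN _ _ _ _ _ _ (@is_RInt_minus RN _ _ _ _ _ _ (@is_RInt_minus RN _ _ _ _ _ _ E1 E2) (is_RInt_id_poly (3.3 * w1) 0)) Z1) as I1.
  pose proof (is_RInt_id_poly (0.65 * 2 / PI * b0 + 0.325 * b1 + 0.24375 * b3) (b0 / (6 * PI) - b3 / 32)) as I2.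
  assert (Hle := is_RInt_le _ _ 0 1 _ _ ltac:(lra) I1 I2).
  match type of Hle with ?A -> _ => assert (HA : A) end.
  { intros s Hs. pose proof (disc_pointwise lz s ltac:(lra) (HD s ltac:(lra))) as P. unfold T in P. rewrite <- Ew in P. rsc. lra. }
  specialize (Hle HA). unfold minus, plus, opp in Hle; simpl in Hle.
  pose proof PI_ge_314 as HPI.
  assert (HP : 0.65 * 2 / PI * b0 / 2 + b0 / (6 * PI) / 4 <= 0.2203 * b0).
  { replace (0.65 * 2 / PI * b0 / 2 + b0 / (6 * PI) / 4) with (b0 * (0.65 + / 24) / PI) by (field; lra).
    apply Rle_div_l; nra. }
  lra.
Qed.
End Disc.

(** * Fourier expansion of the sawtooth function *)

Ltac rring := match goal with |- @eq _ ?a ?b => change (@eq R a b) end; ring.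
Ltac rfield := match goal with |- @eq _ ?a ?b => change (@eq R a b) end; field.

Definition npow (s : C) (x : R) : C := Cexp (- s * RtoC (ln x))%C.

Lemma Cmod_npow (s : C) (x : R) : Cmod (npow s x) = exp (- Re s * ln x).
Proof. unfold npow. rewrite Cmod_Cexp. f_equal. destruct s as [a b]; simpl. ring. Qed.

Lemma npow_plus1 (s : C) (x : R) : 0 < x -> npow (s + 1)%C x = (RtoC (/ x) * npow s x)%C.
Proof.
  intro Hx. unfold npow. replace (- (s + 1) * ln x)%C with (- RtoC (ln x) + - s * ln x)%C by ring.
  rewrite Cexp_plus. rewrite <- RtoC_opp, Cexp_cis. simpl. rewrite exp_Ropp, exp_ln by exact Hx.
  unfold cis. rewrite cos_0, sin_0. apply injective_projections; simpl; ring.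
Qed.

Lemma is_derive_npow (s : C) (x : R) : 0 < x -> CDer (npow s) x (- s * npow (s + 1)%C x)%C.
Proof.
  intro Hx. rewrite npow_plus1 by exact Hx.
  replace (- s * (RtoC (/ x) * npow s x))%C with (npow s x * (- s * RtoC (/ x)))%C by ring.
  apply (is_derive_Cd_comp Cexp (fun x => - s * RtoC (ln x))%C); [apply Cd_Cexp |].
  apply (is_derive_Cd_comp (fun w => - s * w)%C (fun x => RtoC (ln x)) x (- s)%C (RtoC (/ x))).
  - eapply Cd_ext; [| | apply (Cd_scal (- s)%C (fun w => w) _ _ (Cd_id _))]; [reflexivity | ring].
  - apply (is_derive_C_pair ln (fun _ => 0)); [apply is_derive_ln; exact Hx | auto_derive; lra].
Qed.

Lemma Cd_npow (x : R) (s : C) : Cd (fun s => npow s x) s (- RtoC (ln x) * npow s x)%C.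
Proof.
  unfold npow. replace (- ln x * Cexp (- s * ln x))%C with (Cexp (- s * ln x) * - RtoC (ln x))%C by ring.
  apply (Cd_comp (fun s => - s * RtoC (ln x))%C Cexp); [| apply Cd_Cexp].
  eapply Cd_ext; [| | apply (Cd_scal (- RtoC (ln x))%C (fun w => w) s _ (Cd_id s))]; [intro; simpl; ring | ring].
Qed.

Lemma continuous_npow (s : C) (x : R) : 0 < x -> Cont (npow s) x.
Proof. intro Hx. apply (@ex_derive_continuous R_AbsRing CV). eexists. apply is_derive_npow, Hx. Qed.

Lemma is_derive_RtoC (f : R -> R) (x l : R) : is_derive f x l -> CDer (fun x => RtoC (f x)) x (RtoC l).
Proof. intro H. apply (is_derive_C_pair f (fun _ => 0)); [pos | auto_derive; lra].
Qed.

Lemma is_derive_C_mul (f g : R -> C) (x : R) (l m : C) : CDer f x l -> CDer g x m ->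
  CDer (fun x => f x * g x)%C x (l * g x + f x * m)%C.
Proof.
  intros Hf Hg. assert (Hsq : forall z, Cd (fun w => w * w)%C z (z + z)%C) by (intro z; eapply Cd_ext; [| | apply (Cd_mult (fun w => w) (fun w => w)); apply Cd_id]; [reflexivity | ring]).
  pose proof (is_derive_Cd_comp _ _ _ _ _ (Cd_scal (/ 4) _ _ _ (Hsq _)) (@is_derive_plus R_AbsRing CV _ _ _ _ _ Hf Hg)) as D1.
  pose proof (is_derive_Cd_comp _ _ _ _ _ (Cd_scal (/ 4) _ _ _ (Hsq _)) (@is_derive_minus R_AbsRing CV _ _ _ _ _ Hf Hg)) as D2.
  pose proof (@is_derive_minus R_AbsRing CV _ _ _ _ _ D1 D2) as D.
  evar_last; [eapply is_derive_ext; [| exact D]; intro t |]; cbv beta; cfield.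
Qed.

Lemma continuous_RtoC (f : R -> R) (x : R) : continuous f x -> Cont (fun x => RtoC (f x)) x.
Proof. intro H. apply continuous_C_pair; [pos | apply continuous_const].
Qed.

(** The error of the trapezoidal rule for the integral of x^(-s) over [n, n + 1]. *)
Definition EMD (s : C) (n : nat) : C :=
  (RtoC (/ 2) * npow s (INR (S n)) + RtoC (/ 2) * npow s (INR n) - (npow (s - 1) (INR (S n)) - npow (s - 1) (INR n)) / (1 - s))%C.

(** On [0, 1], the antiderivative of 1/2 - x vanishing at both ends, so boundary terms disappear at
    integers. *)
Definition saw (x : R) : R := x * (1 - x) / 2.

Lemma EMD_int (s : C) (n : nat) : s <> 1%C -> (1 <= n)%nat ->
  CInt (fun x => s * (s + 1) * RtoC (saw (x - INR n)) * npow (s + 1 + 1) x)%C (INR n) (INR (S n)) (EMD s n).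
Proof.
  intros Hs Hn. assert (Hn1 : 1 <= INR n) by (apply (le_INR 1); exact Hn).
  assert (Hs1 : (1 - s)%C <> 0%C) by (apply Csub_neq0, not_eq_sym, Hs).
  set (W := fun x => (- s * RtoC (saw (x - INR n)) * npow (s + 1) x + RtoC (x - INR n - / 2) * npow s x - npow (s - 1) x / (1 - s))%C).
  replace (EMD s n) with (@minus CV (W (INR (S n))) (W (INR n))).
  2:{ change ((W (INR (S n)) - W (INR n))%C = EMD s n). unfold W, EMD, saw. rewrite S_INR.
      replace (INR n + 1 - INR n) with 1 by ring. replace (INR n - INR n) with 0 by ring.
      replace (1 * (1 - 1) / 2) with 0 by field. replace (0 * (1 - 0) / 2) with 0 by field. replace (1 - / 2) with (/ 2) by field. replace (0 - / 2) with (- / 2) by ring.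
      rewrite RtoC_opp. field. exact Hs1. }
  apply (@is_RInt_derive CV W).
  - rewrite Rmin_left, Rmax_right by (rewrite S_INR; lra). intros x Hx.
    assert (Hx0 : 0 < x) by lra. assert (D1 := is_derive_C_mul _ _ _ _ _ (is_derive_C_mul _ _ _ _ _ (@is_derive_const R_AbsRing CV (- s)%C x) (is_derive_RtoC (fun x => saw (x - INR n)) x (- (x - INR n - / 2)) ltac:(unfold saw; auto_derive; lra))) (is_derive_npow (s + 1) x Hx0)).
    assert (D2 := is_derive_C_mul _ _ _ _ _ (is_derive_RtoC (fun x => x - INR n - / 2) x 1 ltac:(auto_derive; lra)) (is_derive_npow s x Hx0)).
    assert (D3 := is_derive_C_mul _ _ _ _ _ (is_derive_npow (s - 1) x Hx0) (@is_derive_const R_AbsRing CV (/ (1 - s))%C x)).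
    evar_last; [exact (@is_derive_minus R_AbsRing CV _ _ _ _ _ (@is_derive_plus R_AbsRing CV _ _ _ _ _ D1 D2) D3) |].
    match goal with |- ?v = _ => change v with (((0 * RtoC (saw (x - INR n)) + - s * RtoC (- (x - INR n - / 2))) * npow (s + 1) x + - s * RtoC (saw (x - INR n)) * (- (s + 1) * npow (s + 1 + 1) x))
       + (1 * npow s x + RtoC (x - INR n - / 2) * (- s * npow (s + 1) x)) - (- (s - 1) * npow (s - 1 + 1) x * / (1 - s) + npow (s - 1) x * 0))%C end.
    replace (s - 1 + 1)%C with s by ring. rewrite RtoC_opp. cfield; exact Hs1.
  - rewrite Rmin_left, Rmax_right by (rewrite S_INR; lra). intros x Hx. apply continuous_C_mult.
    + apply continuous_C_mult; [apply continuous_const |]. apply continuous_RtoC. apply derive_cts. unfold saw. auto_derive. exact I.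
    + apply continuous_npow. lra.
Qed.

Lemma sin_PI_nat (k n : nat) : sin (PI * INR k * INR n) = 0.
Proof.
  apply sin_eq_0_1. exists (Z.of_nat (k * n)). rewrite <- INR_IZR_INZ, mult_INR. ring.
Qed.

(** Integration by parts between integers, where sin^2(pi k x) vanishes: it trades the Fourier terms
    of [saw] for the harmonics sin(2 pi k x), lowering the power of x by one. *)
Lemma sin_sq_nat (s : C) (k n m : nat) : (1 <= k)%nat -> (1 <= n <= m)%nat ->
  CInt (fun x => RtoC (PI * INR k) * RtoC (sin (2 * PI * INR k * x)) * npow (s + 1) x - (s + 1) * RtoC (sin (PI * INR k * x) ^ 2) * npow (s + 1 + 1) x)%C (INR n) (INR m) (RtoC 0).
Proof.
  intros Hk Hn. assert (Hn1 : 1 <= INR n) by (apply (le_INR 1); lia). assert (Hnm : INR n <= INR m) by (apply le_INR; lia).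
  set (W := fun x => (RtoC (sin (PI * INR k * x) ^ 2) * npow (s + 1) x)%C).
  replace (RtoC 0) with (@minus CV (W (INR m)) (W (INR n))).
  2:{ change ((W (INR m) - W (INR n))%C = RtoC 0). unfold W. rewrite !sin_PI_nat. replace (0 ^ 2) with 0 by ring. ring. }
  apply (@is_RInt_derive CV W); rewrite Rmin_left, Rmax_right by lra; intros x Hx; assert (Hx0 : 0 < x) by lra.
  - evar_last; [exact (is_derive_C_mul _ _ _ _ _ (is_derive_RtoC (fun x => sin (PI * INR k * x) ^ 2) x (PI * INR k * sin (2 * PI * INR k * x)) ltac:(auto_derive; [lra | replace (2 * PI * INR k * x) with (2 * (PI * INR k * x)) by ring; rewrite sin_2a; ring])) (is_derive_npow (s + 1) x Hx0)) |].
    rewrite RtoC_mult. ring.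
  - apply (@continuous_minus R_UniformSpace R_AbsRing CV).
    + apply continuous_C_mult; [| apply continuous_npow; lra]. apply continuous_C_mult; [apply continuous_const |]. apply continuous_RtoC. cts_derive.
    + apply continuous_C_mult; [| apply continuous_npow; lra]. apply continuous_C_mult; [apply continuous_const |]. apply continuous_RtoC. cts_derive.
Qed.

Lemma PI_ge_3 : 3 <= PI.
Proof. pose proof PI2_3_2. lra. Qed.

(* Remainder of the expansion [x (1 - x) / 2 = sum_k sin^2 (pi k x) / (pi k)^2] and its first two derivatives (up to sign). *)
Definition FK (K : nat) (x : R) : R := saw x - sum_n_m (fun k => sin (PI * INR k * x) ^ 2 / (PI * INR k) ^ 2) 1 K.

Definition FK1 (K : nat) (x : R) : R := / 2 - x - sum_n_m (fun k => sin (2 * PI * INR k * x) / (PI * INR k)) 1 K.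

Definition DK (K : nat) (x : R) : R := 1 + sum_n_m (fun k => 2 * cos (2 * PI * INR k * x)) 1 K.

Lemma is_derive_sum_n_m (f df : nat -> R -> R) (n m : nat) (x : R) : (forall k, (n <= k)%nat -> is_derive (f k) x (df k x)) ->
  is_derive (fun x => sum_n_m (fun k => f k x) n m) x (sum_n_m (fun k => df k x) n m).
Proof.
  intro H. destruct (le_lt_dec n m) as [Hnm | Hnm].
  - induction Hnm as [| m Hm IH].
    + apply (is_derive_ext (f n)); [intro; rewrite sum_n_n; reflexivity |]. rewrite sum_n_n. apply H. lia.
    + apply (is_derive_ext (fun x => plus (sum_n_m (fun k => f k x) n m) (f (S m) x))); [intro t; rewrite sum_n_Sm by lia; reflexivity |].
      rewrite sum_n_Sm by lia. apply (is_derive_plus (fun x => sum_n_m (fun k => f k x) n m) (f (S m))); [pos | apply H; lia].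
  - apply (is_derive_ext (fun _ => 0)); [intro t; rewrite sum_n_m_zero by lia; reflexivity |]. rewrite sum_n_m_zero by lia. apply (@is_derive_const R_AbsRing RN 0).
Qed.

Lemma PIk_pos (k : nat) : (1 <= k)%nat -> 0 < PI * INR k.
Proof. intro H. apply Rmult_lt_0_compat; [apply PI_RGT_0 | pos].
Qed.

Lemma is_derive_FK (K : nat) (x : R) : is_derive (FK K) x (FK1 K x).
Proof. apply (is_derive_minus saw (fun x => sum_n_m (fun k => sin (PI * INR k * x) ^ 2 / (PI * INR k) ^ 2) 1 K)).
  - unfold saw. auto_derive; lra.
  - apply (is_derive_sum_n_m (fun k x => sin (PI * INR k * x) ^ 2 / (PI * INR k) ^ 2) (fun k x => sin (2 * PI * INR k * x) / (PI * INR k))).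
    intros k Hk. auto_derive; [lra |]. replace (2 * PI * INR k * x) with (2 * (PI * INR k * x)) by ring. rewrite sin_2a. field. split; [pos | apply PI_neq0].
Qed.

Lemma is_derive_FK1 (K : nat) (x : R) : is_derive (FK1 K) x (- DK K x).
Proof.
  unfold FK1, DK. replace (- (1 + sum_n_m (fun k => 2 * cos (2 * PI * INR k * x)) 1 K)) with (-1 - sum_n_m (fun k => 2 * cos (2 * PI * INR k * x)) 1 K) by ring.
  apply (is_derive_minus (fun x => / 2 - x) (fun x => sum_n_m (fun k => sin (2 * PI * INR k * x) / (PI * INR k)) 1 K)).
  - auto_derive; lra.
  - apply (is_derive_sum_n_m (fun k x => sin (2 * PI * INR k * x) / (PI * INR k)) (fun k x => 2 * cos (2 * PI * INR k * x))).
    intros k Hk. auto_derive; [lra |]. field. split; [pos | apply PI_neq0].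
Qed.

Lemma DK_closed (K : nat) (x : R) : DK K x * sin (PI * x) = sin ((2 * INR K + 1) * (PI * x)).
Proof.
  unfold DK. induction K as [| K IH].
  - rewrite sum_n_m_zero by lia. change (zero : R) with 0. simpl. replace ((2 * 0 + 1) * (PI * x)) with (PI * x) by ring. ring.
  - rewrite sum_n_Sm by lia. rewrite <- Rplus_assoc, Rmult_plus_distr_r, IH.
    replace (2 * PI * INR (S K) * x) with ((2 * INR K + 1) * (PI * x) + PI * x) by (rewrite S_INR; ring).
    replace ((2 * INR (S K) + 1) * (PI * x)) with ((2 * INR K + 1) * (PI * x) + PI * x + PI * x) by (rewrite S_INR; ring).
    set (A := (2 * INR K + 1) * (PI * x)). set (p := PI * x).
    assert (E : sin A = sin (A + p - p)) by (f_equal; ring). rewrite E, (sin_plus (A + p) p), (sin_minus (A + p) p). ring.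
Qed.

(* Second mean value in the explicit form for [sin ((2K+1) p) / sin p]. *)
Lemma FK1_bound (K : nat) (x : R) : 0 < x <= / 2 -> Rabs (FK1 K x) <= 2 / (PI * (2 * INR K + 1) * (2 * x)).
Proof.
  intro Hx. pose proof PI_RGT_0 as HPI. pose proof (pos_INR K) as HK. set (w := (2 * INR K + 1) * PI). assert (Hw : 0 < w) by pos.
  assert (Hsin : forall u, 0 < u <= / 2 -> 0 < sin (PI * u)) by (intros u Hu; apply sin_gt_0; nra).
  assert (HJ : 2 * x <= sin (PI * x)).
  { pose proof (slope_le (fun u => - sin u) (fun u => - cos u) (PI * x) (PI / 2) ltac:(nra) ltac:(cbv beta; rewrite sin_0; ring)) as J. cbv beta in J. rewrite sin_PI2 in J.
    assert (PI / 2 * - sin (PI * x) <= PI * x * - (1)); [apply J | nra].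
    - intros u _. auto_derive; lra.
    - intros u v Hu Hv. apply Ropp_le_contravar. apply cos_decr_1; lra. }
  (* One integration by parts by hand: V is [FK1] without its boundary term, and its derivative is
     dominated by that of the monotone function U = -1 / (w sin(pi u)). V vanishes at 1/2, so U
     controls V. *)
  set (V := fun u => FK1 K u - cos (w * u) / (w * sin (PI * u))).
  set (dV := fun u => cos (w * u) * (PI * cos (PI * u)) / (w * sin (PI * u) ^ 2)).
  assert (HdV : forall u, 0 < u <= / 2 -> is_derive V u (dV u)).
  { intros u Hu. pose proof (Hsin u Hu) as Hs. unfold V, dV.
    assert (ED : DK K u = sin (w * u) / sin (PI * u)).
    { apply Rmult_eq_reg_r with (sin (PI * u)); [| lra]. rewrite DK_closed. unfold w. replace ((2 * INR K + 1) * PI * u) with ((2 * INR K + 1) * (PI * u)) by ring. field. lra. }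
    evar_last; [apply (is_derive_minus (FK1 K) (fun u => cos (w * u) / (w * sin (PI * u))) u _ (- (sin (w * u) / sin (PI * u)) - cos (w * u) * (PI * cos (PI * u)) / (w * sin (PI * u) ^ 2)) (is_derive_FK1 K u)) |].
    - auto_derive; [nra |]. field. lra.
    - rewrite ED. rsc. lra. }
  set (U := fun u => - / (w * sin (PI * u))).
  set (dU := fun u => PI * cos (PI * u) / (w * sin (PI * u) ^ 2)).
  assert (HdU : forall u, 0 < u <= / 2 -> is_derive U u (dU u)).
  { intros u Hu. pose proof (Hsin u Hu) as Hs. unfold U, dU. auto_derive; [nra |]. field. lra. }
  assert (Hle : forall u, 0 < u <= / 2 -> Rabs (dV u) <= dU u).
  { intros u Hu. pose proof (Hsin u Hu) as Hs. unfold dV, dU. pose proof (COS_bound (w * u)). assert (0 <= cos (PI * u)) by (apply cos_ge_0; nra).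
    assert (0 <= PI * cos (PI * u) / (w * sin (PI * u) ^ 2)) by pos.
    replace (cos (w * u) * (PI * cos (PI * u)) / (w * sin (PI * u) ^ 2)) with (cos (w * u) * (PI * cos (PI * u) / (w * sin (PI * u) ^ 2))) by lra.
    rewrite Rabs_mult, (Rabs_pos_eq (PI * cos (PI * u) / (w * sin (PI * u) ^ 2))) by assumption.
    assert (Rabs (cos (w * u)) <= 1) by (apply Rabs_le; lra). nra. }
  pose proof (MVT_ge (fun u => U u - V u) (fun u => dU u - dV u) x (/ 2) 0 ltac:(lra)) as M1.
  pose proof (MVT_ge (fun u => U u + V u) (fun u => dU u + dV u) x (/ 2) 0 ltac:(lra)) as M2.
  cbv beta in M1, M2.
  assert (HV2 : V (/ 2) = 0).
  { unfold V, FK1. replace (cos (w * / 2)) with 0.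
    - rewrite sum_n_m_ext_loc with (b := fun _ => zero); [rewrite sum_n_m_const_zero; change (zero : R) with 0; field; split; apply Rgt_not_eq; [apply Hsin; lra | lra] |].
      intros k Hk. replace (2 * PI * INR k * / 2) with (PI * INR k * INR 1) by (simpl; field). rewrite sin_PI_nat. change (zero : R) with 0. lra.
    - unfold w. replace ((2 * INR K + 1) * PI * / 2) with (PI / 2 + PI * INR K * INR 1) by (simpl; field). rewrite cos_plus, sin_PI_nat, cos_PI2. ring. }
  assert (HU2 : U (/ 2) = - / w).
  { unfold U. replace (PI * / 2) with (PI / 2) by field. rewrite sin_PI2, Rmult_1_r. reflexivity. }
  rewrite HV2, HU2 in M1, M2.
  assert (B1 : 0 * (/ 2 - x) <= - / w - 0 - (U x - V x)) by (apply M1; [intros u Hu; apply (is_derive_minus U V); [apply HdU | apply HdV]; lra | intros u Hu; pose proof (Hle u ltac:(lra)) as L; apply Rabs_le_between in L; lra]).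
  assert (B2 : 0 * (/ 2 - x) <= - / w + 0 - (U x + V x)) by (apply M2; [intros u Hu; apply (is_derive_plus U V); [apply HdU | apply HdV]; lra | intros u Hu; pose proof (Hle u ltac:(lra)) as L; apply Rabs_le_between in L; lra]).
  assert (Hw0 : 0 < / w) by pos. pose proof (COS_bound (w * x)) as Hc.
  assert (Hq : FK1 K x = V x + cos (w * x) * / (w * sin (PI * x))) by (unfold V; field; lra).
  assert (B3 : Rabs (FK1 K x) <= 2 * / (w * sin (PI * x))) by (rewrite Hq; unfold U in B1, B2; apply Rabs_le; split; nra).
  eapply Rle_trans; [exact B3 |]. unfold Rdiv. apply Rmult_le_compat_l; [lra |]. apply Rinv_le_contravar; [pos |]. replace (PI * (2 * INR K + 1) * (2 * x)) with ((2 * INR K + 1) * PI * (2 * x)) by ring. apply Rmult_le_compat_l; lra.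
Qed.

Lemma FK_0 (K : nat) : FK K 0 = 0.
Proof.
  unfold FK, saw. rewrite sum_n_m_ext_loc with (b := fun _ => zero); [rewrite sum_n_m_const_zero; change (zero : R) with 0; field |].
  intros k Hk. rewrite Rmult_0_r, sin_0. change (zero : R) with 0. lra.
Qed.

Lemma FK_refl (K : nat) (x : R) : FK K (1 - x) = FK K x.
Proof.
  unfold FK, saw. replace ((1 - x) * (1 - (1 - x)) / 2) with (x * (1 - x) / 2) by field. apply (f_equal (Rminus _)). apply sum_n_m_ext. intro k. apply (f_equal (fun u => u / _)).
  replace (PI * INR k * (1 - x)) with (PI * INR k * INR 1 - PI * INR k * x) by (simpl; ring). rewrite sin_minus, sin_PI_nat.
  assert (E := sin2_cos2 (PI * INR k * INR 1)). rewrite sin_PI_nat in E. unfold Rsqr in E.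
  nra.
Qed.

Lemma sum_n_m_le_loc (a b : nat -> R) (n m : nat) : (forall k, (n <= k <= m)%nat -> a k <= b k) -> sum_n_m a n m <= sum_n_m b n m.
Proof.
  intro H. destruct (le_lt_dec n m) as [Hnm | Hnm]; [| rewrite !sum_n_m_zero by lia; apply Rle_refl].
  revert H. induction Hnm as [| m Hm IH]; intro H.
  - rewrite !sum_n_n. apply H. lia.
  - rewrite !sum_n_Sm by lia. apply Rplus_le_compat; [apply IH; intros; apply H; lia | apply H; lia].
Qed.

Lemma sum_n_m_nonneg (a : nat -> R) (n m : nat) : (forall k, (n <= k <= m)%nat -> 0 <= a k) -> 0 <= sum_n_m a n m.
Proof. intro H. apply Rle_trans with (sum_n_m (fun _ => 0) n m); [right; rewrite sum_n_m_const; rring | apply sum_n_m_le_loc, H]. Qed.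

Lemma inv_sq_tail (m K : nat) : (1 <= m)%nat -> sum_n_m (fun k => / INR k ^ 2) (S m) K <= / INR m.
Proof.
  intro Hm. assert (H : forall K, (m <= K)%nat -> sum_n_m (fun k => / INR k ^ 2) (S m) K <= / INR m - / INR K).
  { intros K' HK. induction HK as [| K' HK IH].
    - rewrite sum_n_m_zero by lia. change (zero : R) with 0. lra.
    - rewrite sum_n_Sm by lia. change plus with Rplus. assert (1 <= INR K') by (apply (le_INR 1); lia). rewrite S_INR.
      assert (/ (INR K' + 1) ^ 2 <= / INR K' - / (INR K' + 1)); [| lra].
      replace (/ INR K' - / (INR K' + 1)) with (/ (INR K' * (INR K' + 1))) by (field; lra). apply Rinv_le_contravar; nra. }
  destruct (le_lt_dec m K) as [HK | HK].
  - specialize (H K HK). assert (0 < / INR K) by pos. lra.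
  - rewrite sum_n_m_zero by lia. pos.
Qed.

Lemma FK_tail (x : R) (m K : nat) : (1 <= m)%nat -> 0 <= sum_n_m (fun k => sin (PI * INR k * x) ^ 2 / (PI * INR k) ^ 2) (S m) K <= / 4 * / INR m.
Proof.
  intro Hm. pose proof PI_ge_3 as HP. split.
  - apply sum_n_m_nonneg. intros k Hk. pos.
  - apply Rle_trans with (sum_n_m (fun k => / 4 * / INR k ^ 2) (S m) K).
    + apply sum_n_m_le_loc. intros k Hk. assert (Hkp : 0 < INR k) by pos. unfold Rdiv.
      pose proof (SIN_bound (PI * INR k * x)).
      rewrite Rpow_mult_distr, Rinv_mult, <- Rmult_assoc. assert (/ PI ^ 2 <= / 4) by (apply Rinv_le_contravar; nra). apply Rmult_le_compat_r; [pos | nra].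
    + rewrite (sum_n_m_mult_l (K := R_AbsRing) (/ 4) (fun k => / INR k ^ 2)). apply Rmult_le_compat_l; [lra | apply inv_sq_tail, Hm].
Qed.

(* The derivative bound gives convergence away from 0, and [FK] is small near 0 uniformly in [K]. *)
Lemma FK_lim (x e : R) : 0 < x <= / 2 -> 0 < e -> exists K0, forall K, (K0 <= K)%nat -> Rabs (FK K x) <= e.
Proof.
  intros Hx He. pose proof PI_RGT_0 as HPI. destruct (nfloor_ex (4 / e) ltac:(pos)) as [m0 [Hm0 Hm1]]. set (m := S m0).
  assert (Hm : 4 / e < INR m) by (unfold m; rewrite S_INR; exact Hm1). assert (Hmp : 0 < INR m) by pos.
  assert (Hme : / INR m <= e / 4).
  { apply Rlt_div_l in Hm; [| lra]. apply Rmult_le_reg_r with (INR m); [lra |]. rewrite Rinv_l; lra. }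
  set (y := Rmin x (Rmin (e / 4) (/ INR m))).
  assert (Hy0 : 0 < y) by (unfold y; repeat apply Rmin_glb_lt; try lra; apply Rinv_0_lt_compat, Hmp).
  assert (Hyx : y <= x) by apply Rmin_l. assert (Hye : y <= e / 4) by (eapply Rle_trans; [apply Rmin_r | apply Rmin_l]).
  assert (Hym : INR m * y <= 1).
  { apply Rle_trans with (INR m * / INR m); [apply Rmult_le_compat_l; [lra | eapply Rle_trans; [apply Rmin_r | apply Rmin_r]] | rewrite Rinv_r by lra; lra]. }
  assert (Hsmall : forall K, Rabs (FK K y) <= e / 2 + e / 8 + e / 4).
  { intro K. unfold FK. set (a := fun k => sin (PI * INR k * y) ^ 2 / (PI * INR k) ^ 2).
    assert (Ha0 : forall k, (1 <= k)%nat -> 0 <= a k) by (intros k Hk; pose proof (PIk_pos k Hk); unfold a; apply Rdiv_le_0_compat; nra).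
    assert (Ha1 : forall k, (1 <= k)%nat -> a k <= y ^ 2).
    { intros k Hk. pose proof (PIk_pos k Hk). unfold a. apply Rmult_le_reg_r with ((PI * INR k) ^ 2); [nra |]. unfold Rdiv. rewrite Rmult_assoc, Rinv_l, Rmult_1_r by nra.
      replace (y ^ 2 * (PI * INR k) ^ 2) with ((PI * INR k * y) ^ 2) by ring. rewrite <- !Rsqr_pow2. apply Rsqr_le_abs_1. apply Rabs_sin_le. }
    assert (HS0 : 0 <= sum_n_m a 1 K) by (apply sum_n_m_nonneg; intros; apply Ha0; lia).
    assert (HS : sum_n_m a 1 K <= INR m * y ^ 2 + / 4 * / INR m).
    { assert (Hm1' : forall K', (K' <= m)%nat -> sum_n_m a 1 K' <= INR m * y ^ 2).
      { intros K' HK'. apply Rle_trans with (sum_n_m (fun _ => y ^ 2) 1 K'); [apply sum_n_m_le_loc; intros; apply Ha1; lia |].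
        rewrite sum_n_m_const. replace (S K' - 1)%nat with K' by lia. apply Rmult_le_compat_r; [nra | apply le_INR; exact HK']. }
      destruct (le_lt_dec K m) as [HK | HK]; [specialize (Hm1' K HK); assert (0 < / INR m) by pos; lra |].
      rewrite (sum_n_m_Chasles a 1 m K) by lia. apply Rplus_le_compat; [apply Hm1'; lia |].
      apply FK_tail. unfold m; lia. }
    assert (INR m * y ^ 2 <= y) by nra.
    assert (0 <= saw y <= y) by (unfold saw; nra).
    apply Rabs_le. lra. }
  set (Bd := 2 / (PI * (2 * y))). assert (HB : 0 < Bd) by pos.
  destruct (nfloor_ex (Bd / (e / 8)) ltac:(pos)) as [K0 [HK0 HK1]]. exists (S K0). intros K HK.
  assert (HKI : INR K0 + 1 <= INR K) by (rewrite <- S_INR; apply le_INR; exact HK).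
  assert (Hder : Rabs (FK K x - FK K y) <= e / 8 * (x - y)).
  { assert (Hb : forall u, y <= u <= x -> Rabs (FK1 K u) <= e / 8).
    { intros u Hu. eapply Rle_trans; [apply FK1_bound; lra |].
      pose proof (pos_INR K0). apply Rle_div_l; [pos |].
      assert (E1 : Bd * (PI * (2 * y)) = 2) by (unfold Bd; field; split; lra).
      assert (E2 : Bd < (INR K0 + 1) * (e / 8)) by (apply Rlt_div_l in HK1; lra).
      assert (E3 : PI * (2 * y) <= PI * (2 * u)) by nra.
      assert (E4 : Bd <= (2 * INR K + 1) * (e / 8)) by nra.
      apply Rle_trans with (Bd * (PI * (2 * y))); [lra |]. replace (e / 8 * (PI * (2 * INR K + 1) * (2 * u))) with ((2 * INR K + 1) * (e / 8) * (PI * (2 * u))) by ring.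
      apply Rmult_le_compat; nra. }
    apply Rabs_le. pose proof (MVT_le (FK K) (FK1 K) y x (e / 8) Hyx (fun u _ => is_derive_FK K u) (fun u Hu => proj2 (proj1 (Rabs_le_between _ _) (Hb u Hu)))) as L1.
    pose proof (MVT_ge (FK K) (FK1 K) y x (- (e / 8)) Hyx (fun u _ => is_derive_FK K u) (fun u Hu => proj1 (proj1 (Rabs_le_between _ _) (Hb u Hu)))) as L2.
    lra. }
  specialize (Hsmall K). replace (FK K x) with ((FK K x - FK K y) + FK K y) by ring. eapply Rle_trans; [apply Rabs_triang |].
  nra.
Qed.

(** FK M x tends to 0 as M grows, and FK K x - FK M x is a tail of a series of nonnegative terms.
    The bound is uniform up to the integers, which is the reason for expanding x (1 - x) / 2 and not
    the sawtooth itself. *)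
Lemma FK_bound (K : nat) (x : R) : (1 <= K)%nat -> 0 <= x <= 1 -> Rabs (FK K x) <= / 4 * / INR K.
Proof.
  intros HK Hx. assert (HKp : 0 < INR K) by pos. assert (HKi : 0 < / INR K) by pos.
  assert (Hhalf : forall x, 0 < x <= / 2 -> Rabs (FK K x) <= / 4 * / INR K).
  { clear x Hx. intros x Hx. apply le_epsilon. intros e He. destruct (FK_lim x e Hx He) as [K0 H0].
    set (M := (K0 + K)%nat). specialize (H0 M ltac:(unfold M; lia)).
    assert (E : FK K x = FK M x + sum_n_m (fun k => sin (PI * INR k * x) ^ 2 / (PI * INR k) ^ 2) (S K) M).
    { unfold FK. rewrite (sum_n_m_Chasles _ 1 K M) by (unfold M; lia). change plus with Rplus. ring. }
    rewrite E. destruct (FK_tail x K M HK) as [T0 T1]. set (Tl := sum_n_m _ (S K) M) in *.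
    eapply Rle_trans; [apply Rabs_triang |]. rewrite (Rabs_pos_eq Tl) by exact T0. lra. }
  destruct (Req_dec x 0) as [-> | H0]; [rewrite FK_0, Rabs_R0; lra |].
  destruct (Req_dec x 1) as [-> | H1].
  { replace 1 with (1 - 0) at 1 by ring. rewrite FK_refl, FK_0, Rabs_R0; lra. }
  destruct (Rle_dec x (/ 2)) as [Hc | Hc]; [apply Hhalf; lra |]. rewrite <- FK_refl. apply Hhalf. lra.
Qed.

(** * Approximation of zeta by partial sums *)

Fixpoint csum (f : nat -> C) (n : nat) : C := match n with O => 0%C | S m => (csum f m + f m)%C end.

Lemma csum_ext (f g : nat -> C) (n : nat) : (forall i, (i < n)%nat -> f i = g i) -> csum f n = csum g n.
Proof. induction n as [| n IH]; intro H; [reflexivity |]. simpl. rewrite IH, H by (intros; try apply H; lia). reflexivity. Qed.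

Lemma csum_plus (f g : nat -> C) (n : nat) : csum (fun i => f i + g i)%C n = (csum f n + csum g n)%C.
Proof. induction n as [| n IH]; simpl; [ring | rewrite IH; ring]. Qed.

Lemma Cmod_csum (f : nat -> C) (a : nat -> R) (n : nat) : (forall i, (i < n)%nat -> Cmod (f i) <= a i) -> Cmod (csum f n) <= sum_n_m (fun k => a (pred k)) 1 n.
Proof.
  induction n as [| n IH]; intro H; simpl.
  - rewrite Cmod_0, sum_n_m_zero by lia. apply Rle_refl.
  - rewrite sum_n_Sm by lia. Ctri. apply Rplus_le_compat; [apply IH; intros; apply H; lia | simpl; apply H; lia].
Qed.

Definition oscf (s : C) (k : nat) (x : R) : C := (RtoC (sin (2 * PI * INR k * x)) * npow (s + 1) x)%C.

Definition Ik (s : C) (k : nat) (a b : R) : C := @RInt CV (oscf s k) a b.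

Lemma ex_RInt_oscf (s : C) (k : nat) (a b : R) : 0 < a -> a <= b -> @ex_RInt CV (oscf s k) a b.
Proof.
  intros Ha Hab. apply ex_RInt_C_cts. rewrite Rmin_left, Rmax_right by lra. intros x Hx. apply continuous_C_mult; [| apply continuous_npow; lra].
  apply continuous_RtoC, derive_cts. auto_derive. exact I.
Qed.

Lemma Ik_is (s : C) (k : nat) (a b : R) : 0 < a -> a <= b -> CInt (oscf s k) a b (Ik s k a b).
Proof. intros Ha Hab. apply (RInt_correct (V := CV)), ex_RInt_oscf; assumption. Qed.

Lemma Ik_Chasles (s : C) (k : nat) (a b c : R) : 0 < a -> a <= b -> b <= c -> Ik s k a c = (Ik s k a b + Ik s k b c)%C.
Proof. symmetry. apply (RInt_Chasles (V := CV)); apply ex_RInt_oscf; lra.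
Qed.

(** The contribution of the harmonic i + 1 to the Euler-Maclaurin remainder; the index is shifted
    because [csum] starts at 0. *)
Definition harm (s : C) (a b : R) (i : nat) : C := (s / RtoC (PI * INR (S i)) * Ik s (S i) a b)%C.

Lemma EMD_harm (s : C) (n K : nat) : s <> 1%C -> (1 <= n)%nat ->
  CInt (fun x => s * (s + 1) * RtoC (FK K (x - INR n)) * npow (s + 1 + 1) x)%C (INR n) (INR (S n)) (EMD s n - csum (harm s (INR n) (INR (S n))) K)%C.
Proof.
  intros Hs Hn. assert (Hn1 : 1 <= INR n) by (apply (le_INR 1); exact Hn). induction K as [| K IH].
  - simpl csum. replace (EMD s n - 0)%C with (EMD s n) by ring. pose proof (EMD_int s n Hs Hn) as H. revert H. apply (@is_RInt_ext CV).
    intros x _. unfold FK. rewrite Rminus_0_r. reflexivity.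
  - pose proof (sin_sq_nat s (S K) n (S n) ltac:(lia) ltac:(lia)) as H1.
    pose proof (PIk_pos (S K) ltac:(lia)) as Hp. set (p := PI * INR (S K)) in *.
    pose proof (Ik_is s (S K) (INR n) (INR (S n)) ltac:(lra) ltac:(rewrite S_INR; lra)) as H2.
    pose proof (@is_RInt_minus CV _ _ _ _ _ _ (@is_RInt_plus CV _ _ _ _ _ _ IH (is_RInt_C_mult (s / RtoC (p * p))%C _ _ _ _ H1)) (is_RInt_C_mult (s / RtoC p)%C _ _ _ _ H2)) as HH.
    match type of HH with is_RInt _ _ _ ?v => assert (Ev : (v : C) = (EMD s n - csum (harm s (INR n) (INR (S n))) (S K))%C) end.
    { change (EMD s n - csum (harm s (INR n) (INR (S n))) K + s / RtoC (p * p) * 0 - s / RtoC p * Ik s (S K) (INR n) (INR (S n)) = EMD s n - (csum (harm s (INR n) (INR (S n))) K + harm s (INR n) (INR (S n)) K))%C.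
      unfold harm. fold p. ring. }
    rewrite Ev in HH. revert HH. apply (@is_RInt_ext CV). intros x _.
    match goal with |- ?a = _ => change a with (s * (s + 1) * RtoC (FK K (x - INR n)) * npow (s + 1 + 1) x + s / RtoC (p * p) * (RtoC p * RtoC (sin (2 * PI * INR (S K) * x)) * npow (s + 1) x - (s + 1) * RtoC (sin (p * x) ^ 2) * npow (s + 1 + 1) x) - s / RtoC p * (RtoC (sin (2 * PI * INR (S K) * x)) * npow (s + 1) x))%C end.
    assert (EF : FK (S K) (x - INR n) = FK K (x - INR n) - sin (p * x) ^ 2 / (p * p)).
    { unfold FK. rewrite sum_n_Sm by lia. change plus with Rplus. fold p.
      assert (E : sin (p * (x - INR n)) ^ 2 = sin (p * x) ^ 2).
      { replace (p * (x - INR n)) with (p * x - p * INR n) by ring. rewrite sin_minus. unfold p at 2 4. rewrite sin_PI_nat.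
        assert (E := sin2_cos2 (PI * INR (S K) * INR n)). rewrite sin_PI_nat in E. unfold Rsqr in E. nra. }
      rewrite E. replace (p ^ 2) with (p * p) by ring. ring. }
    assert (ER : RtoC (sin (p * x) ^ 2 / (p * p)) = (RtoC (sin (p * x) ^ 2) * / (RtoC p * RtoC p))%C).
    { unfold Rdiv. rewrite RtoC_mult, RtoC_inv by nra. rewrite RtoC_mult. reflexivity. }
    rewrite EF, RtoC_minus, ER, (RtoC_mult p p).
    assert (N : RtoC p <> 0%C) by (apply RtoC_neq0; lra). cfield. exact N.
Qed.

Lemma Cmod_npow_le1 (s : C) (x : R) : 0 <= Re s -> 1 <= x -> Cmod (npow s x) <= 1.
Proof.
  intros Hs Hx. rewrite Cmod_npow. rewrite <- exp_0. assert (0 <= ln x) by (rewrite <- ln_1; apply ln_le; lra).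
  assert (0 <= Re s * ln x) by nra.
  destruct (Req_dec (- Re s * ln x) 0) as [-> | H']; [lra |]. left. apply exp_increasing. lra.
Qed.

Lemma EMD_harm_bound (s : C) (n K : nat) : s <> 1%C -> (1 <= n)%nat -> (1 <= K)%nat -> -2 <= Re s ->
  Cmod (EMD s n - csum (harm s (INR n) (INR (S n))) K)%C <= Cmod s * Cmod (s + 1)%C * (/ 4 * / INR K).
Proof.
  intros Hs Hn HK Hre. assert (Hn1 : 1 <= INR n) by (apply (le_INR 1); exact Hn).
  replace (Cmod s * Cmod (s + 1)%C * (/ 4 * / INR K)) with (Cmod s * Cmod (s + 1)%C * (/ 4 * / INR K) * (INR (S n) - INR n)) by (rewrite S_INR; ring).
  eapply Cmod_RInt_le_const; [rewrite S_INR; lra | | apply (EMD_harm s n K Hs Hn)].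
  intros x Hx. cbv beta. rewrite !Cmod_mult, Cmod_R. pose proof (Cmod_ge_0 s). pose proof (Cmod_ge_0 (s + 1)%C). rewrite S_INR in Hx.
  pose proof (FK_bound K (x - INR n) HK ltac:(lra)) as HF. pose proof (Rabs_pos (FK K (x - INR n))).
  assert (Cmod (npow (s + 1 + 1) x) <= 1) by (apply Cmod_npow_le1; [destruct s as [a b]; simpl in *; lra | lra]).
  pose proof (Cmod_ge_0 (npow (s + 1 + 1) x)).
  rewrite <- (Rmult_1_r (_ * (/ 4 * / INR K))). apply Rmult_le_compat; [pos | assumption | | assumption].
  apply Rmult_le_compat_l; nra.
Qed.

(** The Euler-Maclaurin approximant of zeta(s). Its increments are the trapezoidal errors [EMD], so
    it converges for Re s >= -1/2, left of the half plane where the series does. *)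
Definition Phi (s : C) (M : nat) : C :=
  (csum (fun i => npow s (INR (S i))) M - RtoC (/ 2) * npow s (INR M) - npow (s - 1) (INR M) / (1 - s))%C.

Lemma Phi_step (s : C) (M : nat) : s <> 1%C -> (Phi s (S M) - Phi s M = EMD s M)%C.
Proof.
  intro Hs. assert (Hs1 : (1 - s)%C <> 0%C) by (apply Csub_neq0, not_eq_sym, Hs).
  unfold Phi, EMD. cbn [csum]. assert (E : RtoC (/ 2) = (/ 2)%C) by (rewrite RtoC_inv by lra; reflexivity). rewrite E. field. exact Hs1.
Qed.

Lemma harm_Chasles (s : C) (N M K : nat) : (1 <= N <= M)%nat ->
  csum (harm s (INR N) (INR (S M))) K = (csum (harm s (INR N) (INR M)) K + csum (harm s (INR M) (INR (S M))) K)%C.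
Proof.
  intro H. rewrite <- csum_plus. apply csum_ext. intros i _. unfold harm.
  assert (1 <= INR N) by (apply (le_INR 1); lia). assert (INR N <= INR M) by (apply le_INR; lia).
  rewrite (Ik_Chasles s (S i) (INR N) (INR M) (INR (S M))) by (try rewrite (S_INR M); lra). ring.
Qed.

Lemma Phi_harm (s : C) (N M K : nat) : s <> 1%C -> (1 <= N <= M)%nat -> (1 <= K)%nat -> -2 <= Re s ->
  Cmod (Phi s M - Phi s N - csum (harm s (INR N) (INR M)) K)%C <= (INR M - INR N) * (Cmod s * Cmod (s + 1)%C * (/ 4 * / INR K)).
Proof.
  intros Hs [HN HM] HK Hre. induction HM as [| M HM IH].
  - assert (E0 : csum (harm s (INR N) (INR N)) K = 0%C).
    { clear. induction K as [| K IH]; [reflexivity |]. cbn [csum]. rewrite IH. unfold harm, Ik. rewrite (RInt_point (V := CV)). change (@zero CV) with (RtoC 0). ring. }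
    rewrite E0. replace (Phi s N - Phi s N - 0)%C with (RtoC 0) by ring. rewrite Cmod_0. lra.
  - rewrite (harm_Chasles s N M K) by lia.
    replace (Phi s (S M) - Phi s N - (csum (harm s (INR N) (INR M)) K + csum (harm s (INR M) (INR (S M))) K))%C
      with ((Phi s M - Phi s N - csum (harm s (INR N) (INR M)) K) + (Phi s (S M) - Phi s M - csum (harm s (INR M) (INR (S M))) K))%C by ring.
    Ctri. rewrite Phi_step by exact Hs.
    pose proof (EMD_harm_bound s M K Hs ltac:(lia) HK Hre).
    replace (INR (S M) - INR N) with (INR M - INR N + 1) by (rewrite S_INR; ring). lra.
Qed.

(** The truncation error of the Fourier expansion is O(1/K) for fixed M, so any bound for the
    harmonics that is uniform in K passes to the limit; no series has to be summed. *)
Lemma Phi_diff_bound (s : C) (N M : nat) (B : R) : s <> 1%C -> (1 <= N <= M)%nat -> -2 <= Re s ->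
  (forall K, sum_n_m (fun k => Cmod s / (PI * INR k) * Cmod (Ik s k (INR N) (INR M))) 1 K <= B) -> Cmod (Phi s M - Phi s N)%C <= B.
Proof.
  intros Hs HNM Hre HB. apply le_epsilon. intros e He.
  assert (HMN : INR N <= INR M) by (apply le_INR; lia).
  set (A := (INR M - INR N) * (Cmod s * Cmod (s + 1)%C * / 4)).
  assert (HA : 0 <= A) by pos.
  destruct (nfloor_ex (A / e) ltac:(pos)) as [k0 [_ Hk]].
  pose proof (Phi_harm s N M (S k0) Hs HNM ltac:(lia) Hre) as H1. specialize (HB (S k0)).
  assert (HK : 0 < INR (S k0)) by pos.
  assert (H2 : (INR M - INR N) * (Cmod s * Cmod (s + 1)%C * (/ 4 * / INR (S k0))) <= e).
  { replace ((INR M - INR N) * (Cmod s * Cmod (s + 1)%C * (/ 4 * / INR (S k0)))) with (A * / INR (S k0)) by (unfold A; ring).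
    apply Rmult_le_reg_r with (INR (S k0)); [lra |]. rewrite Rmult_assoc, Rinv_l by lra. rewrite S_INR.
    apply Rlt_div_l in Hk; lra. }
  assert (H3 : Cmod (csum (harm s (INR N) (INR M)) (S k0)) <= B).
  { eapply Rle_trans; [| exact HB].
    eapply Rle_trans; [apply (Cmod_csum _ (fun i => Cmod s / (PI * INR (S i)) * Cmod (Ik s (S i) (INR N) (INR M)))) |].
    - intros i _. unfold harm. pose proof (PIk_pos (S i) ltac:(lia)). rewrite Cmod_mult, Cmod_div by (apply RtoC_neq0; lra). rewrite Cmod_R, Rabs_pos_eq by lra. apply Rle_refl.
    - right. apply sum_n_m_ext_loc. intros k Hk'. replace (S (pred k)) with k by lia. reflexivity. }
  replace (Phi s M - Phi s N)%C with ((Phi s M - Phi s N - csum (harm s (INR N) (INR M)) (S k0)) + csum (harm s (INR N) (INR M)) (S k0))%C by ring.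
  Ctri. lra.
Qed.

Lemma exp_le (x y : R) : x <= y -> exp x <= exp y.
Proof. intros [H | ->]; [left; apply exp_increasing, H | lra].
Qed.

Lemma inv_sqrt_int (n : nat) : (1 <= n)%nat -> is_RInt (fun x => exp (- (3 / 2) * ln x)) (INR n) (INR (S n)) (2 * exp (- / 2 * ln (INR n)) - 2 * exp (- / 2 * ln (INR (S n)))).
Proof.
  intro Hn. assert (Hn1 : 1 <= INR n) by (apply (le_INR 1); exact Hn).
  set (F := fun x => - 2 * exp (- / 2 * ln x)). replace (2 * exp (- / 2 * ln (INR n)) - 2 * exp (- / 2 * ln (INR (S n)))) with (minus (F (INR (S n))) (F (INR n))) by (unfold F; rsc; ring).
  apply (@is_RInt_derive RV F); rewrite Rmin_left, Rmax_right by (rewrite S_INR; lra); intros x Hx.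
  - unfold F. auto_derive; [lra |]. replace (- (3 / 2) * ln x) with (- / 2 * ln x + - ln x) by field. rewrite exp_plus, exp_Ropp, exp_ln by lra. lra.
  - cts_derive. lra.
Qed.

Lemma EMD_small (s : C) (n : nat) : s <> 1%C -> (1 <= n)%nat -> - / 2 <= Re s ->
  Cmod (EMD s n) <= Cmod s * Cmod (s + 1)%C * (exp (- / 2 * ln (INR n)) - exp (- / 2 * ln (INR (S n)))).
Proof.
  intros Hs Hn Hre. assert (Hn1 : 1 <= INR n) by (apply (le_INR 1); exact Hn). pose proof (Cmod_ge_0 s). pose proof (Cmod_ge_0 (s + 1)%C).
  assert (0 <= Cmod s * Cmod (s + 1)%C) by nra.
  pose proof (@is_RInt_scal RN _ _ _ (Cmod s * Cmod (s + 1)%C * / 2) _ (inv_sqrt_int n Hn)) as HI.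
  eapply Rle_trans; [eapply Cmod_RInt_le; [| | exact (EMD_int s n Hs Hn) | exact HI]; [rewrite S_INR; lra |] |].
  - intros x Hx. rewrite S_INR in Hx. cbv beta. rewrite !Cmod_mult, Cmod_R, Cmod_npow.
    assert (Hsaw : Rabs (saw (x - INR n)) <= / 2) by (unfold saw; rewrite Rabs_pos_eq; nra).
    assert (0 <= ln x) by (rewrite <- ln_1; apply ln_le; lra).
    rewrite Rmult_assoc. rewrite (Rmult_assoc (Cmod s * Cmod (s + 1)%C)).
    apply Rmult_le_compat_l; [lra |]. apply Rmult_le_compat; [pos | left; apply exp_pos | exact Hsaw |].
    apply exp_le. apply Rmult_le_compat_r; [lra |]. destruct s as [a b]; simpl in *. lra.
  - rsc. lra.
Qed.

Lemma Phi_cauchy (s : C) (N M : nat) : s <> 1%C -> (1 <= N <= M)%nat -> - / 2 <= Re s ->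
  Cmod (Phi s M - Phi s N)%C <= Cmod s * Cmod (s + 1)%C * exp (- / 2 * ln (INR N)).
Proof.
  intros Hs [HN HM] Hre. pose proof (Cmod_ge_0 s). pose proof (Cmod_ge_0 (s + 1)%C).
  assert (HA : 0 <= Cmod s * Cmod (s + 1)%C) by nra.
  assert (Hx : Cmod (Phi s M - Phi s N)%C <= Cmod s * Cmod (s + 1)%C * (exp (- / 2 * ln (INR N)) - exp (- / 2 * ln (INR M)))).
  { induction HM as [| M HM IH].
    - rewrite Cmod_minus_0. lra.
    - replace (Phi s (S M) - Phi s N)%C with ((Phi s M - Phi s N) + EMD s M)%C by (rewrite <- (Phi_step s M Hs); ring).
      Ctri. pose proof (EMD_small s M Hs ltac:(lia) Hre). lra. }
  eapply Rle_trans; [exact Hx |]. apply Rmult_le_compat_l; [lra |]. pose proof (exp_pos (- / 2 * ln (INR M))). lra.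
Qed.

Lemma exp_ln_small (a e : R) : 0 < a -> 0 < e -> exists M0, (1 <= M0)%nat /\ forall M, (M0 <= M)%nat -> exp (- a * ln (INR M)) <= e.
Proof.
  intros Ha He. destruct (nfloor_ex (exp (- ln e / a)) ltac:(pos)) as [n [_ Hn]]. exists (S n). split; [lia |]. intros M HM.
  assert (INR n + 1 <= INR M) by (rewrite <- S_INR; apply le_INR; exact HM). pose proof (exp_pos (- ln e / a)).
  assert (K : - ln e / a <= ln (INR M)) by (rewrite <- (ln_exp (- ln e / a)); apply ln_le; lra).
  rewrite <- (exp_ln e He) at 1. apply exp_le. apply -> Rle_div_l in K; lra.
Qed.

Lemma Phi_limit (s : C) : exists p, s <> 1%C -> - / 2 <= Re s -> forall N, (1 <= N)%nat -> Cmod (p - Phi s N)%C <= Cmod s * Cmod (s + 1)%C * exp (- / 2 * ln (INR N)).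
Proof.
  destruct (classic (s <> 1%C /\ - / 2 <= Re s)) as [[Hs Hre] | Hn]; [| exists (RtoC 0); tauto].
  set (A := Cmod s * Cmod (s + 1)%C). assert (HA : 0 <= A) by pos.
  assert (Hsm : forall e, 0 < e -> exists N0, forall n m, (N0 <= n <= m)%nat -> Cmod (Phi s m - Phi s n)%C < e).
  { intros e He. destruct (exp_ln_small (/ 2) (e / (A + 1)) ltac:(lra) ltac:(pos)) as [N0 [HN0 H0]]. exists N0. intros n m Hnm.
    eapply Rle_lt_trans; [apply Phi_cauchy; [pos | lia | exact Hre] |]. fold A. specialize (H0 n ltac:(lia)). apply Rle_div_r in H0; [| lra].
    nra. }
  destruct (proj1 (filterlim_locally_cauchy (U := CV) (F := eventually) (Phi s))) as [p Hp].
  { intro e. destruct (Hsm e (cond_pos e)) as [N0 H0]. exists (fun n => (N0 <= n)%nat). split; [exists N0; auto |]. intros n m Hn Hm.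
    apply (norm_compat1 (V := CV)). rewrite norm_C. destruct (le_lt_dec n m); [| rewrite Cmod_minus_sym]; apply H0; lia. }
  exists p. intros _ _ N HN. apply le_epsilon. intros e He.
  destruct (proj1 (filterlim_locally_ball_norm (U := C_R_NormedModule) _ p) Hp (mkposreal e He)) as [N0 H0]. specialize (H0 (N + N0)%nat ltac:(lia)).
  unfold ball_norm in H0. rewrite norm_C in H0. change (Cmod (Phi s (N + N0) - p)%C < e) in H0. rewrite Cmod_minus_sym in H0.
  pose proof (Cmod_dist_triangle p (Phi s (N + N0)) (Phi s N)). pose proof (Phi_cauchy s N (N + N0) Hs ltac:(lia) Hre). unfold A. lra.
Qed.

(** The limit of [Phi s N], an analytic continuation of zeta to the left. The hypotheses on s sit
    inside the chosen property so that [epsilon] gives a total function. *)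
Definition Psi (s : C) : C := epsilon (inhabits (RtoC 0)) (fun p => s <> 1%C -> - / 2 <= Re s -> forall N, (1 <= N)%nat ->
  Cmod (p - Phi s N)%C <= Cmod s * Cmod (s + 1)%C * exp (- / 2 * ln (INR N))).

Lemma Psi_close (s : C) (N : nat) : s <> 1%C -> (1 <= N)%nat -> - / 2 <= Re s ->
  Cmod (Psi s - Phi s N)%C <= Cmod s * Cmod (s + 1)%C * exp (- / 2 * ln (INR N)).
Proof. intros Hs HN Hre. exact (epsilon_spec _ _ (Phi_limit s) Hs Hre N HN). Qed.

Lemma Psi_lim (s : C) (e : R) : s <> 1%C -> - / 2 <= Re s -> 0 < e -> exists N0, forall N, (N0 <= N)%nat -> Cmod (Psi s - Phi s N)%C <= e.
Proof.
  intros Hs Hre He. set (A := Cmod s * Cmod (s + 1)%C). assert (HA : 0 <= A) by pos.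
  destruct (exp_ln_small (/ 2) (e / (A + 1)) ltac:(lra) ltac:(pos)) as [N0 [HN0 H0]]. exists N0. intros N HN.
  eapply Rle_trans; [apply Psi_close; [pos | lia | exact Hre] |]. fold A. specialize (H0 N HN). apply Rle_div_r in H0; [| lra]. nra.
Qed.

Lemma ex_derive_Cd (f : C -> C) (z : C) : @ex_derive C_AbsRing C_NormedModule f z -> exists l, Cd f z l.
Proof.
  intros [l [_ Hd]]. exists l. intros eps Heps. destruct (Hd z (fun P HP => HP) (mkposreal eps Heps)) as [d Hd'].
  exists d. split; [apply cond_pos |]. intros w Hw. rewrite (Cmult_comm l). apply Hd', Hw.
Qed.

Lemma Phi_holo (M : nat) (s : C) : s <> 1%C -> exists l, Cd (fun s => Phi s M) s l.
Proof.
  intro Hs. assert (Hs1 : (1 - s)%C <> 0%C) by (apply Csub_neq0, not_eq_sym, Hs).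
  assert (H1 : exists l, Cd (fun s => csum (fun i => npow s (INR (S i))) M) s l).
  { induction M as [| M [l IH]]; [exists 0%C; exact (Cd_const 0%C s) |]. eexists. apply (Cd_plus _ _ _ _ _ IH (Cd_npow _ _)). }
  destruct H1 as [l H1]. eexists. apply Cd_minus; [apply Cd_minus; [exact H1 | apply Cd_scal, Cd_npow] |].
  apply Cd_div; [pos | | apply Cd_minus; [apply Cd_const | apply Cd_id]].
  apply (Cd_comp (fun s => s - 1)%C (fun s => npow s (INR M))); [apply Cd_shift | apply Cd_npow].
Qed.

Section Zeta.
Variable zeta : C -> C.
Hypothesis Hz : is_riemann_zeta zeta.

Lemma zeta_partial (s : C) (e : R) : 1 < Re s -> 0 < e ->
  exists M0, forall M, (M0 <= M)%nat -> Cmod (csum (fun i => npow s (INR (S i))) M - zeta s)%C <= e.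
Proof.
  intros Hs He. destruct Hz as [Hz1 _]. specialize (Hz1 s Hs).
  assert (Hloc : @locally C_NormedModule (zeta s) (fun w => Cmod (w - zeta s)%C < e)).
  { apply (@locally_le_locally_norm C_AbsRing C_NormedModule). exists (mkposreal e He). intros w Hw. exact Hw. }
  destruct (Hz1 _ Hloc) as [M0 HM0]. exists (S M0). destruct M as [| M]; [lia |]. left. specialize (HM0 M ltac:(lia)).
  replace (csum (fun i => npow s (INR (S i))) (S M)) with (@sum_n C_AbelianMonoid (fun n => Cexp (- s * RtoC (ln (INR (S n))))%C) M); [pos |].
  clear. induction M as [| M IH]; [rewrite sum_O; cbn [csum]; unfold npow; cring |]. rewrite sum_Sn, IH. reflexivity.
Qed.

Lemma Phi_to_zeta (s : C) (e : R) : 1 < Re s -> 0 < e ->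
  exists M0, forall M, (M0 <= M)%nat -> Cmod (zeta s - Phi s M)%C <= e.
Proof.
  intros Hs He.
  assert (Hs1 : (1 - s)%C <> 0%C) by (intro E; assert (Re (1 - s)%C = 0) by (rewrite E; reflexivity); destruct s as [a b]; simpl in *; lra).
  destruct (zeta_partial s (e / 3) Hs ltac:(lra)) as [M1 H1].
  assert (Hc : 0 < Cmod (1 - s)%C) by (apply Cmod_gt_0; exact Hs1).
  destruct (exp_ln_small (Re s) (e / 3) ltac:(lra) ltac:(lra)) as [M2 [_ H2]].
  destruct (exp_ln_small (Re s - 1) (e / 3 * Cmod (1 - s)%C) ltac:(lra) ltac:(nra)) as [M3 [_ H3]].
  exists (M1 + M2 + M3)%nat. intros M HM. specialize (H1 M ltac:(lia)). specialize (H2 M ltac:(lia)). specialize (H3 M ltac:(lia)).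
  unfold Phi. set (S0 := csum _ M) in *.
  replace (zeta s - (S0 - RtoC (/ 2) * npow s (INR M) - npow (s - 1) (INR M) / (1 - s)))%C with ((zeta s - S0) + RtoC (/ 2) * npow s (INR M) + npow (s - 1) (INR M) / (1 - s))%C by ring.
  Ctri. apply Rle_trans with (e / 3 + e / 3 + e / 3); [| lra].
  apply Rplus_le_compat; [eapply Rle_trans; [apply Cmod_triangle |]; apply Rplus_le_compat |].
  - rewrite Cmod_minus_sym. exact H1.
  - rewrite Cmod_mult, Cmod_npow. rewrite Cmod_R, Rabs_pos_eq by lra. lra.
  - rewrite Cmod_div by exact Hs1. rewrite Cmod_npow. apply Rle_div_l; pos.
Qed.

Lemma zeta_holo (c : C) (rad : R) : rad <= Rabs (Im c) -> holo zeta c rad.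
Proof.
  intros Hc z Hzc. apply ex_derive_Cd, (proj2 Hz). intros ->.
  pose proof (im_le_Cmod (1 - c)%C) as K. replace (Im (1 - c)%C) with (- Im c) in K by (destruct c; simpl; ring). rewrite Rabs_Ropp in K. lra.
Qed.

(** Identity theorem on the disc of radius 1.9 about 3/2 + i Im s: it contains s, stays in Re z >
    -1/2 and off the pole, and its inner disc of radius 0.4 lies in Re z > 1, where both functions
    are the limit of [Phi]. *)
Lemma zeta_Psi (s : C) : 3 <= Rabs (Im s) -> -0.35 <= Re s <= 3 -> zeta s = Psi s.
Proof.
  intros Him Hre. set (c := ((3 / 2, Im s) : C)).
  assert (Hne : forall z, Cmod (z - c)%C < 1.95 -> z <> 1%C /\ - / 2 <= Re z).
  { split.
    - intros ->. pose proof (im_le_Cmod (1 - c)%C) as K. replace (Im (1 - c)%C) with (- Im s) in K by (unfold c; simpl; ring). rewrite Rabs_Ropp in K. lra.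
    - pose proof (re_le_Cmod (z - c)%C) as K. apply Rabs_le_between in K. unfold c in *; destruct z as [a b]; simpl in K |- *. lra. }
  assert (HzR : holo zeta c 1.95) by (apply zeta_holo; unfold c; simpl; lra).
  set (A := (4 + Cmod c) * (4 + Cmod c)).
  assert (HP : holo Psi c 1.9).
  { apply (holo_uniform_limit (fun n s => Phi s (S n)) Psi c 1.95 1.9 (fun n => A * exp (- / 2 * ln (INR (S n))))); [lra | | |].
    - intros n z Hzc. apply Phi_holo. apply Hne, Hzc.
    - intros n z Hzc. destruct (Hne z ltac:(lra)) as [N1 N2]. rewrite Cmod_minus_sym. eapply Rle_trans; [apply Psi_close; [pos | lia | exact N2] |].
      apply Rmult_le_compat_r; [pos |].
      assert (Hm : Cmod z <= 2 + Cmod c) by (replace z with ((z - c) + c)%C by ring; eapply Rle_trans; [apply Cmod_triangle | lra]).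
      assert (Cmod (z + 1)%C <= Cmod z + 1) by (eapply Rle_trans; [apply Cmod_triangle | rewrite Cmod_1; lra]).
      pose proof (Cmod_ge_0 z). pose proof (Cmod_ge_0 (z + 1)%C). apply Rmult_le_compat; lra.
    - intros e He. assert (HA : 0 < A) by (unfold A; pose proof (Cmod_ge_0 c); nra).
      destruct (exp_ln_small (/ 2) (e / A) ltac:(lra) ltac:(pos)) as [N0 [_ H0]]. exists N0. specialize (H0 (S N0) ltac:(lia)). apply Rle_div_r in H0; lra. }
  assert (HD : forall z, Cmod (z - c)%C < 1.9 -> (zeta z - Psi z)%C = 0%C).
  { apply (holo_identity (fun z => zeta z - Psi z)%C c 1.9 0.4); [| lra |].
    - intros z Hzc. destruct (HzR z ltac:(lra)) as [l1 L1]. destruct (HP z Hzc) as [l2 L2]. eexists. apply Cd_minus; eassumption.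
    - intros z Hzc. destruct (Hne z ltac:(lra)) as [N1 N2].
      assert (Hz1 : 1 < Re z) by (pose proof (re_le_Cmod (z - c)%C) as K; apply Rabs_le_between in K; unfold c in Hzc, K; destruct z as [a b]; simpl in K |- *; lra).
      assert (E : zeta z = Psi z); [| rewrite E; ring].
      apply (Cmod_eq_eps _ _ 2). intros e He.
      destruct (Phi_to_zeta z e Hz1 He) as [M0 HM0].
      destruct (Psi_lim z e N1 N2 He) as [N0 H0]. specialize (HM0 (N0 + M0)%nat ltac:(lia)). specialize (H0 (N0 + M0)%nat ltac:(lia)).
      rewrite Cmod_minus_sym in H0. pose proof (Cmod_dist_triangle (zeta z) (Phi z (N0 + M0)) (Psi z)). lra. }
  assert (Hs : Cmod (s - c)%C < 1.9).
  { replace (s - c)%C with (RtoC (Re s - 3 / 2)) by (unfold c; destruct s as [a b]; unfold Cminus, Cplus, Copp, RtoC; simpl; apply injective_projections; simpl; ring).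
    rewrite Cmod_R. apply Rabs_def1; lra. }
  specialize (HD s Hs). replace (zeta s) with ((zeta s - Psi s) + Psi s)%C by ring. rewrite HD. ring.
Qed.

Lemma zeta_Phi_bound (s : C) (N M0 : nat) (B : R) : 3 <= Rabs (Im s) -> -0.35 <= Re s <= 3 -> (1 <= N)%nat ->
  (forall M, (N <= M)%nat -> (M0 <= M)%nat -> Cmod (Phi s M - Phi s N)%C <= B) -> Cmod (zeta s - Phi s N)%C <= B.
Proof.
  intros Him Hre HN HB. rewrite (zeta_Psi s Him Hre). apply le_epsilon. intros e He.
  assert (Hs : s <> 1%C) by (intros ->; simpl in Him; rewrite Rabs_R0 in Him; lra).
  destruct (Psi_lim s e Hs ltac:(lra) He) as [N0 H0]. specialize (H0 (N0 + (N + M0))%nat ltac:(lia)). specialize (HB (N0 + (N + M0))%nat ltac:(lia) ltac:(lia)).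
  pose proof (Cmod_dist_triangle (Psi s) (Phi s (N0 + (N + M0))) (Phi s N)). lra.
Qed.

(** * Oscillatory integrals *)

Lemma rp_plus (a b x : R) : rp (a + b) x = rp a x * rp b x.
Proof. unfold rp. rewrite <- exp_plus. f_equal. ring. Qed.

Lemma rp_1 (x : R) : 0 < x -> rp 1 x = x.
Proof. intro H. unfold rp. rewrite Rmult_1_l, exp_ln; lra. Qed.

Lemma rp_m1 (x : R) : 0 < x -> rp (-1) x = / x.
Proof. intro H. unfold rp. replace (-1 * ln x) with (- ln x) by ring. rewrite exp_Ropp, exp_ln; lra. Qed.

Lemma rp_mult (a x y : R) : 0 < x -> 0 < y -> rp a (x * y) = rp a x * rp a y.
Proof. intros Hx Hy. unfold rp. rewrite ln_mult, <- exp_plus by assumption. f_equal. ring. Qed.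

Lemma rp_le (a b x : R) : 1 <= x -> a <= b -> rp a x <= rp b x.
Proof. intros Hx Hab. apply exp_le, Rmult_le_compat_r; [rewrite <- ln_1; apply ln_le; lra | lra].
Qed.

Lemma rp_mono (a x y : R) : 0 <= a -> 0 < x <= y -> rp a x <= rp a y.
Proof. intros Ha Hx. apply exp_le, Rmult_le_compat_l; [lra | apply ln_le; lra].
Qed.

Lemma rp_anti (a x y : R) : a <= 0 -> 0 < x <= y -> rp a y <= rp a x.
Proof. intros Ha Hx. apply exp_le. assert (ln x <= ln y) by (apply ln_le; lra). nra. Qed.

Lemma is_derive_rp (a x : R) : 0 < x -> is_derive (rp a) x (a * rp (a - 1) x).
Proof.
  intro Hx. unfold rp. auto_derive; [lra |]. replace ((a - 1) * ln x) with (a * ln x + - ln x) by ring. rewrite exp_plus, exp_Ropp, exp_ln by exact Hx. lra.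
Qed.

Definition oscg (q T sg x : R) : C := (RtoC (rp (- sg - 1) x) * cis (q * x - T * ln x))%C.
Notation Jo q T sg := (@RInt CV (oscg q T sg)).

Definition Gq (q T sg x : R) : R := rp (- sg) x / (q * x - T).

Lemma rp_pred (a x : R) : 0 < x -> rp a x = rp (a - 1) x * x.
Proof. intro H. rewrite <- (rp_1 x H) at 3. rewrite <- rp_plus. f_equal. ring. Qed.

Lemma is_derive_Gq (q T sg x : R) : 0 < x -> q * x - T <> 0 ->
  is_derive (Gq q T sg) x (rp (- sg - 1) x * - (sg * (q * x - T) + q * x) / (q * x - T) ^ 2).
Proof.
  intros Hx Hu. evar_last; [exact (is_derive_div (rp (- sg)) (fun x => q * x - T) x _ q (is_derive_rp (- sg) x Hx) ltac:(auto_derive; lra) Hu) |].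
  rewrite (rp_pred (- sg)) by exact Hx. lra.
Qed.

Lemma continuous_rp (a x : R) : 0 < x -> continuous (rp a) x.
Proof. intro H. apply derive_cts. eexists. apply is_derive_rp, H. Qed.

Lemma is_derive_cis_comp (f : R -> R) (x l : R) : is_derive f x l -> CDer (fun x => cis (f x)) x (RtoC l * (Ci * cis (f x)))%C.
Proof.
  intro H. apply is_derive_C_pair; (evar_last; [first [exact (is_derive_comp cos f x _ l (is_derive_cos _) H) | exact (is_derive_comp sin f x _ l (is_derive_sin _) H)] | rsc; ring]).
Qed.

Lemma continuous_cis_phase (q T x : R) : 0 < x -> Cont (fun x => cis (q * x - T * ln x)) x.
Proof.
  intro Hx. apply (@ex_derive_continuous R_AbsRing CV). eexists. apply (is_derive_cis_comp (fun x => q * x - T * ln x) x (q - T * / x)). auto_derive; lra.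
Qed.

Lemma continuous_oscg (q T sg x : R) : 0 < x -> Cont (oscg q T sg) x.
Proof. intro H. apply continuous_C_mult; [apply continuous_RtoC, continuous_rp, H | apply continuous_cis_phase, H]. Qed.

Lemma ex_RInt_oscg (q T sg a b : R) : 0 < a -> a <= b -> @ex_RInt CV (oscg q T sg) a b.
Proof.
  intros Ha Hab. apply ex_RInt_C_cts. rewrite Rmin_left, Rmax_right by lra. intros x Hx. apply continuous_oscg. lra.
Qed.

(* First-derivative test: [oscg = -i G (e^{i phi})'] with [G = Gq] monotone on the interval. *)
Lemma osc_piece (q T sg a b e : R) : 0 < a -> a <= b -> (forall x, a <= x <= b -> q * x - T <> 0) -> e = 1 \/ e = -1 ->
  (forall x, a <= x <= b -> 0 <= e * - (sg * (q * x - T) + q * x)) ->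
  Cmod (Jo q T sg a b) <= Rabs (Gq q T sg a) + Rabs (Gq q T sg b) + e * (Gq q T sg b - Gq q T sg a).
Proof.
  intros Ha Hab Hu He Hsg.
  set (G := Gq q T sg). set (G1 := fun x => rp (- sg - 1) x * - (sg * (q * x - T) + q * x) / (q * x - T) ^ 2).
  set (E := fun x => cis (q * x - T * ln x)).
  assert (HG : forall x, a <= x <= b -> is_derive G x (G1 x)) by (intros x Hx; apply is_derive_Gq; [lra | apply Hu; exact Hx]).
  assert (HG1c : forall x, a <= x <= b -> continuous G1 x).
  { intros x Hx. apply (continuous_mult (fun x => rp (- sg - 1) x * - (sg * (q * x - T) + q * x)) (fun x => / (q * x - T) ^ 2)).
    - apply (continuous_mult (rp (- sg - 1)) (fun x => - (sg * (q * x - T) + q * x))); [apply continuous_rp; lra | cts_derive].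
    - cts_derive. specialize (Hu x Hx). nra. }
  assert (HE : forall x, a <= x <= b -> CDer E x (RtoC ((q * x - T) / x) * (Ci * E x))%C).
  { intros x Hx. apply (is_derive_cis_comp (fun x => q * x - T * ln x)). auto_derive; [lra |]. field. lra. }
  assert (HGE : CInt (fun x => RtoC (G1 x) * E x + Ci * oscg q T sg x)%C a b (RtoC (G b) * E b - RtoC (G a) * E a)%C).
  { apply (@is_RInt_derive CV (fun x => RtoC (G x) * E x)%C).
    - rewrite Rmin_left, Rmax_right by lra. intros x Hx.
      evar_last; [exact (is_derive_C_mul _ _ _ _ _ (is_derive_RtoC G x (G1 x) (HG x Hx)) (HE x Hx)) |].
      unfold oscg. fold (E x). assert (EG : G x * ((q * x - T) / x) = rp (- sg - 1) x).
      { unfold G, Gq. rewrite (rp_pred (- sg)) by lra. field. split; [lra | apply Hu; exact Hx]. }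
      rewrite <- EG, RtoC_mult. cring.
    - rewrite Rmin_left, Rmax_right by lra. intros x Hx. apply (@continuous_plus R_UniformSpace R_AbsRing CV).
      + apply continuous_C_mult; [apply continuous_RtoC, HG1c, Hx | apply continuous_cis_phase; lra].
      + apply continuous_C_mult; [apply continuous_const | apply continuous_oscg; lra]. }
  pose proof (RInt_correct (V := CV) _ _ _ (ex_RInt_oscg q T sg a b Ha Hab)) as HJ. set (J := Jo q T sg a b) in *.
  pose proof (@is_RInt_minus CV _ _ _ _ _ _ HGE (is_RInt_C_mult Ci _ _ _ _ HJ)) as HD.
  assert (HI : is_RInt (fun x => e * G1 x) a b (e * (G b - G a))).
  { apply (@is_RInt_scal RN G1). apply (@is_RInt_derive RV G); rewrite Rmin_left, Rmax_right by lra; pos. }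
  assert (HB : Cmod (RtoC (G b) * E b - RtoC (G a) * E a - Ci * J)%C <= e * (G b - G a)).
  { eapply (Cmod_RInt_le _ _ a b); [lra | | exact HD | exact HI]. intros x Hx.
    change (Cmod (RtoC (G1 x) * E x + Ci * oscg q T sg x - Ci * oscg q T sg x)%C <= e * G1 x).
    replace (RtoC (G1 x) * E x + Ci * oscg q T sg x - Ci * oscg q T sg x)%C with (RtoC (G1 x) * E x)%C by ring.
    rewrite Cmod_mult, Cmod_R. unfold E. rewrite Cmod_cis, Rmult_1_r.
    assert (Hp : 0 <= e * G1 x).
    { specialize (Hsg x Hx). specialize (Hu x Hx). pose proof (rp_pos (- sg - 1) x) as Hr.
      replace (e * G1 x) with (rp (- sg - 1) x * (e * - (sg * (q * x - T) + q * x)) / (q * x - T) ^ 2) by (unfold G1; field; exact Hu).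
      apply Rdiv_le_0_compat; nra. }
    destruct He as [-> | ->]; [rewrite Rabs_pos_eq; lra | rewrite Rabs_left1; lra]. }
  assert (HEm : forall x, Cmod (E x) = 1) by (intro; apply Cmod_cis).
  replace (Cmod J) with (Cmod (Ci * J)%C) by (rewrite Cmod_mult, Cmod_Ci; ring).
  replace (Ci * J)%C with ((RtoC (G b) * E b - RtoC (G a) * E a) - (RtoC (G b) * E b - RtoC (G a) * E a - Ci * J))%C by ring.
  eapply Rle_trans; [apply Cmod_minus_le |]. apply Rplus_le_compat; [| lra].
  eapply Rle_trans; [apply Cmod_minus_le |]. rewrite !Cmod_mult, !Cmod_R, !HEm. lra.
Qed.

Lemma osc_right (q T sg a b : R) : 0 < q -> 0 < T -> -1 <= sg -> 0 < a -> a <= b -> T < q * a ->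
  Cmod (Jo q T sg a b) <= 2 * (rp (- sg) a / (q * a - T)).
Proof.
  intros Hq HT Hsg Ha Hab Hqa.
  eapply Rle_trans; [apply (osc_piece q T sg a b (-1)); [lra | lra | intros; nra | right; reflexivity | intros x Hx; assert (q * a <= q * x) by nra; nra] |].
  assert (Ga : 0 < Gq q T sg a) by pos.
  assert (Gb : 0 < Gq q T sg b) by (unfold Gq; apply Rdiv_lt_0_compat; [pos | nra]).
  rewrite !Rabs_pos_eq by lra. fold (Gq q T sg a). lra.
Qed.

Lemma RInt_oscg_Chasles (q T sg a b c : R) : 0 < a -> a <= b -> b <= c -> Jo q T sg a c = (Jo q T sg a b + Jo q T sg b c)%C.
Proof. symmetry. apply (RInt_Chasles (V := CV)); apply ex_RInt_oscg; lra.
Qed.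

Lemma osc_below (q T sg a b e : R) : 0 < a -> a <= b -> (forall x, a <= x <= b -> q * x < T) -> e = 1 \/ e = -1 ->
  (forall x, a <= x <= b -> 0 <= e * (sg * T - (1 + sg) * q * x)) ->
  Cmod (Jo q T sg a b) <= (1 + e) * (rp (- sg) a / (T - q * a)) + (1 - e) * (rp (- sg) b / (T - q * b)).
Proof.
  intros Ha Hab Hu He Hsg.
  eapply Rle_trans; [apply (osc_piece q T sg a b e); try assumption; intros x Hx; specialize (Hu x Hx); specialize (Hsg x Hx); lra |].
  assert (Gn : forall x, a <= x <= b -> Gq q T sg x = - (rp (- sg) x / (T - q * x)) /\ 0 < rp (- sg) x / (T - q * x)).
  { intros x Hx. specialize (Hu x Hx). split; [unfold Gq; field; lra | pos]. }
  destruct (Gn a ltac:(lra)) as [-> P1]. destruct (Gn b ltac:(lra)) as [-> P2]. rewrite !Rabs_Ropp, !Rabs_pos_eq by lra. lra.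
Qed.

(** Left of the stationary point the amplitude quotient changes monotonicity at most once, at xs;
    splitting there gives one boundary term from each end. *)
Lemma osc_left (q T sg a b : R) : 0 < q -> 0 < T -> -1 < sg -> 0 < a -> a <= b -> q * b < T ->
  Cmod (Jo q T sg a b) <= 2 * (rp (- sg) a / (T - q * a)) + 2 * (rp (- sg) b / (T - q * b)).
Proof.
  intros Hq HT Hsg Ha Hab Hqb.
  assert (P : forall x, a <= x <= b -> q * x < T /\ 0 < rp (- sg) x / (T - q * x)).
  { intros x Hx. assert (q * x < T) by nra. split; pos. }
  pose proof (P a ltac:(lra)). pose proof (P b ltac:(lra)).
  set (xs := sg * T / ((1 + sg) * q)). assert (Hd : 0 < (1 + sg) * q) by nra.
  assert (Exs : sg * T = (1 + sg) * q * xs) by (unfold xs; field; lra).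
  assert (Left : forall y, a <= y <= b -> y <= xs -> Cmod (Jo q T sg a y) <= 2 * (rp (- sg) a / (T - q * a))).
  { intros y Hy Hys. eapply Rle_trans; [apply (osc_below q T sg a y 1); [lra | lra | intros; apply P; lra | lra | rewrite Exs; intros; nra] | lra]. }
  assert (Right : forall y, a <= y <= b -> xs <= y -> Cmod (Jo q T sg y b) <= 2 * (rp (- sg) b / (T - q * b))).
  { intros y Hy Hys. eapply Rle_trans; [apply (osc_below q T sg y b (-1)); [lra | lra | intros; apply P; lra | lra | rewrite Exs; intros; nra] | lra]. }
  destruct (Rle_dec b xs) as [Hc | Hc]; [pose proof (Left b ltac:(lra) Hc); lra |].
  destruct (Rle_dec xs a) as [Hc' | Hc']; [pose proof (Right a ltac:(lra) Hc'); lra |].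
  rewrite (RInt_oscg_Chasles q T sg a xs b) by lra. Ctri.
  pose proof (Left xs ltac:(lra) ltac:(lra)). pose proof (Right xs ltac:(lra) ltac:(lra)). lra.
Qed.

(** The phase has no stationary point. For sg < 0 the amplitude quotient has its maximum at xs, and
    sg >= -1/2 gives xs <= T / p; this accounts for the extra term. *)
Lemma osc_minus (p T sg a b : R) : 0 < p -> 0 < T -> - / 2 <= sg -> 0 < a -> a <= b ->
  Cmod (Jo (- p) T sg a b) <= 2 * (rp (- sg) a / (p * a + T)) + (if Rlt_dec (p * a) T then 4 * (rp (- sg) (T / p) / T) else 0).
Proof.
  intros Hp HT Hsg Ha Hab.
  set (xs := - sg * T / ((1 + sg) * p)). assert (Hd : 0 < (1 + sg) * p) by nra.
  assert (Exs : sg * T = (1 + sg) * - p * xs) by (unfold xs; field; lra).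
  assert (Inc : forall y, a <= y <= b -> xs <= y -> Cmod (Jo (- p) T sg y b) <= 2 * (rp (- sg) y / (p * y + T))).
  { intros y Hy Hys. eapply Rle_trans; [apply (osc_below (- p) T sg y b 1); [lra | lra | intros; nra | lra | rewrite Exs; intros; nra] |].
    replace (T - - p * y) with (p * y + T) by ring. lra. }
  assert (Pa : 0 < rp (- sg) a / (p * a + T)) by (apply Rdiv_lt_0_compat; [pos | nra]).
  assert (P0 : 0 < rp (- sg) (T / p) / T) by pos.
  destruct (Rle_dec xs a) as [Hc | Hc]; [pose proof (Inc a ltac:(lra) Hc); destruct Rlt_dec; lra |].
  assert (Hs0 : sg < 0) by nra.
  destruct (Rlt_dec (p * a) T) as [Hl | Hl]; [| nra].
  assert (Hbd : forall y, a <= y <= xs -> rp (- sg) y / (p * y + T) <= rp (- sg) (T / p) / T).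
  { intros y Hy. assert (0 < p * y) by nra. assert (Hyp : y <= T / p) by (apply Rle_div_r; nra).
    pose proof (rp_mono (- sg) y (T / p) ltac:(lra) ltac:(lra)). pose proof (rp_pos (- sg) y).
    apply Rmult_le_compat; [lra | pos | lra | apply Rinv_le_contravar; lra]. }
  assert (Dec : forall y, a <= y <= b -> y <= xs -> Cmod (Jo (- p) T sg a y) <= 2 * (rp (- sg) y / (p * y + T))).
  { intros y Hy Hys. eapply Rle_trans; [apply (osc_below (- p) T sg a y (-1)); [lra | lra | intros; nra | lra | rewrite Exs; intros; nra] |].
    replace (T - - p * y) with (p * y + T) by ring. lra. }
  destruct (Rle_dec b xs) as [Hb | Hb].
  - pose proof (Dec b ltac:(lra) Hb). pose proof (Hbd b ltac:(lra)). lra.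
  - rewrite (RInt_oscg_Chasles (- p) T sg a xs b) by lra. Ctri.
    pose proof (Dec xs ltac:(lra) ltac:(lra)). pose proof (Inc xs ltac:(lra) ltac:(lra)). pose proof (Hbd xs ltac:(lra)). lra.
Qed.

(* Near the stationary point [T/q] the integral is bounded trivially on [(1 - d, 1 + d) T/q]. *)
Lemma osc_plus (q T sg d a b : R) : 0 < q -> 0 < T -> - / 2 <= sg <= 2 -> 0 < d < 1 -> 0 < a -> a <= b -> (1 + d) * (T / q) <= b ->
  Cmod (Jo q T sg a b) <= rp (- sg) (T / q) * (/ (1 - d) ^ 3 * (2 * d + 4 / (T * d)))
    + (if Rlt_dec (q * a) (T * (1 - d)) then 2 * (rp (- sg) a / (T - q * a)) else 0).
Proof.
  intros Hq HT Hsg Hd Ha Hab Hb. set (x0 := T / q) in *. assert (Hx0 : 0 < x0) by pos.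
  assert (Eq : q * x0 = T) by (unfold x0; field; lra).
  set (A := x0 * (1 - d)). set (B := x0 * (1 + d)). assert (HA0 : 0 < A) by pos. assert (HAB : A < B) by (unfold A, B; nra).
  assert (EqA : q * A = T * (1 - d)) by (unfold A; rewrite <- Eq; ring). assert (EqB : q * B = T * (1 + d)) by (unfold B; rewrite <- Eq; ring).
  set (R0 := rp (- sg) x0). assert (HR0 : 0 < R0) by apply rp_pos.
  assert (Hln2 : 0 <= ln (1 + d) <= - ln (1 - d)).
  { split; [rewrite <- ln_1; apply ln_le; lra |]. assert (H : ln ((1 + d) * (1 - d)) <= ln 1) by (apply ln_le; nra). rewrite ln_mult, ln_1 in H by lra. lra. }
  (* Since sg <= 2, the exponents -sg and -sg - 1 are at least -3, so (1 - d)^(-3) bounds the change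
     of the amplitude across the window. *)
  set (k3 := / (1 - d) ^ 3). assert (Ek3 : k3 = exp (- 3 * ln (1 - d))).
  { unfold k3. rewrite <- (Rpower_pow 3) by lra. unfold Rpower. rewrite <- exp_Ropp. f_equal. simpl. ring. }
  assert (Hk3 : 0 < k3) by pos.
  assert (RA : rp (- sg) A <= R0 * k3).
  { unfold A. rewrite rp_mult by lra. apply Rmult_le_compat_l; [lra |]. rewrite Ek3. apply exp_le. nra. }
  assert (RB : rp (- sg) B <= R0 * k3).
  { unfold B. rewrite rp_mult by lra. apply Rmult_le_compat_l; [lra |]. rewrite Ek3. apply exp_le. nra. }
  assert (Rmid : forall x, A <= x -> x0 * rp (- sg - 1) x <= R0 * k3).
  { intros x Hx. apply Rle_trans with (x0 * rp (- sg - 1) A); [apply Rmult_le_compat_l; [lra | apply rp_anti; lra] |].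
    unfold A. rewrite rp_mult by lra. replace (x0 * (rp (- sg - 1) x0 * rp (- sg - 1) (1 - d))) with (R0 * rp (- sg - 1) (1 - d)).
    - apply Rmult_le_compat_l; [lra |]. rewrite Ek3. apply exp_le. nra.
    - unfold R0. rewrite (rp_pred (- sg)) by lra. ring. }
  assert (HTd : 0 < T * d) by nra.
  set (c1 := Rmax a A). set (c2 := Rmax a B).
  assert (Hc : a <= c1 /\ A <= c1 <= c2 /\ B <= c2 <= b /\ c2 - c1 <= 2 * d * x0).
  { unfold c1, c2, Rmax. repeat destruct Rle_dec; unfold A, B in *; nra. }
  rewrite (RInt_oscg_Chasles q T sg a c1 b), (RInt_oscg_Chasles q T sg c1 c2 b) by lra.
  Ctri.
  assert (M1 : Cmod (Jo q T sg c1 c2) <= R0 * k3 * (2 * d)).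
  { assert (M1 : Cmod (Jo q T sg c1 c2) <= R0 * k3 / x0 * (c2 - c1)).
    { eapply Cmod_RInt_le_const; [lra | | apply (RInt_correct (V := CV)), ex_RInt_oscg; lra].
      intros x Hx. unfold oscg. rewrite Cmod_mult, Cmod_cis, Cmod_R, Rmult_1_r, Rabs_pos_eq by pos.
      apply Rmult_le_reg_l with x0; [lra |]. replace (x0 * (R0 * k3 / x0)) with (R0 * k3) by (field; lra). apply Rmid. lra. }
    eapply Rle_trans; [exact M1 |]. apply Rle_trans with (R0 * k3 / x0 * (2 * d * x0)); [apply Rmult_le_compat_l; pos | right; field; lra]. }
  assert (M2 : Cmod (Jo q T sg c2 b) <= R0 * k3 * (2 / (T * d))).
  { assert (Hqc : q * B <= q * c2) by nra.
    assert (M2 : forall y, B <= y -> rp (- sg) y / (q * y - T) <= rp (- sg) B / (q * B - T)).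
    { intros y Hy. assert (q * B <= q * y) by nra.
      rewrite (rp_pred _ y), (rp_pred _ B), EqB by lra. replace (T * (1 + d) - T) with (T * d) by ring. apply Rle_div_l; [lra |].
      replace (rp (- sg - 1) B * B / (T * d) * (q * y - T)) with (rp (- sg - 1) B * (B * (q * y - T) / (T * d))) by lra.
      apply Rmult_le_compat; [pos | lra | apply rp_anti; lra | apply Rle_div_r; [lra |]]. nra. }
    eapply Rle_trans; [apply (osc_right q T sg c2 b); lra |]. specialize (M2 c2 ltac:(lra)). rewrite EqB in M2.
    replace (T * (1 + d) - T) with (T * d) in M2 by ring.
    apply Rle_trans with (2 * (rp (- sg) B / (T * d))); [lra |].
    replace (R0 * k3 * (2 / (T * d))) with (2 * (R0 * k3 / (T * d))) by lra. apply Rmult_le_compat_l; [lra |].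
    apply Rmult_le_compat_r; pos. }
  assert (M0 : Cmod (Jo q T sg a c1) <= R0 * k3 * (2 / (T * d)) + (if Rlt_dec (q * a) (T * (1 - d)) then 2 * (rp (- sg) a / (T - q * a)) else 0)).
  { destruct (Rlt_dec (q * a) (T * (1 - d))) as [Hl | Hl].
    - assert (HaA : a < A) by nra. unfold c1. rewrite Rmax_right by lra.
      eapply Rle_trans; [apply (osc_left q T sg a A); nra |]. rewrite EqA. replace (T - T * (1 - d)) with (T * d) by ring.
      assert (2 * (rp (- sg) A / (T * d)) <= R0 * k3 * (2 / (T * d))); [| lra].
      replace (R0 * k3 * (2 / (T * d))) with (2 * (R0 * k3 / (T * d))) by lra. apply Rmult_le_compat_l; [lra |].
      apply Rmult_le_compat_r; pos.
    - assert (HaA : A <= a) by nra. unfold c1. rewrite Rmax_left by lra. rewrite (RInt_point (V := CV)). change (@zero CV) with (RtoC 0). rewrite Cmod_0.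
      pos. }
  pose proof (Cmod_triangle (Jo q T sg c1 c2) (Jo q T sg c2 b)) as M3. lra.
Qed.

Lemma Ik_osc (s : C) (k : nat) (a b : R) : 0 < a -> a <= b ->
  Cmod (Ik s k a b) <= / 2 * (Cmod (@RInt CV (oscg (2 * PI * INR k) (Im s) (Re s)) a b) + Cmod (@RInt CV (oscg (- (2 * PI * INR k)) (Im s) (Re s)) a b)).
Proof.
  intros Ha Hab. set (q := 2 * PI * INR k).
  pose proof (RInt_correct (V := CV) _ _ _ (ex_RInt_oscg q (Im s) (Re s) a b Ha Hab)) as H1.
  pose proof (RInt_correct (V := CV) _ _ _ (ex_RInt_oscg (- q) (Im s) (Re s) a b Ha Hab)) as H2.
  set (J1 := @RInt CV (oscg q (Im s) (Re s)) a b) in *. set (J2 := @RInt CV (oscg (- q) (Im s) (Re s)) a b) in *.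
  pose proof (is_RInt_C_mult (- RtoC (/ 2) * Ci)%C _ _ _ _ (@is_RInt_minus CV _ _ _ _ _ _ H1 H2)) as H3.
  assert (E : Ik s k a b = (- RtoC (/ 2) * Ci * (J1 - J2))%C).
  { apply (is_RInt_unique (V := CV)). revert H3. apply (@is_RInt_ext CV). intros x Hx.
    match goal with |- ?v = _ => change v with (- RtoC (/ 2) * Ci * (oscg q (Im s) (Re s) x - oscg (- q) (Im s) (Re s) x))%C end.
    unfold oscf, oscg. fold q. unfold npow. rewrite Cexp_cis. unfold rp.
    replace (Re (- (s + 1) * ln x)%C) with ((- Re s - 1) * ln x) by (destruct s; simpl; ring).
    replace (Im (- (s + 1) * ln x)%C) with (- (Im s * ln x)) by (destruct s; simpl; ring).
    unfold cis. replace (q * x - Im s * ln x) with (q * x + - (Im s * ln x)) by ring. replace (- q * x - Im s * ln x) with (- (q * x) + - (Im s * ln x)) by ring.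
    rewrite !cos_plus, !sin_plus, !cos_neg, !sin_neg. apply injective_projections; simpl; field. }
  rewrite E, !Cmod_mult, Cmod_opp, Cmod_R, Cmod_Ci, Rmult_1_r, Rabs_pos_eq by lra. apply Rmult_le_compat_l; [lra | apply Cmod_minus_le].
Qed.

(** * An explicit bound for zeta *)

Definition HN (n : nat) : R := sum_n_m (fun k => / INR k) 1 n.

Lemma HN_S (n : nat) : HN (S n) = HN n + / INR (S n).
Proof. unfold HN. rewrite sum_n_Sm by lia. reflexivity. Qed.

Lemma HN_0 : HN 0 = 0. Proof. reflexivity.
Qed.

Lemma sum_rev (f : nat -> R) (n : nat) : sum_n_m (fun k => f (n + 1 - k)%nat) 1 n = sum_n_m f 1 n.
Proof.
  induction n as [| n IH]; [rewrite !sum_n_m_zero by lia; reflexivity |].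
  rewrite (sum_n_Sm f) by lia. rewrite <- IH. rewrite sum_Sn_m by lia. rewrite <- sum_n_m_S. rewrite Rplus_comm. replace (S n + 1 - 1)%nat with (S n) by lia. reflexivity.
Qed.

Lemma HN_le_ln (n : nat) : (1 <= n)%nat -> HN n <= 1 + ln (INR n).
Proof.
  intro Hn. induction Hn as [| n Hn IH].
  - rewrite HN_S, HN_0. simpl INR. rewrite ln_1, Rinv_1. lra.
  - rewrite HN_S. assert (1 <= INR n) by (apply (le_INR 1); exact Hn). rewrite S_INR. assert (/ (INR n + 1) <= ln (INR n + 1) - ln (INR n)); [| lra].
    pose proof (exp_ineq1_le (- / (INR n + 1))). assert (E : (INR n + 1) * / (INR n + 1) = 1) by (field; lra).
    assert (K : ln (INR n) <= ln ((INR n + 1) * exp (- / (INR n + 1)))) by (apply ln_le; nra).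
    rewrite ln_mult, ln_exp in K by pos. lra.
Qed.

(* Boundary terms of the integrals with the phases [+ 2 pi k x] and [- 2 pi k x]; the former is stationary inside the range only if [k <= m + 1]. *)
Definition ep (m k : nat) : R :=
  if (k <? m)%nat then / INR k + / INR (m - k) else if (k =? m)%nat then / INR m + 4 else if (k =? S m)%nat then 0 else / INR (k - S m) - / INR k.

Definition em (m k : nat) : R := / INR k - / INR (k + S m).

Lemma inv_INR_pos (n : nat) : (1 <= n)%nat -> 0 < / INR n.
Proof. intro. apply Rinv_0_lt_compat, lt_0_INR. lia. Qed.

Lemma HN_mono (a b : nat) : (a <= b)%nat -> HN a <= HN b.
Proof. intro H. induction H as [| b H IH]; [lra |]. rewrite HN_S. pose proof (inv_INR_pos (S b) ltac:(lia)). lra. Qed.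

Ltac nat_cases := repeat match goal with |- context [(?a <? ?b)%nat] => destruct (Nat.ltb_spec a b) | |- context [(?a =? ?b)%nat] => destruct (Nat.eqb_spec a b) end; try lia.

Lemma ep_nonneg (m k : nat) : (1 <= m)%nat -> (1 <= k)%nat -> 0 <= ep m k.
Proof.
  intros Hm Hk. unfold ep. pose proof (inv_INR_pos k Hk). nat_cases.
  - pose proof (inv_INR_pos (m - k) ltac:(lia)). lra.
  - subst. lra.
  - lra.
  - assert (/ INR k <= / INR (k - S m)); [| lra]. apply Rinv_le_contravar; [apply lt_0_INR; lia | apply le_INR; lia].
Qed.

Lemma em_sum (m K : nat) : sum_n_m (em m) 1 K <= HN (S m).
Proof.
  assert (H : sum_n_m (em m) 1 K = HN K - (HN (K + S m) - HN (S m))).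
  { induction K as [| K IH]; [rewrite sum_n_m_zero by lia; rewrite HN_0, Nat.add_0_l; change (zero : R) with 0; rring |].
    rewrite sum_n_Sm by lia. change plus with Rplus. rewrite IH. unfold em. replace (S K + S m)%nat with (S (K + S m)) by lia. rewrite !(HN_S K), (HN_S (K + S m)). rring. }
  pose proof (HN_mono K (K + S m)%nat ltac:(lia)). lra.
Qed.

(** Below m the terms 1/k and 1/(m - k) give two harmonic sums; past m + 1 they are the telescoping
    terms of [em], which give the third. *)
Lemma ep_sum (m K : nat) : (1 <= m)%nat -> sum_n_m (ep m) 1 K <= 3 * HN (S m) + 4.
Proof.
  intro Hm.
  assert (H1 : sum_n_m (ep m) 1 (S m) <= 2 * HN (S m) + 4).
  { destruct m as [| m]; [lia |]. rewrite !sum_n_Sm by lia. change plus with Rplus.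
    assert (E3 : sum_n_m (ep (S m)) 1 m = HN m + HN m).
    { rewrite (sum_n_m_ext_loc (ep (S m)) (fun k => plus (/ INR k) ((fun j => / INR j) (m + 1 - k)%nat))).
      - rewrite (sum_n_m_plus (fun k => / INR k)). rewrite (sum_rev (fun j => / INR j)). reflexivity.
      - intros k Hk. unfold ep. nat_cases. replace (m + 1 - k)%nat with (S m - k)%nat by lia. reflexivity. }
    rewrite E3, !HN_S. unfold ep. nat_cases. pose proof (inv_INR_pos (S m) ltac:(lia)). pose proof (inv_INR_pos (S (S m)) ltac:(lia)). lra. }
  assert (H2 : sum_n_m (ep m) 1 (S m + K) = sum_n_m (ep m) 1 (S m) + sum_n_m (em m) 1 K).
  { induction K as [| K IH]; [rewrite Nat.add_0_r, (sum_n_m_zero (em m)) by lia; symmetry; apply Rplus_0_r |].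
    rewrite Nat.add_succ_r, sum_n_Sm, IH, (sum_n_Sm (em m)) by lia. change plus with Rplus. rewrite Rplus_assoc. do 2 f_equal.
    unfold ep, em. nat_cases. do 3 f_equal; lia. }
  pose proof (em_sum m K). rewrite Nat.add_comm, (sum_n_m_Chasles (ep m) 1 K) in H2 by lia. change plus with Rplus in H2.
  pose proof (sum_n_m_nonneg (ep m) (S K) (K + S m) ltac:(intros; apply ep_nonneg; lia)). lra.
Qed.

Section Bound.
Variables (s : C) (T sg d kap : R) (N m : nat).
Hypothesis Hs : s = (sg, T).
Hypothesis HT : 1000 <= T.
Hypothesis Hsg : -0.35 <= sg <= 1.2.
Hypothesis Hd : 0 < d < / 2.
Hypothesis Hd2 : T * d ^ 2 = 2.
Hypothesis HN1 : (1 <= N)%nat.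
Hypothesis Hm1 : (1 <= m)%nat.
Hypothesis Hkap : kap * (2 * PI * INR N) = T.
Hypothesis Hm : INR m <= kap < INR m + 1.
Hypothesis Hdk : 1 <= 4 * (d * kap).

(** The choice T d^2 = 2 makes the trivial estimate 2d on the window equal to the first-derivative
    term 4/(T d). The summand 4/T comes from the phase without stationary point, and [x0 k] is the
    stationary point of the harmonic k. *)
Let D3 : R := 4 * d / (1 - d) ^ 3 + 4 / T.
Let x0 (k : nat) : R := T / (2 * PI * INR k).

Definition mainT (k : nat) : R := if (k <=? S m)%nat then rp (1 - sg) (x0 k) * D3 else 0.

Lemma D3_pos : 0 < D3.
Proof. unfold D3. assert (0 < 4 * d / (1 - d) ^ 3) by pos. assert (0 < 4 / T) by pos. lra. Qed.

Lemma Cmod_s : Cmod s <= (1 + 2 / T) * T.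
Proof.
  rewrite Hs. eapply Rle_trans; [apply Cmod_le_abs |]. replace ((1 + 2 / T) * T) with (T + 2) by (field; lra). rewrite (Rabs_pos_eq T) by lra.
  assert (Rabs sg <= 2) by (apply Rabs_le; lra). lra.
Qed.

(** With kap = T / (2 pi N), the stationary point of the harmonic k lies to the right of N exactly
    when k < kap. The boundary term at N therefore depends only on the distance from k to kap, which
    [ep] and [em] bound by integers. *)
Lemma term_bound (k M : nat) : (1 <= k)%nat -> (N <= M)%nat -> T <= INR M ->
  Cmod s / (PI * INR k) * Cmod (Ik s k (INR N) (INR M)) <= (1 + 2 / T) * (mainT k + rp (- sg) (INR N) / PI * (ep m k + em m k)).
Proof.
  intros Hk HNM HM. pose proof PI_RGT_0 as HPI. pose proof PI_ge_3 as HP3. pose proof D3_pos as HD3.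
  assert (Hkp : 1 <= INR k) by (apply (le_INR 1); exact Hk). assert (HNp : 1 <= INR N) by (apply (le_INR 1); exact HN1). assert (HNM' : INR N <= INR M) by (apply le_INR, HNM).
  assert (Hmp : 1 <= INR m) by nra.
  set (q := 2 * PI * INR k). assert (Hq : 0 < q) by (unfold q; nra).
  assert (Hx0 : 0 < x0 k) by (unfold x0; apply Rdiv_lt_0_compat; nra).
  assert (Ex0 : q * x0 k = T) by (unfold x0; fold q; field; lra).
  assert (HqN : q * INR N = 2 * PI * INR N * INR k) by (unfold q; ring). assert (HT' : T = 2 * PI * INR N * kap) by lra.
  set (w := 2 * PI * INR N) in *. assert (Hw : 0 < w) by nra.
  set (RN := rp (- sg) (INR N)). assert (HRN : 0 < RN) by apply rp_pos. set (RX := rp (- sg) (x0 k)). assert (HRX : 0 < RX) by apply rp_pos.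
  pose proof (Ik_osc s k (INR N) (INR M) ltac:(lra) HNM') as HI. fold q in HI. assert (Eim : Im s = T) by (rewrite Hs; reflexivity). assert (Ere : Re s = sg) by (rewrite Hs; reflexivity). rewrite Eim, Ere in HI.
  set (Jp := Cmod (Jo q T sg (INR N) (INR M))) in *. set (Jm := Cmod (Jo (- q) T sg (INR N) (INR M))) in *.
  assert (Hr : Cmod s / (PI * INR k) * Cmod (Ik s k (INR N) (INR M)) <= (1 + 2 / T) * (x0 k * (Jp + Jm))).
  { pose proof Cmod_s as HCs. pose proof (Cmod_ge_0 s). assert (0 < PI * INR k) by nra.
    assert (0 < / (PI * INR k)) by (apply Rinv_0_lt_compat; assumption).
    apply Rle_trans with (((1 + 2 / T) * T) / (PI * INR k) * (/ 2 * (Jp + Jm))).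
    - apply Rmult_le_compat; [nra | apply Cmod_ge_0 | apply Rmult_le_compat_r; lra | exact HI].
    - right. unfold x0. field. repeat split; lra. }
  assert (HJm : x0 k * Jm <= RN / PI * em m k + (if (k <=? S m)%nat then rp (1 - sg) (x0 k) * (4 / T) else 0)).
  { pose proof (osc_minus q T sg (INR N) (INR M) Hq ltac:(lra) ltac:(lra) ltac:(lra) HNM') as K. fold Jm RN in K. replace (T / q) with (x0 k) in K by reflexivity.
    apply Rmult_le_compat_l with (r := x0 k) in K; [| lra]. eapply Rle_trans; [exact K |]. rewrite Rmult_plus_distr_l. apply Rplus_le_compat.
    - replace (x0 k * (2 * (RN / (q * INR N + T)))) with (RN / PI * (/ INR k - / (INR k + kap))).
      + apply Rmult_le_compat_l; [left; apply Rdiv_lt_0_compat; lra |]. apply Rplus_le_compat_l, Ropp_le_contravar. rewrite plus_INR, S_INR. apply Rinv_le_contravar; lra.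
      + rewrite HqN, HT'. unfold x0. rewrite HT'. field. repeat split; try lra. apply Rgt_not_eq; unfold w in *; nra.
    - destruct (Rlt_dec (q * INR N) T) as [Hl | Hl].
      + assert (INR k < INR m + 1) by (rewrite HqN, HT' in Hl; nra). rewrite <- S_INR in H. apply INR_lt in H. destruct (Nat.leb_spec k (S m)); [| lia].
        unfold RX. replace (1 - sg) with (1 + - sg) by ring. rewrite rp_plus, rp_1 by exact Hx0. lra.
      + rewrite Rmult_0_r. destruct (k <=? S m)%nat; [| lra]. pos. }
  assert (HJp : x0 k * Jp <= RN / PI * ep m k + (if (k <=? S m)%nat then rp (1 - sg) (x0 k) * (4 * d / (1 - d) ^ 3) else 0)).
  { assert (HRP : 0 < RN / PI) by pos.
    destruct (Nat.leb_spec k (S m)) as [Hkm | Hkm].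
    - pose proof (osc_plus q T sg d (INR N) (INR M) Hq ltac:(lra) ltac:(lra) ltac:(lra) ltac:(lra) HNM') as K. fold Jp RN in K. replace (T / q) with (x0 k) in K by reflexivity. fold RX in K.
      assert (Hq6 : 6 <= q) by (unfold q; nra). assert (Hx6 : 6 * x0 k <= T) by nra. assert (Hdx : d * x0 k <= x0 k) by nra.
      specialize (K ltac:(lra)).
      apply Rmult_le_compat_l with (r := x0 k) in K; [| lra]. eapply Rle_trans; [exact K |]. rewrite Rmult_plus_distr_l, Rplus_comm. apply Rplus_le_compat.
      + destruct (Rlt_dec (q * INR N) (T * (1 - d))) as [Hl | Hl]; [| rewrite Rmult_0_r; apply Rmult_le_pos; [lra | apply ep_nonneg; assumption]].
        assert (Hkk : INR k < kap * (1 - d)) by (rewrite HqN, HT' in Hl; apply Rmult_lt_reg_l with w; lra).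
        assert (Hkd : 0 < kap * d) by nra. assert (Hkk2 : INR k < kap) by lra.
        replace (x0 k * (2 * (RN / (T - q * INR N)))) with (RN / PI * (/ INR k + / (kap - INR k))).
        2:{ rewrite HqN, HT'. unfold x0. rewrite HT'. field. repeat split; try lra. apply Rgt_not_eq; unfold w in *; nra. }
        apply Rmult_le_compat_l; [lra |].
        assert (Hkm2 : (k <= m)%nat) by (assert (Hlt : INR k < INR (S m)) by (rewrite S_INR; lra); apply INR_lt in Hlt; lia).
        unfold ep. destruct (Nat.ltb_spec k m) as [Hlt | Hge].
        * apply Rplus_le_compat_l. rewrite minus_INR by lia. apply Rinv_le_contravar; [apply lt_INR in Hlt; lra | lra].
        * assert (k = m) by lia. subst k. rewrite Nat.eqb_refl. apply Rplus_le_compat_l.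
          (* The origin of the 4 in [ep]: k = m may be close to kap, but this boundary term occurs
             only for k < kap (1 - d), where kap - k exceeds kap d >= 1/4. *)
          apply Rle_trans with (/ (kap * d)); [apply Rinv_le_contravar; lra |]. replace 4 with (/ / 4) by field. apply Rinv_le_contravar; lra.
      + unfold RX. replace (1 - sg) with (1 + - sg) by ring. rewrite rp_plus, rp_1 by exact Hx0. assert (HTd : 4 / (T * d) = 2 * d) by (apply Rmult_eq_reg_r with (T * d); [field_simplify; nra | nra]).
        rewrite HTd. lra.
    - assert (Hkm' : INR m + 2 <= INR k) by (replace 2 with (INR 2) by reflexivity; rewrite <- plus_INR; apply le_INR; lia).
      pose proof (osc_right q T sg (INR N) (INR M) Hq ltac:(lra) ltac:(lra) ltac:(lra) HNM' ltac:(nra)) as K. fold Jp RN in K.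
      apply Rmult_le_compat_l with (r := x0 k) in K; [| lra]. rewrite Rplus_0_r. eapply Rle_trans; [exact K |].
      replace (x0 k * (2 * (RN / (q * INR N - T)))) with (RN / PI * (/ (INR k - kap) - / INR k)).
      2:{ rewrite HqN, HT'. unfold x0. rewrite HT'. field. repeat split; try lra. apply Rgt_not_eq; unfold w in *; nra. }
      apply Rmult_le_compat_l; [lra |]. unfold ep. nat_cases.
      apply Rplus_le_compat_r. rewrite minus_INR by lia. rewrite S_INR. apply Rinv_le_contravar; lra. }
  eapply Rle_trans; [exact Hr |]. apply Rmult_le_compat_l; [assert (0 < 2 / T) by pos; lra |]. unfold mainT. unfold D3 at 1. destruct (k <=? S m)%nat; lra.
Qed.

Lemma zeta_bound :
  Cmod (zeta s) <= sum_n_m (fun n => rp (- sg) (INR n)) 1 N + rp (1 - sg) (INR N) / T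
    + (1 + 2 / T) * (sum_n_m (fun k => rp (1 - sg) (x0 k) * D3) 1 (S m) + rp (- sg) (INR N) / PI * (4 * HN (S m) + 4)).
Proof.
  pose proof PI_RGT_0 as HPI. pose proof D3_pos as HD3. assert (H2T : 0 < 2 / T) by pos.
  assert (Him : Im s = T) by (rewrite Hs; reflexivity). assert (Hre : Re s = sg) by (rewrite Hs; reflexivity).
  assert (Hs1 : s <> 1%C) by (intros E; rewrite E in Him; simpl in Him; lra).
  set (BB := (1 + 2 / T) * (sum_n_m (fun k => rp (1 - sg) (x0 k) * D3) 1 (S m) + rp (- sg) (INR N) / PI * (4 * HN (S m) + 4))).
  destruct (nfloor_ex T ltac:(lra)) as [M0 [_ HM0]].
  assert (HB : Cmod (zeta s - Phi s N)%C <= BB).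
  { apply (zeta_Phi_bound s N (S M0) BB); [rewrite Him, Rabs_pos_eq; lra | lra | exact HN1 |].
    intros M HM HM1. apply Phi_diff_bound; [exact Hs1 | lia | lra |]. intro K.
    assert (HMT : T <= INR M) by (apply Rle_trans with (INR (S M0)); [rewrite S_INR; lra | apply le_INR; exact HM1]).
    apply Rle_trans with (sum_n_m (fun k => (1 + 2 / T) * (mainT k + rp (- sg) (INR N) / PI * (ep m k + em m k))) 1 K).
    { apply sum_n_m_le_loc. intros k Hk. apply term_bound; [lia | exact HM | lra]. }
    rewrite (sum_n_m_mult_l (K := R_AbsRing) (1 + 2 / T) (fun k => mainT k + rp (- sg) (INR N) / PI * (ep m k + em m k))). apply Rmult_le_compat_l; [lra |].
    rewrite (sum_n_m_plus mainT (fun k => rp (- sg) (INR N) / PI * (ep m k + em m k))). apply Rplus_le_compat.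
    - assert (Hpos : forall k, 0 <= rp (1 - sg) (x0 k) * D3) by (intro; apply Rmult_le_pos; [left; apply rp_pos | lra]).
      apply Rle_trans with (sum_n_m mainT 1 (S m)).
      + assert (Hmp : forall k, 0 <= mainT k) by (intro k; unfold mainT; destruct (k <=? S m)%nat; [apply Hpos | lra]).
        destruct (le_lt_dec K (S m)) as [HK | HK].
        * rewrite (sum_n_m_Chasles mainT 1 K (S m)) by lia. change plus with Rplus. pose proof (sum_n_m_nonneg mainT (S K) (S m) ltac:(intros; apply Hmp)). lra.
        * rewrite (sum_n_m_Chasles mainT 1 (S m) K) by lia. change plus with Rplus.
          rewrite (sum_n_m_ext_loc mainT (fun _ => zero) (S (S m)) K); [rewrite sum_n_m_const_zero; change (zero : R) with 0; lra |].
          intros k Hk. unfold mainT. destruct (Nat.leb_spec k (S m)); [lia | reflexivity].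
      + apply sum_n_m_le_loc. intros k Hk. unfold mainT. destruct (Nat.leb_spec k (S m)); [lra | lia].
    - rewrite (sum_n_m_mult_l (K := R_AbsRing) (rp (- sg) (INR N) / PI) (fun k => ep m k + em m k)).
      apply Rmult_le_compat_l; [left; apply Rdiv_lt_0_compat; [apply rp_pos | lra] |].
      rewrite (sum_n_m_plus (ep m) (em m)). change plus with Rplus. pose proof (ep_sum m K Hm1). pose proof (em_sum m K). lra. }
  assert (HP : Cmod (Phi s N) <= sum_n_m (fun n => rp (- sg) (INR n)) 1 N + rp (1 - sg) (INR N) / T).
  { unfold Phi. destruct N as [| N']; [lia |]. cbn [csum].
    replace (csum (fun i => npow s (INR (S i))) N' + npow s (INR (S N')) - RtoC (/ 2) * npow s (INR (S N')) - npow (s - 1) (INR (S N')) / (1 - s))%C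
      with (csum (fun i => npow s (INR (S i))) N' + RtoC (/ 2) * npow s (INR (S N')) - npow (s - 1) (INR (S N')) / (1 - s))%C.
    2:{ replace (RtoC (/ 2) * npow s (INR (S N')))%C with (npow s (INR (S N')) - RtoC (/ 2) * npow s (INR (S N')))%C at 1; [ring |].
        replace (npow s (INR (S N')) - RtoC (/ 2) * npow s (INR (S N')))%C with ((1 - RtoC (/ 2)) * npow s (INR (S N')))%C by ring. f_equal. rewrite <- RtoC_minus. f_equal. field. }
    assert (Hnp : forall n, Cmod (npow s (INR n)) = rp (- sg) (INR n)) by (intro n; rewrite Cmod_npow, Hre; reflexivity).
    eapply Rle_trans; [apply Cmod_minus_le |]. apply Rplus_le_compat.
    - rewrite sum_n_Sm by lia. Ctri. apply Rplus_le_compat.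
      + eapply Rle_trans; [apply (Cmod_csum _ (fun i => rp (- sg) (INR (S i)))); intros; rewrite Hnp; lra |]. right. apply sum_n_m_ext_loc. intros k Hk. replace (S (pred k)) with k by lia. reflexivity.
      + rewrite Cmod_mult, Cmod_R, Hnp, Rabs_pos_eq by lra. pose proof (rp_pos (- sg) (INR (S N'))). lra.
    - assert (H1s : T <= Cmod (1 - s)%C).
      { pose proof (im_le_Cmod (1 - s)%C) as K. replace (Im (1 - s)%C) with (- T) in K by (rewrite Hs; simpl; ring). rewrite Rabs_Ropp, Rabs_pos_eq in K by lra. exact K. }
      rewrite Cmod_div by (apply Cmod_gt_0; lra). rewrite Cmod_npow. replace (- Re (s - 1)%C) with (1 - sg) by (rewrite Hs; simpl; ring). apply Rmult_le_compat_l; [left; apply rp_pos | apply Rinv_le_contravar; lra]. }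
  replace (zeta s) with (Phi s N + (zeta s - Phi s N))%C by ring. Ctri. lra.
Qed.
End Bound.

(** * Euler product inequalities *)

(** Sieve condition: n has no divisor among 2, ..., q. The clause for 1 keeps the divisor 1 from
    excluding everything. *)
Fixpoint rough (q n : nat) : bool :=
  match q with O => true | S q' => rough q' n && ((q =? 1)%nat || negb (n mod q =? 0)%nat) end.

Lemma rough_spec (q n : nat) : rough q n = true <-> (forall d, (2 <= d <= q)%nat -> ~ Nat.divide d n).
Proof.
  induction q as [| q IH]; [split; [intros _ d Hd; lia | reflexivity] |]. cbn [rough]. rewrite Bool.andb_true_iff, IH. split.
  - intros [H1 H2] d Hd. destruct (Nat.eq_dec d (S q)) as [-> | Hne]; [| apply H1; lia].
    destruct (Nat.eqb_spec (S q) 1) as [E | E]; [lia |]. intro Hdv. apply Nat.mod_divide in Hdv; [| lia]. rewrite Hdv in H2. discriminate.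
  - split; [intros d Hd; apply H; lia |]. destruct (Nat.eqb_spec (S q) 1) as [E | E]; [lra |].
    apply Bool.negb_true_iff, Nat.eqb_neq. intro H0. apply (H (S q)); [lia |]. apply Nat.mod_divide; [lia | pos].
Qed.

Lemma rough_mul (q m : nat) : rough q (S q) = true -> (1 <= q)%nat -> rough q (S q * m) = rough q m.
Proof.
  intros Hp Hq. apply Bool.eq_true_iff_eq. rewrite !rough_spec. rewrite rough_spec in Hp. split; intros H d Hd Hdv.
  - apply (H d Hd). apply Nat.divide_mul_r, Hdv.
  - apply (H d Hd). apply (Nat.gauss d (S q) m Hdv).
    pose proof (Nat.gcd_divide_l d (S q)) as G1. pose proof (Nat.gcd_divide_r d (S q)) as G2. set (g := Nat.gcd d (S q)) in *.
    assert (g <= d)%nat by (apply Nat.divide_pos_le; [lia | pos]).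
    destruct (Nat.eq_dec g 0) as [E | E]; [rewrite E in G1; destruct G1 as [z Ez]; lia |].
    destruct (Nat.eq_dec g 1) as [E1 | E1]; [pos |]. exfalso. apply (Hp g); [lia | pos].
Qed.

Definition Zs (s : C) (q X : nat) : C := csum (fun i => if rough q (S i) then npow s (INR (S i)) else 0%C) X.

Lemma npow_mult (s : C) (x y : R) : 0 < x -> 0 < y -> (npow s (x * y) = npow s x * npow s y)%C.
Proof. intros Hx Hy. unfold npow. rewrite ln_mult, RtoC_plus, <- Cexp_plus by assumption. f_equal. ring. Qed.

(** The numbers removed at the prime q + 1 are the products (q + 1) m with m itself surviving the
    previous step and m <= X / (q + 1). *)
Lemma Zs_step_prime (s : C) (q X : nat) : (1 <= q)%nat -> rough q (S q) = true ->
  (Zs s (S q) X = Zs s q X - npow s (INR (S q)) * Zs s q (X / S q))%C.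
Proof.
  intros Hq Hp. induction X as [| X IH].
  - unfold Zs. simpl csum. ring.
  - unfold Zs in *. cbn [csum]. rewrite IH. cbn [rough]. replace (S q =? 1)%nat with false by (symmetry; apply Nat.eqb_neq; lia).
    destruct (Nat.eqb_spec (S X mod S q) 0) as [E | E].
    + rewrite Bool.andb_false_r.
      assert (Hm : exists m, S X = (S q * S m)%nat).
      { apply Nat.mod_divide in E; [| lia]. destruct E as [z Ez]. destruct z as [| z]; [lia |]. exists z. lia. }
      destruct Hm as [m Hm].
      assert (D1 : (S X / S q = S m)%nat) by (rewrite Hm, Nat.mul_comm; apply Nat.div_mul; lia).
      assert (D2 : (X / S q = m)%nat) by (symmetry; apply (Nat.div_unique X (S q) m q); lia).
      rewrite D1, D2. cbn [csum]. rewrite Hm. rewrite (rough_mul q (S m) Hp Hq). rewrite mult_INR, npow_mult by pos.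
      destruct (rough q (S m)); ring.
    + rewrite Bool.andb_true_r.
      assert (D : (S X / S q = X / S q)%nat).
      { pose proof (Nat.div_mod_eq (S X) (S q)). pose proof (Nat.mod_upper_bound (S X) (S q) ltac:(lia)).
        apply (Nat.div_unique X (S q) (S X / S q) (S X mod S q - 1)); lia. }
      rewrite D. ring.
Qed.

Lemma Zs_step_comp (s : C) (q X : nat) : rough q (S q) = false -> Zs s (S q) X = Zs s q X.
Proof.
  intro Hp. apply csum_ext. intros i _. cbn [rough]. destruct (rough q (S i)) eqn:Er; [| reflexivity].
  destruct (Nat.eqb_spec (S q) 1) as [E | E]; [reflexivity |]. destruct (Nat.eqb_spec (S i mod S q) 0) as [E0 | E0]; [| reflexivity]. exfalso.
  rewrite rough_spec in Er. apply Bool.not_true_iff_false in Hp. apply Hp. rewrite rough_spec. intros d Hd Hdv. apply (Er d Hd).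
  apply Nat.mod_divide in E0; [| lia]. eapply Nat.divide_trans; eassumption.
Qed.

Definition prime_succ (q : nat) : bool := ((1 <=? q)%nat && rough q (S q))%bool.

(** Product of 1 - p^(-s) over the primes p <= q. The sieve acts on partial sums, so no infinite
    product and no unique factorisation is involved. *)
Fixpoint eulerP (s : C) (q : nat) : C :=
  match q with O => 1 | S q' => eulerP s q' * (if prime_succ q' then 1 - npow s (INR q) else 1) end%C.

Definition Clim (u : nat -> C) (l : C) : Prop := forall e, 0 < e -> exists N, forall n, (N <= n)%nat -> Cmod (u n - l)%C <= e.

Lemma Zs_lim (s : C) (q : nat) : 1 < Re s -> Clim (Zs s q) (zeta s * eulerP s q)%C.
Proof.
  intros Hs. induction q as [| q IH].
  - intros e He. destruct (zeta_partial s e Hs He) as [M0 H0]. exists M0. intros n Hn. simpl. replace (zeta s * 1)%C with (zeta s) by ring. apply H0, Hn.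
  - cbn [eulerP]. unfold prime_succ. destruct (Nat.leb_spec 1 q) as [Hq | Hq]; simpl andb.
    + destruct (rough q (S q)) eqn:Er.
      * intros e He. set (p := npow s (INR (S q))). assert (Hp : Cmod p <= 1) by (apply Cmod_npow_le1; [lra | apply (le_INR 1); lia]).
        destruct (IH (e / 2) ltac:(lra)) as [N HN]. exists (N * S q)%nat. intros n Hn. rewrite (Zs_step_prime s q n Hq Er). fold p.
        replace (Zs s q n - p * Zs s q (n / S q) - zeta s * (eulerP s q * (1 - p)))%C with ((Zs s q n - zeta s * eulerP s q) - p * (Zs s q (n / S q) - zeta s * eulerP s q))%C by ring.
        eapply Rle_trans; [apply Cmod_minus_le |]. rewrite Cmod_mult.
        pose proof (HN n ltac:(nia)). pose proof (HN (n / S q)%nat ltac:(apply Nat.div_le_lower_bound; lia)).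
        pose proof (Cmod_ge_0 p). nra.
      * intros e He. destruct (IH e He) as [N HN]. exists N. intros n Hn. rewrite (Zs_step_comp s q n Er), Cmult_1_r. apply HN, Hn.
    + intros e He. destruct (IH e He) as [N HN]. exists N. intros n Hn. rewrite Cmult_1_r. replace (Zs s (S q) n) with (Zs s q n); [apply HN, Hn |]. assert (q = 0)%nat by lia. subst q. reflexivity.
Qed.

Definition zr (x : R) : R := Re (zeta (RtoC x)).

Definition PS (x : R) (n : nat) : R := sum_n_m (fun k => rp (- x) (INR k)) 1 n.

Lemma PS_S (x : R) (n : nat) : PS x (S n) = PS x n + rp (- x) (INR (S n)).
Proof. unfold PS. rewrite sum_n_Sm by lia. reflexivity. Qed.

Lemma npow_real (x y : R) : npow (RtoC x) y = RtoC (rp (- x) y).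
Proof. unfold npow. rewrite <- RtoC_opp, <- RtoC_mult, Cexp_cis. unfold cis; simpl. rewrite cos_0, sin_0. unfold rp, RtoC, Cmult; simpl. apply injective_projections; simpl; ring. Qed.

Lemma csum_real (x : R) (n : nat) : csum (fun i => npow (RtoC x) (INR (S i))) n = RtoC (PS x n).
Proof. induction n as [| n IH]; [unfold PS; rewrite sum_n_m_zero by lia; reflexivity |]. cbn [csum]. rewrite IH, PS_S, npow_real, RtoC_plus. reflexivity. Qed.

Lemma zr_lim (x : R) : 1 < x -> is_lim_seq (PS x) (zr x) /\ zeta (RtoC x) = RtoC (zr x).
Proof.
  intro Hx.
  assert (H : forall e, 0 < e -> exists M0, forall M, (M0 <= M)%nat -> Cmod (RtoC (PS x M) - zeta (RtoC x))%C <= e).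
  { intros e He. destruct (zeta_partial (RtoC x) e ltac:(pos) He) as [M0 H0]. exists M0. intros M HM. rewrite <- csum_real. apply H0, HM. }
  split.
  - apply is_lim_seq_spec. intro e. pose proof (cond_pos e). destruct (H (e / 2) ltac:(lra)) as [M0 HM0]. exists M0. intros M HM. specialize (HM0 M HM).
    pose proof (re_le_Cmod (RtoC (PS x M) - zeta (RtoC x))%C) as K. change (Re (RtoC (PS x M) - zeta (RtoC x))%C) with (PS x M - zr x) in K. lra.
  - assert (E : Im (zeta (RtoC x)) = 0).
    { apply Rle_antisym; apply le_epsilon; intros e He; destruct (H e He) as [M0 H0]; specialize (H0 M0 (Nat.le_refl _));
      pose proof (im_le_Cmod (RtoC (PS x M0) - zeta (RtoC x))%C) as K; replace (Im (RtoC (PS x M0) - zeta (RtoC x))%C) with (- Im (zeta (RtoC x))) in K by (destruct (zeta (RtoC x)); simpl; ring); apply Rabs_le_between in K; lra. }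
    unfold zr. destruct (zeta (RtoC x)) as [u v]. simpl in *. rewrite E. reflexivity.
Qed.

Lemma PS_le_zr (x : R) (n : nat) : 1 < x -> PS x n <= zr x.
Proof.
  intro Hx. destruct (zr_lim x Hx) as [H _]. apply (is_lim_seq_incr_compare (PS x) (zr x) H). intro k. rewrite PS_S. pose proof (rp_pos (- x) (INR (S k))). lra.
Qed.

Lemma zr_ge1 (x : R) : 1 < x -> 1 <= zr x.
Proof.
  intro Hx. pose proof (PS_le_zr x 1 Hx) as K. rewrite PS_S in K. unfold PS in K. rewrite sum_n_m_zero in K by lia. change (zero : R) with 0 in K. unfold rp in K. simpl INR in K. rewrite ln_1, Rmult_0_r, exp_0 in K. lra.
Qed.

(** After sieving up to q only n = 1 and some n > q survive, and the latter are dominated by the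
    tail of the real series. *)
Lemma euler_close (s : C) (q : nat) : 1 < Re s -> (1 <= q)%nat -> Cmod (zeta s * eulerP s q - 1)%C <= zr (Re s) - PS (Re s) q.
Proof.
  intros Hs Hq. apply le_epsilon. intros e He. destruct (Zs_lim s q Hs e He) as [N HN].
  assert (H1 : forall j, (j < q)%nat -> Zs s q (S j) = 1%C).
  { induction j as [| j IH]; intro Hj; unfold Zs in *; cbn [csum].
    - replace (rough q 1) with true; [| symmetry; apply rough_spec; intros d Hd Hdv; apply Nat.divide_1_r in Hdv; lia].
      unfold npow. simpl INR. rewrite ln_1. replace (- s * 0)%C with (RtoC 0) by ring. rewrite Cexp_0. ring.
    - cbn [csum] in IH. rewrite IH by lia. replace (rough q (S (S j))) with false; [ring |]. symmetry. apply Bool.not_true_iff_false. rewrite rough_spec. intro H. apply (H (S (S j))); [lia | apply Nat.divide_refl]. }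
  assert (H2 : forall X, (q <= X)%nat -> Cmod (Zs s q X - 1)%C <= PS (Re s) X - PS (Re s) q).
  { intros X HX. induction HX as [| X HX IH].
    - destruct q as [| q']; [lia |]. rewrite (H1 q' ltac:(lia)), Cmod_minus_0. lra.
    - unfold Zs in *. cbn [csum]. set (c0 := csum _ X) in *. set (tm := if rough q (S X) then npow s (INR (S X)) else 0%C).
      replace (c0 + tm - 1)%C with ((c0 - 1) + tm)%C by ring. Ctri. rewrite PS_S.
      assert (Cmod tm <= rp (- Re s) (INR (S X))) by (unfold tm; destruct (rough q (S X)); [rewrite Cmod_npow; unfold rp; lra | rewrite Cmod_0; left; apply rp_pos]). lra. }
  set (X := (N + q)%nat). specialize (HN X ltac:(unfold X; lia)). specialize (H2 X ltac:(unfold X; lia)).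
  replace (zeta s * eulerP s q - 1)%C with ((Zs s q X - 1) - (Zs s q X - zeta s * eulerP s q))%C by ring.
  eapply Rle_trans; [apply Cmod_minus_le |]. pose proof (PS_le_zr (Re s) X Hs). lra.
Qed.

Lemma euler_lim (s : C) : 1 < Re s -> is_lim_seq (fun q => Cmod (zeta s) * Cmod (eulerP s q)) 1.
Proof.
  intro Hs. destruct (zr_lim (Re s) Hs) as [Hl _]. apply is_lim_seq_spec. intro e. apply is_lim_seq_spec in Hl. destruct (Hl e) as [N HN]. exists (S N). intros q Hq.
  specialize (HN q ltac:(lia)). pose proof (euler_close s q Hs ltac:(lia)) as K. pose proof (PS_le_zr (Re s) q Hs). rewrite Rabs_left1 in HN by lra.
  rewrite <- Cmod_mult. pose proof (Cmod_ge_minus (zeta s * eulerP s q)%C 1%C) as K1. pose proof (Cmod_ge_minus 1%C (zeta s * eulerP s q)%C) as K2. rewrite Cmod_minus_sym in K2. rewrite Cmod_1 in K1, K2.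
  apply Rabs_def1; lra.
Qed.

Lemma zeta_neq0 (s : C) : 1 < Re s -> zeta s <> 0%C.
Proof.
  intros Hs E. pose proof (euler_lim s Hs) as H. rewrite E, Cmod_0 in H.
  assert (H0 : is_lim_seq (fun q => 0 * Cmod (eulerP s q)) 0) by (apply (is_lim_seq_ext (fun _ => 0)); [intro; ring | apply is_lim_seq_const]).
  apply is_lim_seq_unique in H. apply is_lim_seq_unique in H0. rewrite H in H0. injection H0. lra.
Qed.

Lemma prime_npow_le (x : R) (q : nat) : 1 < x -> prime_succ q = true -> 0 < rp (- x) (INR (S q)) < 1.
Proof.
  intros Hx Hq. apply andb_prop, proj1, Nat.leb_le in Hq. split; [pos |]. rewrite <- exp_0. apply exp_increasing.
  assert (0 < ln (INR (S q))) by (rewrite <- ln_1; apply ln_increasing; [lra | apply (lt_INR 1); lia]). nra.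
Qed.

Lemma eulerP_lim (s : C) : 1 < Re s -> is_lim_seq (fun q => Cmod (eulerP s q)) (/ Cmod (zeta s)).
Proof.
  intro Hs. pose proof (proj1 (Cmod_gt_0 _) (zeta_neq0 s Hs)). pose proof (is_lim_seq_scal_l _ (/ Cmod (zeta s)) _ (euler_lim s Hs)) as L.
  simpl in L. rewrite Rmult_1_r in L. revert L. apply is_lim_seq_ext. intro. field. lra.
Qed.

Lemma eulerP_neq0 (s : C) (q : nat) : 1 < Re s -> eulerP s q <> 0%C.
Proof.
  intro Hs. induction q as [| q IH]; [apply C1_nz |]. apply Cmult_neq_0; [pos |]. destruct (prime_succ q) eqn:Hq; [| apply C1_nz].
  intro E. apply (f_equal (fun z => Cmod (1 - z)%C)) in E. replace (1 - (1 - npow s (INR (S q))))%C with (npow s (INR (S q))) in E by ring. rewrite Cmod_npow, Cmod_sub0, Cmod_1 in E.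
  pose proof (prime_npow_le (Re s) q Hs Hq). unfold rp in *. lra.
Qed.

(** Product of 1 + p^(-x) over primes p <= q; by 1 - p^(-2x) = (1 - p^(-x)) (1 + p^(-x)) it tends to
    zeta(x) / zeta(2x). *)
Fixpoint eulerQ (x : R) (q : nat) : R :=
  match q with O => 1 | S q' => eulerQ x q' * (if prime_succ q' then 1 + rp (- x) (INR q) else 1) end.

Lemma eulerQ_ge (x : R) (q : nat) : 1 <= eulerQ x q <= eulerQ x (S q).
Proof.
  assert (H : forall q, 1 <= eulerQ x q -> eulerQ x q <= eulerQ x (S q)).
  { intros n Hn. cbn [eulerQ]. pose proof (rp_pos (- x) (INR (S n))). destruct (prime_succ n); nra. }
  split; [| apply H]; (induction q as [| q IH]; [apply Rle_refl | eapply Rle_trans; [exact IH | apply H, IH]]).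
Qed.

Lemma rp_double (x y : R) : rp (- (2 * x)) y = rp (- x) y * rp (- x) y.
Proof. rewrite <- rp_plus. f_equal. ring. Qed.

Lemma eulerQ_eq (x : R) (q : nat) : (eulerP (RtoC (2 * x)) q = eulerP (RtoC x) q * RtoC (eulerQ x q))%C.
Proof.
  induction q as [| q IH]; [simpl; ring |]. cbn [eulerP eulerQ]. rewrite IH, (RtoC_mult (eulerQ x q)). destruct (prime_succ q); [| ring].
  rewrite !npow_real, rp_double, RtoC_mult, RtoC_plus. ring.
Qed.

Lemma eulerQ_lim (x : R) : 1 < x -> is_lim_seq (eulerQ x) (zr x / zr (2 * x)).
Proof.
  intro Hx. pose proof (eulerP_lim (RtoC x) Hx) as L1. pose proof (eulerP_lim (RtoC (2 * x)) ltac:(simpl; lra)) as L2.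
  pose proof (zr_ge1 x Hx). pose proof (zr_ge1 (2 * x) ltac:(lra)).
  rewrite (proj2 (zr_lim _ Hx)), Cmod_R, Rabs_pos_eq in L1 by lra. rewrite (proj2 (zr_lim (2 * x) ltac:(lra))), Cmod_R, Rabs_pos_eq in L2 by lra.
  replace (zr x / zr (2 * x)) with (/ zr (2 * x) / / zr x) by (field; lra).
  eapply is_lim_seq_ext; [| apply (is_lim_seq_div' _ _ _ _ L2 L1), Rinv_neq_0_compat; lra].
  intro q. cbv beta. pose proof (eulerQ_ge x q). pose proof (proj1 (Cmod_gt_0 _) (eulerP_neq0 (RtoC x) q Hx)).
  rewrite eulerQ_eq, Cmod_mult, Cmod_R, Rabs_pos_eq by lra. field. lra.
Qed.

Lemma zeta_lower (s : C) : 1 < Re s -> zr (2 * Re s) <= Cmod (zeta s) * zr (Re s).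
Proof.
  intro Hs. pose proof (proj1 (Cmod_gt_0 _) (zeta_neq0 s Hs)). pose proof (zr_ge1 (2 * Re s) ltac:(lra)).
  assert (K : / Cmod (zeta s) <= zr (Re s) / zr (2 * Re s)).
  { apply (is_lim_seq_le (fun q => Cmod (eulerP s q)) (eulerQ (Re s)) (/ Cmod (zeta s)) (zr (Re s) / zr (2 * Re s))); [| apply eulerP_lim, Hs | apply eulerQ_lim, Hs].
    induction n as [| q IH]; [simpl; rewrite Cmod_1; lra |]. cbn [eulerP eulerQ]. rewrite Cmod_mult. apply Rmult_le_compat; try apply Cmod_ge_0; [lra |].
    destruct (prime_succ q); [| rewrite Cmod_1; lra]. eapply Rle_trans; [apply Cmod_minus_le |]. rewrite Cmod_1, Cmod_npow. apply Rle_refl. }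
  apply Rle_div_r in K; [| lra]. replace (zr (2 * Re s)) with (Cmod (zeta s) * (/ Cmod (zeta s) * zr (2 * Re s))) by (field; lra). apply Rmult_le_compat_l; lra.
Qed.

(* [|1 - a z| / |1 - b z|] over the unit circle is largest at [z = -1] when [b <= a]. *)
Lemma unit_ratio (a b : R) (z : C) : 0 <= b <= a -> a <= 1 -> Cmod z = 1 ->
  Cmod (1 - RtoC a * z)%C * (1 + b) <= Cmod (1 - RtoC b * z)%C * (1 + a).
Proof.
  intros Hb Ha Hz1. destruct z as [u v].
  assert (E : u ^ 2 + v ^ 2 = 1).
  { unfold Cmod in Hz1. simpl fst in Hz1. simpl snd in Hz1. assert (0 <= u ^ 2 + v ^ 2) by nra. rewrite <- (sqrt_sqrt (u ^ 2 + v ^ 2)) by assumption. nra. }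
  assert (Q : forall t, Cmod (1 - RtoC t * (u, v))%C ^ 2 = 1 - 2 * t * u + t ^ 2).
  { intro t. unfold Cmod. rewrite pow2_sqrt by nra. unfold Cminus, Cplus, Copp, Cmult, RtoC; simpl. nra. }
  apply Rsqr_incr_0; [| pos | pos].
  rewrite !Rsqr_pow2, !Rpow_mult_distr, !Q. assert (-1 <= u) by nra.
  assert (0 <= (a - b) * (1 - a * b) * (1 + u)) by (apply Rmult_le_pos; [apply Rmult_le_pos; nra | lra]). nra.
Qed.

(** Each Euler factor obeys [unit_ratio]. This is a difference form of a bound for Re zeta'/zeta: it
    needs no series for the logarithmic derivative, and h tends to 0 in [log_derivative]. *)
Lemma zeta_ratio (t c h : R) : 1 < c - h -> 0 <= h ->
  Cmod (zeta (c, t)) * (zr (2 * (c - h)) * zr c) <= Cmod (zeta ((c - h)%R, t)) * (zr (2 * c) * zr (c - h)).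
Proof.
  intros Hc Hh. set (c' := c - h) in *. assert (Hcc : c' <= c) by (unfold c'; lra).
  pose proof (proj1 (Cmod_gt_0 _) (zeta_neq0 (c, t) ltac:(simpl; lra))). pose proof (proj1 (Cmod_gt_0 _) (zeta_neq0 (c', t) Hc)). pose proof (zr_ge1 (2 * c) ltac:(lra)). pose proof (zr_ge1 (2 * c') ltac:(lra)).
  set (za := Cmod (zeta (c, t))) in *. set (za' := Cmod (zeta (c', t))) in *.
  assert (K : / za' * (zr c / zr (2 * c)) <= / za * (zr c' / zr (2 * c'))).
  { apply (is_lim_seq_le (fun q => Cmod (eulerP (c', t) q) * eulerQ c q) (fun q => Cmod (eulerP (c, t) q) * eulerQ c' q) (/ za' * (zr c / zr (2 * c))) (/ za * (zr c' / zr (2 * c'))));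
      [| apply is_lim_seq_mult'; [apply eulerP_lim, Hc | apply eulerQ_lim; lra] | apply is_lim_seq_mult'; [apply eulerP_lim; simpl; lra | apply eulerQ_lim; lra]].
    induction n as [| q IH]; [simpl; rewrite !Cmod_1; lra |]. cbn [eulerP eulerQ]. rewrite !Cmod_mult.
    set (n := INR (S q)). set (b := rp (- c) n). set (a := rp (- c') n).
    apply Rle_trans with (Cmod (eulerP (c', t) q) * eulerQ c q * (Cmod (if prime_succ q then 1 - npow (c', t) n else 1) * (if prime_succ q then 1 + b else 1))); [lra |].
    apply Rle_trans with (Cmod (eulerP (c, t) q) * eulerQ c' q * (Cmod (if prime_succ q then 1 - npow (c, t) n else 1) * (if prime_succ q then 1 + a else 1))); [| lra].
    pose proof (eulerQ_ge c q). assert (0 < b) by apply rp_pos.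
    apply Rmult_le_compat; [pos | destruct (prime_succ q); pos | lra |]. destruct (prime_succ q) eqn:Hq; [| lra].
    pose proof (prime_npow_le c' q Hc Hq) as Hp. assert (b <= a) by (apply rp_le; [apply (le_INR 1); lia | lra]).
    assert (En : forall x, npow (x, t) n = (RtoC (rp (- x) n) * cis (- t * ln n))%C).
    { intro x. unfold npow. rewrite Cexp_cis. unfold rp. f_equal; [f_equal; f_equal; simpl; ring | f_equal; simpl; ring]. }
    rewrite !En. fold n a b in Hp |- *. apply unit_ratio; [lra | lra | apply Cmod_cis]. }
  apply (Rmult_le_compat_l (za * za' * zr (2 * c) * zr (2 * c'))) in K; [| pos].
  replace (za * (zr (2 * c') * zr c)) with (za * za' * zr (2 * c) * zr (2 * c') * (/ za' * (zr c / zr (2 * c)))) by (field; lra).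
  eapply Rle_trans; [exact K |]. right. field. lra.
Qed.

(** * The integral of S as a difference of integrals of ln |zeta| *)

(** Two continuous arguments differ by a constant: otherwise the intermediate value theorem yields a
    change e of f - g with 0 < e <= 1, for which cos e = 1 is impossible. *)
Lemma cis_unique (f g : R -> R) (a b : R) : a <= b -> (forall u, a <= u <= b -> continuous f u) -> (forall u, a <= u <= b -> continuous g u) ->
  (forall u, a <= u <= b -> cis (f u) = cis (g u)) -> f b - g b = f a - g a.
Proof.
  intros Hab Hf Hg E. set (d := fun u => f u - g u). pose proof PI_ge_3 as HP3.
  assert (Hcis : forall u, a <= u <= b -> cos (d u) = 1 /\ sin (d u) = 0).
  { intros u Hu. specialize (E u Hu). injection E as E1 E2. unfold d. rewrite cos_minus, sin_minus, E1, E2. generalize (sin2_cos2 (g u)). unfold Rsqr. split; lra. }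
  assert (P : forall s, s = 1 \/ s = -1 -> s * (d b - d a) <= 0).
  { intros s Hs. apply Rnot_lt_le. intro Hl. set (e := Rmin 1 (s * (d b - d a) / 2)).
    assert (He : 0 < e <= 1 /\ e <= s * (d b - d a) / 2) by (unfold e, Rmin; destruct Rle_dec; lra).
    destruct (IVT_interv (fun u => s * (d u - d a) - e) a b) as [u [Hu Eu]]; [| destruct Hab; subst; lra | lra | lra |].
    - intros u Hu. apply continuity_pt_filterlim. apply (continuous_minus (fun u => s * (d u - d a)) (fun _ => e)); [| apply continuous_const].
      apply (continuous_mult (fun _ => s) (fun u => d u - d a)); [apply continuous_const |]. apply (continuous_minus d (fun _ => d a)); [| apply continuous_const].
      apply (continuous_minus f g); [apply Hf | apply Hg]; exact Hu.
    - destruct (Hcis u Hu) as [C1 _]. destruct (Hcis a ltac:(lra)) as [C2 S2]. assert (K : cos (d u - d a) = 1) by (rewrite cos_minus, C1, C2, S2; ring).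
      assert (Ke : cos e = 1) by (destruct Hs as [-> | ->]; [rewrite <- K | rewrite <- K, <- cos_neg]; f_equal; lra).
      rewrite <- cos_0 in Ke. pose proof (cos_decreasing_1 0 e). lra. }
  pose proof (P 1 ltac:(lra)). pose proof (P (-1) ltac:(lra)). unfold d in *. lra.
Qed.

Lemma sqrt_sq_plus (x y : R) : y <> 0 -> sqrt (x ^ 2 + y ^ 2) = Rabs y * sqrt (1 + (x / y)²) /\ 0 < sqrt (1 + (x / y)²).
Proof.
  intro Hy. pose proof (Rle_0_sqr (x / y)). split; [| apply sqrt_lt_R0; lra].
  rewrite <- (sqrt_Rsqr (Rabs y)), <- sqrt_mult by pos. f_equal. rewrite <- Rsqr_abs. unfold Rsqr. field. exact Hy.
Qed.

Lemma polar_right (z : C) : 0 < Re z -> z = (RtoC (Cmod z) * cis (atan (Im z / Re z)))%C.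
Proof.
  destruct z as [x y]. simpl. intro Hx. unfold cis. rewrite cos_atan, sin_atan.
  destruct (sqrt_sq_plus y x ltac:(lra)) as [E Hs]. rewrite Rplus_comm, Rabs_pos_eq in E by lra.
  unfold Cmod; simpl in *. rewrite E. apply injective_projections; simpl; field; lra.
Qed.

(** An argument of x + iy for y different from 0, written with x / y so that it is continuous in x
    across x = 0. *)
Definition phi (x y : R) : R := (if Rlt_dec 0 y then PI / 2 else - (PI / 2)) - atan (x / y).

Lemma polar_phi (x y : R) : y <> 0 -> ((x, y) : C) = (RtoC (Cmod (x, y)) * cis (phi x y))%C.
Proof.
  intro Hy. unfold phi, cis. rewrite cos_minus, sin_minus, cos_atan, sin_atan.
  destruct (sqrt_sq_plus x y Hy) as [E Hs]. unfold Cmod; simpl in *. rewrite E. destruct (Rlt_dec 0 y) as [H | H].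
  - rewrite cos_PI2, sin_PI2, Rabs_pos_eq by lra. apply injective_projections; simpl; field; lra.
  - rewrite cos_neg, sin_neg, cos_PI2, sin_PI2, Rabs_left by lra. apply injective_projections; simpl; field; lra.
Qed.

Lemma cis_plus (a b : R) : (cis (a + b) = cis a * cis b)%C.
Proof. unfold cis. rewrite cos_plus, sin_plus. apply injective_projections; simpl; ring.
Qed.

Lemma polar_cis (z : C) (r a b : R) : z <> 0%C -> z = (RtoC (Cmod z) * cis a)%C -> z = (RtoC (Cmod z) * cis b)%C -> cis a = cis b.
Proof.
  intros Hn Ha Hb. assert (N : RtoC (Cmod z) <> 0%C) by (apply RtoC_neq0; pose proof (proj1 (Cmod_gt_0 z) Hn); lra).
  rewrite Ha in Hb at 1. replace (cis a) with (/ RtoC (Cmod z) * (RtoC (Cmod z) * cis a))%C by (field; exact N). rewrite Hb. field. exact N.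
Qed.

Definition lsum (f : C -> R) (l : list C) : R := fold_right (fun rho acc => f rho + acc) 0 l.

Lemma lsum_continuous (f : C -> R -> R) (l : list C) (t : R) : (forall rho, In rho l -> continuous (f rho) t) -> continuous (fun t => lsum (fun rho => f rho t) l) t.
Proof.
  induction l as [| rho l IH]; intro H; simpl; [apply continuous_const |]. apply (continuous_plus (f rho) (fun t => lsum (fun rho => f rho t) l)); [apply H; left; reflexivity | apply IH; intros; apply H; right; assumption].
Qed.

Lemma lsum_RInt (f F : C -> R -> R) (l : list C) (a b : R) : (forall rho, In rho l -> is_RInt (f rho) a b (F rho b - F rho a)) ->
  is_RInt (fun t => lsum (fun rho => f rho t) l) a b (lsum (fun rho => F rho b) l - lsum (fun rho => F rho a) l).
Proof.
  induction l as [| rho l IH]; intro H; simpl.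
  - replace (0 - 0) with (scal (b - a) 0) by (rsc; ring). apply (@is_RInt_const RN).
  - replace (F rho b + lsum (fun rho => F rho b) l - (F rho a + lsum (fun rho => F rho a) l)) with (plus (F rho b - F rho a) (lsum (fun rho => F rho b) l - lsum (fun rho => F rho a) l)) by (rsc; ring).
    apply (@is_RInt_plus RN (f rho)); [apply H; left; reflexivity | apply IH; intros; apply H; right; assumption].
Qed.

Lemma prodl_polar (l : list C) (x t : R) : (forall rho, In rho l -> t - Im rho <> 0) ->
  prodl l (x, t) = (RtoC (Cmod (prodl l (x, t))) * cis (lsum (fun rho => phi (x - Re rho) (t - Im rho)) l))%C.
Proof.
  induction l as [| rho l IH]; intro H; simpl.
  - rewrite Cmod_1. unfold cis. rewrite cos_0, sin_0. apply injective_projections; simpl; ring.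
  - rewrite Cmod_mult, RtoC_mult, cis_plus. rewrite IH at 1 by (intros; apply H; right; assumption).
    replace ((x, t) - rho)%C with ((x - Re rho, t - Im rho) : C) by (destruct rho; unfold Cminus, Cplus, Copp; simpl; apply injective_projections; simpl; ring).
    rewrite (polar_phi (x - Re rho) (t - Im rho)) at 1 by (apply H; left; reflexivity). ring.
Qed.

Lemma ln_Cmod_prodl (l : list C) (z : C) : (forall rho, In rho l -> (z - rho)%C <> 0%C) -> ln (Cmod (prodl l z)) = lsum (fun rho => ln (Cmod (z - rho)%C)) l.
Proof.
  induction l as [| rho l IH]; intro H; simpl; [rewrite Cmod_1; apply ln_1 |].
  rewrite Cmod_mult, ln_mult; [rewrite IH by (intros; apply H; right; assumption); reflexivity | apply Cmod_gt_0, H; left; reflexivity | apply Cmod_gt_0, prodl_neq0; intros; apply H; right; assumption].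
Qed.

(* Primitive of [y => atan (c / y)], including the junk value at [y = 0]. *)
Definition Pat (c y : R) : R := / 2 * c * ln (c ^ 2 + y ^ 2) + y * atan (c / y).

Lemma atan_div_neg (c y : R) : atan (- c / y) = - atan (c / y).
Proof. replace (- c / y) with (- (c / y)) by lra. apply atan_opp.
Qed.

Lemma atan_div_pos (c y : R) : 0 < c -> 0 < y -> atan (c / y) = PI / 2 - atan (y / c).
Proof. intros Hc Hy. replace (c / y) with (/ (y / c)) by (field; lra). apply atan_inv. apply Rdiv_lt_0_compat; assumption. Qed.

Lemma Pat_int_pos (c a b : R) : 0 < c -> 0 <= a <= b -> is_RInt (fun y => atan (c / y)) a b (Pat c b - Pat c a).
Proof.
  intros Hc Hab. set (Q := fun y => / 2 * c * ln (c ^ 2 + y ^ 2) + y * (PI / 2 - atan (y / c))).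
  assert (EQ : forall y, 0 <= y -> Pat c y = Q y).
  { intros y [Hy | <-]; unfold Pat, Q; [rewrite atan_div_pos by assumption; reflexivity | ring]. }
  rewrite !EQ by lra. apply (is_RInt_ext (fun y => PI / 2 - atan (y / c))).
  - rewrite Rmin_left, Rmax_right by lra. symmetry. apply atan_div_pos; lra.
  - apply (@is_RInt_derive RV Q); intros y _.
    + unfold Q. auto_derive; [nra |]. unfold Rdiv. field. split; nra.
    + cts_derive; lra.
Qed.

Lemma Pat_even (c y : R) : Pat c (- y) = Pat c y.
Proof. unfold Pat. replace (c / - y) with (- (c / y)) by (unfold Rdiv; rewrite Rinv_opp; ring). rewrite atan_opp. replace ((- y) ^ 2) with (y ^ 2) by ring. ring. Qed.

Lemma Pat_int (c a b : R) : a <= b -> is_RInt (fun y => atan (c / y)) a b (Pat c b - Pat c a).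
Proof.
  intro Hab.
  assert (Hpos : forall c, 0 < c -> is_RInt (fun y => atan (c / y)) a b (Pat c b - Pat c a)).
  { clear c. intros c Hc. assert (Hneg : forall a b, a <= b <= 0 -> is_RInt (fun y => atan (c / y)) a b (Pat c b - Pat c a)).
    { clear a b Hab. intros a b Hab. pose proof (Pat_int_pos c (- b) (- a) Hc ltac:(lra)) as K. apply (@is_RInt_swap RN) in K. apply (@is_RInt_comp_opp RN) in K.
      apply (is_RInt_eq _ _ _ _ _ _ K); [rewrite !Pat_even; rsc; ring |]. intros y _. rsc. replace (c / - y) with (- (c / y)) by (unfold Rdiv; rewrite Rinv_opp; ring). rewrite atan_opp. ring. }
    destruct (Rle_dec 0 a) as [Ha | Ha]; [apply Pat_int_pos; lra |]. destruct (Rle_dec b 0) as [Hb | Hb]; [apply Hneg; lra |].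
    replace (Pat c b - Pat c a) with (plus (Pat c 0 - Pat c a) (Pat c b - Pat c 0)) by (rsc; ring).
    apply (@is_RInt_Chasles RN _ a 0 b); [apply Hneg | apply Pat_int_pos]; lra. }
  destruct (Rtotal_order c 0) as [Hc | [Hc | Hc]]; [| | apply Hpos, Hc].
  - specialize (Hpos (- c) ltac:(lra)). apply (@is_RInt_opp RN) in Hpos.
    apply (is_RInt_eq _ _ _ _ _ _ Hpos); [unfold Pat; rewrite !atan_div_neg; replace ((- c) ^ 2) with (c ^ 2) by ring; rsc; ring | intros y _; rewrite atan_div_neg; rsc; ring].
  - subst c. replace (Pat 0 b - Pat 0 a) with (scal (b - a) 0) by (unfold Pat, Rdiv; rsc; rewrite !Rmult_0_l, atan_0; ring).
    apply (is_RInt_ext (fun _ => 0)); [intros y _; unfold Rdiv; rewrite Rmult_0_l, atan_0; reflexivity | apply (@is_RInt_const RN)].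
Qed.

Lemma Pat_shift (c g a b : R) : a <= b -> is_RInt (fun t => atan (c / (t - g))) a b (Pat c (b - g) - Pat c (a - g)).
Proof.
  intro Hab. pose proof (Pat_int c (a - g) (b - g) ltac:(lra)) as K.
  replace (a - g) with (1 * a + - g) in K at 1 by ring. replace (b - g) with (1 * b + - g) in K at 1 by ring.
  apply (@is_RInt_comp_lin RN) in K. revert K. apply is_RInt_ext. intros t _. rsc. replace (1 * t + - g) with (t - g) by ring. ring.
Qed.

(** [Pat] is a primitive in both variables: in y of atan(x / y), in x of ln |x + iy| + 1. For a
    linear factor this is the whole relation between arguments and integrals of ln |zeta|. *)
Lemma ln_Cmod_line (rho : C) (t a b : R) : t - Im rho <> 0 -> a <= b ->
  is_RInt (fun x => ln (Cmod ((x, t) - rho)%C)) a b (Pat (b - Re rho) (t - Im rho) - Pat (a - Re rho) (t - Im rho) - (b - a)).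
Proof.
  intros Hy Hab. set (y := t - Im rho) in *. set (F := fun x => Pat (x - Re rho) y - x).
  replace (Pat (b - Re rho) y - Pat (a - Re rho) y - (b - a)) with (minus (F b) (F a)) by (unfold F; rsc; ring).
  apply (is_RInt_ext (fun x => / 2 * ln ((x - Re rho) ^ 2 + y ^ 2))).
  - intros x _. rewrite ln_Cmod; [f_equal; f_equal; unfold y; destruct rho; simpl; ring |]. intro E. apply Hy. injection E as _ E2. pos.
  - assert (Hp : forall x, 0 < (x - Re rho) ^ 2 + y ^ 2) by (intro x; assert (0 < y ^ 2) by nra; pose proof (pow2_ge_0 (x - Re rho)); lra).
    apply (@is_RInt_derive RV F); intros x _; specialize (Hp x).
    + unfold F, Pat. auto_derive; [lra |]. replace (x + - Re rho) with (x - Re rho) by ring.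
      replace ((x - Re rho) * ((x - Re rho) * 1) + y * (y * 1)) with ((x - Re rho) ^ 2 + y ^ 2) by ring. field. repeat split; first [exact Hy | lra | nra].
    + cts_derive; lra.
Qed.

Lemma is_RInt_finite_ext (L : list R) : forall (f g : R -> R) (a b : R), a <= b -> (forall x, a < x < b -> ~ In x L -> f x = g x) -> ex_RInt f a b -> is_RInt g a b (RInt f a b).
Proof.
  induction L as [| p L IH]; intros f g a b Hab H Hf.
  - apply (is_RInt_ext f); [rewrite Rmin_left, Rmax_right by lra; intros x Hx; apply H; [lra | intros []] | apply (RInt_correct (V := RV)), Hf].
  - destruct (Rlt_dec a p) as [H1 | H1]; [destruct (Rlt_dec p b) as [H2 | H2] |].
    + assert (F1 : ex_RInt f a p) by (apply (ex_RInt_Chasles_1 (V := RV) f a p b); pos).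
      assert (F2 : ex_RInt f p b) by (apply (ex_RInt_Chasles_2 (V := RV) f a p b); pos).
      rewrite <- (RInt_Chasles (V := RV) f a p b F1 F2). apply (@is_RInt_Chasles RN g a p b).
      * apply IH; [lra | | pos]. intros x Hx Hn. apply H; [lra |]. intros [E | E]; [lra | auto].
      * apply IH; [lra | | pos]. intros x Hx Hn. apply H; [lra |]. intros [E | E]; [lra | auto].
    + apply IH; [lra | | pos]. intros x Hx Hn. apply H; [lra |]. intros [E | E]; [lra | auto].
    + apply IH; [lra | | pos]. intros x Hx Hn. apply H; [lra |]. intros [E | E]; [lra | auto].
Qed.

Lemma avoid_list (L : list R) (a b : R) : a < b -> exists x, a < x < b /\ ~ In x L.
Proof.
  revert a b. induction L as [| p L IH]; intros a b Hab; [exists ((a + b) / 2); split; [lra | intros []] |].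
  destruct (IH a (if Rlt_dec a p then Rmin p b else b)) as [x [Hx Hn]]; unfold Rmin in *; repeat destruct Rlt_dec; repeat destruct Rle_dec;
    try (exists x; split; [lra | intros [E | E]; [lra | auto]]); lra.
Qed.

Lemma list_dist (L : list R) (t : R) : ~ In t L -> exists d, 0 < d /\ forall x, Rabs (x - t) < d -> ~ In x L.
Proof.
  induction L as [| p L IH]; intro H; [exists 1; split; [lra | intros x _ []] |].
  destruct IH as [d [Hd Hdx]]; [intro Hin; apply H; right; exact Hin |]. assert (Hp : p <> t) by (intro E; apply H; left; exact E).
  exists (Rmin d (Rabs (p - t))). split; [apply Rmin_glb_lt; [lra | apply Rabs_pos_lt; lra] |].
  intros x Hx [E | E]; [subst p; pose proof (Rmin_r d (Rabs (x - t))); lra | apply (Hdx x); [eapply Rlt_le_trans; [exact Hx | apply Rmin_l] | pos]].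
Qed.

Lemma PS_1 (x : R) : PS x 1 = 1.
Proof. rewrite PS_S. unfold PS. rewrite sum_n_m_zero by lia. change (zero : R) with 0. unfold rp. simpl INR. rewrite ln_1, Rmult_0_r, exp_0. ring. Qed.

Lemma zeta_sub1 (s : C) : 1 < Re s -> Cmod (zeta s - 1)%C <= zr (Re s) - 1.
Proof.
  intro Hs. apply le_epsilon. intros e He. destruct (zeta_partial s e Hs He) as [M0 H0]. specialize (H0 (S M0) ltac:(lia)).
  assert (Hc : Cmod (csum (fun i => npow s (INR (S i))) (S M0) - 1)%C <= PS (Re s) (S M0) - 1).
  { clear H0. induction M0 as [| M IH].
    - rewrite PS_1. cbn [csum]. unfold npow. simpl INR. rewrite ln_1. replace (- s * 0)%C with (RtoC 0) by ring. rewrite Cexp_0. replace (0 + 1 - 1)%C with (RtoC 0) by ring. rewrite Cmod_0. lra.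
    - rewrite PS_S. change (csum (fun i => npow s (INR (S i))) (S (S M))) with (csum (fun i => npow s (INR (S i))) (S M) + npow s (INR (S (S M))))%C.
      set (cs := csum _ (S M)) in *. replace (cs + npow s (INR (S (S M))) - 1)%C with ((cs - 1) + npow s (INR (S (S M))))%C by ring.
      Ctri. rewrite Cmod_npow. unfold rp. lra. }
  pose proof (PS_le_zr (Re s) (S M0) Hs). set (cs := csum _ (S M0)) in *. replace (zeta s - 1)%C with ((cs - 1) - (cs - zeta s))%C by ring. eapply Rle_trans; [apply Cmod_minus_le |]. lra.
Qed.

Lemma zeta_upper (s : C) : 1 < Re s -> Cmod (zeta s) <= zr (Re s).
Proof. intro Hs. replace (zeta s) with (zeta s - 1 + 1)%C by ring. Ctri. rewrite Cmod_1. pose proof (zeta_sub1 s Hs). lra. Qed.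

Lemma zr_far (x : R) : 2 <= x -> zr x - 1 <= 3 / 4 * rp (- (x - 2)) 2.
Proof.
  intro Hx. set (r := rp (- (x - 2)) 2). assert (Hr : 0 < r) by apply rp_pos.
  assert (HP : forall n, PS x (S (S n)) <= 1 + 3 / 4 * r).
  { intro n. unfold PS. rewrite (sum_n_m_Chasles _ 1 1 (S (S n))) by lia. change (sum_n_m (fun k => rp (- x) (INR k)) 1 1) with (PS x 1). rewrite PS_1. apply Rplus_le_compat_l.
    apply Rle_trans with (sum_n_m (fun k => r * / INR k ^ 2) 2 (S (S n))).
    - apply sum_n_m_le_loc. intros k Hk. assert (2 <= INR k) by (apply (le_INR 2); lia). replace (- x) with (- (x - 2) + -2) by ring. rewrite rp_plus.
      replace (rp (-2) (INR k)) with (/ INR k ^ 2).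
      + apply Rmult_le_compat_r; [left; apply Rinv_0_lt_compat; nra | apply rp_anti; lra].
      + unfold rp. replace (-2 * ln (INR k)) with (- (ln (INR k) + ln (INR k))) by ring. rewrite exp_Ropp, exp_plus, exp_ln by lra. f_equal. ring.
    - rewrite (sum_n_m_mult_l (K := R_AbsRing) r (fun k => / INR k ^ 2)). rewrite (Rmult_comm (3 / 4)). apply Rmult_le_compat_l; [lra |].
      rewrite (sum_n_m_Chasles _ 2 2 (S (S n))) by lia. rewrite sum_n_n. pose proof (inv_sq_tail 2 (S (S n)) ltac:(lia)) as T. simpl INR in *. replace (/ (1 + 1) ^ 2) with (/ 4) by rfield. apply Rle_trans with (/ 4 + / 2); [apply Rplus_le_compat_l, T | lra]. }
  destruct (zr_lim x ltac:(lra)) as [Hl _].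
  assert (zr x <= 1 + 3 / 4 * r); [| lra].
  apply (is_lim_seq_le_loc (PS x) (fun _ => 1 + 3 / 4 * r) (zr x) (1 + 3 / 4 * r)); [| pos | apply is_lim_seq_const].
  exists 2%nat. intros n Hn. destruct n as [| [| n]]; [lia | lia | apply HP].
Qed.

Lemma Re_zeta_pos (s : C) : 2 <= Re s -> / 4 <= Re (zeta s).
Proof.
  intro Hs. pose proof (zeta_sub1 s ltac:(lra)) as K. pose proof (zr_far (Re s) Hs) as K2. pose proof (re_le_Cmod (zeta s - 1)%C) as K3.
  assert (rp (- (Re s - 2)) 2 <= 1) by (unfold rp; rewrite <- exp_0; apply exp_le; pose proof ln2_ge; nra).
  replace (Re (zeta s - 1)%C) with (Re (zeta s) - 1) in K3 by (destruct (zeta s); simpl; ring). apply Rabs_le_between in K3. lra.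
Qed.

Lemma zeta_cts (s : C) : s <> 1%C -> Ccts zeta s.
Proof. intro Hs. destruct Hz as [_ Hd]. destruct (ex_derive_Cd zeta s (Hd s Hs)) as [l Hl]. exact (Cd_cts _ _ _ Hl). Qed.

(** The principal argument of zeta(s), continuous on Re s >= 2 because Re zeta >= 1/4 there. *)
Definition AX (s : C) : R := atan (Im (zeta s) / Re (zeta s)).

Lemma AX_polar (s : C) : 2 <= Re s -> zeta s = (RtoC (Cmod (zeta s)) * cis (AX s))%C.
Proof. intro Hs. apply polar_right. pose proof (Re_zeta_pos s Hs). lra. Qed.

Lemma AX_cts (g : R -> C) (u : R) : Cont g u -> 2 <= Re (g u) -> continuous (fun u => AX (g u)) u.
Proof.
  intros Hg Hre. assert (Hc : Cont (fun u => zeta (g u)) u).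
  { apply continuous_Ccts_comp; [| pos]. apply zeta_cts. intro E. rewrite E in Hre. simpl in Hre. lra. } apply (continuous_comp (fun u => Im (zeta (g u)) / Re (zeta (g u))) atan); [| cts_derive].
  apply (continuous_mult (fun u => Im (zeta (g u))) (fun u => / Re (zeta (g u)))); [apply continuous_C_snd, Hc |].
  apply (continuous_comp (fun u => Re (zeta (g u))) Rinv); [apply continuous_C_fst, Hc | cts_derive; pose proof (Re_zeta_pos _ Hre); lra].
Qed.

Lemma cts_horiz (x t : R) : Cont (fun x => ((x, t) : C)) x.
Proof. apply continuous_C_pair; [apply continuous_id | apply continuous_const]. Qed.

Lemma cts_vert (x t : R) : Cont (fun t => ((x, t) : C)) t.
Proof. apply continuous_C_pair; [apply continuous_const | apply continuous_id]. Qed.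

Lemma Ccts_horiz (g : C -> C) (x t : R) : Ccts g (x, t) -> Cont (fun x => g (x, t)) x.
Proof. intro H. apply (continuous_Ccts_comp g (fun x => (x, t)) x H), cts_horiz. Qed.

Lemma Ccts_vert (g : C -> C) (x t : R) : Ccts g (x, t) -> Cont (fun t => g (x, t)) t.
Proof. intro H. apply (continuous_Ccts_comp g (fun t => (x, t)) t H), cts_vert. Qed.

(** * S against integrals of ln |zeta| on a small disc *)

Section Local.
Variables (tau : R) (l : list C) (H : C -> C).
Let c : C := (5 / 4, tau).
Hypothesis Htau : 20 <= tau.
Hypothesis HH : holo H c 1.
Hypothesis HE : forall z, Cmod (z - c)%C < 1 -> zeta z = (prodl l z * Cexp (H z))%C.

Lemma in_disc (x t : R) : / 2 <= x <= 2 -> Rabs (t - tau) <= 2 / 5 -> Cmod ((x, t) - c)%C < 1.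
Proof.
  intros Hx Ht. apply Rabs_le_between in Ht. rewrite <- sqrt_1. apply sqrt_lt_1_alt. unfold c; simpl; rewrite !Rmult_1_r; change (x + - (5 / 4)) with (x - 5 / 4); change (t + - tau) with (t - tau). assert ((x - 5 / 4) * (x - 5 / 4) <= 9 / 16) by nra. assert ((t - tau) * (t - tau) <= 4 / 25) by nra. revert H0 H1. generalize (x - 5 / 4) (t - tau). split; nra.
Qed.

Definition noz (t : R) : Prop := forall rho, In rho l -> t - Im rho <> 0.

Definition Theta (x t : R) : R := Im (H (x, t)) + lsum (fun rho => phi (x - Re rho) (t - Im rho)) l.

Lemma noz_prodl (x t : R) : noz t -> forall rho, In rho l -> ((x, t) - rho)%C <> 0%C.
Proof. intros Hn rho Hin E. apply (Hn rho Hin). apply (f_equal Im) in E. pos.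
Qed.

Lemma Theta_polar (x t : R) : / 2 <= x <= 2 -> Rabs (t - tau) <= 2 / 5 -> noz t ->
  zeta (x, t) <> 0%C /\ zeta (x, t) = (RtoC (Cmod (zeta (x, t))) * cis (Theta x t))%C.
Proof.
  intros Hx Ht Hn. rewrite HE by (apply in_disc; assumption). split.
  - apply Cmult_neq_0; [apply prodl_neq0, noz_prodl, Hn | apply Cexp_neq0].
  - rewrite Cmod_mult, RtoC_mult, Cmod_Cexp. unfold Theta. rewrite Rplus_comm, cis_plus. rewrite (prodl_polar l x t Hn) at 1. rewrite Cexp_cis. ring.
Qed.

Lemma H_cts (z : C) : Cmod (z - c)%C < 1 -> Ccts H z.
Proof. apply (holo_cts H c 1 z HH). Qed.

Lemma Theta_cts (x t : R) : / 2 <= x <= 2 -> Rabs (t - tau) <= 2 / 5 -> noz t -> continuous (fun x => Theta x t) x.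
Proof.
  intros Hx Ht Hn. apply (continuous_plus (fun x => Im (H (x, t))) (fun x => lsum (fun rho => phi (x - Re rho) (t - Im rho)) l)).
  - apply continuous_C_snd. apply Ccts_horiz, H_cts, in_disc; assumption.
  - apply (lsum_continuous (fun rho x => phi (x - Re rho) (t - Im rho))). intros rho _. unfold phi. cts_derive.
Qed.

Lemma cts_half_abs (e u : R) : continuous (fun u => (u + 1 + e * Rabs (u - 1)) / 2) u.
Proof.
  apply (continuous_mult (fun u => u + 1 + e * Rabs (u - 1)) (fun _ => / 2)); [| apply continuous_const].
  apply (continuous_plus (fun u => u + 1) (fun u => e * Rabs (u - 1))); [cts_derive |].
  apply (continuous_mult (fun _ => e) (fun u => Rabs (u - 1))); [apply continuous_const |]. apply continuous_Rabs_comp. cts_derive.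
Qed.

(** On the vertical leg the principal argument is continuous; on the horizontal leg [Theta] is,
    shifted to match at 2 + it. By [cis_unique] the argument chosen by [epsilon] ends at the same
    value. *)
Lemma arg_value (t : R) : Rabs (t - tau) <= 2 / 5 -> noz t -> arg_zeta_half zeta t = AX (2, t) + Theta (/ 2) t - Theta 2 t.
Proof.
  (* [mn] is min(u, 1), and [mx] is the abscissa of the path, built from max(u, 1); with the
     absolute value both are visibly continuous at the corner u = 1. *)
  intros Ht Hn. set (mn := fun u => (u + 1 + -1 * Rabs (u - 1)) / 2). set (mx := fun u => 2 - 3 / 2 * ((u + 1 + 1 * Rabs (u - 1)) / 2 - 1)).
  assert (V : forall u, (u <= 1 -> mn u = u /\ mx u = 2) /\ (1 <= u -> mn u = 1 /\ mx u = 2 - 3 / 2 * (u - 1))) by (intro u; unfold mn, mx, Rabs; destruct Rcase_abs; lra).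
  assert (Hmx : forall u, continuous mx u) by (intro u; apply (continuous_comp (fun u => (u + 1 + 1 * Rabs (u - 1)) / 2) (fun y => 2 - 3 / 2 * (y - 1))); [apply cts_half_abs | cts_derive]).
  set (th := fun u => AX (2, mn u * t) + (Theta (mx u) t - Theta 2 t)).
  assert (Hmxr : forall u, 0 <= u <= 2 -> / 2 <= mx u <= 2) by (intros u Hu; destruct (Rle_dec u 1); [rewrite (proj2 (proj1 (V u) ltac:(lra))) | rewrite (proj2 (proj2 (V u) ltac:(lra)))]; lra).
  assert (Hthc : forall u, 0 <= u <= 2 -> continuous th u).
  { intros u Hu. apply (continuous_plus (fun u => AX (2, mn u * t)) (fun u => Theta (mx u) t - Theta 2 t)).
    - apply (AX_cts (fun u => (2, mn u * t))); [| simpl; lra]. apply continuous_C_pair; [apply continuous_const |]. apply (continuous_mult mn (fun _ => t)); [apply cts_half_abs | apply continuous_const].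
    - apply (continuous_minus (fun u => Theta (mx u) t) (fun _ => Theta 2 t)); [| apply continuous_const].
      apply (continuous_comp mx (fun x => Theta x t)); [apply Hmx | apply Theta_cts; [apply Hmxr, Hu | lra | pos]]. }
  destruct (Theta_polar 2 t ltac:(lra) Ht Hn) as [N2 P2].
  assert (E2 : cis (AX (2, t)) = cis (Theta 2 t)) by (apply (polar_cis (zeta (2, t)) 0); [pos | apply AX_polar; simpl; lra | pos]).
  assert (Hpol : forall u, 0 <= u <= 2 -> zeta (arg_path t u) <> 0%C /\ zeta (arg_path t u) = (RtoC (Cmod (zeta (arg_path t u))) * cis (th u))%C).
  { intros u Hu. unfold arg_path, th. destruct (Rle_dec u 1) as [Hc | Hc].
    - destruct (proj1 (V u) Hc) as [-> ->]. rewrite Rminus_diag, Rplus_0_r. split; [| apply AX_polar; simpl; lra].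
      intro E. pose proof (Re_zeta_pos (2, u * t) ltac:(simpl; lra)) as K. rewrite E in K. simpl in K. lra.
    - destruct (proj2 (V u) ltac:(lra)) as [-> ->]. rewrite Rmult_1_l. destruct (Theta_polar (2 - 3 / 2 * (u - 1)) t ltac:(lra) Ht Hn) as [N P]. split; [pos |].
      replace (AX (2, t) + (Theta (2 - 3 / 2 * (u - 1)) t - Theta 2 t)) with (Theta (2 - 3 / 2 * (u - 1)) t + (AX (2, t) + - Theta 2 t)) by ring.
      rewrite !cis_plus, E2, <- cis_plus, Rplus_opp_r. replace (cis 0) with (RtoC 1) by (unfold cis; rewrite cos_0, sin_0; reflexivity). rewrite Cmult_1_r. exact P. }
  assert (Hcexp : forall y, Cexp (Ci * RtoC y)%C = cis y).
  { intro y. rewrite Cexp_cis. replace (Re (Ci * y)%C) with 0 by (simpl; ring). replace (Im (Ci * y)%C) with y by (simpl; ring). rewrite exp_0. ring. }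
  assert (AX20 : AX (2, 0 * t) = 0).
  { unfold AX. rewrite Rmult_0_l. pose proof (proj2 (zr_lim 2 ltac:(lra))) as E. change (RtoC 2) with ((2, 0) : C) in E. rewrite E. unfold Rdiv. rewrite Rmult_0_l. apply atan_0. }
  assert (Hth0 : th 0 = 0) by (unfold th; destruct (proj1 (V 0) ltac:(lra)) as [-> ->]; rewrite AX20; ring).
  assert (Hex : is_arg_by_variation zeta t (th 2)).
  { exists th. split; [pos |]. split; [intros u Hu; rewrite Hcexp; apply Hpol, Hu |].
    split; lra. }
  assert (Hsp := epsilon_spec (inhabits 0) (is_arg_by_variation zeta t) (ex_intro _ _ Hex)). fold (arg_zeta_half zeta t) in Hsp.
  destruct Hsp as [g [Hgc [Hg [Hg0 Hg2]]]].
  assert (U := cis_unique g th 0 2 ltac:(lra) Hgc Hthc).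
  assert (U' : g 2 - th 2 = g 0 - th 0).
  { apply U. intros u Hu. destruct (Hpol u Hu) as [N P]. apply (polar_cis (zeta (arg_path t u)) 0); [pos | | pos]. rewrite <- Hcexp. apply Hg, Hu. } replace (arg_zeta_half zeta t) with (th 2) by lra. unfold th. destruct (proj2 (V 2) ltac:(lra)) as [-> ->]. replace (2 - 3 / 2 * (2 - 1)) with (/ 2) by field. rewrite Rmult_1_l. ring.
Qed.

Definition Kf (t : R) : R := Im (H (/ 2, t)) - Im (H (2, t)) + lsum (fun rho => atan ((2 - Re rho) / (t - Im rho)) - atan ((/ 2 - Re rho) / (t - Im rho))) l.

Lemma arg_Kf (t : R) : Rabs (t - tau) <= 2 / 5 -> noz t -> arg_zeta_half zeta t = AX (2, t) + Kf t.
Proof.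
  intros Ht Hn. rewrite arg_value by assumption. unfold Theta, Kf.
  assert (E : forall l0 : list C, lsum (fun rho => phi (/ 2 - Re rho) (t - Im rho)) l0 - lsum (fun rho => phi (2 - Re rho) (t - Im rho)) l0 = lsum (fun rho => atan ((2 - Re rho) / (t - Im rho)) - atan ((/ 2 - Re rho) / (t - Im rho))) l0).
  { induction l0 as [| rho l0 IH]; simpl; [ring |]. rewrite <- IH. unfold phi. ring. }
  rewrite <- E. ring.
Qed.

Lemma Kf_cts (t : R) : Rabs (t - tau) <= 2 / 5 -> noz t -> continuous (fun t => AX (2, t) + Kf t) t.
Proof.
  intros Ht Hn. apply (continuous_plus (fun t => AX (2, t)) Kf); [apply (AX_cts (fun t => (2, t))); [apply cts_vert | simpl; lra] |].
  apply (continuous_plus (fun t => Im (H (/ 2, t)) - Im (H (2, t))) (fun t => lsum (fun rho => atan ((2 - Re rho) / (t - Im rho)) - atan ((/ 2 - Re rho) / (t - Im rho))) l)).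
  - apply (continuous_minus (fun t => Im (H (/ 2, t))) (fun t => Im (H (2, t)))); apply continuous_C_snd, Ccts_vert, H_cts, in_disc; lra.
  - apply (lsum_continuous (fun rho t => atan ((2 - Re rho) / (t - Im rho)) - atan ((/ 2 - Re rho) / (t - Im rho)))). intros rho Hin. specialize (Hn rho Hin). cts_derive. split; lra.
Qed.

Lemma noz_map (t : R) : ~ In t (map Im l) -> noz t.
Proof. intros Hn rho Hin E. apply Hn. replace t with (Im rho) by lra. apply in_map, Hin. Qed.

(* Ordinates of zeros outside the disc do not affect the limit defining [S_zeta]. *)
Lemma S_value (t : R) : Rabs (t - tau) < 2 / 5 -> ~ In t (map Im l) -> PI * S_zeta zeta t = AX (2, t) + Kf t.
Proof.
  intros Ht Hn. pose proof PI_RGT_0 as HPI. assert (E : S_zeta zeta t = / PI * (AX (2, t) + Kf t)); [| rewrite E; field; lra].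
  unfold S_zeta. destruct (excluded_middle_informative (zero_ordinate zeta t)) as [Ho | Ho]; [| rewrite arg_Kf by (try apply noz_map; try exact Hn; lra); reflexivity].
  set (g := fun t => AX (2, t) + Kf t). set (P := fun L : R => filterlim (fun eps => / 2 * (/ PI * arg_zeta_half zeta (t + eps) + / PI * arg_zeta_half zeta (t - eps))) (at_right 0) (locally L)).
  assert (HP : P (/ PI * g t)).
  { destruct (list_dist (map Im l) t Hn) as [d [Hd Hdn]]. set (r := Rmin d (2 / 5 - Rabs (t - tau))). assert (Hr : 0 < r) by (apply Rmin_glb_lt; lra).
    apply (filterlim_ext_loc (fun eps => / 2 * (/ PI * g (t + eps) + / PI * g (t - eps)))).
    - assert (Hv : forall v, Rabs (v - t) < r -> / PI * arg_zeta_half zeta v = / PI * g v).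
      { intros v Hv. pose proof (Rmin_l d (2 / 5 - Rabs (t - tau))). pose proof (Rmin_r d (2 / 5 - Rabs (t - tau))). fold r in H0, H1.
        rewrite arg_Kf; [reflexivity | replace (v - tau) with ((v - t) + (t - tau)) by ring; eapply Rle_trans; [apply Rabs_triang | lra] | apply noz_map, Hdn; lra]. }
      exists (mkposreal r Hr). intros eps He _. change (Rabs (eps - 0) < r) in He. rewrite Rminus_0_r in He.
      rewrite !Hv; [lra | change (Rabs (t + - eps - t) < r); rewrite Rplus_minus_l, Rabs_Ropp; exact He | rewrite Rplus_minus_l; exact He].
    - assert (Hg : continuous g t) by (apply Kf_cts; [lra | apply noz_map, Hn]).
      assert (HG : continuous (fun eps => / 2 * (/ PI * g (t + eps) + / PI * g (t - eps))) 0).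
      { apply (continuous_mult (fun _ => / 2) (fun eps => / PI * g (t + eps) + / PI * g (t - eps))); [apply continuous_const |].
        apply (continuous_plus (fun eps => / PI * g (t + eps)) (fun eps => / PI * g (t - eps))).
        - apply (continuous_mult (fun _ => / PI) (fun eps => g (t + eps))); [apply continuous_const |]. apply (continuous_comp (fun eps => t + eps) g); [cts_derive | rewrite Rplus_0_r; exact Hg].
        - apply (continuous_mult (fun _ => / PI) (fun eps => g (t - eps))); [apply continuous_const |]. apply (continuous_comp (fun eps => t - eps) g); [cts_derive | rewrite Rminus_0_r; exact Hg]. }
      unfold continuous in HG. rewrite Rplus_0_r, Rminus_0_r in HG. replace (/ 2 * (/ PI * g t + / PI * g t)) with (/ PI * g t) in HG by lra.
      apply (filterlim_filter_le_1 _ (filter_le_within _)), HG. }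
  assert (Hsp := epsilon_spec (inhabits 0) P (ex_intro _ _ HP)).
  apply (@filterlim_locally_unique _ R_AbsRing RN _ (@Proper_StrongProper _ _ (at_right_proper_filter 0)) _ _ _ Hsp HP) || apply (@filterlim_locally_unique _ R_AbsRing RN _ _ _ _ _ Hsp HP).
Qed.

(** The common primitive: its increments in t integrate the argument ([Kf_int]), and its value at t
    is the integral of ln |zeta| over [1/2, 2] up to 3/2 per zero of the list ([D_value]), a
    constant that cancels in differences. *)
Definition Dt (t : R) : R := Re (J H c (2, t)) - Re (J H c (/ 2, t)) + lsum (fun rho => Pat (2 - Re rho) (t - Im rho) - Pat (/ 2 - Re rho) (t - Im rho)) l.

Lemma JH_vert (x t : R) : / 2 <= x <= 2 -> Rabs (t - tau) <= 2 / 5 -> is_derive (fun t => Re (J H c (x, t))) t (- Im (H (x, t))).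
Proof. intros Hx Ht. apply Cd_Re_t, (holo_primitive H c 1 ltac:(lra) HH), in_disc; assumption. Qed.

Lemma Kf_int (a b : R) : a <= b -> Rabs (a - tau) <= 2 / 5 -> Rabs (b - tau) <= 2 / 5 -> is_RInt Kf a b (Dt b - Dt a).
Proof.
  intros Hab Ha Hb. apply Rabs_le_between in Ha, Hb.
  set (Lf := fun t => lsum (fun rho => Pat (2 - Re rho) (t - Im rho) - Pat (/ 2 - Re rho) (t - Im rho)) l).
  set (G := fun t => Re (J H c (2, t)) - Re (J H c (/ 2, t))).
  change (is_RInt (fun t => Im (H (/ 2, t)) - Im (H (2, t)) + lsum (fun rho => atan ((2 - Re rho) / (t - Im rho)) - atan ((/ 2 - Re rho) / (t - Im rho))) l) a b (G b + Lf b - (G a + Lf a))).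
  replace (G b + Lf b - (G a + Lf a)) with (plus (minus (G b) (G a)) (Lf b - Lf a)) by (rsc; ring).
  apply (@is_RInt_plus RN (fun t => Im (H (/ 2, t)) - Im (H (2, t)))).
  - apply (@is_RInt_derive RV G); rewrite Rmin_left, Rmax_right by lra; intros t Ht; assert (Ht' : Rabs (t - tau) <= 2 / 5) by (apply Rabs_le; lra).
    + replace (Im (H (/ 2, t)) - Im (H (2, t))) with (- Im (H (2, t)) - - Im (H (/ 2, t))) by ring. apply (is_derive_minus (fun t => Re (J H c (2, t))) (fun t => Re (J H c (/ 2, t)))); apply JH_vert; lra.
    + apply (continuous_minus (fun t => Im (H (/ 2, t))) (fun t => Im (H (2, t)))); apply continuous_C_snd, Ccts_vert, H_cts, in_disc; lra.
  - apply (lsum_RInt (fun rho t => atan ((2 - Re rho) / (t - Im rho)) - atan ((/ 2 - Re rho) / (t - Im rho))) (fun rho t => Pat (2 - Re rho) (t - Im rho) - Pat (/ 2 - Re rho) (t - Im rho))).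
    intros rho _. match goal with |- is_RInt _ _ _ ?v => replace v with (minus (Pat (2 - Re rho) (b - Im rho) - Pat (2 - Re rho) (a - Im rho)) (Pat (/ 2 - Re rho) (b - Im rho) - Pat (/ 2 - Re rho) (a - Im rho))) by (rsc; ring) end.
    apply (@is_RInt_minus RN (fun t => atan ((2 - Re rho) / (t - Im rho)))); apply Pat_shift; exact Hab.
Qed.

Lemma D_value (t : R) : Rabs (t - tau) <= 2 / 5 -> noz t -> is_RInt (fun x => ln (Cmod (zeta (x, t)))) (/ 2) 2 (Dt t - 3 / 2 * INR (length l)).
Proof.
  intros Ht Hn. set (G := fun x => Re (J H c (x, t))). set (LP := fun x => lsum (fun rho => Pat (x - Re rho) (t - Im rho) - x) l).
  apply (is_RInt_ext (fun x => plus (Re (H (x, t))) (lsum (fun rho => ln (Cmod ((x, t) - rho)%C)) l))).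
  - rewrite Rmin_left, Rmax_right by lra. intros x Hx. rewrite HE by (apply in_disc; lra). rewrite Cmod_mult, Cmod_Cexp, ln_mult, ln_exp; [| apply Cmod_gt_0, prodl_neq0, noz_prodl, Hn | pos].
    rewrite ln_Cmod_prodl by (apply noz_prodl, Hn). rsc. ring.
  - assert (EL : forall l0 : list C, lsum (fun rho => Pat (2 - Re rho) (t - Im rho) - 2) l0 - lsum (fun rho => Pat (/ 2 - Re rho) (t - Im rho) - / 2) l0
      = lsum (fun rho => Pat (2 - Re rho) (t - Im rho) - Pat (/ 2 - Re rho) (t - Im rho)) l0 - 3 / 2 * INR (length l0)).
    { induction l0 as [| rho l0 IH]; [simpl; ring |]. change (length (rho :: l0)) with (S (length l0)). rewrite S_INR. cbn [lsum fold_right]. fold (lsum (fun rho => Pat (2 - Re rho) (t - Im rho) - 2) l0) (lsum (fun rho => Pat (/ 2 - Re rho) (t - Im rho) - / 2) l0) (lsum (fun rho => Pat (2 - Re rho) (t - Im rho) - Pat (/ 2 - Re rho) (t - Im rho)) l0). lra. }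
    replace (Dt t - 3 / 2 * INR (length l)) with (plus (minus (G 2) (G (/ 2))) (LP 2 - LP (/ 2))) by (unfold plus; rsc; unfold LP; rewrite EL; unfold Dt, G; ring).
    apply (@is_RInt_plus RN (fun x => Re (H (x, t)))).
    + apply (@is_RInt_derive RV G); rewrite Rmin_left, Rmax_right by lra; intros x Hx.
      * apply Cd_Re_x, (holo_primitive H c 1 ltac:(lra) HH), in_disc; lra.
      * apply continuous_C_fst. apply Ccts_horiz, H_cts, in_disc; lra.
    + apply (lsum_RInt (fun rho x => ln (Cmod ((x, t) - rho)%C)) (fun rho x => Pat (x - Re rho) (t - Im rho) - x)). intros rho Hin.
      evar_last; [exact (ln_Cmod_line rho t (/ 2) 2 (Hn rho Hin) ltac:(lra)) | lra].
Qed.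

Lemma local_main (a b : R) : tau <= a -> a <= b -> b < tau + 2 / 5 -> noz a -> noz b ->
  is_RInt (fun t => PI * S_zeta zeta t - AX (2, t)) a b (RInt (fun x => ln (Cmod (zeta (x, b)))) (/ 2) 2 - RInt (fun x => ln (Cmod (zeta (x, a)))) (/ 2) 2).
Proof.
  intros Ha Hab Hb Na Nb. rewrite (is_RInt_unique _ _ _ _ (D_value a ltac:(rewrite Rabs_pos_eq; lra) Na)), (is_RInt_unique _ _ _ _ (D_value b ltac:(rewrite Rabs_pos_eq; lra) Nb)).
  pose proof (Kf_int a b Hab ltac:(rewrite Rabs_pos_eq; lra) ltac:(rewrite Rabs_pos_eq; lra)) as K.
  replace (Dt b - 3 / 2 * INR (length l) - (Dt a - 3 / 2 * INR (length l))) with (RInt Kf a b) by (rewrite (is_RInt_unique _ _ _ _ K); rring).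
  apply (is_RInt_finite_ext (map Im l)); [lra | | eexists; exact K]. intros t Ht Hin. rewrite S_value by (try exact Hin; rewrite Rabs_pos_eq; lra). ring.
Qed.
End Local.

(** The requirements of the disc inequality after scaling by 0.8: no zero on the circle 0.8 times 2
    = 1.6, nor on the diameter 1.3 + 0.8 x with |x| <= 2.2. *)
Definition good (t : R) : Prop := (forall x, -0.46 <= x <= 3.06 -> zeta (x, t) <> 0%C) /\ (forall u, zeta (circ (1.3, t) 1.6 u) <> 0%C).

Lemma zeros_list (c : C) (rad r0 r1 : R) : 1 < Re c -> rad <= Im c -> 0 < r0 -> 2 * r0 < r1 < rad ->
  exists (l : list C) (g : C -> C), holo g c rad /\ (forall w, zeta w = prodl l w * g w)%C /\
    (forall s, Cmod (s - c)%C <= r0 -> (In s l <-> zeta s = 0%C)) /\ (forall rho, In rho l -> Cmod (rho - c)%C <= r0 /\ zeta rho = 0%C) /\ (forall z, Cmod (z - c)%C <= r0 -> g z <> 0%C).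
Proof.
  intros Hc Hi Hr Hr1. destruct (finite_zeros zeta c rad r0 r1) as [l [g [Hg [E [Hl Hgn]]]]].
  - apply zeta_holo; eapply Rle_trans; [exact Hi | apply Rle_abs].
  - apply (zeta_neq0), Hc.
  - lra.
  - lra.
  - exists l, g. split; [pos |]. split; [pos |]. split; [| split; assumption]. intros s Hs. split; [intro Hin; apply Hl, Hin |]. intro H0. apply NNPP. intro Hn.
    apply (Hgn s Hs). rewrite E in H0. destruct (Ceq_dec (g s) 0%C) as [E0 | E0]; [pos | exfalso].
    apply (Cmult_neq_0 (prodl l s) (g s)); [| pos | exact H0]. apply prodl_neq0. intros rho Hin Hd. apply Hn. replace s with rho; [pos |]. replace rho with (s - (s - rho))%C by ring. rewrite Hd. ring.
Qed.

(** A zero rho excludes at most three heights: its ordinate, and the heights Im rho + q and Im rho -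
    q whose circle passes through it. Near a only finitely many zeros matter. *)
Lemma exists_good (a b : R) : 20 <= a -> a < b -> exists t, a < t < b /\ good t.
Proof.
  intros Ha Hab. destruct (zeros_list (1.3, a) 5 2 4.5) as [l [g [_ [_ [Hl _]]]]]; try (simpl; lra).
  set (q := fun rho : C => sqrt (1.6 ^ 2 - (1.3 - Re rho) ^ 2)).
  destruct (avoid_list (map Im l ++ map (fun rho => Im rho + q rho) l ++ map (fun rho => Im rho - q rho) l) a (Rmin b (a + / 10)) ltac:(apply Rmin_glb_lt; lra)) as [t [Ht Hn]].
  assert (Hb1 := Rmin_l b (a + / 10)). assert (Hb2 := Rmin_r b (a + / 10)).
  exists t. split; [lra |]. split.
  - intros x Hx E. apply Hn, in_or_app. left. apply (in_map Im l (x, t)). apply Hl; [| pos].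
    replace ((x, t) - (1.3, a))%C with ((x - 1.3, t - a) : C) by (apply injective_projections; simpl; ring).
    eapply Rle_trans; [apply Cmod_le_abs |]. assert (Rabs (x - 1.3) <= 1.76) by (apply Rabs_le; lra). assert (Rabs (t - a) <= 0.1) by (apply Rabs_le; lra). lra.
  - intros u E. set (rho := circ (1.3, t) 1.6 u) in *. assert (Hin : In rho l).
    { apply Hl; [| pos]. eapply Rle_trans; [apply (Cmod_dist_triangle _ (1.3, t)) |]. unfold rho. rewrite Cmod_circ by lra.
      replace ((1.3, t) - (1.3, a))%C with ((0, t - a) : C) by (apply injective_projections; simpl; ring).
      assert (K := Cmod_le_abs 0 (t - a)). rewrite Rabs_R0 in K. assert (Rabs (t - a) <= 0.1) by (apply Rabs_le; lra). lra. }
    assert (Er : 1.6 ^ 2 - (1.3 - Re rho) ^ 2 = (Im rho - t) ^ 2).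
    { unfold rho, circ, cis; simpl. pose proof (sin2_cos2 u) as K. unfold Rsqr in K. nra. }
    assert (Eq : q rho = Rabs (Im rho - t)) by (unfold q; rewrite Er; rewrite <- Rsqr_pow2; apply sqrt_Rsqr_abs).
    apply Hn, in_or_app. right. apply in_or_app. destruct (Rle_dec 0 (Im rho - t)) as [H | H].
    + right. rewrite Rabs_pos_eq in Eq by exact H. replace t with (Im rho - q rho) by lra. apply (in_map (fun rho => Im rho - q rho) l rho Hin).
    + left. rewrite Rabs_left in Eq by lra. replace t with (Im rho + q rho) by lra. apply (in_map (fun rho => Im rho + q rho) l rho Hin).
Qed.

Definition Uk (K t : R) : R := RInt (fun x => ln (Cmod (zeta (x, t)))) (/ 2) K.

Lemma local_step (a b : R) : 20 <= a -> a <= b < a + 2 / 5 -> good a -> good b -> is_RInt (fun t => PI * S_zeta zeta t - AX (2, t)) a b (Uk 2 b - Uk 2 a).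
Proof.
  intros Ha Hab Ga Gb. destruct (zeros_list (5 / 4, a) 3 1 2.5) as [l [g [Hg [E [_ [Hl Hgn]]]]]]; try (simpl; lra).
  destruct (holo_log g (5 / 4, a) 1) as [H [HH HE]]; [lra | intros z Hz1; apply Hg; lra | intros z Hz1; apply Hgn; lra |].
  assert (Hno : forall t, good t -> forall rho, In rho l -> t - Im rho <> 0).
  { intros t Gt rho Hin E0. destruct (Hl rho Hin) as [Hm H0]. apply (proj1 Gt (Re rho)).
    - set (c := (5 / 4, a) : C) in *. pose proof (re_le_Cmod (rho - c)%C) as K. replace (Re (rho - c)%C) with (Re rho - 5 / 4) in K by (destruct rho; simpl; ring). assert (K2 : Rabs (Re rho - 5 / 4) <= 1) by lra. apply Rabs_le_between in K2. lra.
    - rewrite <- H0. f_equal. destruct rho as [x y]; simpl in *. f_equal. lra. }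
  refine (local_main a l H Ha HH _ a b _ _ _ (Hno a Ga) (Hno b Gb)); try lra.
  intros z Hz1. rewrite E, <- HE by exact Hz1. reflexivity.
Qed.

Lemma chain2 (n : nat) : forall a b, 20 <= a -> a <= b -> b - a < / 10 * (INR n + 1) -> good a -> good b -> is_RInt (fun t => PI * S_zeta zeta t - AX (2, t)) a b (Uk 2 b - Uk 2 a).
Proof.
  induction n as [| n IH]; intros a b Ha Hab Hn Ga Gb; [apply local_step; try assumption; simpl in Hn; lra |].
  destruct (Rlt_dec b (a + 2 / 5)) as [Hc | Hc]; [apply local_step; try assumption; lra |].
  destruct (exists_good (b - 3 / 10) (b - 2 / 10)) as [m [Hm Gm]]; [lra | lra |].
  replace (Uk 2 b - Uk 2 a) with (plus (Uk 2 m - Uk 2 a) (Uk 2 b - Uk 2 m)) by (rsc; ring).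
  apply (@is_RInt_Chasles RN _ a m b); [apply IH; try assumption; try lra; rewrite S_INR in Hn; lra | apply local_step; try assumption; lra].
Qed.

Lemma good_cts (t x : R) : 20 <= t -> good t -> / 2 <= x -> continuous (fun x => ln (Cmod (zeta (x, t)))) x.
Proof.
  intros Ht Gt Hx. apply (ln_Cmod_cts (fun x => zeta (x, t))).
  - apply Ccts_horiz. apply (zeta_cts). intro E. apply (f_equal Im) in E. simpl in E. lra.
  - destruct (Rle_dec x 3.06) as [H | H]; [apply (proj1 Gt); lra | apply zeta_neq0; simpl; lra].
Qed.

Lemma tail_step (K a b : R) : 2 <= K -> a <= b -> is_RInt (fun t => AX (2, t) - AX (K, t)) a b (RInt (fun x => ln (Cmod (zeta (x, b)))) 2 K - RInt (fun x => ln (Cmod (zeta (x, a)))) 2 K).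
Proof.
  (* A disc so large that it contains the whole rectangle [2, K] by [a, b] while staying in Re z >
     1.5: at the left corner this needs (b - a)^2 < X - 1.75. One logarithm then serves for all
     heights. *)
  intros HK Hab. set (X := K + 2 + (b - a) ^ 2). set (c := (X, a) : C).
  assert (HX : K + 2 <= X) by (unfold X; pose proof (pow2_ge_0 (b - a)); lra).
  assert (Hdre : forall z, Cmod (z - c)%C < X - 1.5 -> 1.5 < Re z).
  { intros z Hz1. pose proof (re_le_Cmod (z - c)%C) as Kr. replace (Re (z - c)%C) with (Re z - X) in Kr by (destruct z; simpl; ring). assert (Rabs (Re z - X) < X - 1.5) by lra. apply Rabs_def2 in H. lra. }
  destruct (holo_log zeta c (X - 1.5)) as [H [HH HE]]; [lra | | intros z Hz1; apply zeta_neq0; apply Hdre in Hz1; lra |].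
  { intros z Hz1. apply ex_derive_Cd. apply (proj2 Hz). intro E. apply Hdre in Hz1. rewrite E in Hz1. simpl in Hz1. lra. }
  assert (Hin : forall x t, 2 <= x <= K -> a <= t <= b -> Cmod ((x, t) - c)%C < X - 1.5).
  { intros x t Hx Ht. rewrite <- (sqrt_Rsqr (X - 1.5)) by lra. apply sqrt_lt_1_alt. unfold c; simpl.
    assert (X >= 4 + (b - a) ^ 2) by (unfold X; lra). unfold Rsqr. split; nra. }
  pose proof (holo_primitive H c (X - 1.5) ltac:(lra) HH) as HP. set (F := J H c) in *.
  assert (HV : forall t, a <= t <= b -> RInt (fun x => ln (Cmod (zeta (x, t)))) 2 K = Re (F (K, t)) - Re (F (2, t))).
  { intros t Ht. apply is_RInt_unique. apply (is_RInt_ext (fun x => Re (H (x, t)))).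
    - rewrite Rmin_left, Rmax_right by lra. intros x Hx. rewrite HE by (apply Hin; lra). rewrite Cmod_Cexp, ln_exp. reflexivity.
    - apply (@is_RInt_derive RV (fun x => Re (F (x, t)))); rewrite Rmin_left, Rmax_right by lra; intros x Hx.
      + apply Cd_Re_x, HP, Hin; assumption.
      + apply continuous_C_fst. apply Ccts_horiz, (holo_cts H c _ _ HH), Hin; assumption. }
  assert (HA : forall t, a <= t <= b -> Im (H (2, t)) - AX (2, t) = Im (H (K, t)) - AX (K, t)).
  { symmetry. apply (cis_unique (fun x => Im (H (x, t))) (fun x => AX (x, t)) 2 K HK).
    - intros x Hx. apply continuous_C_snd. apply Ccts_horiz, (holo_cts H c _ _ HH), Hin; assumption.
    - intros x Hx. apply (AX_cts (fun x => (x, t))); [apply cts_horiz | simpl; lra].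
    - intros x Hx. apply (polar_cis (zeta (x, t)) 0); [apply zeta_neq0; simpl; lra | | apply AX_polar; simpl; lra].
      rewrite HE by (apply Hin; assumption). rewrite Cmod_Cexp. apply Cexp_cis. }
  rewrite !HV by lra.
  apply (is_RInt_ext (fun t => Im (H (2, t)) - Im (H (K, t)))); [rewrite Rmin_left, Rmax_right by lra; intros t Ht; specialize (HA t ltac:(lra)); lra |].
  apply (@is_RInt_derive RV (fun t => Re (F (K, t)) - Re (F (2, t)))); rewrite Rmin_left, Rmax_right by lra; intros t Ht.
  - assert (HD : forall x, 2 <= x <= K -> is_derive (fun t => Re (F (x, t))) t (- Im (H (x, t)))) by (intros; apply Cd_Re_t, HP, Hin; assumption).
    replace (Im (H (2, t)) - Im (H (K, t))) with (- Im (H (K, t)) - - Im (H (2, t))) by ring. apply (is_derive_minus (fun t => Re (F (K, t))) (fun t => Re (F (2, t)))); apply HD; lra.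
  - apply (continuous_minus (fun t => Im (H (2, t))) (fun t => Im (H (K, t)))); apply continuous_C_snd, Ccts_vert, (holo_cts H c _ _ HH), Hin; lra.
Qed.

Lemma Uk_split (K t : R) : 20 <= t -> good t -> 2 <= K -> Uk K t = Uk 2 t + RInt (fun x => ln (Cmod (zeta (x, t)))) 2 K.
Proof. symmetry. apply (RInt_Chasles (V := RV)); apply cts_RInt; rewrite Rmin_left, Rmax_right by lra; intros x Hx; apply good_cts; try assumption; lra.
Qed.

Lemma S_main (K a b : R) : 2 <= K -> 20 <= a -> a <= b -> good a -> good b -> is_RInt (fun t => PI * S_zeta zeta t - AX (K, t)) a b (Uk K b - Uk K a).
Proof.
  intros HK Ha Hab Ga Gb. rewrite !(Uk_split K) by pos.
  destruct (nfloor_ex (10 * (b - a)) ltac:(lra)) as [n Hn]. pose proof (chain2 n a b Ha Hab ltac:(lra) Ga Gb) as K1. pose proof (tail_step K a b HK Hab) as K2.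
  pose proof (@is_RInt_plus RN _ _ _ _ _ _ K1 K2) as K3. unfold plus in K3; simpl in K3.
  eapply is_RInt_eq; [exact K3 | ring | cbv beta; intros; rring].
Qed.

Lemma AX_small (K t : R) : 2 <= K -> Rabs (AX (K, t)) <= 3 * rp (- (K - 2)) 2.
Proof.
  intro HK. pose proof (zeta_sub1 (K, t) ltac:(simpl; lra)) as K1. cbn [Re fst] in K1. pose proof (zr_far K HK) as K2. pose proof (Re_zeta_pos (K, t) HK) as K3.
  pose proof (im_le_Cmod (zeta (K, t) - 1)%C) as K4. replace (Im (zeta (K, t) - 1)%C) with (Im (zeta (K, t))) in K4 by (destruct (zeta (K, t)); simpl; ring).
  unfold AX. set (y := Im (zeta (K, t)) / Re (zeta (K, t))).
  assert (Hy : Rabs y <= 3 * rp (- (K - 2)) 2).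
  { unfold y, Rdiv. rewrite Rabs_mult, Rabs_inv, (Rabs_pos_eq (Re _)) by lra. apply Rmult_le_reg_r with (Re (zeta (K, t))); [lra |]. rewrite Rmult_assoc, Rinv_l, Rmult_1_r by lra. pose proof (rp_pos (- (K - 2)) 2). nra. }
  eapply Rle_trans; [| exact Hy].
  assert (P : forall v, 0 <= v -> 0 <= atan v <= v).
  { intros v Hv. split; [destruct Hv as [Hv | <-]; [left; rewrite <- atan_0; apply atan_increasing, Hv | rewrite atan_0; lra] |].
    pose proof (MVT_le atan (fun x => / (1 + x ^ 2)) 0 v 1 Hv) as M. rewrite atan_0 in M. enough (atan v - 0 <= 1 * (v - 0)) by lra. apply M.
    - intros x _. auto_derive; [lra | rfield; nra].
    - intros x _. rewrite <- Rinv_1. apply Rinv_le_contravar; nra. }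
  destruct (Rle_dec 0 y) as [H | H]; [rewrite !Rabs_pos_eq; try apply P; try exact H |].
  pose proof (P (- y) ltac:(lra)) as Q. rewrite atan_opp in Q. rewrite !Rabs_left1 by lra. lra.
Qed.

Lemma AX_ex (K a b : R) : 2 <= K -> ex_RInt (fun t => AX (K, t)) a b.
Proof. intro HK. apply cts_RInt. intros t _. apply (AX_cts (fun t => (K, t))); [apply cts_vert | pos].
Qed.

Lemma S_good_ex (a b : R) : 20 <= a -> a <= b -> good a -> good b -> ex_RInt (S_zeta zeta) a b.
Proof.
  intros Ha Hab Ga Gb. pose proof PI_RGT_0 as HPI. apply (ex_RInt_ext (fun t => scal (/ PI) (plus (PI * S_zeta zeta t - AX (2, t)) (AX (2, t))))).
  - intros t _. unfold scal, plus; simpl. unfold mult; simpl. rfield. lra.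
  - apply (@ex_RInt_scal RN). apply (@ex_RInt_plus RN); [eexists; apply (S_main 2 a b); try assumption; lra | apply AX_ex; lra].
Qed.

Lemma S_good_bound (M a b : R) : 20 <= a -> a <= b -> good a -> good b -> (forall K, 5 <= K -> Rabs (Uk K b - Uk K a) <= M) ->
  ex_RInt (S_zeta zeta) a b /\ Rabs (PI * RInt (S_zeta zeta) a b) <= M.
Proof.
  intros Ha Hab Ga Gb HM.
  assert (ES := S_good_ex a b Ha Hab Ga Gb).
  (* By [AX_small] the argument at abscissa K is at most 3 times 2^(-(K - 2)); this K makes its
     integral over [a, b] at most e. *)
  split; [pos |]. apply le_epsilon. intros e He. set (K := 5 + 6 * (b - a) / e). assert (HK : 5 <= K) by (unfold K; assert (0 <= 6 * (b - a) / e) by pos; lra).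
  pose proof (RInt_correct (V := RV) _ _ _ (AX_ex K a b ltac:(lra))) as Hv.
  pose proof (is_RInt_unique _ _ _ _ (@is_RInt_plus RN _ _ _ _ _ _ (S_main K a b ltac:(lra) Ha Hab Ga Gb) Hv)) as E1.
  rewrite (RInt_ext _ (fun t => scal PI (S_zeta zeta t))) in E1 by (intros t _; unfold plus, scal; simpl; unfold mult; simpl; ring).
  rewrite (RInt_scal (V := RV)) in E1 by exact ES. unfold scal, plus in E1; simpl in E1; unfold mult in E1; simpl in E1. rewrite E1.
  eapply Rle_trans; [apply Rabs_triang |]. apply Rplus_le_compat; [apply HM, HK |].
  eapply Rle_trans; [apply (abs_RInt_le_const (fun t => AX (K, t)) a b (3 * rp (- (K - 2)) 2) Hab (AX_ex K a b ltac:(lra))); intros t _; apply AX_small; lra |].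
  set (y := 6 * (b - a) / e) in *. assert (Hy : 0 <= y) by pos. assert (Er : rp (- (K - 2)) 2 <= / (1 + y / 2)).
  { unfold rp. replace (- (K - 2) * ln 2) with (- ((3 + y) * ln 2)) by (unfold K; ring). rewrite exp_Ropp. pose proof ln2_ge. apply Rinv_le_contravar; [lra |]. eapply Rle_trans; [| apply exp_ineq1_le]. nra. }
  assert (Ey : y * e = 6 * (b - a)) by (unfold y; field; lra).
  apply Rle_trans with ((b - a) * (3 * / (1 + y / 2))); [nra |]. apply Rmult_le_reg_r with (1 + y / 2); [lra |]. replace ((b - a) * (3 * / (1 + y / 2)) * (1 + y / 2)) with (3 * (b - a)) by (field; lra). nra.
Qed.

(** Good heights are dense, and the integral of S depends continuously on its endpoints. The
    hypothesis is one-sided but symmetric in a and b, which gives the absolute value. *)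
Lemma S_bound (M t1 t2 : R) : 21 < t1 -> t1 < t2 -> (forall K a b, 5 <= K -> t1 <= a <= t2 -> t1 <= b <= t2 -> good a -> good b -> Uk K b - Uk K a <= M) ->
  ex_RInt (S_zeta zeta) t1 t2 /\ PI * Rabs (RInt (S_zeta zeta) t1 t2) <= M.
Proof.
  intros H1 H12 HM. pose proof PI_RGT_0 as HPI.
  destruct (exists_good (t1 - 1) t1) as [a0 [Ha0 Ga0]]; [lra | lra |]. destruct (exists_good t2 (t2 + 1)) as [b0 [Hb0 Gb0]]; [lra | lra |].
  assert (E0 : ex_RInt (S_zeta zeta) a0 b0).
  { apply S_good_ex; try assumption; lra. }
  assert (Esub : forall x y, a0 <= x -> x <= y -> y <= b0 -> ex_RInt (S_zeta zeta) x y).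
  { intros x y Hx Hxy Hy. apply (ex_RInt_Chasles_2 (V := RV) _ a0 x y); [lra |]. apply (ex_RInt_Chasles_1 (V := RV) _ a0 y b0); pos. }
  split; [apply Esub; lra |].
  pose (G := (fun x => RInt (S_zeta zeta) a0 x) : R -> R).
  assert (HG : forall x, a0 < x < b0 -> continuous G x).
  { intros x Hx. apply (continuous_RInt_1 (S_zeta zeta) a0 x G). exists (mkposreal (Rmin (x - a0) (b0 - x)) ltac:(apply Rmin_glb_lt; lra)). intros y Hy. change (Rabs (y - x) < Rmin (x - a0) (b0 - x)) in Hy.
    pose proof (Rmin_l (x - a0) (b0 - x)). pose proof (Rmin_r (x - a0) (b0 - x)). apply Rabs_def2 in Hy. apply (RInt_correct (V := RV)). apply Esub; lra. }
  assert (HGd : forall x y, a0 <= x -> x <= y -> y <= b0 -> RInt (S_zeta zeta) x y = G y - G x).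
  { intros x y Hx Hxy Hy. pose proof (RInt_Chasles (V := RV) (S_zeta zeta) a0 x y ltac:(apply Esub; lra) ltac:(apply Esub; lra)) as Q. change (G x + RInt (S_zeta zeta) x y = G y) in Q. lra. }
  apply le_epsilon. intros e He. pose proof (HG t1 ltac:(lra)) as C1. pose proof (HG t2 ltac:(lra)) as C2.
  assert (Hne : 0 < e / (2 * PI)) by pos.
  destruct (proj1 (filterlim_locally _ _) C1 (mkposreal _ Hne)) as [d1 Hd1]. destruct (proj1 (filterlim_locally _ _) C2 (mkposreal _ Hne)) as [d2 Hd2].
  pose proof (cond_pos d1) as P1. pose proof (cond_pos d2) as P2.
  destruct (exists_good t1 (Rmin (t1 + d1) ((t1 + t2) / 2))) as [a [Ha Ga]]; [lra | apply Rmin_glb_lt; lra |].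
  destruct (exists_good (Rmax (t2 - d2) ((t1 + t2) / 2)) t2) as [b [Hb Gb]]; [pose proof (Rmax_r (t2 - d2) ((t1 + t2) / 2)); lra | apply Rmax_lub_lt; lra |].
  pose proof (Rmin_l (t1 + d1) ((t1 + t2) / 2)). pose proof (Rmin_r (t1 + d1) ((t1 + t2) / 2)). pose proof (Rmax_l (t2 - d2) ((t1 + t2) / 2)). pose proof (Rmax_r (t2 - d2) ((t1 + t2) / 2)).
  assert (Q1 : Rabs (G a - G t1) < e / (2 * PI)) by (apply (Hd1 a); apply Rabs_def1; rsc; lra).
  assert (Q2 : Rabs (G b - G t2) < e / (2 * PI)) by (apply (Hd2 b); apply Rabs_def1; rsc; lra).
  destruct (S_good_bound M a b ltac:(lra) ltac:(lra) Ga Gb) as [_ B].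
  { intros K HK. apply Rabs_le. pose proof (HM K a b HK ltac:(lra) ltac:(lra) Ga Gb). pose proof (HM K b a HK ltac:(lra) ltac:(lra) Gb Ga). lra. }
  rewrite HGd in B by lra. rewrite HGd by lra. rewrite Rabs_mult, (Rabs_pos_eq PI) in B by lra.
  replace (G t2 - G t1) with ((G b - G a) + ((G a - G t1) - (G b - G t2))) by ring.
  assert (T : Rabs ((G b - G a) + ((G a - G t1) - (G b - G t2))) <= Rabs (G b - G a) + (e / (2 * PI) + e / (2 * PI))).
  { eapply Rle_trans; [apply Rabs_triang |]. apply Rplus_le_compat_l. eapply Rle_trans; [apply Rabs_triang |]. rewrite Rabs_Ropp. lra. }
  apply (Rmult_le_compat_l PI) in T; [| lra]. replace (PI * (Rabs (G b - G a) + (e / (2 * PI) + e / (2 * PI)))) with (PI * Rabs (G b - G a) + e) in T by (field; lra). lra.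
Qed.

(** * Numerical values on the real axis *)

(** Half of Hermite-Hadamard: for convex f the midpoint value is below the integral, so sums are
    bounded by primitives at half-integers. [trap_conv] is the other half. *)
Lemma mid_conv (F f f1 : R -> R) (n : R) : (forall x, n - / 2 <= x <= n + / 2 -> is_derive F x (f x)) -> (forall x, n - / 2 <= x <= n + / 2 -> is_derive f x (f1 x)) ->
  (forall x y, n - / 2 <= x -> x <= y -> y <= n + / 2 -> f1 x <= f1 y) -> f n <= F (n + / 2) - F (n - / 2).
Proof.
  intros HF Hf H1. pose (G := fun h => F (n + h) - F (n - h)).
  assert (K : 2 * f n * (/ 2 - 0) <= G (/ 2) - G 0).
  { apply (MVT_ge G (fun h => f (n + h) + f (n - h))); [lra | |].
    - intros h Hh. pose proof (HF (n + h) ltac:(lra)) as D1. pose proof (HF (n - h) ltac:(lra)) as D2.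
      replace (f (n + h) + f (n - h)) with (1 * f (n + h) - (-1) * f (n - h)) by ring.
      apply (is_derive_minus (fun h => F (n + h)) (fun h => F (n - h))); [apply (is_derive_comp F (fun h => n + h)) | apply (is_derive_comp F (fun h => n - h))]; try assumption; auto_derive; try exact I; ring.
    - intros h Hh. pose proof (MVT_ge f f1 n (n + h) (f1 n) ltac:(lra) ltac:(intros; apply Hf; lra) ltac:(intros; apply H1; lra)).
      pose proof (MVT_le f f1 (n - h) n (f1 n) ltac:(lra) ltac:(intros; apply Hf; lra) ltac:(intros; apply H1; lra)). nra. }
  unfold G in K. replace (n - 0) with n in K by ring. rewrite Rplus_0_r in K. lra.
Qed.

Lemma trap_conv (F f f1 : R -> R) (k : R) : (forall x, k <= x <= k + 1 -> is_derive F x (f x)) -> (forall x, k <= x <= k + 1 -> is_derive f x (f1 x)) ->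
  (forall x y, k <= x -> x <= y -> y <= k + 1 -> f1 x <= f1 y) -> F (k + 1) - F k <= / 2 * (f k + f (k + 1)).
Proof.
  intros HF Hf H1. pose (G := fun h => F (k + h) - / 2 * h * (f k + f (k + h))).
  assert (K : G 1 - G 0 <= 0 * (1 - 0)).
  { apply (MVT_le G (fun h => f (k + h) - (/ 2 * (f k + f (k + h)) + / 2 * h * f1 (k + h)))); [lra | |].
    - intros h Hh. pose proof (HF (k + h) ltac:(lra)) as D1. pose proof (Hf (k + h) ltac:(lra)) as D2.
      apply (is_derive_minus (fun h => F (k + h)) (fun h => / 2 * h * (f k + f (k + h)))).
      + replace (f (k + h)) with (1 * f (k + h)) by ring. apply (is_derive_comp F (fun h => k + h)); [pos | auto_derive; try exact I; ring].
      + assert (D3 : is_derive (fun h => f k + f (k + h)) h (0 + 1 * f1 (k + h))).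
        { apply (@is_derive_plus R_AbsRing RN (fun _ => f k) (fun h => f (k + h))); [apply (@is_derive_const R_AbsRing RN) |]. apply (is_derive_comp f (fun h => k + h)); [pos | auto_derive; try exact I; ring]. }
        assert (D4 : is_derive (fun h => / 2 * h) h (/ 2)) by (auto_derive; try exact I; ring).
        pose proof (is_derive_mult _ _ _ _ _ D4 D3 Rmult_comm) as D5. assert (E5 : / 2 * (f k + f (k + h)) + / 2 * h * f1 (k + h) = / 2 * (f k + f (k + h)) + / 2 * h * (0 + 1 * f1 (k + h))) by ring. rewrite E5. exact D5.
    - intros h Hh. pose proof (MVT_le f f1 k (k + h) (f1 (k + h)) ltac:(lra) ltac:(intros; apply Hf; lra) ltac:(intros; apply H1; lra)). nra. }
  unfold G in K. rewrite Rplus_0_r in K. lra.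
Qed.

Lemma rp_small (a e : R) : 0 < a -> 0 < e -> exists N, forall n, (N <= n)%nat -> rp (- a) (INR n) <= e.
Proof. destruct (nfloor_ex (exp (- ln e / a)) ltac:(pos)) as [N [_ HN]]. exists (S N). intros n Hn.
  assert (Hx : exp (- ln e / a) <= INR n) by (apply Rle_trans with (INR (S N)); [rewrite S_INR; lra | apply le_INR, Hn]).
  apply Rle_trans with (rp (- a) (exp (- ln e / a))); [apply rp_anti; [lra | split; pos] |].
  unfold rp. rewrite ln_exp. replace (- a * (- ln e / a)) with (ln e) by (field; lra). rewrite exp_ln; lra.
Qed.

Definition Fp (s x : R) : R := - (rp (1 - s) x / (s - 1)).

Definition Fl (s x : R) : R := - (rp (1 - s) x * (ln x / (s - 1) + / (s - 1) ^ 2)).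

Lemma is_derive_Fp (s x : R) : 1 < s -> 0 < x -> is_derive (Fp s) x (rp (- s) x).
Proof.
  intros Hs Hx. unfold Fp. pose proof (is_derive_scal _ _ (- / (s - 1)) _ (is_derive_rp (1 - s) x Hx)) as D.
  apply (is_derive_ext (fun x => - / (s - 1) * rp (1 - s) x)); [intro y; rfield; lra |].
  replace (rp (- s) x) with (- / (s - 1) * ((1 - s) * rp (1 - s - 1) x)); [pos |]. replace (1 - s - 1) with (- s) by ring. field. lra.
Qed.

Lemma is_derive_Fl (s x : R) : 1 < s -> 0 < x -> is_derive (Fl s) x (ln x * rp (- s) x).
Proof.
  intros Hs Hx. unfold Fl, rp. auto_derive; [lra |]. replace (- s * ln x) with ((1 - s) * ln x + - ln x) by ring. rewrite exp_plus, exp_Ropp, exp_ln by exact Hx. field. lra.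
Qed.

Lemma is_derive_lrp (s x : R) : 0 < x -> is_derive (fun x => ln x * rp (- s) x) x (rp (- s - 1) x * (1 - s * ln x)).
Proof.
  intros Hx. unfold rp. auto_derive; [lra |]. replace ((- s - 1) * ln x) with (- s * ln x + - ln x) by ring. rewrite exp_plus, exp_Ropp, exp_ln by exact Hx. lra.
Qed.

Lemma drp_mono (s x y : R) : 0 < s -> 0 < x -> x <= y -> - s * rp (- s - 1) x <= - s * rp (- s - 1) y.
Proof. intros Hs Hx Hxy. pose proof (rp_anti (- s - 1) x y ltac:(lra) ltac:(lra)). nra. Qed.

(** The function ln x times x^(-s) is convex only once ln x >= (2s + 1) / (s (s + 1)). Near s = 1.3
    this holds from 3.5 on but not at 3, so sums at that s keep the terms 2 and 3 apart. *)
Lemma dlrp_mono (s x0 x y : R) : 0 < s -> 0 < x0 -> 2 * s + 1 <= s * (s + 1) * ln x0 -> x0 <= x -> x <= y -> rp (- s - 1) x * (1 - s * ln x) <= rp (- s - 1) y * (1 - s * ln y).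
Proof.
  intros Hs Hx0 H0 Hx Hxy. pose proof (MVT_ge (fun x => rp (- s - 1) x * (1 - s * ln x)) (fun x => rp (- s - 2) x * (s * (s + 1) * ln x - (2 * s + 1))) x y 0 Hxy) as M.
  enough (0 * (y - x) <= rp (- s - 1) y * (1 - s * ln y) - rp (- s - 1) x * (1 - s * ln x)) by lra. apply M.
  - intros z Hw. unfold rp. auto_derive; [lra |]. replace ((- s - 2) * ln z) with ((- s - 1) * ln z + - ln z) by ring. rewrite exp_plus, exp_Ropp, exp_ln by lra. lra.
  - intros z Hw. apply Rmult_le_pos; [pos |]. assert (ln x0 <= ln z) by (apply ln_le; lra). nra.
Qed.

Lemma PS_up (s : R) (n : nat) : 1 < s -> PS s (S (S n)) <= 1 + rp (- s) 2 + Fp s (INR (S (S n)) + / 2) - Fp s 2.5.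
Proof.
  intro Hs. induction n as [| n IH].
  - rewrite PS_S, PS_1. simpl INR. replace (1 + 1 + / 2) with 2.5 by lra. replace (1 + 1) with 2 by ring. lra.
  - rewrite PS_S. set (m := S (S n)) in *. assert (Hm : 2 <= INR m) by (apply (le_INR 2); unfold m; lia).
    pose proof (mid_conv (Fp s) (rp (- s)) (fun x => - s * rp (- s - 1) x) (INR (S m))) as M. rewrite S_INR in *.
    replace (INR m + 1 - / 2) with (INR m + / 2) in M by field. assert (rp (- s) (INR m + 1) <= Fp s (INR m + 1 + / 2) - Fp s (INR m + / 2)); [| lra]. apply M.
    + intros x Hx. apply is_derive_Fp; lra.
    + intros x Hx. apply is_derive_rp. lra.
    + intros x y Hx Hxy Hy. apply drp_mono; lra.
Qed.

Lemma PS_lo (s : R) (n : nat) : 1 < s -> 1 + rp (- s) 2 + / 2 * rp (- s) 3 + / 2 * rp (- s) (INR (S (S (S n)))) + Fp s (INR (S (S (S n)))) - Fp s 3 <= PS s (S (S (S n))).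
Proof.
  intro Hs. induction n as [| n IH].
  - rewrite 2!PS_S, PS_1. simpl INR. replace (1 + 1 + 1) with 3 by ring. replace (1 + 1) with 2 by ring. lra.
  - rewrite PS_S. set (m := S (S (S n))) in *. assert (Hm : 3 <= INR m) by (replace 3 with (INR 3) by (simpl; ring); apply le_INR; unfold m; lia).
    pose proof (trap_conv (Fp s) (rp (- s)) (fun x => - s * rp (- s - 1) x) (INR m)) as M. rewrite S_INR.
    assert (Fp s (INR m + 1) - Fp s (INR m) <= / 2 * (rp (- s) (INR m) + rp (- s) (INR m + 1))); [| lra]. apply M.
    + intros x Hx. apply is_derive_Fp; lra.
    + intros x Hx. apply is_derive_rp. lra.
    + intros x y Hx Hxy Hy. apply drp_mono; lra.
Qed.

Definition LS (s : R) (n : nat) : R := sum_n_m (fun k => ln (INR k) * rp (- s) (INR k)) 1 n.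

Lemma LS_S (s : R) (n : nat) : LS s (S n) = LS s n + ln (INR (S n)) * rp (- s) (INR (S n)).
Proof. unfold LS. rewrite sum_n_Sm by lia. reflexivity. Qed.

Lemma LS_1 (s : R) : LS s 1 = 0.
Proof. unfold LS. rewrite sum_n_n. simpl INR. rewrite ln_1. ring. Qed.

Lemma LS_up (s : R) (n : nat) : 1 < s -> 2 * s + 1 <= s * (s + 1) * ln 3.5 -> LS s (S (S (S n))) <= ln 2 * rp (- s) 2 + ln 3 * rp (- s) 3 + Fl s (INR (S (S (S n))) + / 2) - Fl s 3.5.
Proof.
  intros Hs H35. induction n as [| n IH].
  - rewrite 2!LS_S, LS_1. simpl INR. replace (1 + 1 + 1 + / 2) with 3.5 by lra. replace (1 + 1 + 1) with 3 by ring. replace (1 + 1) with 2 by ring. lra.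
  - rewrite LS_S. set (m := S (S (S n))) in *. assert (Hm : 3 <= INR m) by (replace 3 with (INR 3) by (simpl; ring); apply le_INR; unfold m; lia).
    pose proof (mid_conv (Fl s) (fun x => ln x * rp (- s) x) (fun x => rp (- s - 1) x * (1 - s * ln x)) (INR (S m))) as M. rewrite S_INR in *.
    replace (INR m + 1 - / 2) with (INR m + / 2) in M by field. assert (ln (INR m + 1) * rp (- s) (INR m + 1) <= Fl s (INR m + 1 + / 2) - Fl s (INR m + / 2)); [| lra]. apply M.
    + intros x Hx. apply is_derive_Fl; lra.
    + intros x Hx. apply is_derive_lrp. lra.
    + intros x y Hx Hxy Hy. apply (dlrp_mono s 3.5); lra.
Qed.

Lemma LS_lo (s : R) (n : nat) : 1 < s -> 2 * s + 1 <= s * (s + 1) * ln 3 ->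
  ln 2 * rp (- s) 2 + / 2 * (ln 3 * rp (- s) 3) + / 2 * (ln (INR (S (S (S n)))) * rp (- s) (INR (S (S (S n))))) + Fl s (INR (S (S (S n)))) - Fl s 3 <= LS s (S (S (S n))).
Proof.
  intros Hs H3. induction n as [| n IH].
  - rewrite 2!LS_S, LS_1. simpl INR. replace (1 + 1 + 1) with 3 by ring. replace (1 + 1) with 2 by ring. lra.
  - rewrite LS_S. set (m := S (S (S n))) in *. assert (Hm : 3 <= INR m) by (replace 3 with (INR 3) by (simpl; ring); apply le_INR; unfold m; lia).
    pose proof (trap_conv (Fl s) (fun x => ln x * rp (- s) x) (fun x => rp (- s - 1) x * (1 - s * ln x)) (INR m)) as M. rewrite S_INR.
    assert (Fl s (INR m + 1) - Fl s (INR m) <= / 2 * (ln (INR m) * rp (- s) (INR m) + ln (INR m + 1) * rp (- s) (INR m + 1))); [| lra]. apply M.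
    + intros x Hx. apply is_derive_Fl; lra.
    + intros x Hx. apply is_derive_lrp. lra.
    + intros x y Hx Hxy Hy. apply (dlrp_mono s 3); lra.
Qed.

(** * Log-convexity of sums of exponentials *)

Lemma exp_cvx (l u v : R) : 0 <= l <= 1 -> exp ((1 - l) * u + l * v) <= (1 - l) * exp u + l * exp v.
Proof.
  intro Hl. set (w := (1 - l) * u + l * v). assert (H : forall y, exp w * (1 + (y - w)) <= exp y).
  { intro y. replace (exp y) with (exp w * exp (y - w)) by (rewrite <- exp_plus; f_equal; ring). apply Rmult_le_compat_l; [pos | apply exp_ineq1_le]. }
  pose proof (H u) as Hu. pose proof (H v) as Hv. apply (Rmult_le_compat_l (1 - l)) in Hu; [| lra]. apply (Rmult_le_compat_l l) in Hv; [| lra].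
  replace (exp w) with ((1 - l) * (exp w * (1 + (u - w))) + l * (exp w * (1 + (v - w)))) by (unfold w; ring). lra.
Qed.

(* A sum of exponentials [f] satisfies this for all [p], [q]; taking [exp p], [exp q] above the end values yields log-convexity.
   Unlike log-convexity the condition is linear in [f]. *)
Definition expsum (f : R -> R) : Prop := forall a b l p q, 0 <= l <= 1 ->
  f ((1 - l) * a + l * b) <= exp ((1 - l) * p + l * q) * ((1 - l) * (f a * exp (- p)) + l * (f b * exp (- q))).

Lemma expsum_const (c : R) : 0 <= c -> expsum (fun _ => c).
Proof.
  intros Hc a b l p q Hl. pose proof (exp_cvx l (- p) (- q) Hl) as K. replace ((1 - l) * - p + l * - q) with (- ((1 - l) * p + l * q)) in K by ring. rewrite exp_Ropp in K.
  set (m := exp _) in *. assert (Hm : 0 < m) by apply exp_pos. apply (Rmult_le_compat_l (c * m)) in K; [| pos]. replace (c * m * / m) with c in K by (field; lra). lra.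
Qed.

Lemma expsum_mul_exp (f : R -> R) (k x : R) : expsum f -> expsum (fun s => f s * exp (k * s + x)).
Proof.
  intros Hf a b l p q Hl. specialize (Hf a b l (p - (k * a + x)) (q - (k * b + x)) Hl).
  apply Rmult_le_compat_r with (r := exp (k * ((1 - l) * a + l * b) + x)) in Hf; [| pos]. eapply Rle_trans; [exact Hf | right].
  replace ((1 - l) * p + l * q) with ((1 - l) * (p - (k * a + x)) + l * (q - (k * b + x)) + (k * ((1 - l) * a + l * b) + x)) by ring.
  replace (- (p - (k * a + x))) with (k * a + x + - p) by ring. replace (- (q - (k * b + x))) with (k * b + x + - q) by ring. rewrite !exp_plus. ring.
Qed.

Lemma expsum_plus (f g : R -> R) : expsum f -> expsum g -> expsum (fun s => f s + g s).
Proof. intros Hf Hg a b l p q Hl. specialize (Hf a b l p q Hl). specialize (Hg a b l p q Hl). lra. Qed.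

Lemma expsum_ext (f g : R -> R) : (forall s, f s = g s) -> expsum f -> expsum g.
Proof. intros E Hf a b l p q Hl. rewrite <- !E. apply Hf, Hl. Qed.

Lemma expsum_scal (c : R) (f : R -> R) : 0 <= c -> expsum f -> expsum (fun s => c * f s).
Proof. intros Hc Hf a b l p q Hl. specialize (Hf a b l p q Hl). nra.
Qed.

Lemma expsum_rp (a c x : R) : 0 <= c -> expsum (fun s => rp (a - s) x * c).
Proof.
  intro Hc. apply (expsum_ext (fun s => c * exp (- ln x * s + a * ln x))), expsum_mul_exp, expsum_const, Hc. intro. unfold rp. rewrite Rmult_comm. do 2 f_equal. ring.
Qed.

Lemma expsum_rp_neg (x : R) : expsum (fun s => rp (- s) x).
Proof. apply (expsum_ext (fun s => rp (0 - s) x * 1)), expsum_rp; [intro; rewrite Rmult_1_r; f_equal; ring | lra]. Qed.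

Lemma expsum_sum (f : nat -> R -> R) (m n : nat) : (forall k, (m <= k)%nat -> expsum (f k)) -> expsum (fun s => sum_n_m (fun k => f k s) m n).
Proof.
  intro Hf. induction n as [| n IH].
  - destruct m; [apply (expsum_ext (f 0%nat)); [intro; rewrite sum_n_n; reflexivity | apply Hf; lia] |]. apply (expsum_ext (fun _ => 0)); [intro; rewrite sum_n_m_zero by lia; reflexivity |]. intros a b l p q Hl. lra.
  - destruct (Nat.le_gt_cases m (S n)) as [H | H].
    + apply (expsum_ext (fun s => sum_n_m (fun k => f k s) m n + f (S n) s)); [intro; rewrite sum_n_Sm by exact H; reflexivity |]. apply expsum_plus; [pos | apply Hf, H].
    + apply (expsum_ext (fun _ => 0)); [intro; rewrite sum_n_m_zero by lia; reflexivity |]. intros a b l p q Hl. lra.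
Qed.

Lemma expsum_chord (f : R -> R) (a b l p q : R) : expsum f -> 0 <= l <= 1 -> f a <= exp p -> f b <= exp q -> f ((1 - l) * a + l * b) <= exp ((1 - l) * p + l * q).
Proof.
  intros Hf Hl Ha Hb. eapply Rle_trans; [apply Hf, Hl |]. rewrite <- (Rmult_1_r (exp _)) at 2. apply Rmult_le_compat_l; [pos |].
  assert (H : forall x y, x <= exp y -> x * exp (- y) <= 1) by (intros x y Hx; rewrite exp_Ropp; apply Rmult_le_reg_r with (exp y); [pos | rewrite Rmult_assoc, Rinv_l by pos; lra]).
  pose proof (H _ _ Ha). pose proof (H _ _ Hb). nra.
Qed.

Lemma mix_gt1 (a b l : R) : 1 < a -> 1 < b -> 0 <= l <= 1 -> 1 < (1 - l) * a + l * b.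
Proof. destruct (Rle_dec l (/ 2)); nra.
Qed.

Definition cvx1 (f : R -> R) : Prop := forall a b l, 1 < a -> 1 < b -> 0 <= l <= 1 -> f ((1 - l) * a + l * b) <= (1 - l) * f a + l * f b.

Lemma zr_le_of (s B : R) (n0 : nat) : 1 < s -> (forall n, (n0 <= n)%nat -> PS s n <= B) -> zr s <= B.
Proof.
  intros Hs H. apply (is_lim_seq_le_loc (PS s) (fun _ => B) (zr s) B); [exists n0; exact H | apply (zr_lim s Hs) | apply is_lim_seq_const].
Qed.

Lemma zr_up (s : R) : 1 < s -> zr s <= 1 + rp (- s) 2 + rp (1 - s) 2.5 / (s - 1).
Proof.
  intro Hs. apply (zr_le_of s _ 2 Hs). intros n Hn. destruct n as [| [| n]]; try lia. eapply Rle_trans; [apply PS_up, Hs |]. unfold Fp.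
  assert (0 <= rp (1 - s) (INR (S (S n)) + / 2) / (s - 1)) by pos. lra.
Qed.

Lemma zr_lo (s : R) : 1 < s -> 1 + rp (- s) 2 + / 2 * rp (- s) 3 + rp (1 - s) 3 / (s - 1) <= zr s.
Proof.
  intro Hs. apply le_epsilon. intros e He. destruct (rp_small (s - 1) (e * (s - 1)) ltac:(lra) ltac:(nra)) as [N HN]. specialize (HN (S (S (S N))) ltac:(lia)).
  pose proof (PS_lo s N Hs) as K. pose proof (PS_le_zr s (S (S (S N))) Hs). pose proof (rp_pos (- s) (INR (S (S (S N))))). unfold Fp in K. replace (- (s - 1)) with (1 - s) in HN by ring.
  assert (rp (1 - s) (INR (S (S (S N)))) / (s - 1) <= e) by (apply Rmult_le_reg_r with (s - 1); [lra |]; unfold Rdiv; rewrite Rmult_assoc, Rinv_l; lra). lra.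
Qed.

Lemma cvx_lnzr : cvx1 (fun s => ln (zr s)).
Proof.
  intros a b l Ha Hb Hl. set (s := (1 - l) * a + l * b). assert (Hs : 1 < s) by (apply mix_gt1; assumption).
  pose proof (zr_ge1 a Ha). pose proof (zr_ge1 b Hb). pose proof (zr_ge1 s Hs).
  rewrite <- (ln_exp ((1 - l) * ln (zr a) + l * ln (zr b))). apply ln_le; [lra |]. apply (zr_le_of s _ 0 Hs). intros n _.
  apply (expsum_chord (fun s => PS s n)); [| lra | rewrite exp_ln by lra; apply (PS_le_zr), Ha | rewrite exp_ln by lra; apply (PS_le_zr), Hb]. apply (expsum_sum (fun k s => rp (- s) (INR k))). intros k _. apply expsum_rp_neg.
Qed.

Definition lnQ (s : R) : R := ln (zr s) - ln (zr (2 * s)).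

Lemma lnQ_le (s : R) : 1 < s -> lnQ s <= ln (zr s).
Proof. intro Hs. unfold lnQ. pose proof (zr_ge1 (2 * s) ltac:(lra)) as K. apply ln_le in K; [rewrite ln_1 in K; lra | lra]. Qed.

Lemma eulerQ_expsum (q : nat) : expsum (fun x => eulerQ x q).
Proof.
  induction q as [| q IH]; [apply (expsum_const 1); lra |]. cbn [eulerQ]. destruct (prime_succ q).
  - apply (expsum_ext (fun x => eulerQ x q + eulerQ x q * exp (- ln (INR (S q)) * x + 0))); [intro; replace (- ln (INR (S q)) * s + 0) with (- s * ln (INR (S q))) by ring; unfold rp; ring | apply expsum_plus, expsum_mul_exp; exact IH].
  - apply (expsum_ext (fun x => eulerQ x q)); [intro; ring | pos].
Qed.

(** The partial products of 1 + p^(-x) expand into exponentials with nonnegative coefficients, hence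
    are log-convex, and the property passes to the limit zeta(x) / zeta(2x). As a difference of two
    convex functions [lnQ] would not be covered. *)
Lemma cvx_lnQ : cvx1 lnQ.
Proof.
  intros a b l Ha Hb Hl. set (s := (1 - l) * a + l * b). assert (Hs : 1 < s) by (apply mix_gt1; assumption).
  assert (E : forall x, 1 < x -> 0 < zr x / zr (2 * x) /\ lnQ x = ln (zr x / zr (2 * x)) /\ forall q, eulerQ x q <= exp (lnQ x)).
  { intros x Hx. pose proof (zr_ge1 x Hx). pose proof (zr_ge1 (2 * x) ltac:(lra)). assert (0 < zr x / zr (2 * x)) by pos.
    unfold lnQ. rewrite <- ln_div, exp_ln by lra. repeat split; [lra |]. apply (is_lim_seq_incr_compare _ _ (eulerQ_lim x Hx)). apply eulerQ_ge. }
  destruct (E a Ha) as [_ [_ Ea]]. destruct (E b Hb) as [_ [_ Eb]]. destruct (E s Hs) as [Ps [-> _]].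
  rewrite <- (ln_exp ((1 - l) * lnQ a + l * lnQ b)). apply ln_le; [lra |].
  apply (is_lim_seq_le (eulerQ s) (fun _ => exp ((1 - l) * lnQ a + l * lnQ b)) (zr s / zr (2 * s)) (exp ((1 - l) * lnQ a + l * lnQ b))); [| apply eulerQ_lim; assumption | apply is_lim_seq_const].
  intro q. apply (expsum_chord (fun x => eulerQ x q)); [apply eulerQ_expsum | lra | apply Ea | apply Eb].
Qed.

Lemma zr_cts (x : R) : 1 < x -> continuous (zr) x.
Proof.
  intro Hx. apply (continuous_C_fst (fun x => zeta (RtoC x))). apply (continuous_Ccts_comp zeta RtoC); [apply zeta_cts; intro E; apply (f_equal Re) in E; simpl in E; lra |].
  apply (continuous_C_pair (fun x => x) (fun _ => 0)); [apply continuous_id | apply continuous_const].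
Qed.

Lemma lnzr_cts (x : R) : 1 < x -> continuous (fun x => ln (zr x)) x.
Proof.
  intro Hx. apply (continuous_comp (zr) ln); [apply zr_cts, Hx |]. apply derive_cts. eexists. apply is_derive_ln. pose proof (zr_ge1 x Hx). lra.
Qed.

Lemma lnQ_cts (x : R) : 1 < x -> continuous lnQ x.
Proof.
  intro Hx. apply (continuous_minus (fun x => ln (zr x)) (fun x => ln (zr (2 * x)))); [apply lnzr_cts, Hx |].
  apply (continuous_comp (fun x => 2 * x) (fun x => ln (zr x))); [apply (continuous_mult (fun _ => 2) (fun x => x)); [apply continuous_const | apply continuous_id] | apply lnzr_cts; lra].
Qed.

Lemma zr_decay (s : R) : 5 <= s -> ln (zr s) <= (zr 5 - 1) * rp (- (s - 5)) 2.
Proof.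
  intro Hs. pose proof (zr_ge1 s ltac:(lra)). apply Rle_trans with (zr s - 1); [pose proof (exp_ineq1_le (ln (zr s))) as K; rewrite exp_ln in K by lra; lra |].
  assert (zr s <= 1 + (zr 5 - 1) * rp (- (s - 5)) 2); [| lra]. apply (zr_le_of s _ 1 ltac:(lra)). intros n Hn.
  apply Rle_trans with (1 + (PS 5 n - 1) * rp (- (s - 5)) 2).
  - induction n as [| n IH]; [lia |]. destruct n as [| n]; [rewrite !PS_1; lra |]. rewrite !(PS_S _ (S n)). specialize (IH ltac:(lia)).
    replace (rp (- s) (INR (S (S n)))) with (rp (- (5)) (INR (S (S n))) * rp (- (s - 5)) (INR (S (S n)))) by (rewrite <- rp_plus; f_equal; ring).
    assert (rp (- (s - 5)) (INR (S (S n))) <= rp (- (s - 5)) 2) by (apply rp_anti; [lra | split; [lra | apply (le_INR 2); lia]]). pose proof (rp_pos (- (5)) (INR (S (S n)))). nra.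
  - pose proof (PS_le_zr 5 n ltac:(lra)). pose proof (rp_pos (- (s - 5)) 2). nra.
Qed.

(** Termwise k^(-h) >= 1 - h ln k bounds the increment by the sum of ln k times k^(-(c - h)): a
    finite-difference substitute for -zeta' that avoids differentiating the series. *)
Lemma zr_step_up (c h : R) : 0 < h -> 1 < c - h -> 2 * (c - h) + 1 <= (c - h) * (c - h + 1) * ln 3.5 ->
  zr (c - h) - zr c <= h * (ln 2 * rp (- (c - h)) 2 + ln 3 * rp (- (c - h)) 3 - Fl (c - h) 3.5).
Proof.
  intros Hh Hc H35. set (s := c - h) in *. set (B := h * _). assert (zr s <= zr c + B); [| lra]. apply (zr_le_of s _ 3 Hc). intros n Hn.
  apply Rle_trans with (PS c n + h * LS s n).
  - clear Hn. induction n as [| n IH]; [unfold PS, LS; rewrite !sum_n_m_zero by lia; change (@zero _) with 0; lra |]. rewrite !PS_S, LS_S.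
    set (k := INR (S n)). replace (rp (- c) k) with (rp (- s) k * rp (- h) k) by (rewrite <- rp_plus; f_equal; unfold s; ring).
    assert (1 - h * ln k <= rp (- h) k) by (unfold rp; pose proof (exp_ineq1_le (- h * ln k)); lra). pose proof (rp_pos (- s) k). nra.
  - apply Rplus_le_compat; [apply PS_le_zr; unfold s in Hc; lra |]. apply Rmult_le_compat_l; [lra |]. destruct n as [| [| [| n]]]; try lia. eapply Rle_trans; [apply LS_up; assumption |]. unfold Fl. set (k := INR (S (S (S n))) + / 2). assert (1 <= k) by (unfold k; rewrite !S_INR; pose proof (pos_INR n); lra).
    assert (0 <= ln k) by (rewrite <- ln_1; apply ln_le; lra). assert (0 < / (s - 1)) by pos. assert (0 < / (s - 1) ^ 2) by pos.
    pose proof (rp_pos (1 - s) k). assert (0 <= ln k * / (s - 1)) by nra. nra.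
Qed.

Lemma zr_step_lo (c h : R) : 0 < h -> 2 <= c - h -> 2 * c + 1 <= c * (c + 1) * ln 3 ->
  h * (ln 2 * rp (- c) 2 + / 2 * (ln 3 * rp (- c) 3) - Fl c 3) <= zr (c - h) - zr c.
Proof.
  intros Hh Hc H3. set (s := c - h) in *. set (B := _ - Fl c 3).
  assert (Hd : forall n, h * LS c n <= zr s - zr c).
  { intro n. assert (Hinc : forall k, PS s k - PS c k + h * (ln (INR (S k)) * rp (- c) (INR (S k))) <= PS s (S k) - PS c (S k)).
    { intro k. rewrite !PS_S. set (x := INR (S k)). replace (rp (- s) x) with (rp (- c) x * rp h x) by (rewrite <- rp_plus; f_equal; unfold s; ring).
      assert (1 + h * ln x <= rp h x) by apply exp_ineq1_le. pose proof (rp_pos (- c) x). nra. }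
    assert (Hpos : forall k, 0 <= h * (ln (INR (S k)) * rp (- c) (INR (S k)))).
    { intro k. apply Rmult_le_pos; [lra |]. apply Rmult_le_pos; [rewrite <- ln_1; apply ln_le; [lra | apply (le_INR 1); lia] | pos]. }
    apply Rle_trans with (PS s n - PS c n).
    - induction n as [| n IH]; [unfold PS, LS; rewrite !sum_n_m_zero by lia; change (@zero _) with 0; lra |]. rewrite LS_S. specialize (Hinc n). lra.
    - apply (is_lim_seq_incr_compare (fun n => PS s n - PS c n) (zr s - zr c)).
      + apply is_lim_seq_minus'; apply zr_lim; unfold s in *; lra.
      + intro k. specialize (Hinc k). specialize (Hpos k). lra. }
  assert (HB : B <= (zr s - zr c) / h); [| apply (Rmult_le_compat_l h) in HB; [| lra]; replace (h * ((zr s - zr c) / h)) with (zr s - zr c) in HB by (field; lra); exact HB].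
  apply le_epsilon. intros e He. destruct (rp_small (/ 2) (e / 2) ltac:(lra) ltac:(lra)) as [N HN]. specialize (HN (S (S (S N))) ltac:(lia)).
  specialize (Hd (S (S (S N)))). apply (Rmult_le_compat_l (/ h)) in Hd; [| pos]. replace (/ h * (h * LS c (S (S (S N))))) with (LS c (S (S (S N)))) in Hd by (field; lra).
  pose proof (LS_lo c N ltac:(unfold s in Hc; lra) H3) as K. set (k := INR (S (S (S N)))) in *. assert (Hk : 1 <= k) by (apply (le_INR 1); lia).
  assert (Hl : 0 <= ln k <= k) by (split; [rewrite <- ln_1; apply ln_le; lra | pose proof (exp_ineq1_le (ln k)) as Q; rewrite exp_ln in Q by lra; lra]).
  assert (Ht : - Fl c k <= e).
  { unfold Fl. rewrite Ropp_involutive. assert (Hc1 : 0 < / (c - 1) <= 1) by (split; [apply Rinv_0_lt_compat; unfold s in Hc; lra | rewrite <- Rinv_1; apply Rinv_le_contravar; unfold s in Hc; lra]).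
    assert (Hln : ln k <= 2 * rp (/ 2) k - 2) by (unfold rp; pose proof (exp_ineq1_le (/ 2 * ln k)); lra). rewrite <- pow_inv.
    apply Rle_trans with (rp (-1) k * (2 * rp (/ 2) k)).
    - apply Rmult_le_compat; [pos | nra | apply rp_le; [lra | unfold s in Hc; lra] |]. nra.
    - replace (rp (-1) k * (2 * rp (/ 2) k)) with (2 * (rp (-1) k * rp (/ 2) k)) by ring. rewrite <- rp_plus. replace (-1 + / 2) with (- / 2) by field. lra. }
  assert (0 <= / 2 * (ln k * rp (- c) k)) by pos. unfold B. lra.
Qed.

(** For a rational exponent a = -p / k the comparison with q becomes an inequality between integer
    powers of rationals. *)
Lemma rp_num_le (k p : nat) (a x q : R) : 0 < x -> 0 < q -> (1 <= k)%nat -> a * INR k = - INR p -> 1 <= q ^ k * x ^ p -> rp a x <= q.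
Proof.
  intros Hx Hq Hk Ha H. apply le_INR in Hk. simpl in Hk. rewrite <- (exp_ln q) by exact Hq. apply exp_le. apply ln_le in H; [| lra].
  rewrite ln_1, ln_mult, !ln_pow in H by pos. nra.
Qed.

Lemma rp_num_ge (k p : nat) (a x q : R) : 0 < x -> 0 < q -> (1 <= k)%nat -> a * INR k = - INR p -> q ^ k * x ^ p <= 1 -> q <= rp a x.
Proof.
  intros Hx Hq Hk Ha H. apply le_INR in Hk. simpl in Hk. rewrite <- (exp_ln q) by exact Hq. apply exp_le. apply ln_le in H; [| pos].
  rewrite ln_1, ln_mult, !ln_pow in H by pos. nra.
Qed.
Ltac rpnum L k p := apply (L k%nat p%nat); [lra | lra | lia | simpl INR; lra | lra].
(** k is the denominator and p, p2 are the numerators of the exponents in [zr_up]; a and b are the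
    rational bounds offered for the two powers. [zlo] does the same for [zr_lo] with three
    powers. *)
Ltac zup k p p2 a b := eapply Rle_trans; [apply zr_up; lra |];
  match goal with |- 1 + ?u + ?v / ?w <= _ => assert (u <= a) by rpnum rp_num_le k p; assert (v <= b) by rpnum rp_num_le k p2; lra end.
Ltac zlo k p p2 a b c := eapply Rle_trans; [| apply zr_lo; lra];
  match goal with |- _ <= 1 + ?u + / 2 * ?v + ?w / _ => assert (a <= u) by rpnum rp_num_ge k p; assert (b <= v) by rpnum rp_num_ge k p; assert (c <= w) by rpnum rp_num_ge k p2; lra end.

Lemma lnQ_num (s v w q : R) : zr s <= v -> w <= zr (2 * s) -> 1 < s -> 0 < w -> ln (v / w) <= q -> lnQ s <= q.
Proof.
  intros Hv Hw Hs Hw0 Hq. unfold lnQ. pose proof (zr_ge1 s Hs). assert (0 < v) by lra. apply ln_le in Hv; [| lra]. apply ln_le in Hw; [| lra].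
  unfold Rdiv in Hq. rewrite ln_mult, ln_Rinv in Hq; pos.
Qed.

(** * Integrals of convex functions by trapezoids *)

Fixpoint trapz (l : list (R * R)) : R := match l with p :: ((q :: _) as r) => (fst q - fst p) * (snd p + snd q) / 2 + trapz r | _ => 0 end.

Fixpoint incr_by (f : R -> R) (p : R * R) (l : list (R * R)) : Prop := match l with [] => f (fst p) <= snd p | q :: r => f (fst p) <= snd p /\ fst p < fst q /\ incr_by f q r end.

Lemma is_RInt_affine (u v a b : R) : is_RInt (fun x => u + v * x) a b (u * (b - a) + v * (b ^ 2 - a ^ 2) / 2).
Proof.
  replace (u * (b - a) + v * (b ^ 2 - a ^ 2) / 2) with (minus (u * b + v * b ^ 2 / 2) (u * a + v * a ^ 2 / 2)) by (rsc; field).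
  apply (@is_RInt_derive RV (fun x => u * x + v * x ^ 2 / 2)); intros x _; [auto_derive; lra | cts_derive].
Qed.

Lemma chord_bound (f : R -> R) (a b A B x : R) : cvx1 f -> 1 < a -> a < b -> f a <= A -> f b <= B -> a <= x <= b -> f x <= A + (x - a) / (b - a) * (B - A).
Proof.
  intros Hf Ha Hab HA HB Hx. set (l := (x - a) / (b - a)). assert (El : l * (b - a) = x - a) by (unfold l; field; lra).
  assert (Hl : 0 <= l <= 1) by nra.
  pose proof (Hf a b l Ha ltac:(lra) Hl) as K. replace ((1 - l) * a + l * b) with x in K by lra. nra.
Qed.

Lemma RInt_chord (f : R -> R) (a b A B : R) : a < b -> ex_RInt f a b -> (forall x, a < x < b -> f x <= A + (x - a) / (b - a) * (B - A)) -> RInt f a b <= (b - a) * (A + B) / 2.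
Proof.
  intros Hab He H. apply (is_RInt_le f (fun x => (A - a / (b - a) * (B - A)) + (B - A) / (b - a) * x) a b); [lra | apply (RInt_correct (V := RV)), He | |].
  - pose proof (is_RInt_affine (A - a / (b - a) * (B - A)) ((B - A) / (b - a)) a b) as K. match type of K with is_RInt _ _ _ ?v => replace v with ((b - a) * (A + B) / 2) in K by (field; lra) end. exact K.
  - intros x Hx. eapply Rle_trans; [apply H, Hx |]. lra.
Qed.

Lemma trapz_bound (f : R -> R) : cvx1 f -> (forall x, 1 < x -> continuous f x) -> forall l p, 1 < fst p -> incr_by f p l -> fst p <= fst (last l p) /\ RInt f (fst p) (fst (last l p)) <= trapz (p :: l).
Proof.
  intros Hf Hc. assert (He : forall a b, 1 < a -> a <= b -> ex_RInt f a b) by (intros a b Ha Hab; apply cts_RInt; intros x Hx; rewrite Rmin_left in Hx by exact Hab; apply Hc; lra).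
  induction l as [| q l IH]; intros p Hp Hi; [simpl in *; rewrite RInt_point; change (@zero _) with 0; lra |]. destruct Hi as [H1 [H2 H3]].
  assert (El : last (q :: l) p = last l q) by (clear; revert p q; induction l as [| r l IH]; intros p q; [reflexivity | change (last (r :: l) p = last (r :: l) q); rewrite (IH p r), (IH q r); reflexivity]). rewrite El.
  destruct (IH q ltac:(lra) H3) as [K1 K2]. split; [lra |]. rewrite <- (RInt_Chasles (V := RV) f (fst p) (fst q)) by (apply He; lra).
  apply Rplus_le_compat; [| pos]. apply RInt_chord; [lra | apply He; lra |]. intros x Hx. apply (chord_bound f); try assumption; try lra. destruct l; [pos | apply H3].
Qed.

Lemma zr_le_nodes :
  zr 1.15 <= 7.26119 /\ zr 1.2 <= 5.59805 /\ zr 1.3 <= 3.93833 /\ zr 1.4 <= 3.11180 /\ zr 1.5 <= 2.61847 /\ zr 1.7 <= 2.06001 /\ zr 1.9 <= 1.75504 /\ zr 2.1 <= 1.56506 /\ zr 2.35 <= 1.41116 /\ zr 2.6 <= 1.30921 /\ zr 3.1 <= 1.18615 /\ zr 3.5 <= 1.12887 /\ zr 4 <= 1.08384 /\ zr 5 <= 1.03766.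
Proof.
  repeat apply conj.
  - zup 20%nat 23%nat 3%nat 0.450626 0.871584.
  - zup 5%nat 6%nat 1%nat 0.435276 0.832554.
  - zup 10%nat 13%nat 3%nat 0.406127 0.759658.
  - zup 5%nat 7%nat 2%nat 0.378930 0.693145.
  - zup 2%nat 3%nat 1%nat 0.353554 0.632456.
  - zup 10%nat 17%nat 7%nat 0.307787 0.526553.
  - zup 10%nat 19%nat 9%nat 0.267944 0.438384.
  - zup 10%nat 21%nat 11%nat 0.233259 0.364978.
  - zup 20%nat 47%nat 27%nat 0.196147 0.290256.
  - zup 5%nat 13%nat 8%nat 0.164939 0.230832.
  - zup 10%nat 31%nat 21%nat 0.116630 0.145991.
  - zup 2%nat 7%nat 5%nat 0.088389 0.101193.
  - zup 1%nat 4%nat 3%nat 0.062500 0.064000.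
  - zup 1%nat 5%nat 4%nat 0.031250 0.025600.
Qed.

Lemma zr_ge_nodes :
  1.30144 <= zr (2 * 1.3) /\ 1.24355 <= zr (2 * 1.4) /\ 1.19907 <= zr (2 * 1.5) /\ 1.13649 <= zr (2 * 1.7) /\ 1.09596 <= zr (2 * 1.9) /\ 1.06865 <= zr (2 * 2.1) /\ 1.04597 <= zr (2 * 2.35) /\ 1.03121 <= zr (2 * 2.6) /\ 1.01478 <= zr (2 * 3.1) /\ 1.00826 <= zr (2 * 3.5) /\ 1.00404 <= zr (2 * 4) /\ 1.00098 <= zr (2 * 5).
Proof.
  repeat apply conj.
  - zlo 5%nat 13%nat 8%nat 0.164938 0.057475 0.172427.
  - zlo 5%nat 14%nat 9%nat 0.143587 0.046138 0.138414.
  - zlo 1%nat 3%nat 2%nat 0.125000 0.037037 0.111111.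
  - zlo 5%nat 17%nat 12%nat 0.094732 0.023866 0.071599.
  - zlo 5%nat 19%nat 14%nat 0.071793 0.015379 0.046138.
  - zlo 5%nat 21%nat 16%nat 0.054409 0.009910 0.029731.
  - zlo 10%nat 47%nat 37%nat 0.038473 0.005721 0.017165.
  - zlo 5%nat 26%nat 21%nat 0.027204 0.003303 0.009910.
  - zlo 5%nat 31%nat 26%nat 0.013602 0.001101 0.003303.
  - zlo 1%nat 7%nat 6%nat 0.007812 0.000457 0.001371.
  - zlo 1%nat 8%nat 7%nat 0.003906 0.000152 0.000457.
  - zlo 1%nat 10%nat 9%nat 0.000976 0.000016 0.000050.
Qed.

Lemma ln_zr_nodes :
  ln (zr 1.15) <= 1.98255 /\ ln (zr 1.2) <= 1.72242 /\ ln (zr 1.3) <= 1.37076 /\ ln (zr 1.4) <= 1.13521 /\ ln (zr 1.5) <= 0.96260 /\ ln (zr 1.7) <= 0.72272 /\ ln (zr 1.9) <= 0.56250 /\ ln (zr 2.1) <= 0.44793 /\ ln (zr 2.35) <= 0.34442 /\ ln (zr 2.6) <= 0.26943 /\ ln (zr 3.1) <= 0.17072 /\ ln (zr 3.5) <= 0.12122 /\ ln (zr 4) <= 0.08052 /\ ln (zr 5) <= 0.03697.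
Proof.
  decompose [and] zr_le_nodes. repeat apply conj; (eapply Rle_trans; [apply ln_le; [| eassumption]; apply Rlt_le_trans with 1; [lra | apply zr_ge1; lra] | clear; num_ln_le 15%nat]).
Qed.

Lemma lnQ_nodes :
  lnQ 1.3 <= 1.10729 /\ lnQ 1.4 <= 0.91724 /\ lnQ 1.5 <= 0.78105 /\ lnQ 1.7 <= 0.59477 /\ lnQ 1.9 <= 0.47087 /\ lnQ 2.1 <= 0.38153 /\ lnQ 2.35 <= 0.29947 /\ lnQ 2.6 <= 0.23870 /\ lnQ 3.1 <= 0.15605 /\ lnQ 3.5 <= 0.11300 /\ lnQ 4 <= 0.07648 /\ lnQ 5 <= 0.03599.
Proof.
  decompose [and] zr_le_nodes. decompose [and] zr_ge_nodes.
  repeat apply conj; (eapply lnQ_num; [eassumption | eassumption | lra | lra | clear; num_ln_le 12%nat]).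
Qed.

(** Beyond 5 the decay by powers of 2 suffices: (zeta(5) - 1) / ln 2, with 0.03766 for the
    numerator. *)
Lemma tail5 (f : R -> R) (K : R) : 5 <= K -> (forall x, 1 < x -> continuous f x) -> (forall x, 5 <= x -> f x <= ln (zr x)) -> RInt f 5 K <= 0.0545.
Proof.
  intros HK Hc Hf. set (A := 0.03766 / ln 2). pose proof ln2_ge as L2.
  assert (HA : A <= 0.0545) by (unfold A; apply Rmult_le_reg_r with (ln 2); [lra | unfold Rdiv; rewrite Rmult_assoc, Rinv_l by lra; lra]).
  assert (Hp := rp_pos (- (K - 5)) 2). assert (HA0 : 0 < A) by (apply Rdiv_lt_0_compat; lra).
  apply Rle_trans with (- A * rp (- (K - 5)) 2 - - A * rp (- (5 - 5)) 2).
  - apply (is_RInt_le f (fun x => 0.03766 * rp (- (x - 5)) 2) 5 K); [exact HK | | |].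
    + apply (RInt_correct (V := RV)), cts_RInt. intros x Hx. rewrite Rmin_left in Hx by exact HK. apply Hc. lra.
    + apply (@is_RInt_derive RV (fun x => - A * rp (- (x - 5)) 2)); intros x _; unfold rp; [replace 0.03766 with (A * ln 2) by (unfold A, Rdiv; rewrite Rmult_assoc, Rinv_l by lra; ring); auto_derive; [exact I | replace (x + - (5)) with (x - 5) by ring; ring] | cts_derive].
    + intros x Hx. eapply Rle_trans; [apply Hf; lra |]. eapply Rle_trans; [apply zr_decay; lra |]. apply Rmult_le_compat_r; [left; apply rp_pos | pose proof (zr_le_nodes); lra].
  - replace (rp (- (5 - 5)) 2) with 1 by (unfold rp; replace (- (5 - 5) * ln 2) with 0 by ring; rewrite exp_0; reflexivity). nra.
Qed.

Lemma RInt_split_5 (f : R -> R) (a K : R) : 1 < a -> a <= 5 -> 5 <= K -> (forall x, 1 < x -> continuous f x) -> RInt f a K = RInt f a 5 + RInt f 5 K.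
Proof.
  intros Ha H5 HK Hc. symmetry. apply (RInt_Chasles (V := RV)); apply cts_RInt; intros x Hx; rewrite Rmin_left in Hx by lra; apply Hc; lra.
Qed.

Lemma lnzr_int (K : R) : 5 <= K -> RInt (fun x => ln (zr x)) 1.15 K <= 1.3835.
Proof.
  intro HK. rewrite (RInt_split_5 (fun x => ln (zr x))); [| lra | lra | exact HK | apply (lnzr_cts)].
  pose proof (tail5 (fun x => ln (zr x)) K HK (lnzr_cts) ltac:(intros; lra)) as T.
  pose proof (trapz_bound _ (cvx_lnzr) (lnzr_cts) [(1.2, 1.72242); (1.3, 1.37076); (1.4, 1.13521); (1.5, 0.9626); (1.7, 0.72272); (1.9, 0.5625); (2.1, 0.44793); (2.35, 0.34442); (2.6, 0.26943); (3.1, 0.17072); (3.5, 0.12122); (4, 0.08052); (5, 0.03697)] (1.15, 1.98255)) as B.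
  cbn [fst snd last incr_by trapz] in B. destruct B as [_ B]; [lra | |].
  - pose proof (ln_zr_nodes). repeat split; lra.
  - lra.
Qed.

Lemma lnQ_int1 : RInt (lnQ) 1.3 2.1 <= 0.51553.
Proof.
  pose proof (trapz_bound _ (cvx_lnQ) (lnQ_cts) [(1.4, 0.91724); (1.5, 0.78105); (1.7, 0.59477); (1.9, 0.47087); (2.1, 0.38153)] (1.3, 1.10729)) as B.
  cbn [fst snd last incr_by trapz] in B. destruct B as [_ B]; [lra | | lra].
  pose proof (lnQ_nodes). repeat split; lra.
Qed.

Lemma lnQ_int2 (K : R) : 5 <= K -> RInt (lnQ) 2.1 K <= 0.463.
Proof.
  intro HK. rewrite RInt_split_5; [| lra | lra | exact HK | apply (lnQ_cts)]. pose proof (tail5 _ K HK (lnQ_cts) ltac:(intros; apply lnQ_le; lra)) as T.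
  pose proof (trapz_bound _ (cvx_lnQ) (lnQ_cts) [(2.35, 0.29947); (2.6, 0.2387); (3.1, 0.15605); (3.5, 0.113); (4, 0.07648); (5, 0.03599)] (2.1, 0.38153)) as B.
  cbn [fst snd last incr_by trapz] in B. destruct B as [_ B]; [lra | | lra].
  pose proof (lnQ_nodes). repeat split; lra.
Qed.

(** * The logarithmic derivative of zeta at 1.3 + it *)

Lemma zr_anti (x y : R) : 1 < x -> x <= y -> zr y <= zr x.
Proof.
  intros Hx Hxy. apply (zr_le_of y _ 0 ltac:(lra)). intros n _. eapply Rle_trans; [| apply (PS_le_zr x n Hx)].
  apply sum_n_m_le_loc. intros k Hk. apply rp_le; [apply (le_INR 1); lia | lra].
Qed.

(** ln zeta(x) contributes at most 2.81687 h, from 11.0513 / 3.9233, and ln zeta(2x) takes back at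
    least 0.4999 h. *)
Lemma lnQ_slope (h : R) : 0 < h <= 0.0001 -> lnQ (1.3 - h) - lnQ 1.3 <= 2.3172 * h.
Proof.
  intros Hh. assert (L35 : 1.2527 <= ln 3.5) by num_ln_ge 12%nat. assert (L35' : ln 3.5 <= 1.25277) by num_ln_le 12%nat. assert (L3 : 1.0986 <= ln 3) by num_ln_ge 11%nat. pose proof ln3_le as L3'. pose proof ln2_le as L2'. pose proof ln2_ge as L2.
  pose proof (zr_step_up 1.3 h ltac:(lra) ltac:(lra) ltac:(nra)) as U. pose proof (zr_step_lo 2.6 (2 * h) ltac:(lra) ltac:(lra) ltac:(lra)) as W.
  assert (R2 : rp (- (1.3)) 2 <= 0.406127) by rpnum rp_num_le 10%nat 13%nat. assert (R3 : rp (- (1.3)) 3 <= 0.239742) by rpnum rp_num_le 10%nat 13%nat. assert (R35 : rp (- (0.3)) 3.5 <= 0.686730) by rpnum rp_num_le 10%nat 3%nat.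
  assert (Q2 : 0.164938 <= rp (- (2.6)) 2) by rpnum rp_num_ge 5%nat 13%nat. assert (Q3 : 0.057475 <= rp (- (2.6)) 3) by rpnum rp_num_ge 5%nat 13%nat. assert (Q31 : 0.172427 <= rp (1 - 2.6) 3) by rpnum rp_num_ge 5%nat 8%nat.
  (* The powers are certified at h = 0 only; the shift of the exponent costs at most 1 / (1 - 0.0001
     ln 3.5). *)
  assert (Hrp : forall a x, 2 <= x <= 3.5 -> rp (- (a - h)) x <= 1.00014 * rp (- a) x).
  { intros a x Hx. replace (- (a - h)) with (- a + h) by ring. rewrite rp_plus, Rmult_comm. apply Rmult_le_compat_r; [left; apply rp_pos |].
    assert (0 <= ln x <= 1.25277) by (split; [rewrite <- ln_1; apply ln_le; lra | apply Rle_trans with (ln 3.5); [apply ln_le; lra | exact L35']]).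
    assert (K : rp h x * (1 - h * ln x) <= 1).
    { apply Rle_trans with (rp h x * rp (- h) x); [apply Rmult_le_compat_l; [left; apply rp_pos | unfold rp; pose proof (exp_ineq1_le (- h * ln x)); lra] |]. rewrite <- rp_plus. replace (h + - h) with 0 by ring. unfold rp. rewrite Rmult_0_l, exp_0. lra. }
    pose proof (rp_pos h x). assert (h * ln x <= 0.0001 * 1.25277) by (apply Rmult_le_compat; lra). assert (rp h x * (1 - 0.0001 * 1.25277) <= rp h x * (1 - h * ln x)) by (apply Rmult_le_compat_l; lra). lra. }
  assert (A1 : ln 2 * rp (- (1.3 - h)) 2 + ln 3 * rp (- (1.3 - h)) 3 - Fl (1.3 - h) 3.5 <= 11.0513).
  { pose proof (Hrp 1.3 2 ltac:(lra)). pose proof (Hrp 1.3 3 ltac:(lra)). pose proof (Hrp 0.3 3.5 ltac:(lra)) as H3. unfold Fl. replace (1 - (1.3 - h)) with (- (0.3 - h)) by lra. replace (1.3 - h - 1) with (0.3 - h) by lra.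
    assert (V1 : 0 < / (0.3 - h) <= 3.33445) by (split; [apply Rinv_0_lt_compat; lra | apply Rmult_le_reg_r with (0.3 - h); [lra | rewrite Rinv_l; lra]]).
    rewrite <- pow_inv. unfold Rdiv. set (v := / (0.3 - h)) in *. assert (V2 : ln 3.5 * v + v ^ 2 <= 15.29599) by (assert (v ^ 2 <= 11.11856) by nra; nra).
    pose proof (rp_pos (- (0.3 - h)) 3.5). pose proof (rp_pos (- (1.3 - h)) 2). pose proof (rp_pos (- (1.3 - h)) 3).
    assert (ln 2 * rp (- (1.3 - h)) 2 <= 0.69315 * (1.00014 * 0.406127)) by (apply Rmult_le_compat; lra). assert (ln 3 * rp (- (1.3 - h)) 3 <= 1.09862 * (1.00014 * 0.239742)) by (apply Rmult_le_compat; lra).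
    assert (rp (- (0.3 - h)) 3.5 * (ln 3.5 * v + v ^ 2) <= 1.00014 * 0.686730 * 15.29599) by (apply Rmult_le_compat; nra). lra. }
  assert (A2 : 0.33164 <= ln 2 * rp (- (2.6)) 2 + / 2 * (ln 3 * rp (- (2.6)) 3) - Fl 2.6 3).
  { unfold Fl. assert (0.69314 * 0.164938 <= ln 2 * rp (- (2.6)) 2) by (apply Rmult_le_compat; lra). assert (1.0986 * 0.057475 <= ln 3 * rp (- (2.6)) 3) by (apply Rmult_le_compat; lra).
    assert (0.172427 * (1.0986 / (2.6 - 1) + / (2.6 - 1) ^ 2) <= rp (1 - 2.6) 3 * (ln 3 / (2.6 - 1) + / (2.6 - 1) ^ 2)) by (apply Rmult_le_compat; lra). lra. }
  assert (Z1 : 3.9233 <= zr 1.3) by zlo 10%nat 13%nat 3%nat 0.406126 0.239741 0.719223.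
  assert (Z2 : zr 2.55 <= 1.32667) by zup 20%nat 51%nat 31%nat 0.170756 0.241656.
  pose proof (zr_anti 2.55 (2.6 - 2 * h) ltac:(lra) ltac:(lra)) as Z3. pose proof (zr_ge1 (2.6 - 2 * h) ltac:(lra)) as Z4. pose proof (zr_ge1 2.6 ltac:(lra)) as Z5. pose proof (zr_ge1 (1.3 - h) ltac:(lra)) as Z6.
  unfold lnQ. replace (2 * (1.3 - h)) with (2.6 - 2 * h) by lra. replace (2 * 1.3) with 2.6 by lra.
  pose proof (ln_diff_le (zr 1.3) (zr (1.3 - h)) ltac:(lra) ltac:(lra)) as D1. pose proof (ln_diff_le (zr (2.6 - 2 * h)) (zr 2.6) ltac:(lra) ltac:(lra)) as D2.
  assert (E1 : (zr (1.3 - h) - zr 1.3) / zr 1.3 <= 2.81687 * h).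
  { apply Rmult_le_reg_r with (zr 1.3); [lra |]. unfold Rdiv. rewrite Rmult_assoc, Rinv_l, Rmult_1_r by lra. eapply Rle_trans; [exact U |]. apply Rle_trans with (h * 11.0513); [apply Rmult_le_compat_l; lra | nra]. }
  assert (E2 : (zr 2.6 - zr (2.6 - 2 * h)) / zr (2.6 - 2 * h) <= - 0.4999 * h).
  { apply Rmult_le_reg_r with (zr (2.6 - 2 * h)); [lra |]. unfold Rdiv. rewrite Rmult_assoc, Rinv_l, Rmult_1_r by lra.
    assert (2 * h * 0.33164 <= 2 * h * (ln 2 * rp (- (2.6)) 2 + / 2 * (ln 3 * rp (- (2.6)) 3) - Fl 2.6 3)) by (apply Rmult_le_compat_l; lra). nra. }
  lra.
Qed.

(** Re zeta'/zeta is the derivative of ln |zeta(x + it)| in x; its difference quotients to the left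
    are bounded by [zeta_ratio] and [lnQ_slope]. *)
Lemma log_derivative (t : R) (l : C) : 20 <= t -> Cd zeta (1.3, t) l -> Re (l / zeta (1.3, t)%R)%C <= 2.3172.
Proof.
  intros Ht Hl. set (c := (1.3, t) : C) in *.
  assert (Hre : forall z, Cmod (z - c)%C < 0.2 -> 1.1 < Re z).
  { intros z Hz1. pose proof (re_le_Cmod (z - c)%C) as K. replace (Re (z - c)%C) with (Re z - 1.3) in K by (destruct z; simpl; ring). assert (K2 : Rabs (Re z - 1.3) < 0.2) by lra. apply Rabs_def2 in K2. lra. }
  destruct (holo_log zeta c 0.2) as [H [HH HE]]; [lra | apply (zeta_holo c 0.2); simpl; rewrite Rabs_pos_eq; lra | intros z Hz1; apply zeta_neq0; apply Hre in Hz1; lra |].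
  assert (Hcc : Cmod (c - c)%C < 0.2) by (rewrite Cmod_minus_0; lra). destruct (HH c Hcc) as [m Hm].
  assert (Em : (l / zeta c)%C = m).
  { assert (E : l = (Cexp (H c) * m)%C).
    { apply (Cd_unique zeta c); [exact Hl |]. apply (Cd_ext_loc (fun z => Cexp (H z)) zeta c _); [exists 0.2; split; [lra | intros w Hw; symmetry; apply HE; exact Hw] | apply (Cd_comp H Cexp c m); [exact Hm | apply Cd_Cexp]]. }
    rewrite E, HE by exact Hcc. field. apply Cexp_neq0. }
  change ((1.3)%R, t) with c. rewrite Em.
  pose proof (Cd_Re_x H 1.3 t m Hm) as D.
  apply is_derive_Reals in D. apply le_epsilon. intros e He. destruct (D e He) as [d Hd]. pose proof (cond_pos d) as Pd.
  set (h := Rmin (d / 2) 0.0001). assert (Hh : 0 < h <= 0.0001) by (split; [apply Rmin_glb_lt; lra | apply Rmin_r]). assert (Hh2 : h <= d / 2) by apply Rmin_l.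
  specialize (Hd (- h) ltac:(lra) ltac:(rewrite Rabs_Ropp, Rabs_pos_eq; lra)).
  assert (Hln : forall x, 1.29 <= x <= 1.3 -> Re (H (x, t)) = ln (Cmod (zeta (x, t)))).
  { intros x Hx. rewrite HE; [rewrite Cmod_Cexp, ln_exp; reflexivity |]. replace ((x, t) - c)%C with (RtoC (x - 1.3)) by (apply injective_projections; simpl; ring). rewrite Cmod_R. apply Rabs_def1; lra. }
  rewrite !Hln in Hd by lra. change (1.3 + - h) with (1.3 - h) in Hd.
  pose proof (zeta_ratio t 1.3 h ltac:(lra) ltac:(lra)) as K.
  assert (P1 : 0 < Cmod (zeta (1.3, t))) by (apply Cmod_gt_0, (zeta_neq0); simpl; lra). assert (P2 : 0 < Cmod (zeta ((1.3 - h)%R, t))) by (apply Cmod_gt_0, (zeta_neq0); simpl; lra).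
  pose proof (zr_ge1 1.3 ltac:(lra)). pose proof (zr_ge1 (2 * 1.3) ltac:(lra)). pose proof (zr_ge1 (1.3 - h) ltac:(lra)). pose proof (zr_ge1 (2 * (1.3 - h)) ltac:(lra)).
  apply ln_le in K; [| repeat apply Rmult_lt_0_compat; lra]. rewrite !ln_mult in K by (try apply Rmult_lt_0_compat; lra).
  pose proof (lnQ_slope h Hh) as S. unfold lnQ in S. apply Rabs_def2 in Hd. destruct Hd as [Hd1 Hd2].
  assert (Ed : (ln (Cmod (zeta ((1.3 - h)%R, t))) - ln (Cmod (zeta (1.3, t)))) / - h = (ln (Cmod (zeta (1.3, t))) - ln (Cmod (zeta ((1.3 - h)%R, t)))) / h) by (field; lra).
  assert ((ln (Cmod (zeta (1.3, t))) - ln (Cmod (zeta ((1.3 - h)%R, t)))) / h <= 2.3172).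
  { apply Rmult_le_reg_r with h; [lra |]. unfold Rdiv. rewrite Rmult_assoc, Rinv_l, Rmult_1_r by lra. lra. }
  lra.
Qed.

(** * The bound for zeta at the nodes *)

Lemma HN_ln (n : nat) : (20 <= n)%nat -> HN n <= ln (INR n) + 0.603.
Proof.
  induction 1 as [| n Hn IH].
  - assert (L : 2.9957 <= ln 20) by num_ln_ge 18%nat. replace (INR 20) with 20 by (simpl; ring). do 20 rewrite HN_S. rewrite HN_0. simpl INR. lra.
  - rewrite HN_S. assert (Hp : 20 <= INR n) by (replace 20 with (INR 20) by (simpl; ring); apply le_INR; lia). rewrite S_INR. pose proof (ln_diff_le (INR n + 1) (INR n) ltac:(lra) ltac:(lra)) as K. lra.
Qed.

Lemma rp_half (x : R) : 0 < x -> rp (/ 2) x = sqrt x.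
Proof. intro Hx. rewrite <- (Rpower_sqrt x Hx). reflexivity.
Qed.

Lemma rp_mhalf (x : R) : 0 < x -> rp (- / 2) x = / sqrt x.
Proof. intro Hx. unfold rp. replace (- / 2 * ln x) with (- (/ 2 * ln x)) by ring. rewrite exp_Ropp. f_equal. apply (rp_half x Hx). Qed.

Lemma sum_mhalf (n : nat) : (1 <= n)%nat -> sum_n_m (fun k => rp (- / 2) (INR k)) 1 n <= 2 * sqrt (INR n) - 1.
Proof.
  induction 1 as [| n Hn IH]; [rewrite sum_n_n; simpl INR; rewrite rp_mhalf, sqrt_1 by lra; lra |].
  rewrite sum_n_Sm by lia. change plus with Rplus. assert (Hp : 1 <= INR n) by (apply (le_INR 1); exact Hn). rewrite S_INR, rp_mhalf by lra.
  set (a := sqrt (INR n + 1)). set (b := sqrt (INR n)) in *. assert (Ha : 0 < a) by (apply sqrt_lt_R0; lra). assert (Ea : a * a = INR n + 1) by (apply sqrt_sqrt; lra). assert (Eb : b * b = INR n) by (apply sqrt_sqrt; lra).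
  assert (/ a <= 2 * (a - b)); [| lra]. apply Rmult_le_reg_r with a; [lra |]. rewrite Rinv_l by lra. nra.
Qed.

Lemma sum_pos_pow (a : R) (n : nat) : 0 < a -> sum_n_m (fun k => rp a (INR k)) 1 n <= rp (1 + a) (INR n + 1) / (1 + a).
Proof.
  intro Ha. induction n as [| n IH]; [pos |].
  rewrite sum_n_Sm by lia. change plus with Rplus. pose proof (pos_INR n). rewrite S_INR.
  pose proof (MVT_ge (rp (1 + a)) (fun x => (1 + a) * rp (1 + a - 1) x) (INR n + 1) (INR n + 1 + 1) ((1 + a) * rp a (INR n + 1)) ltac:(lra)) as M.
  assert ((1 + a) * rp a (INR n + 1) * (INR n + 1 + 1 - (INR n + 1)) <= rp (1 + a) (INR n + 1 + 1) - rp (1 + a) (INR n + 1)).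
  { apply M; [intros x Hx; apply is_derive_rp; lra |]. intros x Hx. replace (1 + a - 1) with a by ring. apply Rmult_le_compat_l; [lra |]. apply rp_mono; lra. }
  apply Rle_trans with (rp (1 + a) (INR n + 1) / (1 + a) + rp a (INR n + 1)); [lra |]. apply Rmult_le_reg_r with (1 + a); [lra |].
  replace ((rp (1 + a) (INR n + 1) / (1 + a) + rp a (INR n + 1)) * (1 + a)) with (rp (1 + a) (INR n + 1) + (1 + a) * rp a (INR n + 1)) by (field; lra).
  replace (rp (1 + a) (INR n + 1 + 1) / (1 + a) * (1 + a)) with (rp (1 + a) (INR n + 1 + 1)) by (field; lra). lra.
Qed.

Lemma sqrt_le_of (x q : R) : 0 <= q -> x <= q * q -> sqrt x <= q.
Proof. intros Hq H. rewrite <- (sqrt_square q Hq). apply sqrt_le_1_alt, H. Qed.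

Section Nodes.
Variables (x T D : R) (N M : nat).
Hypothesis Hx : 124.9 <= x.
Hypothesis HT : T = 2 * PI * x ^ 2.
Hypothesis HN1 : 2 * x <= INR N <= 2 * x + 1.
Hypothesis HM : 20 <= INR M <= x / 2 + 1.
Hypothesis HD : 0 < D.
Hypothesis HDx : D * x <= 2.25735 + 4.6 / x.
Hypothesis HT0 : 99990 <= T.

(** The right side of [zeta_bound] with M = m + 1 and D for [D3]. Here x = sqrt (T / (2 pi)) and D x
    is close to 4 / sqrt pi = 2.2568. As the dual sum carries this factor, it is kept shorter, about
    x/2 terms, than the main sum with about 2x. *)
Definition nodeB (sg : R) : R := sum_n_m (fun n => rp (- sg) (INR n)) 1 N + rp (1 - sg) (INR N) / T
    + (1 + 2 / T) * (sum_n_m (fun k => rp (1 - sg) (T / (2 * PI * INR k)) * D) 1 M + rp (- sg) (INR N) / PI * (4 * HN M + 4)).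

Let y : R := / x.
Let lam : R := ln (INR M).

Lemma y_facts : 0 < y <= 0.00801 /\ x * y = 1.
Proof.
  unfold y. assert (E : x * / x = 1) by (apply Rinv_r; lra). nra.
Qed.

Lemma x0_eq (k : nat) : (1 <= k)%nat -> T / (2 * PI * INR k) = x ^ 2 * / INR k.
Proof. intro Hk. apply (le_INR 1) in Hk. simpl in Hk. pose proof PI_RGT_0. rewrite HT. field. split; lra. Qed.

Lemma T_facts : 0 < / T <= 0.00001002 /\ 0 < 2 / T <= 0.0000201 /\ INR N / T <= 0.003.
Proof.
  assert (0 < / T <= 0.00001002) by (split; [pos | apply Rmult_le_reg_r with T; [lra | rewrite Rinv_l; lra]]).
  split; [lra |]. split; [lra |]. apply Rmult_le_reg_r with T; [lra |]. unfold Rdiv. rewrite Rmult_assoc, Rinv_l, Rmult_1_r by lra. pose proof PI_ge_314. nra.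
Qed.

Lemma M_ge20 : (20 <= M)%nat.
Proof. apply INR_le. replace (INR 20) with 20 by (simpl; ring). lra. Qed.

(** Tangents of ln at 64, at x/2, and at 8 for the square root: each node uses the bound matching
    its own scale. *)
Lemma lam_facts : lam <= 3.1746 + x / 128 /\ lam <= ln x - 0.69314 + 2 * y /\ lam <= sqrt (INR M) / 4 + 2.1589 /\ 0 <= lam.
Proof.
  pose proof ln2_le as L2. pose proof ln2_ge as L2'. unfold lam.
  assert (T64 : forall u v, 0 < u -> 0 < v -> ln v <= v / u - 1 + ln u).
  { intros u v Hu Hv. pose proof (ln_diff_le u v Hu Hv) as K. replace ((v - u) / u) with (v / u - 1) in K by (field; lra). lra. }
  split; [| split; [| split]].
  - pose proof (T64 64 (INR M) ltac:(lra) ltac:(lra)) as K. replace 64 with (2 ^ 6) in K at 2 by lra. rewrite ln_pow in K by lra. simpl INR in K. lra.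
  - apply Rle_trans with (ln (x / 2 + 1)); [apply ln_le; lra |]. pose proof (ln_diff_le (x / 2) (x / 2 + 1) ltac:(lra) ltac:(lra)) as K. replace ((x / 2 + 1 - x / 2) / (x / 2)) with (2 * y) in K by (unfold y; field; lra).
    unfold Rdiv in K at 2. rewrite ln_mult, ln_Rinv in K by lra. lra.
  - assert (Hs : 0 < sqrt (INR M)) by (apply sqrt_lt_R0; lra). replace (ln (INR M)) with (2 * ln (sqrt (INR M))).
    + pose proof (T64 8 _ ltac:(lra) Hs) as K. replace 8 with (2 ^ 3) in K at 2 by lra. rewrite ln_pow in K by lra. simpl INR in K. lra.
    + rewrite <- (sqrt_sqrt (INR M)) at 2 by lra. rewrite ln_mult by assumption. ring.
  - rewrite <- ln_1. apply ln_le; lra.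
Qed.

Lemma small_fac (a : R) : 0 <= a -> a / PI * (4 * HN M + 4) <= a * ((8 + 4 * lam) / 3.14).
Proof.
  intro Ha. pose proof PI_ge_314. pose proof M_ge20. pose proof (HN_le_ln M ltac:(lia)) as K. fold lam in K. destruct lam_facts as [_ [_ [_ L]]]. unfold Rdiv. rewrite Rmult_assoc. apply Rmult_le_compat_l; [lra |].
  rewrite Rmult_comm. assert (0 < / PI <= / 3.14) by (split; [pos | apply Rinv_le_contravar; lra]).
  apply Rle_trans with ((8 + 4 * lam) * / PI); nra.
Qed.

Lemma fac_le (z : R) : 0 <= z -> (1 + 2 / T) * z <= 1.0000201 * z.
Proof. intro. destruct T_facts as [_ [K _]]. apply Rmult_le_compat_r; lra. Qed.

Lemma node_1 : nodeB 1 <= ln (2 * x) + 1.805.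
Proof.
  destruct y_facts as [Hy Exy]. destruct T_facts as [HT1 [_ _]]. destruct lam_facts as [L1 [_ [_ L0]]]. unfold nodeB.
  assert (N20 : (20 <= N)%nat) by (apply INR_le; replace (INR 20) with 20 by (simpl; ring); lra).
  assert (S1 : sum_n_m (fun n => rp (- (1)) (INR n)) 1 N <= ln (2 * x) + / 2 * y + 0.603).
  { rewrite (sum_n_m_ext_loc _ (fun n => / INR n)) by (intros k Hk; apply rp_m1; apply lt_0_INR; lia). eapply Rle_trans; [apply HN_ln, N20 |].
    assert (ln (INR N) <= ln (2 * x + 1)) by (apply ln_le; lra). pose proof (ln_diff_le (2 * x) (2 * x + 1) ltac:(lra) ltac:(lra)) as K. replace ((2 * x + 1 - 2 * x) / (2 * x)) with (/ 2 * y) in K by (unfold y; field; lra). lra. }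
  assert (R0 : forall z, rp (1 - 1) z = 1) by (intro z; unfold rp; rewrite Rminus_diag, Rmult_0_l; apply exp_0).
  assert (S3 : sum_n_m (fun k => rp (1 - 1) (T / (2 * PI * INR k)) * D) 1 M <= (2.25735 + 4.6 * y) * (/ 2 + y)).
  { rewrite (sum_n_m_ext _ (fun _ => D)) by (intro k; rewrite R0; rring). rewrite sum_n_m_const. replace (S M - 1)%nat with M by lia.
    apply Rle_trans with ((x / 2 + 1) * D); [nra |]. replace ((x / 2 + 1) * D) with (D * x * (/ 2 + y)) by nra. apply Rmult_le_compat_r; pos. }
  assert (S4 : rp (- (1)) (INR N) / PI * (4 * HN M + 4) <= 0.0315).
  { eapply Rle_trans; [apply small_fac; left; apply rp_pos |]. rewrite rp_m1 by lra.
    assert (/ INR N <= / 2 * y) by (unfold y; rewrite <- Rinv_mult; apply Rinv_le_contravar; lra).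
    apply Rle_trans with (/ 2 * y * ((8 + 4 * lam) / 3.14)); [nra |]. nra. }
  rewrite R0. assert (P3 : 0 <= sum_n_m (fun k => rp (1 - 1) (T / (2 * PI * INR k)) * D) 1 M) by (apply sum_n_m_nonneg; intros; rewrite R0; lra).
  set (s3 := sum_n_m _ 1 M) in *. set (s4 := rp _ _ / PI * _) in *.
  assert (F : (1 + 2 / T) * (s3 + s4) <= 1.0000201 * ((2.25735 + 4.6 * y) * (/ 2 + y) + 0.0315)).
  { destruct T_facts as [_ [K _]]. apply Rle_trans with ((1 + 2 / T) * ((2.25735 + 4.6 * y) * (/ 2 + y) + 0.0315)); [apply Rmult_le_compat_l; lra |]. nra. }
  assert (y * y <= 0.00801 * y) by nra. lra.
Qed.

(** The leading coefficient is 2 sqrt 2 from the main sum plus 2.25735 sqrt 2 from the dual sum; the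
    -1 in [sum_mhalf] pays for the lower-order terms. *)
Lemma node_half : nodeB (/ 2) <= 6.021 * sqrt x.
Proof.
  destruct y_facts as [Hy Exy]. destruct T_facts as [HT1 [_ HT3]]. destruct lam_facts as [_ [_ [L1 L0]]]. pose proof M_ge20 as M20. unfold nodeB. replace (1 - / 2) with (/ 2) by field.
  set (X := sqrt x). assert (HX : 11.17 <= X) by (unfold X; rewrite <- (sqrt_square 11.17) by lra; apply sqrt_le_1_alt; lra). assert (EX : X * X = x) by (apply sqrt_sqrt; lra).
  set (w := / X). assert (EXw : X * w = 1) by (apply Rinv_r; lra). assert (Hw : 0 < w <= 0.0896) by nra.
  assert (Eyw : y = w * w) by nra.
  assert (Hww : 0 <= w * w) by nra. assert (SN : sqrt (INR N) <= 1.41422 * X + 0.3536 * w) by (apply sqrt_le_of; lra). assert (SM : sqrt (INR M) <= 0.70711 * X + 0.7072 * w) by (apply sqrt_le_of; lra).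
  assert (S1 : sum_n_m (fun n => rp (- / 2) (INR n)) 1 N <= 2 * (1.41422 * X + 0.3536 * w) - 1) by (eapply Rle_trans; [apply sum_mhalf; apply INR_le; simpl; lra | lra]).
  assert (S2 : rp (/ 2) (INR N) / T <= 0.003).
  { eapply Rle_trans; [| exact HT3]. apply Rmult_le_compat_r; [lra |]. rewrite <- (rp_1 (INR N)) at 2 by lra. apply rp_le; lra. }
  assert (S3 : sum_n_m (fun k => rp (/ 2) (T / (2 * PI * INR k)) * D) 1 M <= (2.25735 + 4.6 * y) * (1.41422 * X + 1.4144 * w - 1)).
  { rewrite (sum_n_m_ext_loc _ (fun k => mult (D * x) (rp (- / 2) (INR k)))).
    - rewrite (sum_n_m_mult_l (K := R_AbsRing)). pose proof (sum_mhalf M ltac:(lia)) as K. apply Rle_trans with (D * x * (1.41422 * X + 1.4144 * w - 1)); [apply Rmult_le_compat_l; [nra | eapply Rle_trans; [exact K | lra]] |]. apply Rmult_le_compat_r; pos.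
    - intros k Hk. assert (0 < INR k) by pos. rewrite x0_eq by lia. rewrite rp_mult by pos. rewrite (rp_half (x ^ 2)) by nra. replace (x ^ 2) with (x * x) by ring. rewrite sqrt_square by lra.
      replace (rp (/ 2) (/ INR k)) with (rp (- / 2) (INR k)) by (unfold rp; rewrite ln_Rinv by assumption; f_equal; ring). unfold mult; simpl. ring. }
  assert (S4 : rp (- / 2) (INR N) / PI * (4 * HN M + 4) <= 0.51).
  { eapply Rle_trans; [apply small_fac; left; apply rp_pos |]. rewrite rp_mhalf by lra.
    assert (Hn : / sqrt (INR N) <= 0.70711 * w).
    { apply Rmult_le_reg_l with (sqrt (INR N)); [apply sqrt_lt_R0; lra |]. rewrite Rinv_r by (apply Rgt_not_eq, sqrt_lt_R0; lra). assert (1.41421 * X <= sqrt (INR N)) by (rewrite <- (sqrt_square (1.41421 * X)) by lra; apply sqrt_le_1_alt; lra). assert (1.41421 * X * (0.70711 * w) <= sqrt (INR N) * (0.70711 * w)) by (apply Rmult_le_compat_r; lra). lra. }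
    apply Rle_trans with (0.70711 * w * ((8 + 4 * lam) / 3.14)); [apply Rmult_le_compat_r; lra |]. assert (w * lam <= w * ((0.70711 * X + 0.7072 * w) / 4 + 2.1589)) by (apply Rmult_le_compat_l; lra). lra. }
  assert (P3 : 0 <= (2.25735 + 4.6 * y) * (1.41422 * X + 1.4144 * w - 1)) by nra.
  set (s3 := sum_n_m _ 1 M) in *. set (s4 := rp _ _ / PI * _) in *.
  assert (F : (1 + 2 / T) * (s3 + s4) <= 1.0000201 * ((2.25735 + 4.6 * y) * (1.41422 * X + 1.4144 * w - 1) + 0.51)).
  { destruct T_facts as [_ [K _]]. apply Rle_trans with ((1 + 2 / T) * ((2.25735 + 4.6 * y) * (1.41422 * X + 1.4144 * w - 1) + 0.51)); [apply Rmult_le_compat_l; lra |]. nra. }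
  assert (E3 : (2.25735 + 4.6 * y) * (1.41422 * X + 1.4144 * w - 1) <= 3.19239 * X + 3.1929 * w - 2.25735 + 6.5055 * w + 6.5063 * 0.00801 * w).
  { assert (E1 : y * X = w) by (rewrite Eyw; replace (w * w * X) with (X * w * w) by ring; rewrite EXw; ring). assert (y * w <= 0.00801 * w) by (apply Rmult_le_compat_r; lra). lra. }
  lra.
Qed.

(** The dual sum dominates: 2.25735 x ln x, and ln T is about 2 ln x. *)
Lemma node_0 : nodeB 0 <= 1.132 * x * ln T.
Proof.
  destruct y_facts as [Hy Exy]. destruct T_facts as [HT1 [_ HT3]]. destruct lam_facts as [_ [L1 [_ L0]]]. pose proof M_ge20 as M20. unfold nodeB. rewrite Rminus_0_r.
  assert (R0 : forall z, rp (- 0) z = 1) by (intro z; unfold rp; rewrite Ropp_0, Rmult_0_l; apply exp_0).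
  rewrite (sum_n_m_ext _ (fun _ => 1)) by (intro; apply R0). rewrite sum_n_m_const, R0. replace (S N - 1)%nat with N by lia. rewrite rp_1 by lra.
  assert (S3 : sum_n_m (fun k => rp 1 (T / (2 * PI * INR k)) * D) 1 M <= (2.25735 * x + 4.6) * (lam + 0.603)).
  { rewrite (sum_n_m_ext_loc _ (fun k => mult (D * x ^ 2) (/ INR k))).
    - rewrite (sum_n_m_mult_l (K := R_AbsRing)). pose proof (HN_ln M M20) as K. apply Rle_trans with (D * x ^ 2 * (lam + 0.603)); [apply Rmult_le_compat_l; pos |]. apply Rmult_le_compat_r; [lra |]. replace (D * x ^ 2) with (D * x * x) by ring. replace (2.25735 * x + 4.6) with ((2.25735 + 4.6 / x) * x) by (field; lra). apply Rmult_le_compat_r; lra.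
    - intros k Hk. assert (0 < INR k) by pos. rewrite x0_eq by lia. assert (0 < / INR k) by pos. rewrite rp_1 by pos. unfold mult; simpl. ring. }
  assert (S4 : 1 / PI * (4 * HN M + 4) <= (8 + 4 * lam) / 3.14) by (eapply Rle_trans; [apply small_fac; lra | lra]).
  set (s3 := sum_n_m _ 1 M) in *. set (s4 := 1 / PI * _) in *.
  assert (F : (1 + 2 / T) * (s3 + s4) <= 1.0000201 * ((2.25735 * x + 4.6) * (lam + 0.603) + (8 + 4 * lam) / 3.14)).
  { destruct T_facts as [_ [K _]]. apply Rle_trans with ((1 + 2 / T) * ((2.25735 * x + 4.6) * (lam + 0.603) + (8 + 4 * lam) / 3.14)); [nra |]. apply fac_le. nra. }
  assert (EL : 1.8373 + 2 * ln x <= ln T).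
  { assert (K : 1.8373 <= ln 6.28) by num_ln_ge 14%nat. rewrite HT, ln_mult, ln_pow by nra. simpl INR. assert (ln 6.28 <= ln (2 * PI)) by (apply ln_le; pose proof PI_ge_314; lra). lra. }
  set (lx := ln x) in *. assert (Hlx : lx <= x / 128 + 3.8521).
  { pose proof (ln_diff_le 128 x ltac:(lra) ltac:(lra)) as K. replace 128 with (2 ^ 7) in K at 1 by lra. rewrite ln_pow in K by lra. simpl INR in K. pose proof ln2_le. unfold lx. lra. }
  apply Rle_trans with (1.132 * x * (1.8373 + 2 * lx)); [| apply Rmult_le_compat_l; lra].
  assert (A1 : (2.25735 * x + 4.6) * (lam + 0.603) <= (2.25735 * x + 4.6) * (lx - 0.09014 + 2 * y)) by (apply Rmult_le_compat_l; lra).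
  assert (A2 : 124.9 * lx <= x * lx) by (apply Rmult_le_compat_r; lra). lra.
Qed.

(** The dual sum dominates with D x times zeta(1.3), about 9.04; the main sum adds 0.45. *)
Lemma node_left : nodeB (- 0.3) <= 9.506 * rp 1.6 x.
Proof.
  destruct y_facts as [Hy Exy]. destruct T_facts as [HT1 [_ _]]. destruct lam_facts as [L1 [_ [_ L0]]]. pose proof M_ge20 as M20. unfold nodeB. replace (- - 0.3) with 0.3 by lra. replace (1 - - 0.3) with 1.3 by lra.
  set (E := rp 1.6 x). assert (HE : 0 < E) by apply rp_pos.
  assert (R3 : 0 < rp (- (0.3)) x <= 0.2351) by (split; [pos | apply Rle_trans with (rp (- (0.3)) 124.9); [apply rp_anti; lra | rpnum rp_num_le 10%nat 3%nat]]).
  assert (E13 : rp 1.3 x = E * rp (- (0.3)) x) by (unfold E; rewrite <- rp_plus; f_equal; lra).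
  assert (E03 : rp 0.3 x = rp 1.3 x * y) by (unfold y; rewrite <- (rp_m1 x), <- rp_plus by lra; f_equal; lra).
  assert (Q : rp 1.3 2.0161 <= 2.489 /\ rp 0.3 2.0161 <= 1.2346).
  { assert (Q0 : 0.40178 <= rp (- (1.3)) 2.0161) by rpnum rp_num_ge 10%nat 13%nat. assert (Q1 : rp 1.3 2.0161 * rp (- (1.3)) 2.0161 = 1) by (rewrite <- rp_plus; unfold rp; rewrite Rplus_opp_r, Rmult_0_l; apply exp_0).
    pose proof (rp_pos 1.3 2.0161). assert (Q2 : rp 1.3 2.0161 <= 2.489) by nra. split; [lra |]. replace 1.3 with (0.3 + 1) in Q2 by lra. rewrite rp_plus, rp_1 in Q2 by lra. lra. }
  destruct Q as [Q13 Q03]. pose proof (rp_pos 1.3 x). pose proof (rp_pos 0.3 x).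
  assert (N13 : rp 1.3 (INR N + 1) <= 2.489 * 0.2351 * E).
  { apply Rle_trans with (rp 1.3 (2.0161 * x)); [apply rp_mono; lra |]. rewrite rp_mult by lra. rewrite E13. assert (rp 1.3 2.0161 * (E * rp (- (0.3)) x) <= 2.489 * (E * 0.2351)); [| lra]. apply Rmult_le_compat; [pos | nra | exact Q13 | apply Rmult_le_compat_l; lra]. }
  assert (N03 : rp 0.3 (INR N) <= 1.2346 * 0.2351 * E * y).
  { apply Rle_trans with (rp 0.3 (2.0161 * x)); [apply rp_mono; lra |]. rewrite rp_mult by lra. rewrite E03, E13. assert (rp 0.3 2.0161 * (E * rp (- (0.3)) x * y) <= 1.2346 * (E * 0.2351 * y)); [| lra].
    apply Rmult_le_compat; [pos | apply Rmult_le_pos; nra | exact Q03 | apply Rmult_le_compat_r; nra]. }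
  assert (S1 : sum_n_m (fun n => rp 0.3 (INR n)) 1 N <= 0.4502 * E).
  { eapply Rle_trans; [apply sum_pos_pow; lra |]. replace (1 + 0.3) with 1.3 by lra. lra. }
  assert (S2 : rp 1.3 (INR N) / T <= 0.00001 * E).
  { assert (rp 1.3 (INR N) <= rp 1.3 (INR N + 1)) by (apply rp_mono; lra). nra. }
  assert (S3 : sum_n_m (fun k => rp 1.3 (T / (2 * PI * INR k)) * D) 1 M <= (2.25735 + 4.6 * y) * 3.93833 * E).
  { rewrite (sum_n_m_ext_loc _ (fun k => mult (D * x * E) (rp (- (1.3)) (INR k)))).
    - rewrite (sum_n_m_mult_l (K := R_AbsRing)). change (D * x * E * PS 1.3 M <= (2.25735 + 4.6 * y) * 3.93833 * E). pose proof (PS_le_zr 1.3 M ltac:(lra)) as K. pose proof (zr_le_nodes).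
      apply Rle_trans with (D * x * E * 3.93833); [apply Rmult_le_compat_l; [apply Rmult_le_pos; nra | lra] |]. replace ((2.25735 + 4.6 * y) * 3.93833 * E) with ((2.25735 + 4.6 * y) * E * 3.93833) by ring. apply Rmult_le_compat_r; [lra |]. apply Rmult_le_compat_r; [lra | exact HDx].
    - intros k Hk. assert (0 < INR k) by (apply lt_0_INR; lia). rewrite x0_eq by lia. assert (0 < / INR k) by (apply Rinv_0_lt_compat; assumption). rewrite rp_mult by nra.
      replace (rp 1.3 (/ INR k)) with (rp (- (1.3)) (INR k)) by (unfold rp; rewrite ln_Rinv by assumption; f_equal; ring). replace (rp 1.3 (x ^ 2)) with (x * E); [unfold mult; simpl; ring |].
      unfold E. rewrite <- (rp_1 x) at 1 by lra. rewrite <- rp_plus. unfold rp. rewrite ln_pow by lra. simpl INR. f_equal. lra. }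
  assert (S4 : rp 0.3 (INR N) / PI * (4 * HN M + 4) <= 0.0184 * E).
  { eapply Rle_trans; [apply small_fac; left; apply rp_pos |]. apply Rle_trans with (1.2346 * 0.2351 * E * y * ((8 + 4 * lam) / 3.14)); [apply Rmult_le_compat_r; lra |].
    assert (K : y * lam <= 3.1746 * y + / 128) by (apply Rle_trans with (y * (3.1746 + x / 128)); [apply Rmult_le_compat_l; lra | nra]).
    replace (1.2346 * 0.2351 * E * y * ((8 + 4 * lam) / 3.14)) with (1.2346 * 0.2351 * ((8 * y + 4 * (y * lam)) / 3.14) * E) by (unfold Rdiv; lra). apply Rmult_le_compat_r; lra. }
  set (s3 := sum_n_m _ 1 M) in *. set (s4 := rp _ _ / PI * _) in *.
  assert (F : (1 + 2 / T) * (s3 + s4) <= 1.0000201 * ((2.25735 + 4.6 * y) * 3.93833 * E + 0.0184 * E)).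
  { apply Rle_trans with ((1 + 2 / T) * ((2.25735 + 4.6 * y) * 3.93833 * E + 0.0184 * E)); [apply Rmult_le_compat_l; lra |]. apply fac_le. nra. }
  assert (y * E <= 0.00801 * E) by (apply Rmult_le_compat_r; lra). lra.
Qed.

Lemma HN_pos : 0 < 4 * HN M + 4.
Proof. pose proof (HN_mono 0 M ltac:(lia)) as K. rewrite HN_0 in K. lra. Qed.

Lemma nodeB_expsum : expsum nodeB.
Proof.
  destruct T_facts as [HT1 [HT2 _]]. pose proof PI_RGT_0. pose proof HN_pos. apply expsum_plus; [apply expsum_plus; [| apply expsum_rp; lra] |].
  - apply (expsum_sum (fun k s => rp (- s) (INR k))). intros k _. apply expsum_rp_neg.
  - apply expsum_scal; [lra |]. apply expsum_plus.
    + apply (expsum_sum (fun k s => rp (1 - s) (T / (2 * PI * INR k)) * D)). intros k _. apply expsum_rp. lra.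
    + apply (expsum_ext (fun s => rp (0 - s) (INR N) * (/ PI * (4 * HN M + 4)))), expsum_rp; [intro; replace (0 - s) with (- s) by ring; rfield; lra | pos].
Qed.

Lemma nodeB_right (s : R) : 1 <= s -> nodeB s <= nodeB 1.
Proof.
  intro Hs. destruct T_facts as [HT1 [HT2 _]]. pose proof PI_RGT_0. pose proof HN_pos. apply Rplus_le_compat; [apply Rplus_le_compat |].
  - apply sum_n_m_le_loc. intros k Hk. apply rp_le; [apply (le_INR 1); lia | lra].
  - apply Rmult_le_compat_r; [lra |]. apply rp_le; lra.
  - apply Rmult_le_compat_l; [lra |]. apply Rplus_le_compat.
    + apply sum_n_m_le_loc. intros k Hk. apply Rmult_le_compat_r; [lra |]. apply rp_le; [| lra]. rewrite x0_eq by lia. assert (Hk1 : 1 <= INR k) by (apply (le_INR 1); lia). assert (Hk2 : INR k <= INR M) by (apply le_INR; lia).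
      apply Rmult_le_reg_r with (INR k); [lra |]. rewrite Rmult_assoc, Rinv_l by lra. nra.
    + apply Rmult_le_compat_r; [lra |]. apply Rmult_le_compat_r; [pos | apply rp_le; lra].
Qed.
End Nodes.

Lemma zeta_nodes (T : R) : 99990 <= T -> exists (x : R) (B : R -> R), 0 < x /\ ln T = ln (2 * PI) + 2 * ln x /\ expsum B /\
  (forall s, -0.35 <= s <= 1.2 -> Cmod (zeta (s, T)) <= B s) /\ (forall s, 1 <= s -> B s <= B 1) /\
  B 1 <= ln (2 * x) + 1.805 /\ B (/ 2) <= 6.021 * sqrt x /\ B 0 <= 1.132 * x * ln T /\ B (- 0.3) <= 9.506 * rp 1.6 x.
Proof.
  intros HT. pose proof PI_ge_314 as P1. pose proof PI_le_32 as P2. set (x := sqrt (T / (2 * PI))).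
  assert (Hq : 15600.1 <= T / (2 * PI)) by (apply Rmult_le_reg_r with (2 * PI); [lra |]; unfold Rdiv; rewrite Rmult_assoc, Rinv_l; lra).
  assert (Hx : 124.9 <= x) by (unfold x; rewrite <- (sqrt_square 124.9) by lra; apply sqrt_le_1_alt; lra).
  assert (ET : T = 2 * PI * x ^ 2) by (unfold x; simpl; rewrite Rmult_1_r, sqrt_sqrt by lra; field; lra).
  destruct (nfloor_ex (2 * x) ltac:(lra)) as [n Hn]. set (N := S n). assert (HN1 : 2 * x <= INR N <= 2 * x + 1) by (unfold N; rewrite S_INR; lra).
  set (kap := T / (2 * PI * INR N)). assert (Ek : kap * INR N = x ^ 2) by (unfold kap; rewrite ET; field; split; lra).
  assert (Hk : 62 <= kap <= x / 2) by nra.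
  destruct (nfloor_ex kap ltac:(lra)) as [m Hm]. set (d := sqrt (2 / T)). assert (H2T : 0 < 2 / T) by pos.
  assert (Hd0 : 0 < d) by (apply sqrt_lt_R0; lra). assert (Ed : T * d ^ 2 = 2) by (unfold d; simpl; rewrite Rmult_1_r, sqrt_sqrt by lra; field; lra).
  (* T d^2 = 2 and T = 2 pi x^2 give d x = 1 / sqrt pi, whence 4 d x is at most 2.25734. *)
  set (g := d * x). assert (Eg : PI * (g * g) = 1) by (unfold g; rewrite ET in Ed; nra). assert (Hg0 : 0 < g) by pos. assert (Hg : 0.559 <= g <= 0.564335) by nra.
  assert (Hd : d <= 0.0046) by (apply Rmult_le_reg_r with x; [lra |]; fold g; nra).
  set (D := 4 * d / (1 - d) ^ 3 + 4 / T).
  assert (Hinv : / (1 - d) ^ 3 <= 1 + 3.06 * d) by (apply Rmult_le_reg_r with ((1 - d) ^ 3); [apply pow_lt; lra |]; rewrite Rinv_l by (apply pow_nonzero; lra); nra).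
  assert (Hinv0 : 0 < / (1 - d) ^ 3) by pos.
  assert (HD : 0 < D) by (unfold D; assert (0 < 4 / T) by lra; assert (0 < 4 * d / (1 - d) ^ 3) by nra; lra).
  assert (HDx : D * x <= 2.25735 + 4.6 / x).
  { assert (Hy : 0 < / x) by (apply Rinv_0_lt_compat; lra). assert (E4 : 4 / T * x = 2 / PI * / x) by (rewrite ET; field; split; lra).
    assert (HPi : 2 / PI <= 0.637) by (apply Rmult_le_reg_r with PI; [lra |]; unfold Rdiv; rewrite Rmult_assoc, Rinv_l; lra).
    unfold D. rewrite Rmult_plus_distr_r, E4. replace (4 * d / (1 - d) ^ 3 * x) with (4 * g * / (1 - d) ^ 3) by (unfold g; field; lra).
    assert (Egd : d = g * / x) by (unfold g; field; lra). assert (K1 : 4 * g * / (1 - d) ^ 3 <= 4 * g * (1 + 3.06 * d)) by (apply Rmult_le_compat_l; lra).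
    assert (K2 : 2 / PI * / x <= 0.637 * / x) by (apply Rmult_le_compat_r; lra). assert (K3 : g * d <= 0.31848 * / x) by nra. lra. }
  assert (HM1 : 20 <= INR (S m) <= x / 2 + 1) by (rewrite S_INR; lra).
  exists x, (nodeB T D N (S m)). split; [lra |]. split; [rewrite ET, ln_mult, ln_pow by nra; simpl INR; ring |]. split; [apply (nodeB_expsum x); assumption |]. split; [| split; [| split; [| split; [| split]]]].
  - intros s Hs. apply (zeta_bound (s, T) T s d kap N m); try reflexivity; try lra; try lia.
    + apply INR_le. simpl. lra.
    + unfold kap. field. split; lra.
    + replace (d * kap) with (g * (kap / x)) by (unfold g; field; lra). assert (0.498 <= kap / x); [| nra]. apply Rmult_le_reg_r with (x * INR N); [nra |]. replace (kap / x * (x * INR N)) with (x ^ 2) by (rewrite <- Ek; field; lra). nra.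
  - apply (nodeB_right x); assumption.
  - apply (node_1 x); assumption.
  - apply (node_half x); assumption.
  - apply (node_0 x); assumption.
  - apply (node_left x T D N (S m) Hx ET HN1 HM1 HD HDx HT).
Qed.

(** * Upper and lower bounds for the integral of ln |zeta| *)

Lemma L_facts (t : R) : 100000 <= t -> 11.5129 <= ln t /\ 2.4434 <= ln (ln t).
Proof.
  intro Ht. assert (K : 11.5129 <= ln t).
  { apply Rle_trans with (ln (10 ^ 5)); [| apply ln_le; lra]. rewrite ln_pow by lra. replace (ln 10) with (ln 2 + ln 5) by (rewrite <- ln_mult by lra; f_equal; ring).
    assert (0.69314718 <= ln 2) by num_ln_ge 12%nat. assert (1.6094379 <= ln 5) by num_ln_ge 16%nat. simpl INR. lra. }
  split; [lra |]. apply Rle_trans with (ln 11.5129); [num_ln_ge 18%nat | apply ln_le; lra].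
Qed.

(** Expresses the node values at any height T met by the circle through ln t. At abscissa 1 the
    bound (ln T) / 2 + const becomes 0.6376 ln t, using that ln t exceeds 11.5, and 0.6376 <=
    exp(-0.45). *)
Lemma nodes_t (t T : R) : 100000 <= t -> Rabs (T - t) <= 1.6 -> exists B : R -> R, expsum B /\
  (forall s, -0.35 <= s <= 1.2 -> Cmod (zeta (s, T)) <= B s) /\ (forall s, 1 <= s -> B s <= B 1) /\
  B 1 <= exp (ln (ln t) - 0.45) /\ B (/ 2) <= exp (ln t / 4 + 1.336) /\ B 0 <= exp (ln t / 2 + ln (ln t) - 0.794) /\ B (-0.3) <= exp (0.8 * ln t + 0.7825).
Proof.
  intros Ht HT. apply Rabs_le_between in HT. destruct (zeta_nodes T ltac:(lra)) as [x [B [Hx [ET [HB [Hup [Hmono [B1 [B2 [B3 B4]]]]]]]]]].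
  exists B. split; [pos |]. split; [pos |]. split; [pos |].
  assert (E2pi : 1.8373 <= ln (2 * PI)) by (apply Rle_trans with (ln 6.28); [num_ln_ge 14%nat | apply ln_le; pose proof PI_ge_314; lra]).
  assert (ELT : ln T <= ln t + 0.000016).
  { pose proof (ln_diff_le t T ltac:(lra) ltac:(lra)) as K. assert ((T - t) / t <= 0.000016); [| lra]. apply Rmult_le_reg_r with t; [lra |]. unfold Rdiv. rewrite Rmult_assoc, Rinv_l; lra. }
  set (L := ln t) in *. pose proof ln2_le as L2. assert (ETl : 11.5 <= ln T) by (apply Rle_trans with (ln 99990); [| apply ln_le; lra]; replace 99990 with (100000 * 0.9999) by lra; rewrite ln_mult by lra;
    pose proof (proj1 (L_facts 100000 ltac:(lra))); pose proof (ln_diff_le 0.9999 1 ltac:(lra) ltac:(lra)) as K; rewrite ln_1 in K; lra).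
  split; [| split; [| split]].
  - eapply Rle_trans; [exact B1 |]. unfold Rminus. rewrite exp_plus, exp_ln by lra. rewrite ln_mult by lra.
    assert (K : 0.6376 <= exp (- (0.45))).
    { rewrite exp_Ropp. replace 0.6376 with (/ (10000 / 6376)) by lra. apply Rinv_le_contravar; [pos |]. rewrite <- (exp_ln (10000 / 6376)) by lra. apply exp_le. num_ln_ge 9%nat. }
    nra.
  - eapply Rle_trans; [exact B2 |]. rewrite <- (exp_ln (6.021 * sqrt x)) by (apply Rmult_lt_0_compat; [lra | apply sqrt_lt_R0, Hx]). apply exp_le. rewrite ln_mult by (try apply sqrt_lt_R0; lra).
    rewrite <- (rp_half x Hx). unfold rp. rewrite ln_exp. assert (ln 6.021 <= 1.79526) by num_ln_le 14%nat. lra.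
  - eapply Rle_trans; [exact B3 |]. rewrite <- (exp_ln (1.132 * x * ln T)) by nra. apply exp_le. rewrite !ln_mult by nra.
    assert (ln 1.132 <= 0.124) by num_ln_le 7%nat. pose proof (ln_diff_le L (ln T) ltac:(lra) ltac:(lra)) as K.
    assert ((ln T - L) / L <= 0.000016) by (apply Rmult_le_reg_r with L; [lra |]; unfold Rdiv; rewrite Rmult_assoc, Rinv_l; lra). lra.
  - eapply Rle_trans; [exact B4 |]. rewrite <- (exp_ln (9.506 * rp 1.6 x)) by pos. apply exp_le. rewrite ln_mult by pos. unfold rp. rewrite ln_exp.
    assert (ln 9.506 <= 2.25195) by num_ln_le 16%nat. lra.
Qed.

Lemma ln_chord (B : R -> R) (T a b p q s : R) : expsum B -> (forall s, -0.35 <= s <= 1.2 -> Cmod (zeta (s, T)) <= B s) -> -0.35 <= a -> a < b -> b <= 1.2 -> B a <= exp p -> B b <= exp q -> a <= s <= b ->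
  zeta (s, T) <> 0%C -> ln (Cmod (zeta (s, T))) <= p + (s - a) / (b - a) * (q - p).
Proof.
  intros HB Hup Ha Hab Hb Hp Hq Hs Hn. set (l := (s - a) / (b - a)). assert (El : l * (b - a) = s - a) by (unfold l; field; lra).
  assert (Hl : 0 <= l <= 1) by nra.
  rewrite <- (ln_exp (p + l * (q - p))). apply ln_le; [apply Cmod_gt_0, Hn |]. eapply Rle_trans; [apply Hup; lra |].
  pose proof (expsum_chord B a b l p q HB Hl Hp Hq) as K. replace ((1 - l) * a + l * b) with s in K by lra. replace ((1 - l) * p + l * q) with (p + l * (q - p)) in K by ring. exact K.
Qed.

Lemma ln_zeta_le (s T : R) : 1 < s -> ln (Cmod (zeta (s, T))) <= ln (zr s).
Proof. intro Hs. apply ln_le; [apply Cmod_gt_0, (zeta_neq0); exact Hs | apply (zeta_upper (s, T)); exact Hs]. Qed.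

Lemma ln_zeta_ge (s T : R) : 1 < s -> - lnQ s <= ln (Cmod (zeta (s, T))).
Proof.
  intro Hs. pose proof (zeta_lower (s, T) Hs) as K. cbn [Re fst] in K. unfold lnQ. pose proof (zr_ge1 s Hs). pose proof (zr_ge1 (2 * s) ltac:(lra)). assert (0 < Cmod (zeta (s, T))) by nra.
  apply ln_le in K; [| lra]. rewrite ln_mult in K by lra. lra.
Qed.

Lemma u_ex (t a b : R) : 20 <= t -> good t -> / 2 <= a -> a <= b -> ex_RInt (fun x => ln (Cmod (zeta (x, t)))) a b.
Proof. intros Ht Gt Ha Hab. apply cts_RInt. intros x Hx. rewrite Rmin_left in Hx by exact Hab. apply good_cts; try assumption; lra. Qed.

Lemma Uk_Chasles (t K p : R) : 20 <= t -> good t -> / 2 <= p <= K -> Uk K t = RInt (fun x => ln (Cmod (zeta (x, t)))) (/ 2) p + RInt (fun x => ln (Cmod (zeta (x, t)))) p K.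
Proof. symmetry. apply (RInt_Chasles (V := RV)); apply u_ex; try assumption; lra.
Qed.

(** The switch to ln zeta(sigma) is made at 1.15, where for t = 10^5 the two available bounds nearly
    agree: 1.983 for ln zeta(1.15), 1.993 for ln ln t - 0.45. *)
Lemma upper_bound (t K : R) : 100000 <= t -> good t -> 5 <= K -> Uk K t <= (ln t / 4 + 1.336 + (ln (ln t) - 0.45)) / 4 + 0.15 * (ln (ln t) - 0.45) + 1.3835.
Proof.
  intros Ht Gt HK. destruct (nodes_t t t Ht ltac:(rewrite Rminus_diag, Rabs_R0; lra)) as [B [HB [Hup [Hmono [B1 [B2 _]]]]]].
  set (h1 := ln (ln t) - 0.45) in *. set (hh := ln t / 4 + 1.336) in *. set (u := fun x => ln (Cmod (zeta (x, t)))).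
  rewrite (Uk_Chasles t K 1) by pos. fold u. rewrite <- (RInt_Chasles (V := RV) u 1 1.15 K) by (apply u_ex; try assumption; lra).
  assert (I1 : RInt u (/ 2) 1 <= (1 - / 2) * (hh + h1) / 2).
  { apply RInt_chord; [lra | apply u_ex; try assumption; lra |]. intros x Hx. apply (ln_chord B); try assumption; try lra. apply (proj1 Gt). lra. }
  assert (I2 : RInt u 1 1.15 <= (1.15 - 1) * (h1 + h1) / 2).
  { apply RInt_chord; [lra | apply u_ex; try assumption; lra |]. intros x Hx. rewrite Rminus_diag, Rmult_0_r, Rplus_0_r. rewrite <- (ln_exp h1). apply ln_le; [apply Cmod_gt_0, (proj1 Gt); lra |].
    eapply Rle_trans; [apply Hup; lra |]. eapply Rle_trans; [apply Hmono; lra | lra]. }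
  assert (I3 : RInt u 1.15 K <= RInt (fun x => ln (zr x)) 1.15 K).
  { apply RInt_le; [lra | apply u_ex; try assumption; lra | apply cts_RInt; intros x Hx; rewrite Rmin_left in Hx by lra; apply lnzr_cts; lra |]. intros x Hx. apply ln_zeta_le. lra. }
  pose proof (lnzr_int K HK). change plus with Rplus. lra.
Qed.

(** X^3 lies above its tangents and below its chords; with these facts the comparison of an affine
    function with a cubic is linear in X and X^3. *)
Lemma tangent_cube (X a : R) : 0 <= X -> 0 <= a -> 3 * a ^ 2 * X - 2 * a ^ 3 <= X ^ 3.
Proof. intros HX Ha. assert (0 <= (X - a) ^ 2 * (X + 2 * a)) by pos. lra.
Qed.

Lemma chord_cube (X a b : R) : 0 <= a -> a <= X <= b -> X ^ 3 <= (a ^ 2 + a * b + b ^ 2) * X - a * b * (a + b).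
Proof. intros Ha HX. assert (0 <= (X - a) * (b - X) * (X + a + b)) by pos. lra.
Qed.

Ltac majorant X mp lp a b xc xl := pose proof (tangent_cube X xc ltac:(lra) ltac:(lra)); pose proof (tangent_cube X xl ltac:(lra) ltac:(lra)); pose proof (chord_cube X a b ltac:(lra) ltac:(lra)).

(* Decoupled in 1, [mp], [lp], where [mp] and [lp] are the nonnegative excesses of ln ln t and ln t over their values at 10^5: each
   coefficient of the piecewise linear left side lies below its cubic; the cubics solve the linear program minimising the final bound. *)
Lemma circle_majorant (t y X mp lp : R) : 100000 <= t -> ln t = 11.5129 + lp -> ln (ln t) = 2.4434 + mp -> 0 <= mp -> 0 <= lp -> 0 <= X <= 1 -> Rabs y <= 1.6 ->
  zeta ((1.3 - 1.6 * X)%R, (t + y)%R) <> 0%C ->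
  ln (Cmod (zeta ((1.3 - 1.6 * X)%R, (t + y)%R))) + lnQ (1.3 + 1.6 * X)
    <= (2.489 + 0.7875 * mp + 0.0005 * lp) + (3.8903 + 2.3004 * mp + 0.4103 * lp) * X + (3.8958 - 3.0873 * mp + 0.3898 * lp) * X ^ 3.
Proof.
  intros Ht EL Em Hm Hl HX Hy Hn. destruct (nodes_t t (t + y) Ht) as [B [HB [Hup [Hmono [B1 [B2 [B3 B4]]]]]]]; [replace (t + y - t) with y by ring; exact Hy |].
  rewrite EL, Em in *. set (s := 1.3 - 1.6 * X) in *. set (u := ln (Cmod (zeta (s, (t + y)%R)))).
  assert (Hq : forall a b A C0, 1 < a -> a < b -> lnQ a <= A -> lnQ b <= C0 -> a <= 1.3 + 1.6 * X <= b -> lnQ (1.3 + 1.6 * X) <= A + (1.3 + 1.6 * X - a) / (b - a) * (C0 - A)) by (intros a b A C0 Ha Hab HA HC HX'; apply (chord_bound (lnQ)); try assumption; apply (cvx_lnQ)).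
  destruct (lnQ_nodes) as (Q0 & _ & Q1 & Q2 & _ & Q3 & _ & Q4 & Q5 & _).
  assert (Fin : forall cu mu lu qq, u <= cu + mp * mu + lp * lu -> lnQ (1.3 + 1.6 * X) <= qq ->
    cu + qq <= 2.489 + 3.8903 * X + 3.8958 * X ^ 3 -> mu <= 0.7875 + 2.3004 * X - 3.0873 * X ^ 3 -> lu <= 0.0005 + 0.4103 * X + 0.3898 * X ^ 3 ->
    u + lnQ (1.3 + 1.6 * X) <= (2.489 + 0.7875 * mp + 0.0005 * lp) + (3.8903 + 2.3004 * mp + 0.4103 * lp) * X + (3.8958 - 3.0873 * mp + 0.3898 * lp) * X ^ 3).
  { intros cu mu lu qq H1 H2 H3 H4 H5. nra. }
  assert (P1 : 1 <= s <= 1.2 -> u <= 1.9934 + mp * 1 + lp * 0).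
  { intro Hs. rewrite <- (ln_exp (1.9934 + mp * 1 + lp * 0)). apply ln_le; [apply Cmod_gt_0, Hn |]. eapply Rle_trans; [apply Hup; lra |]. eapply Rle_trans; [apply Hmono; lra |]. eapply Rle_trans; [exact B1 |]. apply exp_le. lra. }
  assert (Hc : forall a b p q, -0.35 <= a -> a < b -> b <= 1.2 -> B a <= exp p -> B b <= exp q -> a <= s <= b -> u <= p + (s - a) / (b - a) * (q - p)) by (intros a b p q Ha Hab Hb Hp Hq' Hs; apply (ln_chord B); assumption).
  assert (P2 : / 2 <= s <= 1 -> u <= (4.214225 + (2.6 - 3.2 * X - 1) * (1.9934 - 4.214225)) + mp * (2.6 - 3.2 * X - 1) + lp * (/ 4 * (1 - (2.6 - 3.2 * X - 1)))).
  { intro Hs. eapply Rle_trans; [apply (Hc (/ 2) 1 _ _ ltac:(lra) ltac:(lra) ltac:(lra) B2 B1 Hs) |]. unfold s. lra. }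
  assert (P3 : 0 <= s <= / 2 -> u <= (7.40585 + (2.6 - 3.2 * X) * (4.214225 - 7.40585)) + mp * (1 - (2.6 - 3.2 * X)) + lp * (/ 2 - / 4 * (2.6 - 3.2 * X))).
  { intro Hs. eapply Rle_trans; [apply (Hc 0 (/ 2) _ _ ltac:(lra) ltac:(lra) ltac:(lra) B3 B2 Hs) |]. unfold s. lra. }
  assert (P4 : -0.3 <= s <= 0 -> u <= (9.99282 + (16 / 3) * (1 - X) * (7.40585 - 9.99282)) + mp * ((16 / 3) * (1 - X)) + lp * (0.8 - 0.3 * ((16 / 3) * (1 - X)))).
  { intro Hs. eapply Rle_trans; [apply (Hc (-0.3) 0 _ _ ltac:(lra) ltac:(lra) ltac:(lra) B4 B3 Hs) |]. replace ((s - -0.3) / (0 - -0.3)) with ((16 / 3) * (1 - X)) by (unfold s, Rdiv; lra). lra. }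
  (* Breakpoints: 1.3 - 1.6 X passes 1.15, 1, 1/2 and 0 at X = 0.09375, 0.1875, 0.5 and 0.8125, and
     1.3 + 1.6 X passes the nodes 1.5, 1.7, 2.1 and 2.6 of [lnQ] at X = 0.125, 0.25, 0.5 and
     0.8125. *)
  destruct (Rle_dec X 0.09375) as [X1 | X1].
  { assert (Hs : 1.15 <= s <= 1.3) by (unfold s; lra). eapply (Fin (1.98255 + (s - 1.15) / (1.3 - 1.15) * (1.37076 - 1.98255)) 0 0); [| apply (Hq 1.3 1.5); try eassumption; lra | | |]; try (unfold s; majorant X mp lp 0 0.09375 0.0467 0; lra).
    rewrite !Rmult_0_r, !Rplus_0_r. eapply Rle_trans; [apply ln_zeta_le; lra |]. apply (chord_bound (fun x => ln (zr x))); try lra; [apply (cvx_lnzr) | apply (ln_zr_nodes) | apply (ln_zr_nodes)]. }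
  destruct (Rle_dec X 0.125) as [X2 | X2]; [eapply Fin; [apply P1; unfold s; lra | apply (Hq 1.3 1.5); try eassumption; lra | | |]; majorant X mp lp 0.09375 0.125 0.0938 0.0938; lra |].
  destruct (Rle_dec X 0.1875) as [X3 | X3]; [eapply Fin; [apply P1; unfold s; lra | apply (Hq 1.5 1.7); try eassumption; lra | | |]; majorant X mp lp 0.125 0.1875 0.125 0.125; lra |].
  destruct (Rle_dec X 0.25) as [X4 | X4]; [eapply Fin; [apply P2; unfold s; lra | apply (Hq 1.5 1.7); try eassumption; lra | | |]; majorant X mp lp 0.1875 0.25 0.25 0.25; lra |].
  destruct (Rle_dec X 0.5) as [X5 | X5]; [eapply Fin; [apply P2; unfold s; lra | apply (Hq 1.7 2.1); try eassumption; lra | | |]; majorant X mp lp 0.25 0.5 0.4497 0.5; lra |].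
  destruct (Rle_dec X 0.8125) as [X6 | X6]; [eapply Fin; [apply P3; unfold s; lra | apply (Hq 2.1 2.6); try eassumption; lra | | |]; majorant X mp lp 0.5 0.8125 0.7084 0.5773; lra |].
  eapply Fin; [apply P4; unfold s; lra | apply (Hq 2.6 3.1); try eassumption; lra | | |]; majorant X mp lp 0.8125 1 0.9083 1; lra.
Qed.

Lemma RInt_scale (g : R -> R) (e : R) : (forall x, / 2 <= x <= 2.1 -> continuous g x) -> e = 0.8 \/ e = -0.8 -> RInt (fun s => g (e * s + 1.3)) 0 1 = / e * RInt g 1.3 (e + 1.3).
Proof.
  intros Hg He. assert (Hex : ex_RInt g (e * 0 + 1.3) (e * 1 + 1.3)).
  { apply cts_RInt. intros x Hx. apply Hg. unfold Rmin, Rmax in Hx. destruct (Rle_dec (e * 0 + 1.3) (e * 1 + 1.3)); destruct He; subst e; lra. }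
  pose proof (RInt_comp_lin (V := RV) g e 1.3 0 1 Hex) as K. rewrite Rmult_0_r, Rplus_0_l, Rmult_1_r in K. rewrite <- K.
  rewrite (RInt_scal (V := RV)).
  - rewrite <- Rmult_assoc, Rinv_l by lra. lra.
  - apply cts_RInt. intros s Hs. rewrite Rmin_left, Rmax_right in Hs by lra. apply (continuous_comp (fun s => e * s + 1.3) g); [cts_derive | apply Hg; destruct He; subst e; lra].
Qed.

(** The map z -> c + 0.8 z carries the circle |z| = 2 to radius 1.6 and the segments from 0 to -1
    and to 1 onto [1/2, 1.3] and [1.3, 2.1]. The integral over [1.3, 2.1] occurs twice, in the disc
    inequality and in U itself, hence 2 times 0.51553. *)
Lemma lower_bound (t K mp lp : R) : 100000 <= t -> good t -> 5 <= K -> ln t = 11.5129 + lp -> ln (ln t) = 2.4434 + mp -> 0 <= mp -> 0 <= lp ->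
  - Uk K t <= 0.8 * (1.65 * 0.8 * 2.3172 + 0.2203 * (2.489 + 0.7875 * mp + 0.0005 * lp) + 0.1625 * (3.8903 + 2.3004 * mp + 0.4103 * lp) + 0.1140625 * (3.8958 - 3.0873 * mp + 0.3898 * lp)) + 2 * 0.51553 + 0.463.
Proof.
  intros Ht Gt HK EL Em Hm Hl. set (c := (1.3, t) : C). set (f := fun z => zeta (c + RtoC 0.8 * z)%C).
  set (b0 := 2.489 + 0.7875 * mp + 0.0005 * lp). set (b1 := 3.8903 + 2.3004 * mp + 0.4103 * lp). set (b3 := 3.8958 - 3.0873 * mp + 0.3898 * lp). set (u := fun x => ln (Cmod (zeta (x, t)))).
  assert (Hf : holo f 0%C 5).
  { intros z Hz1. rewrite Cmod_sub0 in Hz1. destruct (zeta_holo c 4.1 ltac:(simpl; rewrite Rabs_pos_eq; lra) (c + RtoC 0.8 * z)%C) as [l Hl'].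
    - replace (c + RtoC 0.8 * z - c)%C with (RtoC 0.8 * z)%C by ring. rewrite Cmod_mult, Cmod_R, Rabs_pos_eq by lra. lra.
    - exists (l * RtoC 0.8)%C. apply (Cd_comp (fun z => c + RtoC 0.8 * z)%C zeta); [apply Cd_poly1 | pos]. }
  assert (Ef : forall x y, f (x, y) = zeta ((1.3 + 0.8 * x)%R, (t + 0.8 * y)%R)) by (intros x y; unfold f; f_equal; unfold c; apply injective_projections; simpl; ring).
  destruct (zeta_holo c 4.1 ltac:(simpl; rewrite Rabs_pos_eq; lra) c) as [l Hl']; [rewrite Cmod_minus_0; lra |].
  assert (Ec : (c + RtoC 0.8 * 0)%C = c) by ring.
  assert (Hfl : Cd f 0%C (l * RtoC 0.8)%C) by (apply (Cd_comp (fun z => c + RtoC 0.8 * z)%C zeta 0%C (RtoC 0.8) l); [apply Cd_poly1 | rewrite Ec; exact Hl']).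
  assert (Er : forall x, f (RtoC x) = zeta ((1.3 + 0.8 * x)%R, t)) by (intro x; change (RtoC x) with ((x, 0) : C); rewrite Ef; do 2 f_equal; ring).
  pose proof (disc_lower f (l * RtoC 0.8)%C b0 b1 b3 Hf) as DL.
  assert (DL' : RInt (fun s => ln (Cmod (f (RtoC s)))) 0 1 - RInt (fun s => ln (Cmod (f (- RtoC s)%C))) 0 1 <= 1.65 * Re ((l * RtoC 0.8) / f 0)%C + 0.2203 * b0 + 0.1625 * b1 + 0.1140625 * b3).
  { apply DL.
    - intros z _ Hre. destruct z as [x y]. simpl in Hre. apply (zeta_neq0). simpl. lra.
    - intro v. unfold f. replace (c + RtoC 0.8 * circ 0%C 2 v)%C with (circ (1.3, t) 1.6 v); [apply (proj2 Gt) |]. apply injective_projections; simpl; lra.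
    - intros x Hx. rewrite Er. apply Rabs_le_between in Hx. apply (proj1 Gt). lra.
    - pos.
    - pos.
    - intros x y Hx Hxy. rewrite !Ef. set (X := x / 2). assert (HX : 0 <= X <= 1) by (unfold X; split; nra). assert (Hy : Rabs (0.8 * y) <= 1.6) by (apply Rabs_le; nra).
      replace (1.3 + 0.8 * - x) with (1.3 - 1.6 * X) by (unfold X; lra). replace (1.3 + 0.8 * x) with (1.3 + 1.6 * X) by (unfold X; lra).
      pose proof (ln_zeta_ge (1.3 + 1.6 * X) (t + 0.8 * y) ltac:(lra)) as G.
      assert (Hn : zeta ((1.3 - 1.6 * X)%R, (t + 0.8 * y)%R) <> 0%C).
      { intro E0. destruct (circ_surj (- x, y) 2 ltac:(lra)) as [a Ea]; [unfold Cmod; simpl; replace (- x * (- x * 1) + y * (y * 1)) with (2 * 2) by lra; apply sqrt_square; lra |].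
        apply (proj2 Gt a). rewrite <- E0. f_equal. assert (E1 := f_equal Re Ea). assert (E2 := f_equal Im Ea). simpl in E1, E2. unfold circ, cis, X. apply injective_projections; simpl; lra. }
      pose proof (circle_majorant t (0.8 * y) X mp lp Ht EL Em Hm Hl HX Hy Hn) as Mj. fold b0 b1 b3 in Mj. lra. }
  assert (EZ : Re ((l * RtoC 0.8) / f 0)%C <= 0.8 * 2.3172).
  { unfold f. rewrite Ec. pose proof (log_derivative t l ltac:(lra) Hl') as Q. replace (l * RtoC 0.8 / zeta c)%C with (RtoC 0.8 * (l / zeta c))%C by (unfold Cdiv; ring).
    replace (Re (RtoC 0.8 * (l / zeta c))%C) with (0.8 * Re (l / zeta c)%C) by (destruct (l / zeta c)%C; simpl; ring). apply Rmult_le_compat_l; [lra | pos]. }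
  assert (Hcu : forall x, / 2 <= x <= 2.1 -> continuous u x) by (intros x Hx; apply good_cts; try assumption; lra).
  assert (R1 : RInt (fun s => ln (Cmod (f (RtoC s)))) 0 1 = / 0.8 * RInt u 1.3 2.1).
  { replace 2.1 with (0.8 + 1.3) by lra. rewrite <- (RInt_scale u 0.8 Hcu) by nra. apply RInt_ext. intros s _. rewrite Er. unfold u. do 3 f_equal. apply injective_projections; simpl; ring. }
  assert (R2 : RInt (fun s => ln (Cmod (f (- RtoC s)%C))) 0 1 = / 0.8 * RInt u (/ 2) 1.3).
  { rewrite <- (opp_RInt_swap (V := RV) u 1.3 (/ 2)) by (apply (@ex_RInt_swap RV), u_ex; try assumption; lra). replace (/ 2) with (-0.8 + 1.3) by lra. replace (/ 0.8 * opp (RInt u 1.3 (-0.8 + 1.3))) with (/ (-0.8) * RInt u 1.3 (-0.8 + 1.3)) by (rsc; lra).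
    rewrite <- (RInt_scale u (-0.8) Hcu) by lra. apply RInt_ext. intros s _. rewrite <- RtoC_opp, Er. unfold u. do 3 f_equal. apply injective_projections; simpl; lra. }
  rewrite (Uk_Chasles t K 1.3) by pos. fold u.
  assert (Ech : RInt u 1.3 K = RInt u 1.3 2.1 + RInt u 2.1 K) by (symmetry; apply (RInt_Chasles (V := RV) u 1.3 2.1 K); apply u_ex; try assumption; lra).
  assert (Lw : forall p q, 1 < p -> p <= q -> - RInt u p q <= RInt (lnQ) p q).
  { intros p q Hp Hpq. assert (Ex : ex_RInt u p q) by (apply u_ex; try assumption; lra). assert (ExQ : ex_RInt (lnQ) p q) by (apply cts_RInt; intros x Hx; rewrite Rmin_left in Hx by exact Hpq; apply lnQ_cts; lra).
    pose proof (@is_RInt_opp RN _ _ _ _ (RInt_correct (V := RV) _ _ _ Ex)) as Eo. pose proof (RInt_correct (V := RV) _ _ _ ExQ) as EQ.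
    apply (is_RInt_le _ _ p q _ _ Hpq Eo EQ). intros x Hx. rsc. pose proof (ln_zeta_ge x t ltac:(lra)). unfold u. lra. }
  pose proof (Lw 1.3 2.1 ltac:(lra) ltac:(lra)). pose proof (Lw 2.1 K ltac:(lra) ltac:(lra)). pose proof (lnQ_int1). pose proof (lnQ_int2 K HK). lra.
Qed.
End Zeta.

Theorem theorem1 (zeta : C -> C) (Hzeta : is_riemann_zeta zeta)
  (t1 t2 : R) (Ht1 : 10 ^ 5 < t1) (Ht12 : t1 < t2) :
  ex_RInt (S_zeta zeta) t1 t2 /\
  Rabs (RInt (S_zeta zeta) t1 t2)
    <= 1.698 + 0.183 * ln (ln t2) + 0.049 * ln t2.
Proof. destruct (L_facts t2 ltac:(lra)) as [F1 F2].
  destruct (S_bound zeta Hzeta (3.14 * (1.698 + 0.183 * ln (ln t2) + 0.049 * ln t2)) t1 t2 ltac:(lra) Ht12) as [Ex Bd].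
  - intros K a b HK Ha Hb Ga Gb. destruct (L_facts a ltac:(lra)) as [Fa1 Fa2]. destruct (L_facts b ltac:(lra)) as [Fb1 Fb2].
    assert (ln a <= ln t2) by (apply ln_le; lra). assert (ln b <= ln t2) by (apply ln_le; lra). assert (ln (ln a) <= ln (ln t2)) by (apply ln_le; lra). assert (ln (ln b) <= ln (ln t2)) by (apply ln_le; lra).
    pose proof (upper_bound zeta Hzeta b K ltac:(lra) Gb HK) as U.
    pose proof (lower_bound zeta Hzeta a K (ln (ln a) - 2.4434) (ln a - 11.5129) ltac:(lra) Ga HK ltac:(lra) ltac:(lra) ltac:(lra) ltac:(lra)) as Lo. lra.
  - split; [pos |]. pose proof PI_ge_314. nra.
Qed.
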